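(* For all $\ell,R>0$ and $p\in\mathbb{N}$ there is some $n\in\mathbb{N}$ such that the diagonal infinite-volume correlation function $(z_1,\ldots,z_n)\mapsto\rho_n(z_1,\ldots,z_n;z_1,\ldots,z_n)$ has $p\ell^2/R$ as its smallest period with respect to simultaneous translations $x_j\mapsto x_j+\theta$ of all points along the cylinder axis.
   Context: Setting. $\mathcal{Z}=\mathbb{R}\times[0,2\pi R]$ is a cylinder of radius $R$, with points $z=x+iy$ and measure $dx\,dy$. Laughlin's function. For $N\in\mathbb{N}$, $$\Psi_N(z_1,\ldots,z_N)=\kappa_N\prod_{j<k}\bigl(e^{z_k/R}-e^{z_j/R}\bigr)^p\exp\Bigl(-\frac{1}{2\ell^2}\sum_k x_k^2\Bigr),$$ with $\kappa_N>0$ a normalizing constant. Finite-volume correlation functions. On the whole cylinder, $$\rho_n^{N,\mathcal{Z}}(z_1,\ldots,z_n;z'_1,\ldots,z'_n)=\frac{N!}{(N-n)!\,\|\Psi_N\|^2}\int_{\mathcal{Z}^{N-n}}\Psi_N(z_1,\ldots,z_n,z_{n+1},\ldots)\,\overline{\Psi_N(z'_1,\ldots,z'_n,z_{n+1},\ldots)}\,\prod_{j>n}dx_j\,dy_j .$$ Infinite-volume correlation functions. $\rho_n$ denotes the bulk limit of $\rho_n^{N,\mathcal{Z}}$ as $N\to\infty$: $\rho_n^{N,\mathcal{Z}}$ converges to $\rho_n$ uniformly at points whose $x$-coordinates have distance at least $d\to\infty$ from $0$ and from $pN\ell^2/R$. This limit exists, is unique, and is independent of the choice of domain of integration. *)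

(* Defs.v *)
From HB Require Import structures.
From mathcomp Require Import all_boot all_order all_algebra.
From mathcomp Require Import all_classical all_reals.
From mathcomp Require Import interval_inference topology normedtype sequences
  exp trigo measure lebesgue_measure lebesgue_integral.
From mathcomp Require Import complex.
Set Implicit Arguments. Unset Strict Implicit. Unset Printing Implicit Defensive.
Import Order.TTheory GRing.Theory Num.Theory.
Local Open Scope classical_set_scope.
Local Open Scope ring_scope.
Local Open Scope complex_scope.

Section Laughlin.
Variable R : realType.
Local Notation C := R[i].

Definition cexp (z : C) : C :=
  (expR (complex.Re z))%:C * ((cos (complex.Im z))%:C + 'i * (sin (complex.Im z))%:C).

(* Laughlin's function WITHOUT the normalizing constant kappa_N
   (kappa_N cancels in the correlation functions):
   prod_{j<k} (e^{z_k/r} - e^{z_j/r})^p * exp(-(1/(2 l^2)) sum_k x_k^2) *)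
Definition laughlin (p : nat) (l r : R) (zs : seq C) : C :=
  (\prod_(k < size zs) \prod_(j < size zs | (j < k)%N)
      (cexp (nth 0 zs k / r%:C) - cexp (nth 0 zs j / r%:C)) ^+ p)
  * (expR (- (\sum_(z <- zs) complex.Re z ^+ 2) / (2 * l ^+ 2)))%:C.

Definition laughlin_sq (p : nat) (l r : R) (zs : seq C) : R :=
  ComplexField.Normc.normc (laughlin p l r zs) ^+ 2.

Fixpoint cyl_int (r : R) (m : nat) (f : seq C -> \bar R) : \bar R :=
  match m with
  | 0 => f [::]
  | m'.+1 =>
      (\int[@lebesgue_measure R]_(x in [set: R])
        \int[@lebesgue_measure R]_(y in `[0%R, (2 * pi * r)%R])
          cyl_int r m' (fun s => f ((x +i* y) :: s)))%E
  end.

Definition pts (n : nat) (z : 'I_n -> C) : seq C := [seq z i | i <- enum 'I_n].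

Definition rhoN (p : nat) (l r : R) (N n : nat) (z : 'I_n -> C) : R :=
  (N`!)%:R / ((N - n)`!)%:R
  * fine (cyl_int r (N - n) (fun w => (laughlin_sq p l r (pts z ++ w))%:E))
  / fine (cyl_int r N (fun w => (laughlin_sq p l r w)%:E)).

Definition on_cyl (r : R) (n : nat) (z : 'I_n -> C) : Prop :=
  forall i, 0 <= complex.Im (z i) <= 2 * pi * r.

Definition in_bulk (p : nat) (l r : R) (N : nat) (d : R) (n : nat) (z : 'I_n -> C) : Prop :=
  forall i, d <= complex.Re (z i) <= (p * N)%:R * l ^+ 2 / r - d.

Definition bulk_limit (p : nat) (l r : R) (n : nat) (rho : ('I_n -> C) -> R) : Prop :=
  forall eps : R, 0 < eps ->
  exists d : R, exists N0 : nat, forall N : nat, (N0 <= N)%N -> (n <= N)%N ->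
    forall z, on_cyl r z -> in_bulk p l r N d z -> `| rhoN p l r N z - rho z | < eps.

Definition shift (n : nat) (z : 'I_n -> C) (theta : R) : 'I_n -> C :=
  fun i => z i + theta%:C.

Definition is_period (r : R) (n : nat) (rho : ('I_n -> C) -> R) (theta : R) : Prop :=
  forall z, on_cyl r z -> rho (shift z theta) = rho z.

Definition smallest_period (r : R) (n : nat) (rho : ('I_n -> C) -> R) (T : R) : Prop :=
  0 < T /\ is_period r rho T /\ forall theta, 0 < theta < T -> ~ is_period r rho theta.

End Laughlin.

(* Main.v *)
Require Import Defs.
From HB Require Import structures.
From mathcomp Require Import all_boot all_order all_algebra.
From mathcomp Require Import all_classical all_reals.
From mathcomp Require Import interval_inference topology normedtype sequences
  derive exp trigo measure lebesgue_measure lebesgue_integral realfun ftc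
  normal_distribution.
From mathcomp Require Import complex.
From mathcomp Require Import ring lra zify.
Set Implicit Arguments. Unset Strict Implicit. Unset Printing Implicit Defensive.
Import Order.TTheory GRing.Theory Num.Theory.
Local Open Scope ring_scope.

(** Expanding [prod_(j<k) (t_k - t_j)^p] in monomials turns [|Psi_N|^2] into a
    probability on occupation sequences [m] of lattice orbitals, with weight
    [|coefficient of m|^2 * exp (g * sum m_i^2)], and integrating out a particle
    sums over its orbital (Parseval in [y], Gaussian integral in [x]).  The weight
    factorizes at every [k] such that the [k] lowest particles occupy orbitals
    below [p k] with total [p k (k - 1) / 2]: these renewal points make the system
    a renewal process.  A bound on the energy of the one-component plasma gives
    uniform exponential moments of local particle numbers and
    [Z_(m+n) <= K Z_m Z_n], hence a positive density of renewal points.  Cutting at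
    a renewal point to the left (right) of the observed points shows that the
    correlation functions forget the edges up to translations by multiples of
    [p l^2 / r], which yields the bulk limit and its periodicity.

    For minimality, twist the particles in a window [[X, X + L]] by the phase
    [exp (- 2 i pi (m - X) / L)].  Between two renewal points the product of these
    phases is determined by [X], and its expectation winds like
    [exp (2 i pi X / p)] as [X] moves over one period.  It is approximated by a
    finite combination of [k]-point functions, [k <= n], so a period between one
    and two thirds of [p l^2 / r] of the [n]-point function (hence, averaging
    points out, of all [k]-point functions with [k <= n]) is impossible; every
    smaller period would have a multiple in that range. *)

(** * Sums over tuples *)

Section SequenceSums.

(** A configuration offers no deterministic place to cut it: the interaction across a cut is small
    only where the particles stay near the root positions [p * i]. Hence the plasma bound looks for
    a good cut on either side of a prescribed place and lets the stretch in between pay for its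
    displacements; the weight 1/2 per particle of the stretch makes the partition functions
    multiplicative up to a constant. These estimates are run on finite grids of points with roots of
    unity as angles, so that the statistical mechanics is about finite sums; Lebesgue integrals
    enter only to identify [rhoN] with a ratio of such sums. Two obstacles shape the second half.
    Points see orbitals only through Gaussians, so the phase must be deconvolved, at a cost of order
    [1/q] for the mesh and [1/L] at the ends of the window. And [n] must be fixed before the
    hypothetical period is known, so the truncation of the expansion is bounded by a power of 1/2
    times a moment, uniformly in the position of the window. Between one and two thirds of the
    period, the factor gained by the phase is at distance more than 1 from 1, against a total error
    of 9/16. *)

Fixpoint tsum {X : Type} {K : nmodType} (rs : seq X) (n : nat)
    (F : seq X -> K) : K :=
  if n is n'.+1 then \sum_(x <- rs) tsum rs n' (fun s => F (x :: s))
  else F [::].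

Lemma tsumS (X : Type) (K : nmodType) (rs : seq X) n (F : seq X -> K) :
  tsum rs n.+1 F = \sum_(x <- rs) tsum rs n (fun s => F (x :: s)).
Proof. by []. Qed.

Lemma big_iota0 (K : nmodType) M (f : nat -> K) :
  \sum_(j <- iota 0 M) f j = \sum_(j < M) f j.
Proof. by rewrite -(big_mkord xpredT) /index_iota subn0. Qed.

Lemma eq_tsum (X : Type) (K : nmodType) (rs : seq X) n (F G : seq X -> K) :
  (forall t, size t = n -> F t = G t) -> tsum rs n F = tsum rs n G.
Proof.
elim: n F G => [|n IH] F G H /=; first exact: H.
by apply: eq_bigr => x _; apply: IH => t st; apply: H; rewrite /= st.
Qed.

Lemma eq_tsum_in (X : eqType) (K : nmodType) (rs : seq X) n
    (F G : seq X -> K) :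
  (forall t, size t = n -> {subset t <= rs} -> F t = G t) ->
  tsum rs n F = tsum rs n G.
Proof.
elim: n F G => [|n IH] F G H /=; first by apply: H => // x; rewrite in_nil.
apply: eq_big_seq => x xr; apply: IH => t st tr; apply: H; first by rewrite /= st.
by move=> y; rewrite inE => /orP[/eqP->|/tr].
Qed.

Lemma tsum0 (X : Type) (K : nmodType) (rs : seq X) n :
  tsum rs n (fun=> 0 : K) = 0.
Proof. by elim: n => //= n IH; rewrite big1. Qed.

Lemma tsumD (X : Type) (K : nmodType) (rs : seq X) n (F G : seq X -> K) :
  tsum rs n (fun t => F t + G t) = tsum rs n F + tsum rs n G.
Proof.
elim: n F G => //= n IH F G; rewrite -big_split /=.
by apply: eq_bigr => x _; rewrite IH.
Qed.

Lemma tsum_sum (X I : Type) (K : nmodType) (rs : seq X) n (l : seq I)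
    (P : pred I) (F : I -> seq X -> K) :
  tsum rs n (fun t => \sum_(i <- l | P i) F i t) =
  \sum_(i <- l | P i) tsum rs n (F i).
Proof.
elim: n F => //= n IH F; rewrite exchange_big /=.
by apply: eq_bigr => x _; rewrite IH.
Qed.

Lemma tsum_exch (X Y : Type) (K : nmodType) (rs : seq X) (rs' : seq Y) n k
    (F : seq X -> seq Y -> K) :
  tsum rs n (fun s => tsum rs' k (F s)) =
  tsum rs' k (fun t => tsum rs n (fun s => F s t)).
Proof.
elim: k F => //= k IH F; rewrite tsum_sum.
by apply: eq_bigr => x _; rewrite IH.
Qed.

Lemma raddf_tsum (X : Type) (K L : nmodType) (f : {additive K -> L})
    (rs : seq X) n (F : seq X -> K) :
  f (tsum rs n F) = tsum rs n (fun t => f (F t)).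
Proof.
elim: n F => //= n IH F; rewrite raddf_sum.
by apply: eq_bigr => x _; rewrite IH.
Qed.

Lemma tsumZ (X : Type) (K : pzRingType) (rs : seq X) n (c : K)
    (F : seq X -> K) :
  tsum rs n (fun t => c * F t) = c * tsum rs n F.
Proof.
elim: n F => //= n IH F; rewrite mulr_sumr.
by apply: eq_bigr => x _; rewrite IH.
Qed.

Lemma tsumZr (X : Type) (K : pzRingType) (rs : seq X) n (c : K)
    (F : seq X -> K) :
  tsum rs n (fun t => F t * c) = tsum rs n F * c.
Proof.
elim: n F => //= n IH F; rewrite mulr_suml.
by apply: eq_bigr => x _; rewrite IH.
Qed.

Lemma tsumB (X : Type) (K : zmodType) (rs : seq X) n (F G : seq X -> K) :
  tsum rs n (fun t => F t - G t) = tsum rs n F - tsum rs n G.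
Proof. by rewrite tsumD; congr (_ + _); rewrite -(raddf_tsum -%R). Qed.

Lemma tsum_cat (X : Type) (K : nmodType) (rs : seq X) n k (F : seq X -> K) :
  tsum rs (n + k) F = tsum rs n (fun s => tsum rs k (fun t => F (s ++ t))).
Proof. by elim: n F => //= n IH F; apply: eq_bigr => x _; rewrite IH. Qed.

Lemma tsum_map (X Y : Type) (K : nmodType) (h : X -> Y) (rs : seq X) n
    (F : seq Y -> K) :
  tsum (map h rs) n F = tsum rs n (fun t => F (map h t)).
Proof.
elim: n F => //= n IH F; rewrite big_map.
by apply: eq_bigr => x _; rewrite IH.
Qed.

Lemma tsum_perm (X : eqType) (K : nmodType) (rs rs' : seq X) n
    (F : seq X -> K) : perm_eq rs rs' -> tsum rs n F = tsum rs' n F.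
Proof.
move=> prs; elim: n F => //= n IH F; rewrite (perm_big _ prs).
by apply: eq_bigr => x _; rewrite IH.
Qed.

Lemma tsum_filter (X : Type) (K : nmodType) (P : pred X) (rs : seq X) n
    (F : seq X -> K) :
  tsum (seq.filter P rs) n F = tsum rs n (fun t => if all P t then F t else 0).
Proof.
elim: n F => //= n IH F; rewrite big_filter big_mkcond /=.
apply: eq_bigr => x _; case: (P x) => /=; first exact: IH.
by rewrite tsum0.
Qed.

(** Each entry is routed by its bit to one of two lists that vary independently, so the sum over [t]
    decouples. *)
Lemma tsum_mask (X : Type) (K : nmodType) (rs : seq X) (b : bitseq)
    (H : seq X -> seq X -> K) :
  tsum rs (size b) (fun t => H (mask b t) (mask (map negb b) t)) =
  tsum rs (count id b) (fun s => tsum rs (count negb b) (H s)).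
Proof.
elim: b H => [|[] b IH] H //=.
  by apply: eq_bigr => x _; rewrite (IH (fun s => H (x :: s))).
rewrite tsum_sum; apply: eq_bigr => x _.
exact: (IH (fun s s' => H s (x :: s'))).
Qed.

Lemma tsum_count (K : nmodType) N (G : nat -> K) :
  tsum [:: true; false] N (fun b => G (count id b)) =
  \sum_(k < N.+1) G k *+ 'C(N, k).
Proof.
elim: N G => [|N IH] G; first by rewrite big_ord_recl big_ord0 addr0.
rewrite /= big_cons big_seq1 /= (IH (fun k => G (1 + k)%N)) (IH G).
rewrite [RHS]big_ord_recl /= bin0.
rewrite [X in _ + X]big_ord_recl /= bin0 addrCA; congr (_ + _).
rewrite [RHS](eq_bigr (fun i : 'I_N.+1 =>
  G i.+1 *+ 'C(N, i.+1) + G i.+1 *+ 'C(N, i))); last first.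
  by move=> i _; rewrite binS mulrnDr.
rewrite big_split /= addrC; congr (_ + _).
by rewrite big_ord_recr /= bin_small // mulr0n addr0; apply: eq_bigr.
Qed.

Lemma tsum_masks (X : Type) (K : nmodType) (rs : seq X) N
    (H : seq X -> seq X -> K) :
  tsum rs N (fun t => tsum [:: true; false] N
    (fun b => H (mask b t) (mask (map negb b) t))) =
  \sum_(k < N.+1) tsum rs k (fun s => tsum rs (N - k) (H s)) *+ 'C(N, k).
Proof.
rewrite tsum_exch -(tsum_count N (fun k => tsum rs k
  (fun s => tsum rs (N - k) (H s)))).
apply: eq_tsum => b sb; rewrite -sb tsum_mask -(count_predC id b) addKn.
by apply: eq_tsum.
Qed.

Lemma le_tsum (X : Type) (K : numDomainType) (rs : seq X) n
    (F G : seq X -> K) :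
  (forall t, size t = n -> F t <= G t) -> tsum rs n F <= tsum rs n G.
Proof.
elim: n F G => [|n IH] F G H /=; first exact: H.
by apply: ler_sum => x _; apply: IH => t st; apply: H; rewrite /= st.
Qed.

Lemma le_tsum_in (X : eqType) (K : numDomainType) (rs : seq X) n
    (F G : seq X -> K) :
  (forall t, size t = n -> {subset t <= rs} -> F t <= G t) ->
  tsum rs n F <= tsum rs n G.
Proof.
elim: n F G => [|n IH] F G H /=; first by apply: H => // x; rewrite in_nil.
rewrite big_seq [leRHS]big_seq; apply: ler_sum => x xr.
apply: IH => t st tr; apply: H; first by rewrite /= st.
by move=> y; rewrite inE => /orP[/eqP->|/tr].
Qed.

Lemma tsum_ge0 (X : Type) (K : numDomainType) (rs : seq X) n
    (F : seq X -> K) :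
  (forall t, size t = n -> 0 <= F t) -> 0 <= tsum rs n F.
Proof. by move=> H; rewrite -(tsum0 K rs n); apply: le_tsum. Qed.

Lemma ler_norm_tsum (X : Type) (K : numDomainType) (rs : seq X) n
    (F : seq X -> K) :
  `|tsum rs n F| <= tsum rs n (fun t => `|F t|).
Proof.
elim: n F => //= n IH F; apply: (le_trans (ler_norm_sum _ _ _)).
by apply: ler_sum.
Qed.

Fixpoint prod_zip {X : Type} {K : pzRingType} (fs : seq (X -> K)) (t : seq X) : K :=
  match fs, t with
  | f :: fs', x :: t' => f x * prod_zip fs' t'
  | _, _ => 1
  end.

Lemma tsum_prod_zip (X : Type) (K : comPzRingType) (rs : seq X)
    (fs : seq (X -> K)) :
  tsum rs (size fs) (prod_zip fs) = \prod_(f <- fs) \sum_(x <- rs) f x.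
Proof.
elim: fs => [|f fs IH] /=; first by rewrite big_nil.
rewrite big_cons -IH mulr_suml; apply: eq_bigr => x _.
by rewrite -tsumZ.
Qed.

Lemma prod_zip_ge0 (X : Type) (K : numDomainType) (fs : seq (X -> K)) (t : seq X) :
  (forall f x, List.In f fs -> 0 <= f x) -> 0 <= prod_zip fs t.
Proof.
elim: fs t => [|f fs IH] [|x t] H //=; rewrite ?ler01 //.
apply: mulr_ge0; first by apply: H; left.
by apply: IH => h y hf; apply: H; right.
Qed.

Definition perm_inv {X : eqType} {K : Type} (F : seq X -> K) :=
  forall s t, perm_eq s t -> F s = F t.

(** Adjacent transpositions generate all permutations; symmetry of the weights is checked this way,
    as the coefficients only change sign under such a swap. *)
Lemma swap_perm_inv (X : eqType) (K : Type) (F : seq X -> K) :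
  (forall s x y t, F (s ++ x :: y :: t) = F (s ++ y :: x :: t)) -> perm_inv F.
Proof.
move=> swF; have mv u s x t : F (u ++ s ++ x :: t) = F (u ++ x :: s ++ t).
  elim: s u => [|y s IH] u //=.
  by rewrite -cat_rcons IH cat_rcons swF.
have main s t u : perm_eq s t -> F (u ++ s) = F (u ++ t).
  elim: s t u => [|x s IH] t u pst.
    by move: pst; rewrite perm_sym => /perm_nilP ->.
  have xt : x \in t by rewrite -(perm_mem pst) mem_head.
  case/splitPr: xt pst => t1 t2 pst; rewrite mv -2!cat_rcons; apply: IH.
  move: pst; rewrite -[x :: t2]cat1s perm_sym perm_catCA /= perm_cons.
  by rewrite perm_sym.
by move=> s t /(main s t [::]).
Qed.

Lemma perm_inv_cons (X : eqType) (K : Type) (F : seq X -> K) x :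
  perm_inv F -> perm_inv (fun s => F (x :: s)).
Proof. by move=> HF s t st; apply: HF; rewrite perm_cons. Qed.

(** The factor [1/n!] turns sums over ordered tuples into sums over configurations of identical
    particles; splitting a configuration then produces no binomial coefficients ([isum_masks]). *)
Definition isum {X : Type} {K : numFieldType} (rs : seq X) n
    (F : seq X -> K) : K := (n`!)%:R^-1 * tsum rs n F.

Lemma fact_neq0 (K : numFieldType) n : (n`!)%:R != 0 :> K.
Proof. by rewrite pnatr_eq0 -lt0n fact_gt0. Qed.

Lemma factV_ge0 (K : numFieldType) n : 0 <= (n`!)%:R^-1 :> K.
Proof. by rewrite invr_ge0 ler0n. Qed.

Lemma eq_isum (X : Type) (K : numFieldType) (rs : seq X) n
    (F G : seq X -> K) :
  (forall t, size t = n -> F t = G t) -> isum rs n F = isum rs n G.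
Proof. by move=> H; rewrite /isum (eq_tsum _ H). Qed.

Lemma isum_sum (X I : Type) (K : numFieldType) (rs : seq X) n (l : seq I)
    (P : pred I) (F : I -> seq X -> K) :
  isum rs n (fun t => \sum_(i <- l | P i) F i t) =
  \sum_(i <- l | P i) isum rs n (F i).
Proof. by rewrite /isum tsum_sum mulr_sumr. Qed.

Lemma isumZ (X : Type) (K : numFieldType) (rs : seq X) n (c : K)
    (F : seq X -> K) :
  isum rs n (fun t => c * F t) = c * isum rs n F.
Proof. by rewrite /isum tsumZ mulrCA. Qed.

Lemma isumD (X : Type) (K : numFieldType) (rs : seq X) n (F G : seq X -> K) :
  isum rs n (fun t => F t + G t) = isum rs n F + isum rs n G.
Proof. by rewrite /isum tsumD mulrDr. Qed.

Lemma isumB (X : Type) (K : numFieldType) (rs : seq X) n (F G : seq X -> K) :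
  isum rs n (fun t => F t - G t) = isum rs n F - isum rs n G.
Proof. by rewrite /isum tsumB mulrBr. Qed.

Lemma isum_ge0 (X : Type) (K : numFieldType) (rs : seq X) n
    (F : seq X -> K) :
  (forall t, size t = n -> 0 <= F t) -> 0 <= isum rs n F.
Proof. by move=> H; rewrite mulr_ge0 ?factV_ge0 ?tsum_ge0. Qed.

Lemma le_isum (X : Type) (K : numFieldType) (rs : seq X) n
    (F G : seq X -> K) :
  (forall t, size t = n -> F t <= G t) -> isum rs n F <= isum rs n G.
Proof. by move=> H; rewrite ler_wpM2l ?factV_ge0 ?le_tsum. Qed.

Lemma le_isum_in (X : eqType) (K : numFieldType) (rs : seq X) n
    (F G : seq X -> K) :
  (forall t, size t = n -> {subset t <= rs} -> F t <= G t) ->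
  isum rs n F <= isum rs n G.
Proof. by move=> H; rewrite ler_wpM2l ?factV_ge0 ?le_tsum_in. Qed.

Lemma isum_masks (X : Type) (K : numFieldType) (rs : seq X) N
    (H : seq X -> seq X -> K) :
  isum rs N (fun t => tsum [:: true; false] N
    (fun b => H (mask b t) (mask (map negb b) t))) =
  \sum_(k < N.+1) isum rs k (fun s => isum rs (N - k) (H s)).
Proof.
rewrite /isum tsum_masks mulr_sumr; apply: eq_bigr => k _.
rewrite tsumZ -[_ *+ _]mulr_natr.
set S := tsum _ _ _.
have kN : (k <= N)%N by rewrite -ltnS.
rewrite -(bin_fact kN) !natrM; field.
by rewrite !fact_neq0 /= pnatr_eq0 -lt0n bin_gt0.
Qed.

Lemma perm_mask (X : eqType) (b : bitseq) (t : seq X) :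
  size b = size t -> perm_eq (mask b t ++ mask (map negb b) t) t.
Proof.
elim: b t => [|[] b IH] [|x t] //= [st]; first by rewrite perm_cons IH.
by rewrite -cat1s perm_catCA /= perm_cons IH.
Qed.

(** Among all ways to distribute a tuple over two lists, exactly one puts the entries satisfying [P]
    on the left and the others on the right; [H] is 0 on all other ways. With a threshold for [P]
    this separates the particles left and right of a cut. *)
Lemma isum_threshold (X : eqType) (K : numFieldType) (rs : seq X) N
    (P : pred X) (F : seq X -> K) : perm_inv F ->
  isum rs N F = \sum_(k < N.+1) isum (seq.filter P rs) k
    (fun s => isum (seq.filter (predC P) rs) (N - k) (fun s' => F (s ++ s'))).
Proof.
move=> HF; pose H s s' := if all P s then
  (if all (predC P) s' then F (s ++ s') else 0) else 0.
have key (t : seq X) (G : seq X -> seq X -> K) :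
  tsum [:: true; false] (size t) (fun b => if all P (mask b t) then
    (if all (predC P) (mask (map negb b) t) then
      G (mask b t) (mask (map negb b) t) else 0) else 0) =
  G (seq.filter P t) (seq.filter (predC P) t).
  elim: t G => //= x t IH G; rewrite big_cons big_seq1 /=.
  case: (P x) => /=.
    rewrite (IH (fun s => G (x :: s))) [X in _ + X](_ : _ = 0) ?addr0 //.
    by rewrite -[RHS](tsum0 K [:: true; false] (size t)); apply: eq_tsum => b _; case: ifP.
  rewrite tsum0 add0r; exact: (IH (fun s s' => G s (x :: s'))).
transitivity (isum rs N (fun t => tsum [:: true; false] N
    (fun b => H (mask b t) (mask (map negb b) t)))).
  apply: eq_isum => t st; rewrite -st (key t (fun s s' => F (s ++ s'))); apply: HF.
  by rewrite perm_sym; apply/permPl/perm_filterC.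
rewrite isum_masks; apply: eq_bigr => k _.
rewrite /isum tsum_filter; congr (_ * _); apply: eq_tsum => s _.
rewrite /H; case: ifP => _; last by rewrite tsum0 mulr0.
by rewrite tsum_filter.
Qed.

Lemma prod_masks (X : Type) (K : comPzRingType) (phi : X -> K) (t : seq X) :
  \prod_(x <- t) (1 + phi x) =
  tsum [:: true; false] (size t) (fun b => \prod_(x <- mask b t) phi x).
Proof.
elim: t => [|x t IH] /=; first by rewrite !big_nil.
rewrite !big_cons IH big_nil addr0 mulrDl mul1r addrC; congr (_ + _).
by rewrite -tsumZ; apply: eq_tsum => b _; rewrite /= big_cons.
Qed.

(** Expanding the product over subsets of the particles and summing out the other particles is the
    expansion of a generating functional in correlation functions. *)
Lemma isum_prod1 (X : eqType) (K : numFieldType) (rs : seq X) N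
    (phi : X -> K) (F : seq X -> K) : perm_inv F ->
  isum rs N (fun t => F t * \prod_(x <- t) (1 + phi x)) =
  \sum_(k < N.+1) isum rs k (fun s =>
     isum rs (N - k) (fun s' => F (s ++ s')) * \prod_(x <- s) phi x).
Proof.
move=> HF; pose H s s' := F (s ++ s') * \prod_(x <- s) phi x.
transitivity (isum rs N (fun t => tsum [:: true; false] N
    (fun b => H (mask b t) (mask (map negb b) t)))).
  apply: eq_isum => t st; rewrite prod_masks st -tsumZ; apply: eq_tsum => b sb.
  by rewrite /H; congr (_ * _); apply: HF; rewrite perm_sym perm_mask // sb st.
rewrite isum_masks; apply: eq_bigr => k _; apply: eq_isum => s _.
by rewrite /isum /H tsumZr mulrA.
Qed.

(** Campbell's formula: by symmetry the marked particle may be taken to come first, and the choice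
    of the mark turns [1/(N+1)!] into [1/N!]. *)
Lemma campbell (X : eqType) (K : numFieldType) (rs : seq X) N
    (phi : X -> K) (F : seq X -> K) : perm_inv F ->
  isum rs N.+1 (fun t => F t * \sum_(x <- t) phi x) =
  \sum_(x <- rs) phi x * isum rs N (fun s => F (x :: s)).
Proof.
move=> HF; have key : tsum rs N.+1 (fun t => F t * \sum_(x <- t) phi x) =
    N.+1%:R * \sum_(x <- rs) phi x * tsum rs N (fun s => F (x :: s)).
  elim: N F HF => [|N IH] F HF.
    by rewrite /= mul1r; apply: eq_bigr => x _; rewrite big_seq1 mulrC.
  rewrite [LHS]/=.
  transitivity (\sum_(x <- rs) (phi x * tsum rs N.+1 (fun t => F (x :: t)) +
      N.+1%:R * \sum_(y <- rs) phi y * tsum rs N (fun s => F (x :: y :: s)))).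
    apply: eq_bigr => x _.
    rewrite -(IH (fun s => F (x :: s)) (perm_inv_cons x HF)) -tsumZ -tsumD.
    apply: (@eq_tsum X K rs N.+1 (fun t => F (x :: t) *
      \sum_(y <- x :: t) phi y)) => t _.
    by rewrite big_cons mulrDr [F _ * phi x]mulrC.
  rewrite big_split /= -[in RHS]natr1 mulrDl mul1r addrC; congr (_ + _).
  rewrite -mulr_sumr exchange_big /=; congr (_ * _); apply: eq_bigr => x _.
  rewrite -mulr_sumr; congr (_ * _); apply: eq_bigr => y _.
  by apply: eq_tsum => s _; apply: HF; rewrite -[_ :: _ :: s]/([:: y] ++ [:: x] ++ s) perm_catCA.
rewrite /isum key factS natrM.
under [RHS]eq_bigr do rewrite mulrCA.
rewrite -mulr_sumr mulrA; congr (_ * _).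
by rewrite invfM mulrAC mulVf ?mul1r // pnatr_eq0.
Qed.

(** Several marks give only an inequality: the right side also counts marks that fall on the same
    particle, and these terms are nonnegative. *)
Lemma campbell_le (X : eqType) (K : numFieldType) (rs : seq X) N
    (fs : seq (X -> K)) (F : seq X -> K) : perm_inv F ->
  (forall f x, List.In f fs -> 0 <= f x) -> (forall t, 0 <= F t) ->
  tsum rs (size fs) (fun m => isum rs N (fun s => F (m ++ s)) * prod_zip fs m) <=
  isum rs (size fs + N) (fun t => F t * \prod_(f <- fs) \sum_(x <- t) f x).
Proof.
elim: fs F => [|f fs IH] F HF Hf HF0.
  rewrite /= mulr1 le_eqVlt; apply/orP; left; apply/eqP.
  by apply: eq_isum => t _; rewrite big_nil mulr1.
rewrite addSn [leLHS]/=.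
have f0 x : 0 <= f x by apply: Hf; left.
have Hfs : forall h x, List.In h fs -> 0 <= h x.
  by move=> h x hh; apply: Hf; right.
have sum0 h (t : seq X) : List.In h fs -> 0 <= \sum_(x <- t) h x.
  by move=> hh; apply: sumr_ge0 => x _; exact: Hfs.
have prod_le (t : seq X) x : 0 <= \prod_(h <- fs) \sum_(y <- t) h y <=
    \prod_(h <- fs) \sum_(y <- x :: t) h y.
  clear IH Hf; elim: fs Hfs sum0 => [|h fs IH] Hfs sum0.
    by rewrite !big_nil ler01 lexx.
  have /andP[A B] : 0 <= \prod_(h <- fs) \sum_(y <- t) h y <=
    \prod_(h <- fs) \sum_(y <- x :: t) h y.
    by apply: IH => [k y hk|k s hk]; [apply: Hfs; right|apply: sum0; right].
  have h0 : 0 <= \sum_(y <- t) h y by apply: sum0; left.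
  have hx : 0 <= h x by apply: Hfs; left.
  rewrite !big_cons mulr_ge0 //=; apply: ler_pM => //.
  by rewrite lerDr.
have step x : tsum rs (size fs) (fun m =>
    isum rs N (fun s => F (x :: m ++ s)) * (f x * prod_zip fs m)) <=
    f x * isum rs (size fs + N) (fun t => F (x :: t) *
      \prod_(h <- fs) \sum_(y <- x :: t) h y).
  rewrite (eq_tsum _ (G := fun m => f x *
    (isum rs N (fun s => F (x :: m ++ s)) * prod_zip fs m))); last first.
    by move=> m _; rewrite mulrCA.
  rewrite tsumZ; apply: ler_wpM2l => //.
  apply: (le_trans (IH (fun s => F (x :: s)) (perm_inv_cons x HF) Hfs _)) => //.
  apply: le_isum => t _; apply: ler_wpM2l => //.
  by have /andP[] := prod_le t x.
apply: (le_trans (ler_sum _ (fun x _ => step x))).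
rewrite -(@campbell _ _ _ _ f (fun t => F t * \prod_(h <- fs) \sum_(y <- t) h y)).
  apply: le_isum => t _; rewrite big_cons le_eqVlt; apply/orP; left.
  by rewrite -mulrA [X in _ * X]mulrC.
move=> s t st; congr (_ * _); first exact: HF.
by apply: eq_bigr => h _; apply: perm_big.
Qed.

Lemma perm_mask_ex (X : eqType) (t s1 s2 : seq X) : perm_eq t (s1 ++ s2) ->
  exists2 b, size b = size t &
  perm_eq (mask b t) s1 /\ perm_eq (mask (map negb b) t) s2.
Proof.
elim: t s1 s2 => [|x t IH] s1 s2 H.
  move: H; rewrite perm_sym => /perm_nilP; case: s1 s2 => [|//] [|//] _.
  by exists [::].
have : x \in s1 ++ s2 by rewrite -(perm_mem H) mem_head.
rewrite mem_cat => /orP[xs|xs].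
  have p1 := perm_to_rem xs.
  have /IH[b sb [b1 b2]] : perm_eq t (rem x s1 ++ s2).
    rewrite -(perm_cons x); apply: (perm_trans H).
    by rewrite -cat_cons perm_cat2r.
  exists (true :: b); first by rewrite /= sb.
  split=> //=; rewrite perm_sym (perm_trans p1) // perm_cons perm_sym //.
have p1 := perm_to_rem xs.
have /IH[b sb [b1 b2]] : perm_eq t (s1 ++ rem x s2).
  rewrite -(perm_cons x); apply: (perm_trans H).
  rewrite perm_sym -cat1s perm_catCA perm_cat2l /=; by rewrite perm_sym.
exists (false :: b); first by rewrite /= sb.
by split=> //=; rewrite perm_sym (perm_trans p1) // perm_cons perm_sym.
Qed.

Lemma tsum_mask_ge (K : numDomainType) n (J : bitseq -> K) (c : bitseq) :
  (forall c, 0 <= J c) -> size c = n -> J c <= tsum [:: true; false] n J.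
Proof.
elim: n J c => [|n IH] J c J0; first by move/size0nil ->.
case: c => // d c [sc] /=; rewrite big_cons big_seq1.
have A := IH (fun s => J (true :: s)) c (fun _ => J0 _) sc.
have B := IH (fun s => J (false :: s)) c (fun _ => J0 _) sc.
by case: d; [rewrite ler_wpDr|rewrite ler_wpDl] => //; apply: tsum_ge0.
Qed.

Lemma isum_masks1 (X : Type) (K : numFieldType) (rs : seq X) N k
    (G1 G2 : seq X -> K) : (k <= N)%N ->
  isum rs N (fun t => tsum [:: true; false] N (fun b =>
    if size (mask b t) == k then G1 (mask b t) * G2 (mask (map negb b) t) else 0)) =
  isum rs k G1 * isum rs (N - k) G2.
Proof.
move=> kN; rewrite (isum_masks rs N (fun s s' => if size s == k then G1 s * G2 s' else 0)).
rewrite (bigD1 (Ordinal (kN : (k < N.+1)%N))) //= big1 ?addr0; last first.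
  move=> i /eqP ik; rewrite /isum (eq_tsum _ (G := fun=> 0)) ?tsum0 ?mulr0 //.
  move=> s ss; rewrite (eq_tsum _ (G := fun=> 0)) ?tsum0 ?mulr0 // => s' _.
  rewrite ss ifF //.
  by apply/negbTE/eqP => e; apply: ik; apply: val_inj.
rewrite /isum (eq_tsum _ (G := fun s => (N - k)`!%:R^-1 * tsum rs (N - k) G2 * G1 s)).
  by rewrite tsumZ mulrA mulrC mulrCA !mulrA.
move=> s ss; rewrite (eq_tsum _ (G := fun s' => G1 s * G2 s')) => [|s' _].
  by rewrite tsumZ mulrA mulrAC -mulrA mulrC mulrAC.
by rewrite ss eqxx.
Qed.

(** Cutting the sorted tuple at the ranks [k1] and [k2] is one of the ways to distribute its entries
    over three blocks. Bounding it by the sum over all ways removes the sorting and decouples the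
    blocks without any combinatorial factor. *)
Lemma isum_cut3_le (X : eqType) (K : numFieldType) (rs : seq X) N k1 k2
    (srt : seq X -> seq X) (F G1 G2 G3 : seq X -> K) :
  (k1 <= k2 <= N)%N -> (forall t, perm_eq (srt t) t) ->
  (forall t, 0 <= G1 t) -> (forall t, 0 <= G2 t) -> (forall t, 0 <= G3 t) ->
  perm_inv G1 -> perm_inv G2 -> perm_inv G3 ->
  (forall t, size t = N -> {subset t <= rs} -> F t <= G1 (take k1 (srt t)) *
    (G2 (take (k2 - k1) (drop k1 (srt t))) * G3 (drop k2 (srt t)))) ->
  isum rs N F <= isum rs k1 G1 * (isum rs (k2 - k1) G2 * isum rs (N - k2) G3).
Proof.
move=> /andP[k12 k2N] srtP G10 G20 G30 pG1 pG2 pG3 HF.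
have k1N := leq_trans k12 k2N.
have kk : (k2 - k1 <= N - k1)%N by rewrite leq_sub2r.
have e : (N - k2 = N - k1 - (k2 - k1))%N by lia.
rewrite e -(isum_masks1 rs G2 G3 kk) -isum_masks1 //.
pose J2 (t : seq X) b := if size (mask b t) == (k2 - k1)%N then
  G2 (mask b t) * G3 (mask (map negb b) t) else 0.
have J20 t b : 0 <= J2 t b by rewrite /J2; case: ifP => // _; apply: mulr_ge0.
pose J1 (t : seq X) b := if size (mask b t) == k1 then
  G1 (mask b t) * tsum [:: true; false] (N - k1) (J2 (mask (map negb b) t)) else 0.
have J10 t b : 0 <= J1 t b.
  by rewrite /J1; case: ifP => // _; rewrite mulr_ge0 // tsum_ge0.
apply: le_isum_in => t st tr; apply: (le_trans (HF t st tr)).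
have ssrt : size (srt t) = N by rewrite (perm_size (srtP t)).
have : perm_eq t (take k1 (srt t) ++ drop k1 (srt t)).
  by rewrite cat_take_drop perm_sym.
case/perm_mask_ex => b sb [b1 b2].
have s1 : size (mask b t) = k1 by rewrite (perm_size b1) size_takel // ssrt.
apply: (le_trans _ (@tsum_mask_ge _ N (J1 t) b _ _)); rewrite ?sb //.
rewrite /J1 s1 eqxx -(pG1 _ _ b1); apply: ler_wpM2l => //.
have : perm_eq (mask (map negb b) t)
   (take (k2 - k1) (drop k1 (srt t)) ++ drop k2 (srt t)).
  rewrite (perm_trans b2) // -{1}(cat_take_drop (k2 - k1) (drop k1 (srt t))).
  by rewrite drop_drop subnK.
case/perm_mask_ex => c sc [c1 c2].
have s2 : size (mask c (mask (map negb b) t)) = (k2 - k1)%N.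
  by rewrite (perm_size c1) size_takel // size_drop ssrt.
have s3 : size (mask (map negb b) t) = (N - k1)%N.
  by rewrite (perm_size b2) size_drop ssrt.
apply: (le_trans _ (@tsum_mask_ge _ (N - k1) (J2 _) c _ _)); rewrite ?sc //.
by rewrite /J2 s2 eqxx -(pG2 _ _ c1) -(pG3 _ _ c2).
Qed.

Lemma isum_cut_le (X : eqType) (K : numFieldType) (rs : seq X) N k
    (srt : seq X -> seq X) (F G1 G2 : seq X -> K) :
  (k <= N)%N -> (forall t, perm_eq (srt t) t) ->
  (forall t, 0 <= G1 t) -> (forall t, 0 <= G2 t) ->
  perm_inv G1 -> perm_inv G2 ->
  (forall t, size t = N -> F t <= G1 (take k (srt t)) * G2 (drop k (srt t))) ->
  isum rs N F <= isum rs k G1 * isum rs (N - k) G2.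
Proof.
move=> kN srtP G10 G20 pG1 pG2 HF; rewrite -isum_masks1 //.
apply: le_isum => t st; apply: (le_trans (HF t st)).
have : perm_eq t (take k (srt t) ++ drop k (srt t)).
  by rewrite cat_take_drop perm_sym.
case/perm_mask_ex => b sb [b1 b2].
have sk : size (mask b t) = k.
  by rewrite (perm_size b1) size_takel // (perm_size (srtP t)) st.
pose J c := if size (mask c t) == k then G1 (mask c t) * G2 (mask (map negb c) t) else 0.
have J0 c : 0 <= J c by rewrite /J; case: ifP => // _; apply: mulr_ge0.
apply: (le_trans _ (@tsum_mask_ge _ N J b _ _)); rewrite ?sb //.
by rewrite /J sk eqxx (pG1 _ _ b1) (pG2 _ _ b2).
Qed.

End SequenceSums.

(** * Coefficients of powers of the Vandermonde product *)

Section LaughlinPolynomial.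
Variables (C : numFieldType) (p : nat).

Fixpoint vdm (t : seq C) : C :=
  if t is x :: t' then (\prod_(y <- t') (y - x) ^+ p) * vdm t' else 1.

Definition cross (s t : seq C) : C := \prod_(x <- s) \prod_(y <- t) (y - x) ^+ p.

Lemma vdm_cat s t : vdm (s ++ t) = vdm s * vdm t * cross s t.
Proof.
elim: s => [|x s IH] /=; first by rewrite /cross big_nil mulr1 mul1r.
by rewrite big_cat /= IH /cross big_cons; ring.
Qed.

Lemma cross_catr s t t' : cross s (t ++ t') = cross s t * cross s t'.
Proof. by rewrite -big_split /=; apply: eq_bigr => x _; rewrite big_cat. Qed.

Fixpoint mon (m : seq nat) (t : seq C) : C :=
  match m, t with
  | j :: m', x :: t' => x ^+ j * mon m' t'
  | _, _ => 1
  end.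

Lemma mon_cat m m' t t' : size m = size t ->
  mon (m ++ m') (t ++ t') = mon m t * mon m' t'.
Proof.
elim: m t => [|j m IH] [|x t] //= => [_|[/IH ->]]; first by rewrite mul1r.
by rewrite mulrA.
Qed.

Lemma poly_eq_eval (P Q : {poly C}) :
  (forall x, x != 0 -> P.[x] = Q.[x]) -> P = Q.
Proof.
move=> H; apply/eqP; rewrite -subr_eq0; apply/negPn/negP => nz.
set n := size (P - Q).
have := max_poly_roots (rs := [seq i.+1%:R | i <- iota 0 n]) nz.
rewrite size_map size_iota ltnn; case: (boolP (all _ _)) => [_|/allPn].
  case: (boolP (uniq _)) => [_ /(_ isT isT) //|].
  rewrite map_inj_uniq ?iota_uniq // => i j /eqP; rewrite eqr_nat => /eqP[] //.
case=> x /mapP[i _ ->] /negP[].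
by rewrite rootE hornerD hornerN H ?subrr // pnatr_eq0.
Qed.

(** Uniqueness of coefficients, by induction on the number of variables. Vanishing is assumed only
    for nonzero arguments, because the reflection [x -> 1/x] needs invertible ones. *)
Lemma tsum_mon_inj M N (A : seq nat -> C) :
  (forall t, size t = N -> all (fun x => x != 0) t ->
    tsum (iota 0 M) N (fun m => A m * mon m t) = 0) ->
  forall m, size m = N -> all (fun j => j < M)%N m -> A m = 0.
Proof.
elim: N A => [|N IH] A H m.
  by move/size0nil => -> _; have := H [::] erefl erefl; rewrite /= mulr1.
case: m => // j m [sm] /= /andP[jM am].
apply: (IH (fun m => A (j :: m))) => // t st nt.
pose B i := tsum (iota 0 M) N (fun m => A (i :: m) * mon m t).
have : \poly_(i < M) B i = 0.
  apply: poly_eq_eval => x x0; rewrite horner0 horner_poly.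
  have H1 : tsum (iota 0 M) N.+1 (fun m => A m * mon m (x :: t)) = 0.
    by apply: H; rewrite /= ?st ?x0.
  rewrite tsumS in H1.
  rewrite -[RHS]H1 big_iota0.
  apply: eq_bigr => i _; rewrite /B -tsumZr; apply: eq_tsum => m' _.
  by rewrite mulrAC mulrA.
by move/(congr1 (fun q : {poly C} => q`_j)); rewrite coef_poly jM coef0.
Qed.

Lemma eq_tsum_mon M N (A B : seq nat -> C) :
  (forall t, size t = N -> all (fun x => x != 0) t ->
    tsum (iota 0 M) N (fun m => A m * mon m t) =
    tsum (iota 0 M) N (fun m => B m * mon m t)) ->
  forall m, size m = N -> all (fun j => j < M)%N m -> A m = B m.
Proof.
move=> H m sm am; apply/eqP; rewrite -subr_eq0; apply/eqP.
apply: (@tsum_mon_inj M N (fun m => A m - B m)) => // t st nt.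
rewrite (eq_tsum _ (G := fun m => A m * mon m t - B m * mon m t)) => [|m' _].
  by rewrite tsumB H ?subrr.
by rewrite mulrBl.
Qed.

Lemma tsum_iota_le (K : nmodType) M M' N (F : seq nat -> K) : (M <= M')%N ->
  (forall m, size m = N -> ~~ all (fun j => j < M)%N m -> F m = 0) ->
  tsum (iota 0 M') N F = tsum (iota 0 M) N F.
Proof.
move=> MM H; have -> : iota 0 M = seq.filter (fun j => j < M)%N (iota 0 M').
  rewrite -(subnK MM) addnC iotaD filter_cat add0n.
  rewrite (_ : seq.filter _ (iota M _) = [::]) ?cats0.
    by apply/esym/all_filterP/allP => x; rewrite mem_iota.
  apply/eqP; rewrite -size_eq0 size_filter -leqn0 leqNgt -has_count.
  by apply/hasPn => x; rewrite mem_iota -leqNgt => /andP[].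
rewrite tsum_filter; apply: eq_tsum => m sm; case: ifP => // /negbT.
exact: H.
Qed.

Let cshift (d m : seq nat) := [seq (x.1 - x.2)%N | x <- zip m d].

Lemma big_iota_shift (K : nmodType) k M q (f : nat -> K) : (k <= q)%N ->
  (forall j, (M <= j)%N -> f j = 0) ->
  \sum_(j <- iota 0 M) f j =
  \sum_(j <- iota 0 (M + q)) (if (k <= j)%N then f (j - k)%N else 0).
Proof.
move=> kq f0; rewrite (_ : M + q = k + (M + (q - k)))%N; last by lia.
rewrite !iotaD !big_cat /= add0n.
rewrite [X in _ = X + _]big1_seq ?add0r => [|j /=]; last first.
  by rewrite mem_iota add0n => /andP[_ jk]; rewrite leqNgt jk.
rewrite [X in _ = _ + X]big1_seq ?addr0 => [|j /=]; last first.
  by rewrite mem_iota => /andP[kj _]; case: ifP => // _; apply: f0; lia.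
rewrite (_ : iota k M = map (addn k) (iota 0 M)) ?big_map; last first.
  by rewrite -iotaDl addn0.
 apply: eq_bigr => j _.
by rewrite leq_addr addKn.
Qed.

(** Multiplication by the monomial with exponents [d] shifts exponents; enlarging their range by [p]
    leaves enough room, as the entries of [d] are at most [p]. *)
Lemma tsum_shift M (A : seq nat -> C) (d : seq nat) (t : seq C) :
  size t = size d -> all (fun i => i <= p)%N d ->
  (forall m, size m = size d -> ~~ all (fun j => j < M)%N m -> A m = 0) ->
  tsum (iota 0 M) (size d) (fun m => A m * (mon d t * mon m t)) =
  tsum (iota 0 (M + p)) (size d)
    (fun m => if all2 leq d m then A (cshift d m) * mon m t else 0).
Proof.
elim: d t A => [|k d IH] [|y t] A //=; first by rewrite mul1r.
case=> st /andP[kp dp] A0.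
rewrite [LHS](eq_bigr (fun j => y ^+ (k + j) * tsum (iota 0 (M + p)) (size d)
  (fun m => if all2 leq d m then A (j :: cshift d m) * mon m t else 0))).
  rewrite (@big_iota_shift _ k _ p) //; last first.
    move=> j Mj; rewrite (eq_tsum _ (G := fun=> 0)) ?tsum0 ?mulr0 // => m sm.
    case: ifP => // dm; rewrite A0 ?mul0r //=; last by rewrite ltnNge Mj.
    by rewrite /cshift size_map size_zip sm minnn.
  apply: eq_bigr => j _; case: leqP => kj /=; last by rewrite tsum0.
  rewrite -tsumZ; apply: eq_tsum => m sm; rewrite subnKC //.
  by case: ifP => _; rewrite ?mulr0 //= mulrCA.
move=> j _.
rewrite (eq_tsum _ (G := fun m => y ^+ (k + j) *
  (A (j :: m) * (mon d t * mon m t)))) => [|m _]; last by rewrite exprD; ring.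
rewrite tsumZ; congr (_ * _); apply: IH => // m sm nm.
by apply: A0 => /=; rewrite ?sm // negb_and nm orbT.
Qed.

Lemma prod_expand (x : C) (t : seq C) :
  \prod_(y <- t) (y - x) ^+ p = tsum (iota 0 p.+1) (size t) (fun d =>
    (\prod_(i <- d) ((- x) ^+ (p - i) *+ 'C(p, i))) * mon d t).
Proof.
elim: t => [|y t IH]; first by rewrite /= !big_nil mulr1.
rewrite big_cons IH tsumS big_iota0 addrC exprDn mulr_suml.
apply: eq_bigr => i _; rewrite -tsumZ; apply: eq_tsum => d _.
by rewrite big_cons /= -mulrnAl mulrACA.
Qed.

(** Induction on the number of variables: the factor of the first variable [x] is expanded in the
    others with exponents [d], and the complementary degree [deg d] falls on [x]. The degree bound
    in each variable is recorded because it tells how many roots of unity separate the exponents. *)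
Lemma vdm_poly N : exists A : seq nat -> C,
  (forall m, size m = N -> ~~ all (fun j => j <= p * N.-1)%N m -> A m = 0) /\
  (forall t, size t = N ->
    vdm t = tsum (iota 0 (p * N.-1).+1) N (fun m => A m * mon m t)).
Proof.
elim: N => [|N [A [A0 HA]]].
  exists (fun=> 1); split; first by move=> m /size0nil ->.
  by move=> t /size0nil ->; rewrite /= mulr1.
pose c (d : seq nat) : C :=
  \prod_(i <- d) ((-1) ^+ (p - i) *+ 'C(p, i)).
pose deg (d : seq nat) := sumn [seq (p - i)%N | i <- d].
pose B m := if m is j :: m' then tsum (iota 0 p.+1) N (fun d =>
  if all2 leq d m' then (if deg d == j then c d * A (cshift d m') else 0) else 0)
  else 0.
have degle d : (deg d <= p * size d)%N.
  by elim: d => //= i d IH; rewrite mulnS /deg /= leq_add // leq_subr.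
have cE x d : (\prod_(i <- d) ((- x) ^+ (p - i) *+ 'C(p, i))) = c d * x ^+ deg d.
  rewrite /c; elim: d => [|i d IH]; first by rewrite !big_nil mulr1.
  rewrite !big_cons IH /deg /= exprD exprNn.
  move: ('C(p, i)) => b; rewrite -mulrnAl !mulrA; congr (_ * _).
  by rewrite mulrAC -!mulrA; congr (_ * _); rewrite mulrC.
exists B; split.
  case=> // j m' [sm] /= nall; rewrite /B (eq_tsum_in (G := fun=> 0)) ?tsum0 //.
  move=> d sd dr; have dp : all (fun i => i <= p)%N d.
    by apply/allP => i /dr; rewrite -[_ :: _]/(iota 0 p.+1) mem_iota add0n ltnS.
  case: ifP => // dm; case: eqP => // dj.
  rewrite A0 ?mulr0 //; first by rewrite size_map size_zip sm sd minnn.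
  apply: contra nall => al; apply/andP; split.
    by rewrite -dj (leq_trans (degle _)) // sd.
  move: al sm sd dm dp degle; rewrite /cshift; clear.
  case: N => [|N]; first by case: m' => // _.
  rewrite /= mulnS; move=> al sm sd dm dp _.
  elim: m' d al dm dp {sm sd} => [|a m IH] [|b d] //= /andP[ab al] /andP[le dm] /andP[bp dp].
  by rewrite (IH d al dm dp) andbT; lia.
case=> // x t [st]; rewrite [LHS]/= prod_expand (HA t st) st tsumS -[N.+1.-1]/N.
rewrite -tsumZr.
rewrite (eq_tsum_in (G := fun d => \sum_(j <- iota 0 (p * N).+1)
   x ^+ j * tsum (iota 0 (p * N).+1) N (fun m => if all2 leq d m then
   (if deg d == j then c d * A (cshift d m) * mon m t else 0) else 0))).
  rewrite tsum_sum; apply: eq_bigr => j _.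
  rewrite tsumZ tsum_exch -tsumZ; apply: eq_tsum => m _.
  rewrite -!tsumZ -!tsumZr; apply: eq_tsum => d _.
  case: ifP => _; last by rewrite mulr0 mul0r.
  by case: ifP => _; rewrite /= ?mulr0 ?mul0r //; ring.
move=> d sd dr; rewrite cE.
rewrite (bigD1_seq (deg d)) ?iota_uniq //; last first.
  by rewrite mem_iota add0n ltnS /= -sd degle.
rewrite [X in _ = _ + X]big1 ?addr0; last first.
  move=> j jd; rewrite (eq_tsum _ (G := fun=> 0)) ?tsum0 ?mulr0 // => m _.
  by case: ifP => // _; rewrite ifF // eq_sym (negbTE jd).
rewrite -!tsumZ.
rewrite (eq_tsum _ (G := fun m => (c d * x ^+ deg d) * (A m * (mon d t * mon m t)))).
  have dp : all (fun i => i <= p)%N d.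
    by apply/allP => i /dr; rewrite mem_iota add0n ltnS.
  have := @tsum_shift (p * N.-1).+1 A d t; rewrite sd => /(_ st dp A0) S.
  rewrite [LHS]tsumZ S -tsumZ.
  rewrite (_ : (p * N.-1).+1 + p = if N is 0 then p.+1 else (p * N).+1)%N.
    case: (N) => [|n].
      by rewrite /= !eqxx; case: ifP => _; rewrite ?mulr0 //; ring.
    apply: eq_tsum => m _; rewrite eqxx.
    by case: ifP => _; rewrite ?mulr0 //; ring.
  by case: (N) => [|n] /=; rewrite ?muln0 //; lia.
by move=> m _; ring.
Qed.

(* The coefficient of [mon m t] in [vdm t], obtained by choice from its existence. *)
Definition cf (m : seq nat) : C := sval (cid (vdm_poly (size m))) m.

Lemma cf_supp m : cf m != 0 -> all (fun j => j <= p * (size m).-1)%N m.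
Proof.
apply: contra_neqT; rewrite /cf; case: cid => A [A0 _] /=; exact: A0.
Qed.

Lemma cf_ge0 m M : ((p * (size m).-1) < M)%N -> ~~ all (fun j => j < M)%N m ->
  cf m = 0.
Proof.
move=> H; apply: contraNeq => /cf_supp /allP al; apply/allP => j /al jl.
exact: leq_ltn_trans H.
Qed.

Lemma vdmE t M : ((p * (size t).-1) < M)%N ->
  vdm t = tsum (iota 0 M) (size t) (fun m => cf m * mon m t).
Proof.
move=> H; rewrite (@tsum_iota_le _ (p * (size t).-1).+1) //; last first.
  by move=> m sm nm; rewrite (cf_ge0 _ nm) ?mul0r // sm.
rewrite /cf; have [_ HA] := svalP (cid (vdm_poly (size t))).
by rewrite [LHS]HA //; apply: eq_tsum => m ->.
Qed.

Lemma cf_nil : cf [::] = 1.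
Proof. by have := @vdmE [::] (p * 0).+1 (ltnSn _); rewrite /= mulr1. Qed.

Lemma vdmEN t N : (0 < p)%N -> (size t <= N)%N ->
  vdm t = tsum (iota 0 (p * N)) (size t) (fun m => cf m * mon m t).
Proof.
case: t => [|x t] p0 sN; first by rewrite /= cf_nil mulr1.
by apply: vdmE; rewrite ltn_mul2l p0.
Qed.

Lemma vdmZ (c : C) t : vdm [seq c * x | x <- t] = c ^+ (p * 'C(size t, 2)) * vdm t.
Proof.
elim: t => [|x t IH] /=; first by rewrite muln0 mulr1.
rewrite IH binS bin1 mulnDr exprD.
rewrite (_ : \prod_(y <- _) _ = c ^+ (p * size t) * \prod_(y <- t) (y - x) ^+ p).
  by ring.
clear IH; elim: t => [|y t IH]; first by rewrite !big_nil muln0 mulr1.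
by rewrite /= !big_cons IH -mulrBr exprMn mulnS exprD; ring.
Qed.

Lemma monZ (c : C) m t : size m = size t ->
  mon m [seq c * x | x <- t] = c ^+ sumn m * mon m t.
Proof.
elim: m t => [|j m IH] [|x t] //= => [_|[/IH ->]]; first by rewrite mulr1.
by rewrite exprMn exprD; ring.
Qed.

(** Homogeneity: scaling all variables by 2 multiplies a coefficient by [2 ^+ sumn m] on one side
    and by 2 to the total degree on the other. *)
Lemma cf_sum m : cf m != 0 -> sumn m = (p * 'C(size m, 2))%N.
Proof.
move=> nz; pose M := (p * (size m).-1).+1.
have al : all (fun j => j < M)%N m by exact: cf_supp.
have E : 2 ^+ sumn m * cf m = 2 ^+ (p * 'C(size m, 2)) * cf m.
  apply: (@eq_tsum_mon M (size m) (fun m => 2 ^+ sumn m * cf m)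
    (fun m' => 2 ^+ (p * 'C(size m, 2)) * cf m')) => // t st _.
  transitivity (vdm [seq 2 * x | x <- t]).
    rewrite (@vdmE _ M) size_map st //; apply: eq_tsum => m' sm'.
    by rewrite monZ ?sm' ?st //; ring.
  by rewrite vdmZ st (@vdmE _ M) st // -tsumZ; apply: eq_tsum => m' _; ring.
apply/eqP; rewrite -(@eqn_exp2l 2) // -(eqr_nat C) !natrX.
by apply/eqP; apply: (mulIf nz).
Qed.

Lemma vdm_swap s x y t : vdm (s ++ x :: y :: t) = (-1) ^+ p * vdm (s ++ y :: x :: t).
Proof.
rewrite !vdm_cat (_ : cross s (x :: y :: t) = cross s (y :: x :: t)); last first.
  by apply: eq_bigr => z _; rewrite !big_cons mulrCA.
rewrite /= !big_cons.
have -> : (y - x) ^+ p = (-1) ^+ p * (x - y) ^+ p by rewrite -exprMn mulN1r opprB.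
by move: ((-1) ^+ p) ((x - y) ^+ p) => e f; ring.
Qed.

Lemma cf_swap s x y m : cf (s ++ x :: y :: m) = (-1) ^+ p * cf (s ++ y :: x :: m).
Proof.
pose i := size s; pose k := size m; pose N := (i + k.+2)%N.
(* [M] exceeds the degree bound and every entry of the given exponents, so the comparison of
   coefficients also covers exponents where both sides vanish. *)
pose M := (maxn (maxn x y) (maxn (foldr maxn 0 s) (foldr maxn 0 m)) + p * N).+1%N.
have fm (l : seq nat) : all (fun j => j <= foldr maxn 0 l)%N l.
  elim: l => //= a l IH; rewrite leq_maxl; apply: sub_all IH => b.
  by rewrite leq_max => ->; rewrite orbT.
have al : all (fun j => j < M)%N (s ++ y :: x :: m).
  rewrite all_cat /= /M; apply/and4P; split; try lia.
    by apply: sub_all (fm s) => j jl; lia.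
  by apply: sub_all (fm m) => j jl; lia.
pose sw (X : Type) (d : X) (l : seq X) := take i l ++ nth d l i.+1 :: nth d l i :: drop i.+2 l.
have swE (X : Type) (d : X) l1 a b (l2 : seq X) : size l1 = i ->
    sw X d (l1 ++ a :: b :: l2) = l1 ++ b :: a :: l2.
  move=> sl; rewrite /sw -sl take_size_cat // !nth_cat ltnn subnn ltnNge leqnSn /=.
  rewrite subSn // subnn /= drop_cat ltnNge (leq_trans (leqnSn _)) //=.
  have -> : ((size l1).+2 - size l1 = 2)%N by lia.
  by rewrite /= drop0.
have mE : size (s ++ y :: x :: m) = N by rewrite size_cat.
have sz (t : seq C) : size t = N -> exists t1 a b t2, t = t1 ++ a :: b :: t2 /\ size t1 = i.
  move=> st; exists (take i t); case E : (drop i t) => [|a [|b t2]].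
  - by have := size_drop i t; rewrite E st /N /=; lia.
  - by have := size_drop i t; rewrite E st /N /=; lia.
  - exists a, b, t2; rewrite -E cat_take_drop size_takel // st /N; lia.
rewrite -[LHS]/(cf (s ++ x :: y :: m)) -(swE nat 0%N s y x m) //.
apply: (@eq_tsum_mon M N (fun m => cf (sw nat 0%N m)) (fun m => (-1) ^+ p * cf m)) => // t st _.
have [t1 [a [b [t2 [tE st1]]]]] := sz t st.
have st2 : size t2 = k by move: st; rewrite tE size_cat /= /N st1; lia.
transitivity (vdm (t1 ++ b :: a :: t2)).
  rewrite (@vdmE _ M); last by rewrite size_cat /= st1 st2 /M /N; lia.
  rewrite size_cat /= st1 st2 -/N /N !tsum_cat; apply: eq_tsum => m1 sm1 /=.
  rewrite exchange_big /=; apply: eq_bigr => u _; apply: eq_bigr => v _.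
  apply: eq_tsum => m2 sm2; rewrite swE // tE !mon_cat ?sm1 ?st1 //=.
  by congr (_ * _); rewrite !mulrA [X in _ = X * _]mulrAC.
rewrite vdm_swap -tE (@vdmE t M) ?st; last by rewrite /M /N; lia.
by rewrite -tsumZ; apply: eq_tsum => m' _; rewrite mulrA.
Qed.

(** Coefficients in the remaining variables when the first ones are held at [zs]; [mu] lists the
    orbitals of the particles that are not observed. *)
Definition cfz (zs : seq C) (mu : seq nat) : C :=
  tsum (iota 0 (p * (size zs + size mu))) (size zs)
    (fun m => cf (m ++ mu) * mon m zs).

Lemma cfzE zs mu : cfz zs mu = tsum (iota 0 (p * (size zs + size mu))) (size zs)
    (fun m => cf (m ++ mu) * mon m zs).
Proof. by []. Qed.

Lemma cfz0 mu : cfz [::] mu = cf mu.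
Proof. by rewrite /cfz /= mulr1. Qed.

Hypothesis p0 : (0 < p)%N.

Lemma ltn_pred N : (0 < N)%N -> (p * N.-1 < p * N)%N.
Proof. by case: N => // N _; rewrite ltn_mul2l p0 /=. Qed.

Lemma vdm_cfz zs t : vdm (zs ++ t) =
  tsum (iota 0 (p * (size zs + size t))) (size t) (fun mu => cfz zs mu * mon mu t).
Proof.
rewrite (@vdmEN _ (size zs + size t)) ?size_cat //.
rewrite tsum_cat tsum_exch; apply: eq_tsum => mu smu.
rewrite /cfz smu -tsumZr; apply: eq_tsum => m sm.
by rewrite mon_cat ?sm // mulrA.
Qed.

Lemma cfz_supp zs mu : cfz zs mu != 0 ->
  all (fun j => j <= p * (size zs + size mu).-1)%N mu.
Proof.
apply: contra_neqT => nal; rewrite /cfz (eq_tsum _ (G := fun=> 0)) ?tsum0 //.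
move=> m sm; rewrite (_ : cf _ = 0) ?mul0r //; apply/eqP; apply: contraNT nal.
by move/cf_supp; rewrite all_cat size_cat sm => /andP[].
Qed.

Lemma mon_addn k m t : size m = size t ->
  mon (map (addn k) m) t = (\prod_(y <- t) y) ^+ k * mon m t.
Proof.
elim: m t => [|j m IH] [|x t] //= => [_|[/IH ->]]; first by rewrite big_nil expr1n mul1r.
by rewrite big_cons exprMn exprD; ring.
Qed.

(* The part of lowest degree in the variables [t1], extracted by scaling them. *)
Lemma cfz_low zs m1 (t2 : seq C) k' : size t2 = k' ->
  sumn m1 = (p * 'C(size m1, 2))%N ->
  all (fun j => j < p * (size zs + (size m1 + k')))%N m1 ->
  tsum (iota 0 (p * (size zs + (size m1 + k')))) k'
     (fun m2 => cfz zs (m1 ++ m2) * mon m2 t2) =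
  cf m1 * (((-1) ^+ (p * size zs) * (\prod_(z <- zs) z) ^+ p *
     (\prod_(y <- t2) y) ^+ p) ^+ size m1 * vdm (zs ++ t2)).
Proof.
move=> st2 sm1 am1; set k := size m1; set N := (size zs + (k + k'))%N.
pose d := (p * 'C(k, 2))%N.
pose B m := tsum (iota 0 (p * N)) k' (fun m2 => cfz zs (m ++ m2) * mon m2 t2).
set K := (X in _ = _ * X).
have E : forall m, size m = k -> all (fun j => j < p * N)%N m ->
    (if sumn m == d then B m else 0) = cf m * K; last first.
  by have := E m1 erefl am1; rewrite sm1 eqxx.
apply: (@eq_tsum_mon _ _ (fun m => if sumn m == d then B m else 0)
   (fun m => cf m * K)) => t1 st1 _.
(* [t1] is scaled by the indeterminate. The factors joining [t1] to the other variables form [Q],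
   and [vdm t1] contributes exactly ['X^d]; the coefficient of degree [d] therefore sees only
   [Q.[0]]. *)
pose Q : {poly C} := \prod_(x <- t1) ((\prod_(z <- zs) (x *: 'X - z%:P) ^+ p) *
   \prod_(y <- t2) (y%:P - x *: 'X) ^+ p).
have PQ : tsum (iota 0 (p * N)) k (fun m => (B m * mon m t1) *: 'X^(sumn m)) =
    (vdm (zs ++ t2) * vdm t1) *: ('X^d * Q).
  apply: poly_eq_eval => c _.
  have -> : forall F : seq nat -> {poly C}, (tsum (iota 0 (p * N)) k F).[c] =
      tsum (iota 0 (p * N)) k (fun m => (F m).[c]).
    by move=> F; apply: (raddf_tsum (horner_eval c)).
  transitivity (vdm (zs ++ [seq c * x | x <- t1] ++ t2)).
    rewrite vdm_cfz size_cat size_map st1 st2 -/N tsum_cat.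
    apply: eq_tsum => m sm; rewrite hornerZ hornerXn /B mulrAC -!tsumZr.
    apply: eq_tsum => m2 _; rewrite mon_cat ?size_map ?sm ?st1 // monZ ?sm ?st1 //.
    by ring.
  rewrite hornerZ hornerM hornerXn !vdm_cat vdmZ st1 -/d.
  have -> : Q.[c] = cross zs [seq c * x | x <- t1] * cross [seq c * x | x <- t1] t2.
    rewrite /Q horner_prod /cross [X in _ = X * _]exchange_big !big_map -big_split /=.
    apply: eq_bigr => x _; rewrite hornerM !horner_prod; congr (_ * _).
      by apply: eq_bigr => z _; rewrite !hornerE mulrC.
    by apply: eq_bigr => z _; rewrite !hornerE mulrC.
  by rewrite cross_catr; ring.
move/(congr1 (fun q : {poly C} => q`_d)): PQ.
have -> : forall F : seq nat -> {poly C}, (tsum (iota 0 (p * N)) k F)`_d =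
      tsum (iota 0 (p * N)) k (fun m => (F m)`_d).
  by move=> F; apply: (raddf_tsum (coefp d)).
rewrite coefZ coefXnM ltnn subnn -horner_coef0.
have -> : Q.[0] = ((-1) ^+ (p * size zs) * (\prod_(z <- zs) z) ^+ p *
     (\prod_(y <- t2) y) ^+ p) ^+ k.
  rewrite /Q horner_prod.
  rewrite (eq_bigr (fun=> (-1) ^+ (p * size zs) * (\prod_(z <- zs) z) ^+ p *
     (\prod_(y <- t2) y) ^+ p)).
    by rewrite big_const_seq count_predT -st1 -Monoid.iteropE /= /GRing.exp.
  move=> x _; rewrite hornerM !horner_prod; congr (_ * _).
    rewrite (eq_bigr (fun z => (-1) ^+ p * z ^+ p)) => [|z _]; last first.
      by rewrite horner_exp hornerD hornerN hornerC hornerZ hornerX mulr0 add0r [LHS]exprNn.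
    clear; elim: zs => [|z zs IH]; first by rewrite !big_nil muln0 expr1n mulr1.
    by rewrite !big_cons IH /= mulnS exprD exprMn; ring.
  rewrite -prodrXl; apply: eq_bigr => y _.
  by rewrite horner_exp hornerD hornerN hornerC hornerZ hornerX mulr0 subr0.
move=> E; rewrite (eq_tsum _ (G := fun m => ((B m * mon m t1) *: 'X^(sumn m))`_d)).
  rewrite E (@vdmEN t1 N) //; last by rewrite st1 /N; lia.
  by rewrite st1 mulrAC -tsumZ; apply: eq_tsum => m _; rewrite /K; ring.
move=> m _; rewrite coefZ coefXn eq_sym; case: eqP => _; rewrite ?mulr1 ?mulr0 //.
by rewrite mul0r.
Qed.

Lemma iota_addn a b : [seq (a + i)%N | i <- iota 0 b] =
  seq.filter (fun j => a <= j)%N (iota 0 (a + b)).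
Proof.
rewrite -iotaDl addn0 iotaD filter_cat add0n (_ : seq.filter _ (iota 0 a) = [::]).
  by apply/esym/all_filterP/allP => x; rewrite mem_iota => /andP[].
apply/eqP; rewrite -size_eq0 size_filter -leqn0 leqNgt -has_count.
by apply/hasPn => x; rewrite mem_iota add0n -ltnNge.
Qed.

(** Exponents [m1] with the smallest possible sum select the part of lowest degree in their
    variables. It is [vdm] of these variables times a power of the product of all the others, and
    this power moves the exponents of the others by [p * size m1]. *)
Lemma cfz_factor zs m1 m2 : sumn m1 = (p * 'C(size m1, 2))%N ->
  all (fun j => j < p * size m1)%N m1 ->
  all (fun j => j < p * (size zs + size m2))%N m2 ->
  `|cfz zs (m1 ++ map (addn (p * size m1)) m2)| =
  `|cf m1| * `|\prod_(z <- zs) z| ^+ (p * size m1) * `|cfz zs m2|.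
Proof.
move=> sm1 am1 am2; set k := size m1; set k' := size m2.
pose N := (size zs + (k + k'))%N.
pose c0 := cf m1 * ((-1) ^+ (p * size zs) * (\prod_(z <- zs) z) ^+ p) ^+ k.
have pN : (p * N = p * k + p * (size zs + k'))%N by rewrite -mulnDr /N; lia.
have am1' : all (fun j => j < p * N)%N m1.
  by apply: sub_all am1 => j jl; rewrite pN; apply: leq_trans jl _; rewrite leq_addr.
have E : cfz zs (m1 ++ map (addn (p * k)) m2) = c0 * cfz zs m2; last first.
  rewrite E /c0 !normrM !normrX !normrM !normrX normrN1 !expr1n mul1r.
  by rewrite exprM.
have := @eq_tsum_mon (p * N) k' (fun m => cfz zs (m1 ++ m)) (fun m =>
  if all (fun j => p * k <= j)%N m then c0 * cfz zs [seq (j - p * k)%N | j <- m]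
  else 0) _ (map (addn (p * k)) m2).
rewrite size_map => /(_ _ erefl) ->.
- rewrite (_ : all _ _ = true); last by apply/allP => j /mapP[i _ ->]; rewrite leq_addr.
  rewrite -map_comp (eq_map (g := id)) ?map_id // => j /=; by rewrite addKn.
- move=> t2 st2 _; rewrite (cfz_low st2 sm1 am1').
  rewrite (eq_tsum _ (G := fun m => if all (fun j => p * k <= j)%N m then
    c0 * cfz zs [seq (j - p * k)%N | j <- m] * mon m t2 else 0)); last first.
    by move=> m _; case: ifP => _ //; rewrite mul0r.
  rewrite pN -tsum_filter -iota_addn tsum_map vdm_cfz st2.
  rewrite /c0 -/k -!tsumZ; apply: eq_tsum => m sm.
  rewrite mon_addn ?sm ?st2 // -map_comp (eq_map (g := id)) ?map_id; last first.
    by move=> j /=; rewrite addKn.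
  rewrite [(_ * _ * _) ^+ k]exprMn -[(_ ^+ p) ^+ k in X in _ * (_ * X * _)]exprM.
  move: (_ ^+ k) (_ ^+ (p * k)) => u v; ring.
by apply/allP => j /mapP[i /(allP am2) il ->]; rewrite pN ltn_add2l.
Qed.

Lemma cfzZ c zs mu :
  c ^+ sumn mu * cfz [seq c * z | z <- zs] mu =
  c ^+ (p * 'C(size zs + size mu, 2)) * cfz zs mu.
Proof.
rewrite /cfz size_map -!tsumZ; apply: eq_tsum => m sm.
rewrite monZ //; have [->|nz] := eqVneq (cf (m ++ mu)) 0.
  by rewrite !mul0r !mulr0.
have <- : sumn (m ++ mu) = (p * 'C(size zs + size mu, 2))%N.
  by rewrite (cf_sum nz) size_cat sm.
by rewrite sumn_cat exprD; ring.
Qed.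

(** From [1/y - 1/x = - (y - x) / (x y)]: each variable occurs in [(size t).-1] differences, each
    raised to the power [p]. *)
Lemma vdm_inv t : all (fun x => x != 0) t ->
  vdm (map GRing.inv t) * (\prod_(x <- t) x) ^+ (p * (size t).-1) =
  (-1) ^+ (p * 'C(size t, 2)) * vdm t.
Proof.
elim: t => [|x t IH] /=; first by rewrite !muln0 !expr0 !mulr1.
case/andP=> x0 t0; have {}IH := IH t0.
have E : \prod_(y <- map GRing.inv t) (y - x^-1) ^+ p *
    (x ^+ (p * size t) * (\prod_(y <- t) y) ^+ p) =
    (-1) ^+ (p * size t) * \prod_(y <- t) (y - x) ^+ p.
  clear IH; elim: t t0 => [|y t IH] /= t0.
    by rewrite !big_nil muln0 !expr0 expr1n !mulr1.
  move: t0 => /andP[y0 /IH {}IH]; rewrite !big_cons /= mulnS !exprD exprMn.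
  have -> : (y^-1 - x^-1) ^+ p = (-1) ^+ p * (y - x) ^+ p * x ^- p * y ^- p.
    rewrite -!exprVn -!exprMn; congr (_ ^+ _); field; by rewrite x0 y0.
  have xp : x ^+ p != 0 by rewrite expf_neq0.
  have yp : y ^+ p != 0 by rewrite expf_neq0.
  transitivity ((-1) ^+ p * (y - x) ^+ p * (\prod_(y <- map GRing.inv t) (y - x^-1) ^+ p *
    (x ^+ (p * size t) * (\prod_(y <- t) y) ^+ p))).
    move: ((-1) ^+ p) ((y - x) ^+ p) (x ^+ (p * size t)) => a b c; field.
    by rewrite xp yp.
  rewrite IH; move: ((-1) ^+ p) ((y - x) ^+ p) ((-1) ^+ (p * size t)) => a b c; ring.
rewrite big_cons exprMn binS bin1 mulnDr exprD.
transitivity (((-1) ^+ (p * size t) * \prod_(y <- t) (y - x) ^+ p) *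
  ((-1) ^+ (p * 'C(size t, 2)) * vdm t)); last first.
  by rewrite mulrACA [X in X * _]mulrC.
rewrite -IH -E.
have -> : (\prod_(y <- t) y) ^+ (p * size t) =
    (\prod_(y <- t) y) ^+ p * (\prod_(y <- t) y) ^+ (p * (size t).-1).
  clear; case: t => [|y t]; first by rewrite big_nil !expr1n mulr1.
  by rewrite -exprD /= mulnS.
move: (_ ^+ (p * size t)) (_ ^+ p) (_ ^+ (p * (size t).-1)) => a b c; ring.
Qed.

Lemma mon_inv D m t : size m = size t -> all (fun x => x != 0) t ->
  all (fun j => j <= D)%N m ->
  mon m (map GRing.inv t) * (\prod_(x <- t) x) ^+ D = mon (map (subn D) m) t.
Proof.
elim: m t => [|j m IH] [|x t] //= => [_ _ _|[st] /andP[x0 t0] /andP[jD mD]].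
  by rewrite big_nil expr1n mulr1.
rewrite -(IH t) // big_cons exprMn -(subnK jD) exprD addnK exprVn.
have xj : x ^+ j != 0 by rewrite expf_neq0.
by move: (x ^+ (D - j)) xj => a xj; field.
Qed.

Lemma perm_iota_subn D : perm_eq (map (subn D) (iota 0 D.+1)) (iota 0 D.+1).
Proof.
apply: uniq_perm; rewrite ?iota_uniq ?map_inj_in_uniq ?iota_uniq //.
  by move=> i j; rewrite !mem_iota; lia.
move=> j; rewrite mem_iota; apply/mapP/idP => [ [k] |jD].
  by rewrite mem_iota => ? ->; lia.
by exists (D - j)%N; rewrite ?mem_iota; lia.
Qed.

Lemma map_subnK D m : all (fun j => j <= D)%N m -> map (subn D) (map (subn D) m) = m.
Proof.
by elim: m => //= j m IH /andP[jD /IH ->]; rewrite subKn.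
Qed.

Lemma cf_refl m : all (fun j => j <= p * (size m).-1)%N m ->
  cf (map (subn (p * (size m).-1)) m) = (-1) ^+ (p * 'C(size m, 2)) * cf m.
Proof.
set D := (p * _)%N => mD.
apply: (@eq_tsum_mon D.+1 (size m) (fun m => cf (map (subn D) m))
  (fun m' => (-1) ^+ (p * 'C(size m, 2)) * cf m')) => // t st t0.
transitivity ((-1) ^+ (p * 'C(size t, 2)) * vdm t); last first.
  by rewrite (@vdmE t D.+1) st -/D // -tsumZ; apply: eq_tsum => m' _; rewrite mulrA.
rewrite -vdm_inv // st -/D (@vdmE _ D.+1) size_map st // -tsumZr.
rewrite -(tsum_perm _ _ (perm_iota_subn D)) tsum_map; apply: eq_tsum_in => m' sm' mr.
have m'D : all (fun j => j <= D)%N m'.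
  by apply/allP => j /mr; rewrite mem_iota add0n ltnS.
by rewrite map_subnK // -(mon_inv _ t0) ?sm' ?st // mulrA.
Qed.

(** Inverting all variables reverses the order of the orbitals; this later transfers estimates from
    the left edge to the right edge. *)
Lemma cfz_refl zs mu : all (fun x => x != 0) zs ->
  all (fun j => j <= p * (size zs + size mu).-1)%N mu ->
  `|cfz (map GRing.inv zs) (map (subn (p * (size zs + size mu).-1)) mu)| *
   `|\prod_(z <- zs) z| ^+ (p * (size zs + size mu).-1) = `|cfz zs mu|.
Proof.
set N := (size zs + size mu)%N; set D := (p * N.-1)%N => z0 muD.
have D1 : (D < p * N)%N \/ size zs = 0%N.
  by case: (posnP N) => [/eqP|/ltn_pred]; [rewrite addn_eq0 => /andP[/eqP]|]; auto.
have E (zs' : seq C) mu' : size zs' = size zs -> size mu' = size mu ->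
    cfz zs' mu' = tsum (iota 0 D.+1) (size zs) (fun m => cf (m ++ mu') * mon m zs').
  move=> szs smu; rewrite /cfz szs smu -/N; case: D1 => [D1|->] //.
  apply: tsum_iota_le => // m sm nm; rewrite (_ : cf _ = 0) ?mul0r //.
  apply: (@cf_ge0 _ D.+1); first by rewrite size_cat sm smu.
  by rewrite all_cat negb_and nm.
rewrite (E (map _ zs)) ?size_map // -normrX -normrM -tsumZr E //.
rewrite -[in RHS](tsum_perm _ _ (perm_iota_subn D)) tsum_map.
rewrite (eq_tsum_in (G := fun m => (-1) ^+ (p * 'C(N, 2)) *
   (cf (map (subn D) m ++ mu) * mon (map (subn D) m) zs))).
  by rewrite tsumZ normrM normrX normrN1 expr1n mul1r.
move=> m sm mr; have mD : all (fun j => j <= D)%N m.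
  by apply/allP => j /mr; rewrite mem_iota add0n ltnS.
rewrite -mulrA (mon_inv _ z0) // mulrA; congr (_ * _).
have sN : size (map (subn D) m ++ mu) = N by rewrite size_cat size_map sm.
rewrite -sN -cf_refl sN -/D ?map_cat ?map_subnK //.
rewrite all_cat muD andbT; apply/allP => j /mapP[i _ ->]; exact: leq_subr.
Qed.

End LaughlinPolynomial.

(** * Weights of orbital configurations and renewal points *)

Notation nc := (@ComplexField.Normc.normc _).

Section Weights.
Variables (R : realType) (p : nat) (g : R).
Local Notation C := R[i].
Local Notation cf := (@cf C p).
Local Notation cfz := (@cfz C p).
Hypothesis p0 : (0 < p)%N.

(* A point [(x, u)] of the cylinder stands for [z = l^2/r * x + i y] with
   [u = exp (i y / r)]: in these units the orbital of index [m] sits at [m]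
   and the period is [p]. *)
Definition point_val (q : R * C) : C := (expR (g * q.1))%:C%C * q.2.

Definition unitp (ps : seq (R * C)) := all (fun q => nc q.2 == 1) ps.

(* [gs_energy N] normalizes to [1] the weight of the root configuration [p * i], [i < N]. *)
Definition gs_energy (N : nat) : R := g * p%:R ^+ 2 * \sum_(j < N) (j%:R) ^+ 2.

Lemma ENE N : gs_energy N = g * p%:R ^+ 2 * \sum_(j < N) (j%:R) ^+ 2.
Proof. by []. Qed.

Definition ssq (m : seq nat) : R := \sum_(j <- m) (j%:R) ^+ 2.

(** For empty [ps], the unnormalized probability of an orbital configuration. Otherwise, the squared
    modulus of the wave function with some particles at the points [ps] and the others resolved into
    the orbitals [mu]. *)
Definition cweight (ps : seq (R * C)) (mu : seq nat) : R :=
  expR (- gs_energy (size ps + size mu)) * expR (- g * \sum_(q <- ps) q.1 ^+ 2) *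
  nc (cfz (map point_val ps) mu) ^+ 2 * expR (g * ssq mu).

Definition shiftp (ps : seq (R * C)) (k : nat) :=
  [seq (q.1 - (p * k)%:R, q.2) | q <- ps].

Lemma nc_norm (z : C) : `|z| = (nc z)%:C%C. Proof. by []. Qed.

Lemma ncX (z : C) n : nc (z ^+ n) = nc z ^+ n.
Proof.
elim: n => [|n IH]; first by rewrite !expr0 ComplexField.Normc.normc1.
by rewrite !exprS ComplexField.Normc.normcM IH.
Qed.

Lemma nc_ge0 (z : C) : 0 <= nc z.
Proof. by case: z => a b; rewrite /= sqrtr_ge0. Qed.

Lemma nc_real (x : R) : nc x%:C%C = `|x|.
Proof. by rewrite /= expr0n /= addr0 sqrtr_sqr. Qed.

Lemma nc_point_val q : nc q.2 == 1 -> nc (point_val q) = expR (g * q.1).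
Proof.
move=> /eqP q1; rewrite ComplexField.Normc.normcM q1 mulr1 nc_real.
by rewrite ger0_norm ?expR_ge0.
Qed.

Lemma nc_prod_point_val ps : unitp ps ->
  nc (\prod_(z <- map point_val ps) z) = expR (g * \sum_(q <- ps) q.1).
Proof.
elim: ps => [_|q ps IH /= /andP[q1 /IH {}IH]].
  by rewrite !big_nil ComplexField.Normc.normc1 mulr0 expR0.
rewrite !big_cons ComplexField.Normc.normcM IH nc_point_val // mulrDr expRD //.
Qed.

Lemma bin2D k n : ('C(k + n, 2) = 'C(k, 2) + 'C(n, 2) + k * n)%N.
Proof.
elim: k => [|k IH]; first by rewrite !add0n mul0n addn0.
by rewrite addSn !binS !bin1 IH; lia.
Qed.

Lemma gs_energy_add k n : gs_energy (k + n) = gs_energy k + gs_energy n +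
  g * p%:R ^+ 2 * (2 * k%:R * ('C(n, 2))%:R + n%:R * k%:R ^+ 2).
Proof.
rewrite /gs_energy big_split_ord /= -!mulrDr; congr (_ * _); rewrite -!addrA; congr (_ + _).
elim: n => [|n IH]; first by rewrite !big_ord0 bin0n /= mulr0 mul0r !addr0.
rewrite !big_ord_recr /= IH binS bin1 -[n.+1%:R]natr1 !natrD; ring.
Qed.

Lemma nc_cfzZ ps k mu : unitp ps ->
  nc (cfz (map point_val ps) mu) * expR (g * (p * k)%:R * (sumn mu)%:R) =
  expR (g * (p * k)%:R * (p * 'C(size ps + size mu, 2))%:R) *
  nc (cfz (map point_val (shiftp ps k)) mu).
Proof.
move=> ups; pose c : C := (expR (- (g * (p * k)%:R)))%:C%C.
have cz : map point_val (shiftp ps k) = [seq c * z | z <- map point_val ps].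
  rewrite /shiftp -!map_comp; apply: eq_map => q /=.
  by rewrite /point_val /= mulrA -rmorphM /= -expRD; congr ((expR _)%:C%C * _); ring.
have := congr1 (@ComplexField.Normc.normc R) (cfzZ p c (map point_val ps) mu).
rewrite -cz !ComplexField.Normc.normcM !ncX nc_real ger0_norm ?expR_ge0 //.
rewrite size_map -!expRM_natl => E.
set a := expR _ in E; set b := expR _ in E.
have -> : expR (g * (p * k)%:R * (sumn mu)%:R) = a^-1.
  by rewrite /a -expRN; congr expR; ring.
have -> : expR (g * (p * k)%:R * (p * 'C(size ps + size mu, 2))%:R) = b^-1.
  by rewrite /b -expRN; congr expR; ring.
have a0 : a != 0 by rewrite gt_eqF ?expR_gt0.
have b0 : b != 0 by rewrite gt_eqF ?expR_gt0.
apply: (mulfI a0); apply: (mulfI b0).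
by rewrite [a * (_ / a)]mulrC divfK // (mulrCA a b^-1) mulVKf // E.
Qed.

Lemma ssq_cat m m' : ssq (m ++ m') = ssq m + ssq m'.
Proof. by rewrite /ssq big_cat. Qed.

Lemma ssq_addn k m : ssq (map (addn k) m) =
  ssq m + 2 * k%:R * (sumn m)%:R + (size m)%:R * k%:R ^+ 2.
Proof.
rewrite /ssq; elim: m => [|j m IH]; first by rewrite !big_nil mulr0 mul0r !addr0.
by rewrite /= !big_cons IH /= !natrD -natr1; ring.
Qed.

Lemma cweight_ge0 ps mu : 0 <= cweight ps mu.
Proof. rewrite /cweight; apply: mulr_ge0; last exact: expR_ge0.
by apply: mulr_ge0; rewrite ?exprn_ge0 ?nc_ge0 // mulr_ge0 ?expR_ge0. Qed.

(** The coefficient factorizes by [cfz_factor]. Homogeneity ([nc_cfzZ]) turns the shift of [ps] and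
    [m2] by [p * size m1] into exponentials of [sumn m2], which cancel against the Gaussian weights
    and the mixed term of [gs_energy_add]; no constant is left over. *)
Lemma cweight_factor ps m1 m2 : unitp ps -> sumn m1 = (p * 'C(size m1, 2))%N ->
  all (fun j => j < p * size m1)%N m1 ->
  all (fun j => j < p * (size ps + size m2))%N m2 ->
  cweight ps (m1 ++ map (addn (p * size m1)) m2) =
  cweight [::] m1 * cweight (shiftp ps (size m1)) m2.
Proof.
move=> ups sm1 am1 am2; set k := size m1; set k' := size m2; set n := size ps.
have := @cfz_factor C p p0 (map point_val ps) m1 m2 sm1 am1; rewrite size_map => /(_ am2).
rewrite !nc_norm -rmorphXn -!rmorphM => /complexI E.
rewrite /cweight E nc_prod_point_val // /= cfz0 size_cat size_map -/k -/k' -/n.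
have K := nc_cfzZ k m2 ups; rewrite -/k' -/n in K.
set X := nc (cfz (map point_val ps) m2) in K *.
set Y := nc (cfz (map point_val (shiftp ps k)) m2) in K *.
have {K}-> : X = expR (g * (p * k)%:R * ((p * 'C(n + k', 2))%:R - (sumn m2)%:R)) * Y.
  rewrite mulrBr expRB mulrAC -K mulfK // gt_eqF ?expR_gt0 //.
rewrite !exprMn -exprM -!expRM_natl big_nil mulr0 expR0 mulr1 add0n.
rewrite size_map -/n ssq_cat ssq_addn -/k'.
have -> : \sum_(q <- shiftp ps k) q.1 ^+ 2 = \sum_(q <- ps) q.1 ^+ 2 -
    2 * (p * k)%:R * (\sum_(q <- ps) q.1) + n%:R * (p * k)%:R ^+ 2.
  rewrite big_map /n; elim: (ps) => [|q qs IH]; first by rewrite !big_nil mulr0 mul0r subrr addr0.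
  by rewrite !big_cons IH /= -natr1; ring.
set S2 := \sum_(q <- ps) q.1 ^+ 2; set S1 := \sum_(q <- ps) q.1.
set A := nc (cf m1).
transitivity (A ^+ 2 * Y ^+ 2 * expR (- gs_energy (n + (k + k')) + (- g) * S2 +
  (p * k * 2)%:R * (g * S1) + 2 * (g * (p * k)%:R * ((p * 'C(n + k', 2))%:R - (sumn m2)%:R)) +
  g * (ssq m1 + (ssq m2 + 2 * (p * k)%:R * (sumn m2)%:R + k'%:R * (p * k)%:R ^+ 2)))).
  rewrite !expRD; ring.
transitivity (A ^+ 2 * Y ^+ 2 * expR (- gs_energy k + g * ssq m1 - gs_energy (n + k') + (- g) * (S2 -
    2 * (p * k)%:R * S1 + n%:R * (p * k)%:R ^+ 2) + g * ssq m2)).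
  congr (_ * expR _); rewrite (_ : n + (k + k') = k + (n + k'))%N; last by lia.
  rewrite (gs_energy_add k (n + k')) !natrM !natrD; ring.
rewrite -/k -/k' !expRD; ring.
Qed.

Lemma cfz_swap zs s x y m : cfz zs (s ++ x :: y :: m) =
  (-1) ^+ p * cfz zs (s ++ y :: x :: m).
Proof.
rewrite /cfz !size_cat /= -tsumZ; apply: eq_tsum => m' _.
by rewrite !catA cf_swap mulrA.
Qed.

Lemma cweight_perm ps : perm_inv (cweight ps).
Proof.
apply: swap_perm_inv => s x y m; rewrite /cweight cfz_swap !size_cat /=.
rewrite ComplexField.Normc.normcM ncX normcN ComplexField.Normc.normc1 expr1n mul1r.
have e : ssq (x :: y :: m) = ssq (y :: x :: m) by rewrite /ssq !big_cons addrCA.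
by rewrite !ssq_cat e.
Qed.

Lemma cweight_sum m : cweight [::] m != 0 -> sumn m = (p * 'C(size m, 2))%N.
Proof.
move=> nz; apply: (@cf_sum C); apply: contra_neq nz => e.
by rewrite /cweight /= cfz0 e ComplexField.Normc.normc0 expr0n /= mulr0 mul0r.
Qed.

Lemma cweight_supp ps mu : cweight ps mu != 0 ->
  all (fun j => j <= p * (size ps + size mu).-1)%N mu.
Proof.
move=> nz; rewrite -(size_map point_val); apply: (@cfz_supp C); apply: contra_neq nz => e.
by rewrite /cweight e ComplexField.Normc.normc0 expr0n /= mulr0 mul0r.
Qed.

Definition renewal_at (k : nat) (mu : seq nat) :=
  (count (fun j => j < p * k)%N mu == k) &&
  (sumn (seq.filter (fun j => j < p * k)%N mu) == p * 'C(k, 2))%N.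

Definition no_renewal (a b : nat) (mu : seq nat) :=
  all (fun k => ~~ renewal_at k mu) (iota a.+1 (b - a)).

Definition mass ps N' (P : pred (seq nat)) : R :=
  isum (iota 0 (p * (size ps + N'))) N' (fun mu => if P mu then cweight ps mu else 0).

Definition Z N := mass [::] N xpredT.

Lemma perm_sumn (s t : seq nat) : perm_eq s t -> sumn s = sumn t.
Proof. by move=> st; rewrite !sumnE; apply: perm_big. Qed.

Lemma renewal_at_perm k : perm_inv (renewal_at k).
Proof.
move=> s t st; rewrite /renewal_at (permP st); congr (_ && (_ == _)).
by apply: perm_sumn; apply: perm_filter.
Qed.

Lemma no_renewal_perm a b : perm_inv (no_renewal a b).
Proof. by move=> s t st; apply: eq_all => k; rewrite (renewal_at_perm k st). Qed.

Lemma LR0 mu : renewal_at 0 mu.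
Proof.
rewrite /renewal_at muln0 (@eq_count _ _ pred0) ?count_pred0 // (@eq_filter _ _ pred0) //.
by rewrite filter_pred0.
Qed.

Lemma renewal_at_filter k j mu : (j <= k)%N ->
  renewal_at j (seq.filter (fun i => i < p * k)%N mu) = renewal_at j mu.
Proof.
move=> jk; rewrite /renewal_at -filter_predI count_filter.
have E : predI (fun i => i < p * j)%N (fun i => i < p * k)%N =1 (fun i => i < p * j)%N.
  move=> i /=; case: ltnP => //= ij; apply: leq_trans ij _.
  by rewrite leq_mul2l jk orbT.
by rewrite (eq_count E) (eq_filter E).
Qed.

(** Count and total below a later cut split additively at [k], and [bin2D] supplies the mixed term
    [k * i] that the shift produces. *)
Lemma renewal_at_shift k i mu : renewal_at k mu -> renewal_at (k + i) mu =
  renewal_at i [seq (j - p * k)%N | j <- mu & (p * k <= j)%N].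
Proof.
case/andP=> /eqP ck /eqP sk; rewrite /renewal_at.
set r := [seq (j - p * k)%N | j <- mu & (p * k <= j)%N].
have cE : (count (fun j => j < p * (k + i)) mu =
    count (fun j => j < p * k) mu + count (fun j => j < p * i) r)%N.
  rewrite /r count_map count_filter; elim: (mu) => //= j m ->.
  by rewrite mulnDr; case: (ltnP j (p * k)) => h1; case: ltnP => h2; case: ltnP => h3 //=; lia.
have sE : (sumn (seq.filter (fun j => j < p * (k + i)) mu) =
    sumn (seq.filter (fun j => j < p * k) mu) + sumn (seq.filter (fun j => j < p * i) r) +
    p * k * count (fun j => j < p * i) r)%N.
  rewrite /r; elim: (mu) => [|j m IH] /=; first by rewrite muln0.
  case: (ltnP j (p * k)) => h1 /=.
    have -> : (j < p * (k + i))%N by rewrite mulnDr; lia.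
    by rewrite /= IH; lia.
  have -> : (j < p * (k + i))%N = (j - p * k < p * i)%N by rewrite mulnDr; lia.
  by case: ifP => h2 /=; rewrite IH // mulnDr muln1; lia.
rewrite cE sE ck sk eqn_add2l; case: eqP => //= ->.
by rewrite bin2D !mulnDr; apply/eqP/eqP; lia.
Qed.

Lemma iota_lt a M : (a <= M)%N -> seq.filter (fun j => j < a)%N (iota 0 M) = iota 0 a.
Proof.
move=> aM; rewrite -(subnK aM) addnC iotaD filter_cat add0n.
rewrite (_ : seq.filter _ (iota a _) = [::]) ?cats0.
  by apply/all_filterP/allP => x; rewrite mem_iota.
apply/eqP; rewrite -size_eq0 size_filter -leqn0 leqNgt -has_count.
by apply/hasPn => x; rewrite mem_iota -leqNgt => /andP[].
Qed.

Lemma iota_ge a M : (a <= M)%N ->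
  seq.filter (predC (fun j => j < a)%N) (iota 0 M) = map (addn a) (iota 0 (M - a)).
Proof.
move=> aM; rewrite iota_addn subnKC //; apply: eq_filter => j /=.
by rewrite -leqNgt.
Qed.

(** Renewal at [k] decouples the particles: those below [p * k] form a free system of [k] particles,
    and the others, together with [ps], the same kind of system moved back by [k] periods. *)
Lemma mass_split ps N' k (P1 P2 : pred (seq nat)) : unitp ps -> (k <= N')%N ->
  perm_inv P1 -> perm_inv P2 ->
  mass ps N' (fun mu => [&& renewal_at k mu, P1 (seq.filter (fun j => j < p * k)%N mu) &
     P2 [seq (j - p * k)%N | j <- mu & (p * k <= j)%N]]) =
  mass [::] k P1 * mass (shiftp ps k) (N' - k) P2.
Proof.
move=> ups kN pP1 pP2.
rewrite /mass (@isum_threshold _ _ _ _ (fun j => j < p * k)%N); last first.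
  move=> s t st; rewrite (renewal_at_perm k st) (cweight_perm ps st).
  rewrite (pP1 _ (seq.filter (fun j => j < p * k)%N t)) ?perm_filter //.
  by rewrite (pP2 _ [seq (j - p * k)%N | j <- t & (p * k <= j)%N]) // perm_map // perm_filter.
have kM : (p * k <= p * (size ps + N'))%N by rewrite leq_mul2l; apply/orP; right; lia.
rewrite (iota_lt kM) (iota_ge kM) -mulnBr (_ : size ps + N' - k = size ps + (N' - k))%N; last by lia.
have f1 (s : seq nat) : {subset s <= iota 0 (p * k)} ->
    seq.filter (fun j => j < p * k)%N s = s /\ seq.filter (fun j => p * k <= j)%N s = [::].
  move=> sr; split; first by apply/all_filterP/allP => j /sr; rewrite mem_iota.
  apply/eqP; rewrite -size_eq0 size_filter -leqn0 leqNgt -has_count.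
  by apply/hasPn => x /sr; rewrite mem_iota -ltnNge.
have f2 (s : seq nat) : seq.filter (fun j => j < p * k)%N (map (addn (p * k)) s) = [::]
    /\ [seq (j - p * k)%N | j <- map (addn (p * k)) s & (p * k <= j)%N] = s.
  elim: s => // j s [h1 h2]; rewrite /= ltnNge leq_addr /= addKn h2; split=> //.
have key i : isum (iota 0 (p * k)) i (fun s =>
   isum [seq (p * k + i)%N | i <- iota 0 (p * (size ps + (N' - k)))] (N' - i) (fun s' =>
   if [&& renewal_at k (s ++ s'), P1 [seq j <- s ++ s' | (j < p * k)%N] &
       P2 [seq (j - p * k)%N | j <- s ++ s' & (p * k <= j)%N]] then cweight ps (s ++ s') else 0)) =
   isum (iota 0 (p * k)) i (fun s => if (i == k) && P1 s then cweight [::] s *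
     isum (iota 0 (p * (size ps + (N' - k)))) (N' - k) (fun s' =>
      if P2 s' then cweight (shiftp ps k) s' else 0) else 0).
  rewrite /isum; congr (_ * _); apply: eq_tsum_in => s si sr.
  have [fs1 fs2] := f1 s sr; rewrite tsum_map.
  have [ik|ik] := eqVneq i k; last first.
    rewrite (eq_tsum _ (G := fun=> 0)) ?tsum0 ?mulr0 // => s' _.
    rewrite /renewal_at count_cat -!size_filter fs1 (f2 s').1 addn0 si (negbTE ik).
    by case: (P1 _).
  rewrite ik /=; move: si; rewrite ik => si; case: (boolP (P1 s)) => P1s; last first.
    rewrite (eq_tsum _ (G := fun=> 0)) ?tsum0 ?mulr0 // => s' _.
    by rewrite filter_cat fs1 (f2 s').1 cats0 (negbTE P1s) andbF.
  rewrite mulrCA; congr (_ * _); rewrite -tsumZ; apply: eq_tsum_in => s' ss' sr'.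
  rewrite /renewal_at count_cat -!size_filter !filter_cat fs1 fs2 (f2 s').1 !cats0 cat0s.
  rewrite (f2 s').2 P1s /= ?addn0 si eqxx /=.
  case: (boolP (P2 s')) => P2s'; last by rewrite andbF mulr0.
  rewrite andbT; case: eqP => [sk|sk].
    have -> : (p * k = p * size s)%N by rewrite si.
    rewrite cweight_factor ?si //.
      by apply/allP => j /sr; rewrite mem_iota.
    by apply/allP => j /sr'; rewrite mem_iota ss'.
  (* If the total below the cut is not the minimal one, the left side has no renewal at [k], and on
     the right side the weight of [s] vanishes by homogeneity. *)
  have [->|/cweight_sum] := eqVneq (cweight [::] s) 0; first by rewrite mul0r.
  by rewrite si => /sk.
rewrite (eq_bigr _ (fun (i : 'I_N'.+1) _ => key i)).
rewrite (bigD1 (Ordinal (kN : (k < N'.+1)%N))) //= big1 ?addr0; last first.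
  move=> i /eqP ik; rewrite /isum (eq_tsum _ (G := fun=> 0)) ?tsum0 ?mulr0 // => s _.
  by rewrite ifF //; apply/negbTE/negP => /andP[/eqP e _]; apply: ik; apply: val_inj.
rewrite eqxx size_map mulrC -isumZ add0n; apply: eq_isum => s _.
by case: (P1 s); rewrite ?mulr0 // mulrC.
Qed.

Lemma mass_ge0 ps N' P : 0 <= mass ps N' P.
Proof. by apply: isum_ge0 => t _; case: ifP => // _; apply: cweight_ge0. Qed.

Lemma Z_ge0 N : 0 <= Z N. Proof. exact: mass_ge0. Qed.

Lemma le_mass ps N' (P Q : pred (seq nat)) :
  (forall mu, size mu = N' -> cweight ps mu != 0 -> P mu -> Q mu) -> mass ps N' P <= mass ps N' Q.
Proof.
move=> H; apply: le_isum => t st; case: ifP => Pt; last by case: ifP => // _; apply: cweight_ge0.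
case: ifP => // Qt; have [->//|nz] := eqVneq (cweight ps t) 0.
by rewrite (H t st nz Pt) in Qt.
Qed.

Lemma eq_mass ps N' (P Q : pred (seq nat)) :
  (forall mu, size mu = N' -> cweight ps mu != 0 -> P mu = Q mu) -> mass ps N' P = mass ps N' Q.
Proof.
move=> H; apply/eqP; rewrite eq_le; apply/andP.
by split; apply: le_mass => t st nz; rewrite (H t st nz).
Qed.

(** Decomposition according to the last renewal point up to [B], which exists because 0 is always
    one. *)
Lemma mass_last ps N' A B : unitp ps -> (B <= A <= N')%N ->
  mass ps N' (no_renewal B A) =
  \sum_(k < B.+1) Z k * mass (shiftp ps k) (N' - k) (no_renewal 0 (A - k)).
Proof.
move=> ups /andP[BA AN].
have step k : (k <= A)%N -> mass ps N' (fun mu => renewal_at k mu && no_renewal k A mu) =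
    Z k * mass (shiftp ps k) (N' - k) (no_renewal 0 (A - k)).
  move=> kA; rewrite -(@mass_split ps N' k xpredT (no_renewal 0 (A - k))) //; last first.
  - exact: no_renewal_perm.
  - exact: leq_trans kA AN.
  apply: eq_mass => mu _ _; case: (boolP (renewal_at k mu)) => //= Lk.
  rewrite /no_renewal subn0 -[k.+1]addn1 iotaDl all_map; apply: eq_all => i /=.
  by rewrite renewal_at_shift.
elim: B BA => [|B IH] BA.
  rewrite big_ord1 -step //; apply: eq_mass => mu _ _; by rewrite LR0.
rewrite big_ord_recr /= -IH ?(ltnW BA) // -step //.
rewrite /mass -isumD; apply: eq_isum => mu _.
have -> : no_renewal B A mu = ~~ renewal_at B.+1 mu && no_renewal B.+1 A mu.
  by rewrite /no_renewal (_ : A - B = (A - B.+1).+1)%N; last by lia.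
by case: (renewal_at _ _); case: (no_renewal _ _ _); rewrite /= ?addr0 ?add0r.
Qed.

Lemma mass_total ps N' A : unitp ps -> (A <= N')%N ->
  mass ps N' xpredT =
  \sum_(k < A.+1) Z k * mass (shiftp ps k) (N' - k) (no_renewal 0 (A - k)).
Proof.
move=> ups AN; rewrite -mass_last ?leqnn //; apply: eq_mass => mu _ _.
by rewrite /no_renewal subnn.
Qed.

(** Weight of [j] particles without interior renewal point: the unnormalized law of a step of the
    renewal process. *)
Definition alpha j := mass [::] j (no_renewal 0 j.-1).

Lemma mass_first N i : (i <= N)%N ->
  mass [::] N (no_renewal 0 i) = Z N - \sum_(j < i) alpha j.+1 * Z (N - j.+1).
Proof.
elim: i => [|i IH] iN.
  by rewrite big_ord0 subr0; apply: eq_mass.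
rewrite big_ord_recr /= opprD addrA -IH ?(ltnW iN) //.
rewrite /alpha -[i.+1.-1]/i (_ : Z (N - i.+1) = mass (shiftp [::] i.+1) (N - i.+1) xpredT) //.
rewrite -(@mass_split [::] N i.+1 (no_renewal 0 i) xpredT) //; last exact: no_renewal_perm.
rewrite /mass -isumB; apply: eq_isum => mu _.
have -> : no_renewal 0 i.+1 mu = no_renewal 0 i mu && ~~ renewal_at i.+1 mu.
  by rewrite /no_renewal !subn0 -[i.+1]addn1 iotaD all_cat /= add1n addn1 andbT.
have -> : no_renewal 0 i (seq.filter (fun j => j < p * i.+1)%N mu) = no_renewal 0 i mu.
  apply: eq_in_all => j; rewrite mem_iota => /andP[_ ji].
  by rewrite renewal_at_filter //; lia.
by case: (renewal_at _ _); case: (no_renewal _ _ _); rewrite /= ?subr0 ?subrr.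
Qed.

Lemma renewal_at_full N mu : size mu = N -> cweight [::] mu != 0 -> renewal_at N mu.
Proof.
move=> sN nz; have al : all (fun j => j < p * N)%N mu.
  case: mu sN nz => [//|a mu] sN nz; apply: sub_all (cweight_supp nz) => j jl.
  by rewrite -sN; apply: leq_ltn_trans jl _; rewrite /= ltn_mul2l p0 /=.
rewrite /renewal_at; have -> : count (fun j => j < p * N)%N mu = N.
  by move: al; rewrite all_count => /eqP ->.
by move/all_filterP: al => ->; rewrite (cweight_sum nz) sN !eqxx.
Qed.

(** All particles lie below [p * N], so [N] itself is a renewal point and a first positive one
    always exists. *)
Lemma Z_renewal N : (0 < N)%N -> Z N = \sum_(j < N) alpha j.+1 * Z (N - j.+1).
Proof.
move=> N0; apply/eqP; rewrite -subr_eq0 -mass_first //; apply/eqP.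
rewrite /mass (@eq_isum _ _ _ _ _ (fun=> 0)) ?/isum ?tsum0 ?mulr0 // => mu sN.
case: ifP => // nL; apply: contraTeq nL => nz.
apply/allPn; exists N; first by rewrite mem_iota; lia.
by rewrite negbK renewal_at_full.
Qed.

Lemma alpha_ge0 j : 0 <= alpha j. Proof. exact: mass_ge0. Qed.

Lemma Z0 : Z 0 = 1.
Proof.
rewrite /Z /mass /isum /= invr1 mul1r /cweight /= cfz0 cf_nil.
rewrite ComplexField.Normc.normc1 expr1n /gs_energy big_ord0 big_nil /ssq big_nil.
by rewrite !mulr0 oppr0 expR0 !mulr1.
Qed.

Lemma Z1 : Z 1 = 1.
Proof.
have c0 : cf [:: 0%N] = 1.
  have := @vdmE C p [:: 1] 1; rewrite /= muln0 => /(_ isT).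
  by rewrite big_seq1 big_nil !mulr1 => <-.
rewrite /Z /mass /isum /= invr1 mul1r add0n muln1.
rewrite (bigD1_seq 0%N) ?iota_uniq ?mem_iota ?add0n //= big1 ?addr0; last first.
  move=> j j0; apply/eqP; apply: contraTT j0 => /cweight_supp /=.
  by rewrite muln0 andbT leqn0 negbK.
rewrite /cweight /= cfz0 c0 ComplexField.Normc.normc1 expr1n /gs_energy big_ord_recl big_ord0 big_nil.
by rewrite /ssq big_seq1 /= !expr0n /= !mulr0 addr0 mulr0 oppr0 expR0 !mulr1.
Qed.

Lemma mass_superM ps k N' : unitp ps ->
  Z k * mass (shiftp ps k) N' xpredT <= mass ps (k + N') xpredT.
Proof.
move=> ups; have := @mass_split ps (k + N') k xpredT xpredT ups (leq_addr _ _) (fun _ _ _ => erefl) (fun _ _ _ => erefl).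
rewrite addKn => <-; exact: le_mass.
Qed.

Lemma Z_superM k N : Z k * Z N <= Z (k + N).
Proof. exact: (@mass_superM [::] k N). Qed.

Lemma Z_ge1 N : 1 <= Z N.
Proof.
elim: N => [|N IH]; first by rewrite Z0.
by rewrite -addn1 (le_trans _ (Z_superM N 1)) // Z1 mulr1.
Qed.

(** Steps of length 1 have positive weight: the aperiodicity on which the renewal theorem rests. *)
Lemma alpha1 : alpha 1 = 1.
Proof. by rewrite -[RHS]Z1 Z_renewal // big_ord1 subnn Z0 mulr1. Qed.

End Weights.

(** * Parseval identities over roots of unity *)

Lemma mul_regroup7 (K : comPzRingType) (e f h a b a' d : K) :
  e * ((f * (a * b)) * (h * (a' * d))) = e * f * h * (a * a') * (b * d).
Proof. ring. Qed.

Lemma mul_regroup5 (K : comPzRingType) (v b b' e m : K) :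
  v * b * b' * e * m = m * (b * b' * (v * e)).
Proof. ring. Qed.

Section Parseval.
Variable R : realType.
Local Notation C := R[i].

Lemma cjM (x y : C) : (x * y)^*%C = x^*%C * y^*%C.
Proof. exact: (rmorphM (@conjc R)). Qed.

Lemma cjX (x : C) n : (x ^+ n)^*%C = x^*%C ^+ n.
Proof. exact: (rmorphXn (@conjc R)). Qed.

Lemma cj_sum (I : Type) (r : seq I) (F : I -> C) :
  (\sum_(i <- r) F i)^*%C = \sum_(i <- r) (F i)^*%C.
Proof. exact: (rmorph_sum (@conjc R)). Qed.

Lemma rcM (x y : R) : (x * y)%:C%C = x%:C%C * y%:C%C :> C.
Proof. exact: (rmorphM (real_complex R)). Qed.

Lemma rc_prod (I : Type) (r : seq I) (F : I -> R) :
  (\prod_(i <- r) F i)%:C%C = \prod_(i <- r) (F i)%:C%C :> C.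
Proof. exact: (rmorph_prod (real_complex R)). Qed.

Lemma rc_sum (I : Type) (r : seq I) (F : I -> R) :
  (\sum_(i <- r) F i)%:C%C = \sum_(i <- r) (F i)%:C%C :> C.
Proof. exact: (rmorph_sum (real_complex R)). Qed.

Definition ee (t : R) : C := Complex (cos (2 * pi * t)) (sin (2 * pi * t)).

Lemma ee0 : ee 0 = 1.
Proof. by rewrite /ee mulr0 cos0 sin0. Qed.

Lemma eeD s t : ee (s + t) = ee s * ee t.
Proof. by rewrite /ee mulrDr cosD sinD; apply/eqP; rewrite eq_complex /= eqxx addrC eqxx. Qed.

Lemma eeN t : ee (- t) = (ee t)^*%C.
Proof. by rewrite /ee mulrN cosN sinN. Qed.

Lemma nc_ee t : nc (ee t) = 1.
Proof. by rewrite /= cos2Dsin2 sqrtr1. Qed.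

Lemma eeX t n : ee (n%:R * t) = ee t ^+ n.
Proof.
elim: n => [|n IH]; first by rewrite mul0r ee0.
by rewrite -natr1 mulrDl mul1r eeD IH exprSr.
Qed.

Lemma ee1 : ee 1 = 1.
Proof. rewrite /ee (_ : 2 * pi * 1 = pi *+ 2); last by rewrite mulr2n; ring.
rewrite cos_mulr2n sin_mulr2n cospi sinpi; apply/eqP; rewrite eq_complex /=.
by apply/andP; split; apply/eqP; rewrite ?mulr0 ?mul0rn // sqrrN expr1n mulr2n; ring. Qed.

Lemma ee_nat n : ee n%:R = 1.
Proof. by rewrite -[n%:R]mulr1 eeX ee1 expr1n. Qed.

Lemma ee_neq1 t : 0 < t < 1 -> ee t != 1.
Proof.
move=> /andP[t0 t1]; apply/eqP => /(congr1 (@complex.Re R)) /=.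
rewrite (_ : 2 * pi * t = (pi * t) *+ 2); last by rewrite mulr2n; ring.
rewrite cos_mulr2n => /eqP; rewrite -subr_eq0 => /eqP e.
have s0 : 0 < sin (pi * t).
  by apply: sin_gt0_pi; rewrite mulr_gt0 ?pi_gt0 //= gtr_pMr ?pi_gt0.
have := cos2Dsin2 (pi * t); nra.
Qed.

Lemma conjc_ee t : (ee t)^*%C * ee t = 1.
Proof. by rewrite -eeN -eeD addNr ee0. Qed.

Lemma ee_sum M (j k : nat) : (j < M)%N -> (k < M)%N ->
  \sum_(y <- iota 0 M) ee (y%:R / M%:R) ^+ j * ((ee (y%:R / M%:R))^*%C) ^+ k =
  if j == k then M%:R else 0.
Proof.
move=> jM kM; have M0 : M%:R != 0 :> R by rewrite pnatr_eq0; lia.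
have [<-|jk] := eqVneq j k.
  rewrite (eq_bigr (fun=> 1)) => [|y _].
    by rewrite big_const_seq count_predT size_iota -Monoid.iteropE.
  by rewrite -exprMn mulrC conjc_ee expr1n.
wlog jk' : j k jM kM jk / (k < j)%N => [W|].
  have [kj|] := ltnP k j; first exact: W.
  rewrite leq_eqVlt (negbTE jk) /= => jk'.
  have := W k j kM jM; rewrite eq_sym => /(_ jk jk') /(congr1 (@conjc R)).
  rewrite cj_sum conjc0 => E; rewrite -[RHS]E; apply: eq_bigr => y _.
  by rewrite cjM !cjX conjcK mulrC.
pose w := ee ((j - k)%:R / M%:R).
have tr y : ee (y%:R / M%:R) ^+ j * ((ee (y%:R / M%:R))^*%C) ^+ k = w ^+ y.
  have {1}-> : j = (j - k + k)%N by lia.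
  rewrite exprD -mulrA -exprMn [_ * (_)^*%C]mulrC conjc_ee expr1n mulr1.
  by rewrite -!eeX; congr ee; field.
rewrite (eq_bigr _ (fun y _ => tr y)) big_iota0.
have w1 : w != 1.
  apply: ee_neq1; rewrite divr_gt0 ?ltr0n ?subn_gt0 //=; last by lia.
  by rewrite ltr_pdivrMr ?mul1r ?ltr_nat ?ltr0n; lia.
have wM : w ^+ M = 1 by rewrite -eeX mulrC divfK // ee_nat.
have : (w - 1) * \sum_(y < M) w ^+ y = 0 by rewrite -subrX1 wM subrr.
by move/eqP; rewrite mulf_eq0 subr_eq0 (negbTE w1) /= => /eqP.
Qed.

Variable g : R.

Definition grid (ss : seq R) (M : nat) : seq (R * C) :=
  [seq (s, ee (y%:R / M%:R)) | s <- ss, y <- iota 0 M].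

Lemma grid_unit ss M q : q \in grid ss M -> nc q.2 == 1.
Proof. by case/allpairsP => -[s y] [_ _ ->] /=; rewrite cos2Dsin2 sqrtr1. Qed.

Definition kap (v : R -> C) (ss : seq R) (M j : nat) : C :=
  M%:R * \sum_(s <- ss) v s * (expR (2 * g * j%:R * s))%:C%C.

(** Since the exponents stay below [M], the [M]-th roots of unity separate them as well as the full
    circle does: a finite grid of angles computes the angular average exactly. *)
Lemma parseval1 (v : R -> C) (B : nat -> C) ss M :
  \sum_(q <- grid ss M) v q.1 * ((\sum_(j <- iota 0 M) B j * point_val g q ^+ j) *
     (\sum_(j <- iota 0 M) B j * point_val g q ^+ j)^*%C) =
  \sum_(j <- iota 0 M) B j * (B j)^*%C * kap v ss M j.
Proof.
rewrite /grid big_allpairs_dep /=.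
rewrite /kap; under [RHS]eq_bigr do rewrite mulrCA mulr_sumr mulr_sumr.
rewrite [RHS]exchange_big /=; apply: eq_bigr => s _.
transitivity (\sum_(j <- iota 0 M) \sum_(k <- iota 0 M) v s * B j * (B k)^*%C *
   (expR (g * s))%:C%C ^+ (j + k) *
   \sum_(y <- iota 0 M) ee (y%:R / M%:R) ^+ j * ((ee (y%:R / M%:R))^*%C) ^+ k).
  transitivity (\sum_(y <- iota 0 M) \sum_(j <- iota 0 M) \sum_(k <- iota 0 M)
     v s * B j * (B k)^*%C * (expR (g * s))%:C%C ^+ (j + k) *
     (ee (y%:R / M%:R) ^+ j * ((ee (y%:R / M%:R))^*%C) ^+ k)).
    apply: eq_bigr => y _; rewrite cj_sum mulr_suml mulr_sumr.
    apply: eq_bigr => j _; rewrite mulr_sumr mulr_sumr; apply: eq_bigr => k _.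
    set P := point_val g _; have PC : P^*%C = (expR (g * s))%:C%C * (ee (y%:R / M%:R))^*%C.
      by rewrite /P /point_val cjM conjc_real.
    rewrite cjM cjX PC (_ : P = (expR (g * s))%:C%C * ee (y%:R / M%:R)) // !exprMn exprD.
    exact: mul_regroup7.
  rewrite exchange_big /=; apply: eq_bigr => j _.
  rewrite exchange_big /=; apply: eq_bigr => k _.
  by rewrite mulr_sumr.
apply: eq_big_seq => j; rewrite mem_iota add0n => /andP[_ jM].
rewrite (bigD1_seq j) ?iota_uniq ?mem_iota ?add0n //= [X in _ + X]big1_seq; last first.
  move=> k /andP[kj]; rewrite mem_iota add0n => /andP[_ kM].
  by rewrite ee_sum // eq_sym (negbTE kj) mulr0.
rewrite addr0 ee_sum // eqxx -rmorphXn /= -expRM_natr.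
have -> : g * s * (j + j)%:R = 2 * g * j%:R * s by rewrite natrD; ring.
exact: mul_regroup5.
Qed.

Definition mval M n (A : seq nat -> C) (ps : seq (R * C)) :=
  tsum (iota 0 M) n (fun m => A m * mon m (map (point_val g) ps)).

Lemma parseval (v : R -> C) (A : seq nat -> C) ss M n :
  tsum (grid ss M) n (fun ps => (\prod_(q <- ps) v q.1) *
     (mval M n A ps * (mval M n A ps)^*%C)) =
  tsum (iota 0 M) n (fun m => A m * (A m)^*%C * \prod_(j <- m) kap v ss M j).
Proof.
elim: n A => [|n IH] A; first by rewrite /= !big_nil /mval /= !mulr1 mul1r.
rewrite tsumS.
pose Aq q m := \sum_(j <- iota 0 M) A (j :: m) * point_val g q ^+ j.
have mvE q ps : mval M n.+1 A (q :: ps) = mval M n (Aq q) ps.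
  rewrite /mval tsumS -tsum_sum; apply: eq_tsum => m _.
  by rewrite /Aq mulr_suml; apply: eq_bigr => j _; rewrite /= mulrA.
rewrite (eq_bigr (fun q => v q.1 * tsum (iota 0 M) n (fun m =>
   Aq q m * (Aq q m)^*%C * \prod_(j <- m) kap v ss M j))); last first.
  move=> q _; rewrite -IH -tsumZ; apply: eq_tsum => ps _.
  by rewrite mvE big_cons -[LHS]mulrA.
under eq_bigr do rewrite -tsumZ.
rewrite -tsum_sum tsumS -tsum_sum; apply: eq_tsum => m _.
rewrite (eq_bigr (fun q => v q.1 * (Aq q m * (Aq q m)^*%C) *
  \prod_(j <- m) kap v ss M j)) => [|q _]; last exact: mulrA.
rewrite -mulr_suml (parseval1 v (fun j => A (j :: m))) mulr_suml.
by apply: eq_bigr => j _; rewrite big_cons mulrA.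
Qed.

Lemma conjc_nc (z : C) : z * z^*%C = ((nc z) ^+ 2)%:C%C.
Proof.
case: z => a b; rewrite /= sqr_sqrtr ?addr_ge0 ?sqr_ge0 //.
by apply/eqP; rewrite eq_complex /=; apply/andP; split; apply/eqP; ring.
Qed.

Definition kapr (w : R -> R) (ss : seq R) (M j : nat) : R :=
  M%:R * \sum_(s <- ss) w s * expR (2 * g * j%:R * s).

Lemma parseval_real (w : R -> R) (A : seq nat -> C) ss M n :
  tsum (grid ss M) n (fun ps => (\prod_(q <- ps) w q.1) * nc (mval M n A ps) ^+ 2) =
  tsum (iota 0 M) n (fun m => nc (A m) ^+ 2 * \prod_(j <- m) kapr w ss M j).
Proof.
apply: (@complexI R); have := parseval (fun s => (w s)%:C%C) A ss M n.
rewrite !(raddf_tsum (real_complex R)) => E.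
have kE j : kap (fun s => (w s)%:C%C) ss M j = (kapr w ss M j)%:C%C.
  rewrite /kap /kapr rcM rc_sum; congr (_ * _); first by rewrite (rmorph_nat (real_complex R)).
  by apply: eq_bigr => s _; rewrite rcM.
transitivity (tsum (grid ss M) n (fun ps => (\prod_(q <- ps) (w q.1)%:C%C) *
     (mval M n A ps * (mval M n A ps)^*%C))).
  by apply: eq_tsum => ps _; rewrite conjc_nc -rc_prod -rcM.
rewrite E; apply: eq_tsum => m _.
by rewrite conjc_nc (eq_bigr _ (fun j _ => kE j)) -rc_prod -rcM.
Qed.

End Parseval.

(** * Localization of particles *)

Section Localization.
Variable R : realType.

(** [Psi] clamps its argument between [- h] and [h + 1]. Its increments are nonnegative and equal 1
    where the indicator is 1, so the sum telescopes. *)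
Lemma count_close (h x : R) M : 0 <= h ->
  \sum_(0 <= k < M) (if `|k%:R - x| < h then 1 else 0) <= 2 * h + 1.
Proof.
move=> h0; pose Psi (v : R) := Num.min (h + 1) (Num.max (- h) v).
have PsiB v : - h <= Psi v <= h + 1.
  by rewrite /Psi /Num.min /Num.max; do 2 case: ifP; move=> *; apply/andP; split; lra.
have step v : (if `|v| < h then 1 else 0) <= Psi (v + 1) - Psi v.
  rewrite /Psi ltr_norml.
  have mono : Num.min (h + 1) (Num.max (- h) v) <= Num.min (h + 1) (Num.max (- h) (v + 1)).
    by rewrite le_min2 // le_max2 // lerDl.
  case: ifP => [/andP[a1 a2]|_]; last by clear -mono; lra.
  have e1 : Num.max (- h) v = v by rewrite max_r // ltW.
  have e2 : Num.max (- h) (v + 1) = v + 1 by rewrite max_r //; clear -a1; lra.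
  by rewrite e1 e2 !min_r; clear -a1 a2; lra.
have : \sum_(0 <= k < M) (if `|k%:R - x| < h then 1 else 0) <= Psi (M%:R - x) - Psi (- x).
  elim: M => [|M IH]; first by rewrite big_geq // sub0r subrr.
  rewrite big_nat_recr //=; have := step (M%:R - x).
  rewrite (_ : M%:R - x + 1 = M.+1%:R - x); last by rewrite -natr1; ring.
  move=> A; apply: (le_trans (lerD IH A)); clear; lra.
by have /andP[_ A] := PsiB (M%:R - x); have /andP[B _] := PsiB (- x); lra.
Qed.

Lemma exp_sum_geom (a x : R) n : 0 < a ->
  \sum_(0 <= i < n) expR (- (a * `|i%:R - x|)) <= 2 / (1 - expR (- a)).
Proof.
move=> a0; pose c := 1 - expR (- a).
have ea : expR (- a) < 1 by rewrite expR_lt1 oppr_lt0.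
have ea0 := expR_gt0 (- a).
have c0 : 0 < c by rewrite subr_gt0.
(* A bounded discrete primitive: its increments dominate [c] times the summand, so the sum
   telescopes. *)
pose Phi (v : R) := if v <= 0 then expR (a * v) else 2 - expR (- (a * v)).
have eneg v : v <= 0 -> 0 < expR (a * v) <= 1.
  by move=> v0; rewrite expR_gt0 expR_le1; nra.
have PhiB v : 0 <= Phi v <= 2.
  rewrite /Phi; case: ifP => [/eneg|/negbT]; first lra.
  rewrite -ltNge => v0; have := @eneg (- v); rewrite mulrN => H.
  have : 0 < expR (- (a * v)) <= 1 by apply: H; lra.
  by lra.
have step v : c * expR (- (a * `|v|)) <= Phi (v + 1) - Phi v.
  rewrite /Phi; case: (leP v 0) => v0; case: (leP (v + 1) 0) => v1.
  - rewrite ler0_norm // mulrN opprK mulrDr mulr1 expRD /c.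
    have e1 : 1 <= expR a by rewrite -expR0 ler_expR ltW.
    have e2 : expR a * expR (- a) = 1 by rewrite -expRD subrr expR0.
    have e3 : 1 - expR (- a) <= expR a - 1.
      have e4 : 0 <= (expR a - 1) * (1 - expR (- a)) by rewrite mulr_ge0 //; lra.
      by lra.
    by rewrite [leRHS](_ : _ = (expR a - 1) * expR (a * v)) ?ler_wpM2r ?expR_ge0 //; ring.
  - rewrite ler0_norm // mulrN opprK.
    have /andP[A1 A2] := @eneg v v0.
    have /andP[B1 B2] : 0 < expR (- (a * (v + 1))) <= 1.
      by rewrite expR_gt0 expR_le1; nra.
    have E : expR (a * v) * expR (- (a * (v + 1))) = expR (- a).
      by rewrite -expRD; congr expR; ring.
    rewrite /c; nra.
  - by exfalso; lra.
  - rewrite (ger0_norm (ltW v0)) mulrDr mulr1 opprD expRD /c.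
    by rewrite le_eqVlt; apply/orP; left; apply/eqP; ring.
rewrite -/c ler_pdivlMr // mulrC.
have : c * \sum_(0 <= i < n) expR (- (a * `|i%:R - x|)) <= Phi (n%:R - x) - Phi (- x).
  elim: n => [|n IH]; first by rewrite big_geq // mulr0 sub0r subrr.
  rewrite big_nat_recr //= mulrDr; have := step (n%:R - x).
  rewrite (_ : n%:R - x + 1 = n.+1%:R - x); last by rewrite -natr1; ring.
  by lra.
by have /andP[_ A] := PhiB (n%:R - x); have /andP[B _] := PhiB (- x); lra.
Qed.

Lemma exp_sum_le (a : R) : 0 < a -> exists2 K : R, 1 <= K & forall x n,
  \sum_(0 <= i < n) expR (- (a * `|i%:R - x|)) <= K.
Proof.
move=> a0; exists (2 / (1 - expR (- a))) => [|x n]; last exact: exp_sum_geom.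
have ea : expR (- a) < 1 by rewrite expR_lt1 oppr_lt0.
have ea0 := expR_gt0 (- a).
by rewrite ler_pdivlMr ?subr_gt0 // mul1r; lra.
Qed.

Lemma sum_nat_ge0 a b (f : nat -> R) : (forall i, 0 <= f i) ->
  0 <= \sum_(a <= i < b) f i.
Proof. by move=> f0; apply: sumr_ge0. Qed.

Lemma sum_nat_widen a b a' b' (f : nat -> R) : (forall i, 0 <= f i) ->
  (a' <= a)%N -> (b <= b')%N -> \sum_(a <= i < b) f i <= \sum_(a' <= i < b') f i.
Proof.
move=> f0 aa bb; have [ba|ab] := leqP b a; first by rewrite big_geq // sum_nat_ge0.
rewrite [leRHS](@big_cat_nat _ _ _ a) //=; last by rewrite (leq_trans (ltnW ab)).
rewrite [X in _ <= _ + X](@big_cat_nat _ _ _ b) ?(ltnW ab) //=.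
have := sum_nat_ge0 a' a f0; have := sum_nat_ge0 b b' f0; lra.
Qed.

Lemma cut_cross_arith (g P H i j k ui uj : R) : 0 < g ->
  4 * `|ui| <= P * H + P * (k - i) -> 4 * `|uj| <= P * H + P * (j - k) ->
  - (g * (P * j + uj - (P * i + ui))) <=
  g * P * H / 2 + - (3 / 4 * g * P * (k - i)) + - (3 / 4 * g * P * (j - k)).
Proof.
move=> g0 A1 A2; have := ler_norm ui; have := ler_norm (- uj); rewrite normrN => A3 A4.
suff : 0 <= g * (P * H / 2 - 3 / 4 * P * (j - i) + (P * j + uj - (P * i + ui))).
  by clear; lra.
by rewrite mulr_ge0 ?(ltW g0) //; clear -A1 A2 A3 A4; lra.
Qed.

Lemma cut_left_arith (g P H i k ui x : R) : 0 < g -> 0 <= P * H ->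
  4 * `|ui| <= P * H + P * (k - i) -> P * k <= x ->
  - (g * `|P * i + ui - x|) <= g * P * H / 2 + - (3 / 4 * g * P * (k - i)).
Proof.
move=> g0 A0 A1 A2; have A3 := ler_norm ui.
have A4 : x - (P * i + ui) <= `|P * i + ui - x| by rewrite distrC ler_norm.
suff : 0 <= g * (P * H / 2 - 3 / 4 * P * (k - i) + `|P * i + ui - x|).
  by clear; lra.
by rewrite mulr_ge0 ?(ltW g0) //; clear -A0 A1 A2 A3 A4; lra.
Qed.

Lemma cut_right_arith (g P H i k ui x : R) : 0 < g -> 0 <= P * H ->
  4 * `|ui| <= P * H + P * (i - k) -> x <= P * (k + 1) ->
  - (g * `|P * i + ui - x|) <= g * P * H / 2 + g * P + - (3 / 4 * g * P * (i - k)).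
Proof.
move=> g0 A0 A1 A2; have := ler_norm (- ui); rewrite normrN => A3.
have A4 := ler_norm (P * i + ui - x).
suff : 0 <= g * (P * H / 2 + P - 3 / 4 * P * (i - k) + `|P * i + ui - x|).
  by clear; lra.
by rewrite mulr_ge0 ?(ltW g0) //; clear -A0 A1 A2 A3 A4; lra.
Qed.

Lemma cut_inner_arith (g P i j ui uj hi hj : R) : 0 < g -> 0 < P ->
  `|ui| = P * hi / 4 -> `|uj| = P * hj / 4 -> hi <= j - i -> hj <= j - i ->
  g * P / 2 * (j - i) <= g * (P * j + uj - (P * i + ui)).
Proof.
move=> g0 P0 E1 E2 A1 A2.
have := ler_norm ui; have := ler_norm (- uj); rewrite normrN E1 E2 => A3 A4.
suff : 0 <= g * (P * j + uj - (P * i + ui) - P / 2 * (j - i)) by clear; lra.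
rewrite mulr_ge0 ?(ltW g0) //.
have A5 : P * hi <= P * (j - i) by exact: ler_wpM2l (ltW P0) _ _ A1.
have A6 : P * hj <= P * (j - i) by exact: ler_wpM2l (ltW P0) _ _ A2.
by clear -A3 A4 A5 A6; lra.
Qed.

Lemma cut_square_arith (g P ui hi : R) : 0 < g -> P * hi = 4 * `|ui| ->
  (4 * hi + 2) * (2 * P) <= g / 4 * `|ui| ^+ 2 + (1024 / g + 4 * P).
Proof.
move=> g0 hE.
have : 0 <= g^-1 * (g / 2 * `|ui| - 32) ^+ 2 by rewrite mulr_ge0 ?sqr_ge0 // invr_ge0 ltW.
rewrite (_ : g^-1 * _ = g / 4 * `|ui| ^+ 2 - 32 * `|ui| + 1024 / g).
  by move=> A; clear -A hE; lra.
by field; rewrite gt_eqF.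
Qed.

Lemma cut_final_arith (g P KQ K1 B Kl Kr c w d X Y q1 q2 ph S2 : R) :
  0 < P -> 0 <= B -> 0 <= d -> Y <= d * K1 + X ->
  X * (2 * P) <= g / 4 * S2 + (1024 / g + 4 * P) * d -> w * (d - 1) <= g / 4 * S2 ->
  ph <= Kl + Kr + d -> q1 <= KQ -> q2 <= KQ ->
  2 * P * K1 + 4 * P + 1024 / g + B + c <= w ->
  2 * P * q1 + 2 * P * q2 + 2 * P * Y - g * S2 + B * ph <=
  4 * P * KQ + B * (Kl + Kr) + w - c * d - g / 2 * S2.
Proof.
move=> P0 B0 d0 H1 H2 H3 H4 H5 H6 H7.
have E1 : 2 * P * q1 <= 2 * P * KQ by rewrite ler_wpM2l // mulr_ge0 ?ltW.
have E2 : 2 * P * q2 <= 2 * P * KQ by rewrite ler_wpM2l // mulr_ge0 ?ltW.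
have E3 : 2 * P * Y <= 2 * P * (d * K1 + X) by rewrite ler_wpM2l // mulr_ge0 ?ltW.
have E4 : B * ph <= B * (Kl + Kr + d) by rewrite ler_wpM2l.
have E5 : (2 * P * K1 + 4 * P + 1024 / g + B + c) * d <= w * d by rewrite ler_wpM2r.
by clear -E1 E2 E3 E4 E5 H2 H3; lra.
Qed.

Definition cross_energy (g : R) (s : nat -> R) a b c d :=
  \sum_(a <= i < b) \sum_(c <= j < d) expR (- (g * (s j - s i))).

Definition self_energy (g : R) (s : nat -> R) a b :=
  \sum_(a <= i < b) \sum_(i.+1 <= j < b) expR (- (g * (s j - s i))).

(* If every bad cut of [(k1, k2)] lies within [4 |u_i| / p] of some [i], then the
   displacements [u_i] in the stretch are large on average, which makes long bad
   stretches exponentially unlikely. *)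
Lemma cut_exists p (g B c : R) : (0 < p)%N -> 0 < g -> 0 <= B -> 0 <= c ->
  exists K0 : R,
  forall N (s : nat -> R) k0 x, (k0 <= N)%N ->
  (forall i j, (i <= j)%N -> (j < N)%N -> s i <= s j) ->
  (k0 = 0%N \/ (p * k0)%:R <= x) -> (k0 = N \/ x <= (p * k0.+1)%:R) ->
  exists k1 k2, [/\ (k1 <= k0)%N, (k0 <= k2)%N, (k2 <= N)%N &
   2 * p%:R * cross_energy g s 0 k1 k1 N + 2 * p%:R * cross_energy g s k1 k2 k2 N + 2 * p%:R * self_energy g s k1 k2 -
   g * (\sum_(k1 <= i < k2) (s i - (p * i)%:R) ^+ 2) +
   B * (\sum_(0 <= i < N) expR (- (g * `|s i - x|))) <=
   K0 - c * (k2 - k1)%:R - g / 2 * (\sum_(k1 <= i < k2) (s i - (p * i)%:R) ^+ 2)].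
Proof.
move=> p0 g0 B0 c0; set P : R := p%:R.
have P0 : 0 < P by rewrite ltr0n.
pose b := 3 / 4 * g * P.
have b0 : 0 < b by rewrite /b !mulr_gt0 //; lra.
have [Kb Kb1 HKb] := exp_sum_le b0.
have gp20 : 0 < g * P / 2 by rewrite divr_gt0 // mulr_gt0.
have [K1 K11 HK1] := exp_sum_le gp20.
(* What a particle of the stretch may cost: its interactions, its charge and the prescribed gain
   [c]. *)
pose D := 2 * P * K1 + 4 * P + 1024 / g + B + c.
have g1024 : 0 < 1024 / g by exact: divr_gt0 (ltr0Sn R 1023) g0.
have D0 : 0 < D.
  have A1 : 0 < 2 * P * K1 by rewrite !mulr_gt0 // (lt_le_trans ltr01).
  have A2 : 0 < 4 * P by rewrite mulr_gt0.
  move: A1 A2 g1024; rewrite /D; move: (2 * P * K1) (4 * P) (1024 / g) => a1 a2 a3.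
  by clear -B0 c0; lra.
have [H HH H1] : exists2 H : nat, D <= g * P ^+ 2 * H%:R / 192 & 1 <= H%:R :> R.
  exists (Num.truncn (192 * D / (g * P ^+ 2))).+1; last by rewrite ler1n.
  have gP2 : 0 < g * P ^+ 2 by rewrite mulr_gt0 // exprn_gt0.
  have := truncnS_gt (192 * D / (g * P ^+ 2)).
  by rewrite ltr_pdivrMr // => A; clear -A; lra.
pose eH := expR (g * P * H%:R / 2).
pose KQ := eH * Kb ^+ 2.
pose Kl := eH * Kb; pose Kr := eH * expR (g * P) * Kb.
have eH1 : 1 <= eH by rewrite -expR0 ler_expR; have := mulr_gt0 g0 P0; nra.
exists (4 * P * KQ + B * (Kl + Kr) + g * P ^+ 2 * H%:R / 192).
move=> N s k0 x k0N srt xl xr.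
pose u i := s i - (p * i)%:R.
pose dd i k := ((i - k) + (k - i))%N.
(* A cut is good when no particle is displaced by more than a quarter of its unperturbed distance to
   the cut, displacements up to [p * H / 4] being tolerated everywhere. [dd] is the absolute
   difference of indices, one of its two truncated subtractions being 0. *)
pose goodb k := all (fun i => 4 * `|u i| <= (p * maxn H (dd i k))%:R) (iota 0 N).
have goodP k i : goodb k -> (i < N)%N -> 4 * `|u i| <= P * H%:R + P * (dd i k)%:R.
  move=> /allP gk iN; have := gk i; rewrite mem_iota => /(_ iN) /le_trans; apply.
  rewrite natrM -/P -mulrDr ler_wpM2l ?(ltW P0) // -natrD ler_nat; clear; lia.
have ex1 : exists k, (k <= k0)%N && ((k == 0%N) || goodb k) by exists 0%N; rewrite leq0n.
have ub1 k : (k <= k0)%N && ((k == 0%N) || goodb k) -> (k <= k0)%N by case/andP.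
have ex2 : exists k, (k0 <= k)%N && ((k == N) || goodb k) by exists N; rewrite k0N eqxx.
have [k1 /andP[k1k0 g1] m1] := ex_maxnP ex1 ub1.
have [k2 /andP[k0k2 g2] m2] := ex_minnP ex2.
have k2N : (k2 <= N)%N by apply: m2; rewrite k0N eqxx.
have k12 := leq_trans k1k0 k0k2.
exists k1, k2; split=> //.
have sE i : s i = P * i%:R + u i by rewrite /u natrM -/P; ring.
have Qgood k : (k <= N)%N -> goodb k -> cross_energy g s 0 k k N <= KQ.
  move=> kN gk; rewrite /cross_energy.
  have tb i j : (i < k)%N -> (k <= j < N)%N -> expR (- (g * (s j - s i))) <=
      eH * expR (- (b * `|i%:R - k%:R|)) * expR (- (b * `|j%:R - k%:R|)).
    move=> ik /andP[kj jN]; rewrite /eH -!expRD ler_expR.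
    have := goodP k i gk (leq_trans ik kN); have := goodP k j gk jN.
    have -> : dd i k = (k - i)%N by rewrite /dd; clear -ik; lia.
    have -> : dd j k = (j - k)%N by rewrite /dd; clear -kj; lia.
    rewrite !natrB // ?(ltnW ik) //.
    rewrite (ler0_norm (x := i%:R - k%:R)) ?subr_le0 ?ler_nat ?(ltnW ik) //.
    rewrite (ger0_norm (x := j%:R - k%:R)) ?subr_ge0 ?ler_nat //.
    rewrite opprB !sE /b => A1 A2; exact: cut_cross_arith g0 _ _.
  apply: (@le_trans _ _ (\sum_(0 <= i < k) eH * expR (- (b * `|i%:R - k%:R|)) * Kb)).
    rewrite big_nat [leRHS]big_nat; apply: ler_sum => i /andP[_ ik].
    apply: (@le_trans _ _ (\sum_(k <= j < N) eH * expR (- (b * `|i%:R - k%:R|)) *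
       expR (- (b * `|j%:R - k%:R|)))).
      rewrite big_nat [leRHS]big_nat; apply: ler_sum => j kjN; exact: tb.
    rewrite -mulr_sumr ler_wpM2l ?mulr_ge0 ?expR_ge0 //.
    by apply: le_trans (HKb k%:R N); apply: sum_nat_widen => // j; apply: expR_ge0.
  rewrite -mulr_suml -mulr_sumr /KQ expr2 mulrA ler_wpM2r ?(le_trans ler01 Kb1) //.
  by rewrite ler_wpM2l ?expR_ge0.
have KQ0 : 0 <= KQ by rewrite mulr_ge0 ?expR_ge0 ?exprn_ge0 // (le_trans ler01 Kb1).
have Q1 : cross_energy g s 0 k1 k1 N <= KQ.
  case/orP: g1 => [/eqP ->|]; first by rewrite /cross_energy big_geq.
  by apply: Qgood; exact: leq_trans k12 k2N.
have Q2 : cross_energy g s k1 k2 k2 N <= KQ.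
  apply: (@le_trans _ _ (cross_energy g s 0 k2 k2 N)).
    by apply: sum_nat_widen => // i; apply: sum_nat_ge0 => j; apply: expR_ge0.
  case/orP: g2 => [/eqP ->|]; last exact: Qgood.
  by rewrite /cross_energy big1 // => i _; rewrite big_geq.
have Phi_b : \sum_(0 <= i < N) expR (- (g * `|s i - x|)) <= Kl + Kr + (k2 - k1)%:R.
  rewrite (@big_cat_nat _ _ _ k1) //=; last exact: leq_trans k12 k2N.
  rewrite (@big_cat_nat _ _ _ k2 k1) //=.
  have A1 : \sum_(0 <= i < k1) expR (- (g * `|s i - x|)) <= Kl.
    case/orP: g1 => [/eqP ->|gk]; first by rewrite big_geq // /Kl mulr_ge0 ?expR_ge0 // (le_trans ler01 Kb1).
    apply: (@le_trans _ _ (eH * \sum_(0 <= i < k1) expR (- (b * `|i%:R - k1%:R|)))); last first.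
      by rewrite ler_wpM2l ?expR_ge0.
    rewrite mulr_sumr big_nat [leRHS]big_nat; apply: ler_sum => i /andP[_ ik].
    rewrite /eH -expRD ler_expR.
    have k00 : k0 <> 0%N by clear -ik k1k0; lia.
    have xk : P * k1%:R <= x.
      case: xl => // xl; apply: le_trans xl; rewrite natrM ler_wpM2l ?(ltW P0) //.
      by rewrite ler_nat.
    have := goodP k1 i gk (leq_trans ik (leq_trans k12 k2N)).
    have -> : dd i k1 = (k1 - i)%N by rewrite /dd; clear -ik; lia.
    rewrite natrB ?(ltnW ik) // (ler0_norm (x := i%:R - k1%:R)) ?subr_le0 ?ler_nat ?(ltnW ik) // => A2.
    have HP : 0 <= P * H%:R by exact: mulr_ge0 (ltW P0) (ler0n _ _).
    by rewrite opprB (sE i) /b; exact: cut_left_arith g0 _ _ _.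
  have A2 : \sum_(k1 <= i < k2) expR (- (g * `|s i - x|)) <= (k2 - k1)%:R.
    apply: (@le_trans _ _ (\sum_(k1 <= i < k2) (1 : R))).
      by apply: ler_sum => i _; rewrite expR_le1 oppr_le0 mulr_ge0 // ltW.
    by rewrite sumr_const_nat.
  have A3 : \sum_(k2 <= i < N) expR (- (g * `|s i - x|)) <= Kr.
    case/orP: g2 => [/eqP ->|gk].
      by rewrite big_geq // /Kr !mulr_ge0 ?expR_ge0 // (le_trans ler01 Kb1).
    have [k2N'|k2N'] := eqVneq k2 N.
      by rewrite k2N' big_geq // /Kr !mulr_ge0 ?expR_ge0 // (le_trans ler01 Kb1).
    apply: (@le_trans _ _ (eH * expR (g * P) * \sum_(k2 <= i < N) expR (- (b * `|i%:R - k2%:R|)))); last first.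
      rewrite ler_wpM2l ?mulr_ge0 ?expR_ge0 //; apply: le_trans (HKb k2%:R N).
      by apply: sum_nat_widen => // j; apply: expR_ge0.
    rewrite mulr_sumr big_nat [leRHS]big_nat; apply: ler_sum => i /andP[ki iN].
    rewrite /eH -!expRD ler_expR.
    have xk : x <= P * (k2%:R + 1).
      case: xr => [a|xr]; first by exfalso; clear -k2N' k0k2 k2N a; lia.
      apply: le_trans xr _; rewrite natrM ler_wpM2l ?(ltW P0) // natr1 ler_nat.
      by rewrite ltnS.
    have := goodP k2 i gk iN.
    have -> : dd i k2 = (i - k2)%N by rewrite /dd; clear -ki; lia.
    rewrite natrB // (ger0_norm (x := i%:R - k2%:R)) ?subr_ge0 ?ler_nat // => A4.
    have HP : 0 <= P * H%:R by exact: mulr_ge0 (ltW P0) (ler0n _ _).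
    by rewrite (sE i) /b; exact: cut_right_arith g0 _ _ _.
  by clear -A1 A2 A3; lra.
(* Particle [i] spoils exactly the cuts at index distance less than [h i], and these only if [h i]
   exceeds [H]. *)
pose h i := 4 * `|u i| / P.
have h0 i : 0 <= h i by rewrite /h divr_ge0 ?mulr_ge0 ?(ltW P0).
have uh i : `|u i| = P * h i / 4 by rewrite /h; field; rewrite gt_eqF.
(* A pair at index distance at least both radii keeps half of its unperturbed distance, which gives
   the geometric sum; any other pair costs at most 1 and is counted through the radii. *)
have PPb : self_energy g s k1 k2 <= (k2 - k1)%:R * K1 + \sum_(k1 <= i < k2) (4 * h i + 2).
  pose f i j : R := expR (- (g * P / 2 * `|j%:R - i%:R|)) +
    (if `|j%:R - i%:R| < h i then 1 else 0) + (if `|j%:R - i%:R| < h j then 1 else 0).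
  have f0 i j : 0 <= f i j.
    by rewrite /f; have := expR_ge0 (- (g * P / 2 * `|j%:R - i%:R|)); by move=> e; do 2 case: ifP; clear -e; lra.
  have tb i j : (i < j)%N -> (j < N)%N -> expR (- (g * (s j - s i))) <= f i j.
    move=> ij jN; rewrite /f.
    have e0 := expR_gt0 (- (g * P / 2 * `|j%:R - i%:R|)).
    have e1 : expR (- (g * (s j - s i))) <= 1.
      by rewrite expR_le1 oppr_le0 mulr_ge0 ?(ltW g0) // subr_ge0 srt // ltnW.
    case: ltP => A1; first by case: ifP; clear -e0 e1; lra.
    case: ltP => A2; first by clear -e0 e1; lra.
    rewrite !addr0 ler_expR lerN2.
    move: A1 A2; rewrite ger0_norm ?subr_ge0 ?ler_nat ?(ltnW ij) // => A1 A2.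
    by rewrite !sE; apply: (cut_inner_arith g0 P0 (uh i) (uh j)).
  apply: (@le_trans _ _ (\sum_(k1 <= i < k2) \sum_(k1 <= j < k2) f i j)).
    rewrite /self_energy big_nat [leRHS]big_nat; apply: ler_sum => i /andP[ki ik].
    apply: (@le_trans _ _ (\sum_(i.+1 <= j < k2) f i j)).
      rewrite big_nat [leRHS]big_nat; apply: ler_sum => j /andP[ij jk].
      by apply: tb => //; exact: leq_trans jk k2N.
    by apply: sum_nat_widen => //; exact: leqW.
  rewrite /f; under eq_bigr do rewrite !big_split /=.
  rewrite [X in X <= _]big_split /= [X in X + _ <= _]big_split /= [X in _ + X <= _]exchange_big /=.
  have cb i : \sum_(k1 <= j < k2) (if `|j%:R - i%:R| < h i then 1 else 0) <= 2 * h i + 1.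
    apply: le_trans (count_close i%:R k2 (h0 i)).
    by apply: sum_nat_widen => // j; case: ifP.
  have C1 : \sum_(k1 <= i < k2) \sum_(k1 <= j < k2) expR (- (g * P / 2 * `|j%:R - i%:R|)) <=
      (k2 - k1)%:R * K1.
    apply: (@le_trans _ _ (\sum_(k1 <= i < k2) K1)); last by rewrite sumr_const_nat mulr_natl.
    apply: ler_sum => i _; apply: le_trans (HK1 i%:R k2).
    by apply: sum_nat_widen => // j; apply: expR_ge0.
  have C2 : \sum_(k1 <= i < k2) \sum_(k1 <= j < k2) (if `|j%:R - i%:R| < h i then 1 else 0) <=
     \sum_(k1 <= i < k2) (2 * h i + 1) by apply: ler_sum => i _; apply: cb.
  have C3 : \sum_(k1 <= j < k2) \sum_(k1 <= i < k2) (if `|j%:R - i%:R| < h j then 1 else 0) <=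
     \sum_(k1 <= i < k2) (2 * h i + 1).
    apply: ler_sum => j _; apply: le_trans (cb j).
    by apply: ler_sum => i _; rewrite distrC.
  have C4 : \sum_(k1 <= i < k2) (4 * h i + 2) =
     \sum_(k1 <= i < k2) (2 * h i + 1) + \sum_(k1 <= i < k2) (2 * h i + 1).
    by rewrite -big_split /=; apply: eq_bigr => i _; clear; lra.
  by clear -C1 C2 C3 C4; lra.
(* Every cut strictly between [k1] and [k2] is bad, and the particle spoiling it belongs to the
   stretch, since otherwise it would also spoil [k1] or [k2]. Particle [i] spoils at most
   [2 * h i + 1] cuts, which is at most [3 * h i ^+ 2 / H] because [h i > H >= 1]. *)
have bad : (k2 - k1)%:R - 1 <= \sum_(k1 <= i < k2) 3 * h i ^+ 2 / H%:R.
  have [k12'|k12'] := eqVneq k1 k2.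
    by rewrite k12' subnn big_geq // sub0r oppr_le0 ler01.
  have lt12 : (k1 < k2)%N by rewrite ltn_neqAle k12' k12.
  have -> : (k2 - k1)%:R - 1 = \sum_(k1.+1 <= k < k2) (1 : R).
    by rewrite sumr_const_nat (_ : k2 - k1 = (k2 - k1.+1).+1)%N -?natr1 ?addrK // subnSK.
  pose t i k : R := if (H%:R < h i) && (`|k%:R - i%:R| < h i) then 1 else 0.
  have t0 i k : 0 <= t i k by rewrite /t; case: ifP.
  apply: (@le_trans _ _ (\sum_(k1.+1 <= k < k2) \sum_(k1 <= i < k2) t i k)).
    rewrite big_nat [leRHS]big_nat; apply: ler_sum => k /andP[k1k kk2].
    have ng : ~~ goodb k.
      apply/negP => gk; have [kk0|kk0] := leqP k k0.
        by have := m1 k; rewrite kk0 gk orbT => /(_ isT); clear -k1k; lia.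
      by have := m2 k; rewrite (ltnW kk0) gk orbT => /(_ isT); clear -kk2; lia.
    case/allPn: ng => i; rewrite mem_iota add0n => iN; rewrite -ltNge => big_u.
    have ki : (k1 <= i)%N.
      rewrite leqNgt; apply/negP => ik; case/orP: g1 => [/eqP a|/allP gk]; first by clear -a ik; lia.
      have := gk i; rewrite mem_iota => /(_ iN); rewrite leNgt => /negP; apply.
      apply: le_lt_trans big_u; rewrite ler_nat leq_mul2l; apply/orP; right; rewrite /dd; clear -ik k1k; lia.
    have ik : (i < k2)%N.
      rewrite ltnNge; apply/negP => ik; case/orP: g2 => [/eqP a|/allP gk].
        by clear -a ik iN; lia.
      have := gk i; rewrite mem_iota => /(_ iN); rewrite leNgt => /negP; apply.
      apply: le_lt_trans big_u; rewrite ler_nat leq_mul2l; apply/orP; right; rewrite /dd; clear -ik kk2; lia.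
    have tik : t i k = 1.
      rewrite /t; have hE : P * h i = 4 * `|u i| by rewrite uh; clear; field.
      have : P * (maxn H (dd i k))%:R < P * h i by rewrite hE -natrM.
      rewrite ltr_pM2l // => mh.
      have -> : H%:R < h i by apply: le_lt_trans mh; rewrite ler_nat leq_maxl.
      have -> // : `|k%:R - i%:R| < h i.
      apply: le_lt_trans mh; apply: (@le_trans _ _ (dd i k)%:R); last by rewrite ler_nat leq_maxr.
      rewrite /dd natrD ler_norml; have [ik'|ki'] := leqP i k.
        have A : i%:R <= k%:R :> R by rewrite ler_nat.
        by rewrite (eqP ik') (natrB _ ik') add0r; apply/andP; split; clear -A; lra.
      have A : k%:R <= i%:R :> R by rewrite ler_nat ltnW.
      rewrite natrB ?(ltnW ki') // (eqP (ltnW ki')) addr0.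
      by apply/andP; split; clear -A; lra.
    rewrite (bigD1_seq i) ?iota_uniq ?mem_index_iota ?ki //= tik lerDl.
    by apply: sumr_ge0.
  rewrite exchange_big /=; apply: ler_sum => i _.
  have Hp : 0 < H%:R :> R by clear -H1; lra.
  rewrite /t; have [Hh|hH] := ltP H%:R (h i); last first.
    by rewrite big1 // divr_ge0 ?ler0n // mulr_ge0 ?exprn_ge0 ?ler0n.
  apply: (@le_trans _ _ (2 * h i + 1)).
    apply: le_trans (count_close i%:R k2 (h0 i)).
    by apply: sum_nat_widen => // j; case: ifP.
  rewrite ler_pdivlMr //; clear -Hh H1; nra.
have uu i : (s i - (p * i)%:R) ^+ 2 = `|u i| ^+ 2 by rewrite real_normK ?num_real.
rewrite (eq_bigr _ (fun i _ => uu i)); set S2 := \sum_(k1 <= i < k2) _.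
have T1 : \sum_(k1 <= i < k2) (4 * h i + 2) * (2 * P) <= g / 4 * S2 + (1024 / g + 4 * P) * (k2 - k1)%:R.
  have -> : (k2 - k1)%:R = \sum_(k1 <= i < k2) (1 : R) by rewrite sumr_const_nat.
  rewrite /S2 !mulr_sumr -big_split /=; apply: ler_sum => i _.
  by rewrite mulr1; apply: (cut_square_arith g0); rewrite uh; field.
have T2 : g * P ^+ 2 * H%:R / 192 * ((k2 - k1)%:R - 1) <= g / 4 * S2.
  have cc0 : 0 <= g * P ^+ 2 * H%:R / 192.
    apply: divr_ge0; last exact: ler0n.
    apply: mulr_ge0; last exact: ler0n.
    by apply: mulr_ge0; [exact: ltW | exact: exprn_ge0 _ (ltW P0)].
  apply: (le_trans (ler_wpM2l cc0 bad)); rewrite !mulr_sumr; apply: ler_sum => i _.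
  rewrite uh le_eqVlt; apply/orP; left; apply/eqP; field; rewrite gt_eqF //; clear -H1; lra.
have S20 : 0 <= S2 by apply: sum_nat_ge0 => i; rewrite exprn_ge0.
rewrite -mulr_suml in T1.
have d0 : 0 <= (k2 - k1)%:R :> R by rewrite ler0n.
by apply: cut_final_arith PPb T1 T2 Phi_b Q1 Q2 HH.
Qed.

End Localization.

(** * The one-component plasma bound *)

Section PlasmaBound.
Variable R : realType.
Local Notation C := R[i].

Lemma nc_prod (I : Type) (r : seq I) (F : I -> C) :
  nc (\prod_(i <- r) F i) = \prod_(i <- r) nc (F i).
Proof.
elim: r => [|i r IH]; first by rewrite !big_nil ComplexField.Normc.normc1.
by rewrite !big_cons ComplexField.Normc.normcM IH.
Qed.

Lemma nc_sub (x y : C) : nc (x - y) <= nc x + nc y.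
Proof.
have := ler_normB x y; rewrite !nc_norm -(rmorphD (real_complex R)).
by rewrite lecR.
Qed.

(** The one-dimensional Coulomb picture: a term linear in the right point, to be balanced by the
    Gaussian background, and an interaction that decays with the separation. *)
Lemma nc_point_val_sub (g : R) (x y : R * C) : nc x.2 == 1 -> nc y.2 == 1 ->
  nc (point_val g y - point_val g x) <= expR (g * y.1 + expR (- (g * (y.1 - x.1)))).
Proof.
move=> x1 y1; apply: (le_trans (nc_sub _ _)); rewrite !nc_point_val // expRD.
have -> : expR (g * y.1) + expR (g * x.1) =
    expR (g * y.1) * (1 + expR (- (g * (y.1 - x.1)))).
  rewrite mulrDr mulr1 -expRD; congr (_ + expR _); ring.
by rewrite ler_wpM2l ?expR_ge0 // expR_ge1Dx.
Qed.

Lemma expR_bigsum (I : Type) (r : seq I) (f : I -> R) :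
  \prod_(i <- r) expR (f i) = expR (\sum_(i <- r) f i).
Proof.
elim: r => [|i r IH]; first by rewrite !big_nil expR0.
by rewrite !big_cons expRD IH.
Qed.

Lemma ler_prod_seq (I : Type) (r : seq I) (f h : I -> R) :
  (forall i, 0 <= f i <= h i) -> 0 <= \prod_(i <- r) f i <= \prod_(i <- r) h i.
Proof.
move=> H; elim: r => [|i r /andP[A B]]; first by rewrite !big_nil ler01 lexx.
have /andP[a b] := H i.
by rewrite !big_cons mulr_ge0 //= ler_pM.
Qed.

Variables (p : nat) (g : R) (q : nat -> R * C).
Hypothesis q1 : forall i, nc (q i).2 == 1.
Local Notation s := (fun i => (q i).1).
Local Notation tq a b := (map (point_val g \o q) (index_iota a b)).

Lemma nc_cross_le a b c d : (a <= b)%N ->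
  nc (cross p (tq a b) (tq c d)) <=
  expR (p%:R * (g * (b - a)%:R * (\sum_(c <= j < d) s j) + cross_energy g s a b c d)).
Proof.
move=> ab; rewrite /cross big_map nc_prod.
apply: (@le_trans _ _ (\prod_(a <= i < b) expR (p%:R * \sum_(c <= j < d)
   (g * s j + expR (- (g * (s j - s i))))))).
  have H i : 0 <= nc (\prod_(y <- tq c d) (y - (point_val g \o q) i) ^+ p) <=
      expR (p%:R * \sum_(c <= j < d) (g * s j + expR (- (g * (s j - s i))))).
    rewrite nc_ge0 /= big_map nc_prod.
    rewrite (eq_bigr (fun j => nc (point_val g (q j) - point_val g (q i)) ^+ p)) => [|j _]; last first.
      by rewrite ncX.
    rewrite prodrXl expRM_natl -expR_bigsum.
    have H' j : 0 <= nc (point_val g (q j) - point_val g (q i)) <= expR (g * s j + expR (- (g * (s j - s i)))).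
      by rewrite nc_ge0 nc_point_val_sub.
    have /andP[A B] := ler_prod_seq (index_iota c d) H'.
    by apply: lerXn2r => //; rewrite nnegrE // (le_trans A B).
  by have /andP[_ A] := ler_prod_seq (index_iota a b) H; exact: A.
rewrite expR_bigsum ler_expR -mulr_sumr ler_wpM2l ?ler0n // /cross_energy.
rewrite (eq_bigr (fun i => g * (\sum_(c <= j < d) s j) +
   \sum_(c <= j < d) expR (- (g * (s j - s i))))) => [|i _]; last first.
  by rewrite big_split /= mulr_sumr.
rewrite big_split /= sumr_const_nat lerD2r -mulr_natr.
by rewrite le_eqVlt; apply/orP; left; apply/eqP; ring.
Qed.

Lemma nc_vdm_le a b : (a <= b)%N ->
  nc (vdm p (tq a b)) <=
  expR (p%:R * (g * (\sum_(a <= i < b) (i - a)%:R * s i) + self_energy g s a b)).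
Proof.
move=> ab; have [n ->] : exists n, b = (a + n)%N by exists (b - a)%N; rewrite subnKC.
elim: n a {ab} => [|n IH] a.
  rewrite /self_energy !big_geq ?addn0 // mulr0 addr0 mulr0 expR0.
  have -> : tq a a = [::] by rewrite /index_iota subnn.
  by rewrite -[vdm _ _]/1 ComplexField.Normc.normc1.
have aS : (a < a + n.+1)%N by rewrite -addSnnS leq_addr.
have -> : tq a (a + n.+1) = (point_val g \o q) a :: tq a.+1 (a + n.+1).
  by rewrite /index_iota addKn -addSnnS addKn.
rewrite [vdm _ _]/= ComplexField.Normc.normcM -addSnnS.
have := @nc_cross_le a a.+1 a.+1 (a.+1 + n) (leqnSn a).
rewrite /cross /index_iota subSnn /= big_seq1 => A.
apply: (le_trans (ler_pM (nc_ge0 _) (nc_ge0 _) A (IH a.+1))).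
rewrite -expRD ler_expR /self_energy [X in _ <= _ * (_ + X)]big_ltn; last by rewrite addSnnS.
rewrite [X in _ <= _ * (g * X + _)]big_ltn; last by rewrite addSnnS.
rewrite /cross_energy big_nat1 subnn mul0r add0r.
have -> : \sum_(a.+1 <= i < a.+1 + n) (i - a)%:R * s i =
    \sum_(a.+1 <= i < a.+1 + n) (i - a.+1)%:R * s i + \sum_(a.+1 <= i < a.+1 + n) s i.
  rewrite -big_split /= big_nat [RHS]big_nat; apply: eq_bigr => i /andP[ai _].
  by rewrite -[X in _ + X]mul1r -mulrDl natr1 subnSK.
rewrite le_eqVlt; apply/orP; left; apply/eqP; rewrite mulr1.
by move: (\sum_(_ <= i < _) s i) (\sum_(_ <= i < _) _ * _) (\sum_(_ <= i < _) expR _) (\sum_(_ <= i < _) \sum_(_ <= j < _) _) => e1 e2 e3 e4; ring.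
Qed.

End PlasmaBound.

(** * Grid sums, sorted configurations and exponential moments *)

Section PlasmaBound2.
Variable R : realType.
Local Notation C := R[i].

(** Sorting compensates the [1/n!]: forgetting the order only adds nonnegative terms. The induction
    splits off the smallest point. *)
Lemma isum_sorted_prod_zip_le (ss : seq (R * C)) (fs : seq (R -> R)) :
  (forall f x, List.In f fs -> 0 <= f x) ->
  isum ss (size fs) (fun t => prod_zip fs (sort <=%R (map fst t))) <=
  \prod_(f <- fs) \sum_(q <- ss) f q.1.
Proof.
elim: fs => [|f fs IH] Hf.
  by rewrite /isum /= big_nil invr1 mul1r.
have f0 x : 0 <= f x by apply: Hf; left.
have Hfs h x : List.In h fs -> 0 <= h x by move=> hh; apply: Hf; right.
pose srt := sort (relpre fst <=%R : rel (R * C)).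
have tot : total (relpre fst <=%R : rel (R * C)) by move=> x y; apply: le_total.
have tr : transitive (relpre fst <=%R : rel (R * C)) by move=> x y z /=; apply: le_trans.
have srtP t : perm_eq (srt t) t by rewrite perm_sort.
have Hpi (gs : seq (R -> R)) : perm_inv (fun t : seq (R * C) => prod_zip gs (sort <=%R (map fst t))).
  move=> t t' tt; congr (prod_zip _ _); apply/perm_sortP.
  - exact: le_total.
  - exact: le_trans.
  - exact: le_anti.
  - exact: perm_map.
have -> : size (f :: fs) = (1 + size fs)%N by [].
rewrite big_cons.
have e1 : isum ss 1 (fun t => prod_zip [:: f] (sort <=%R (map fst t))) = \sum_(q <- ss) f q.1.
  by rewrite /isum /= invr1 mul1r; apply: eq_bigr => x _; rewrite mulr1.
rewrite -e1; apply: (@le_trans _ _ (isum ss 1 (fun t => prod_zip [:: f] (sort <=%R (map fst t))) *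
  isum ss (1 + size fs - 1) (fun t => prod_zip fs (sort <=%R (map fst t))))).
  apply: (@isum_cut_le _ _ _ _ _ srt) => //.
  - by move=> t; apply: prod_zip_ge0 => h x [<- //|[]].
  - by move=> t; apply: prod_zip_ge0.
  - move=> t st; rewrite sort_map -/srt.
    have : size (srt t) = (1 + size fs)%N by rewrite (perm_size (srtP t)).
    have : sorted (relpre fst <=%R : rel (R * C)) (srt t) by exact: sort_sorted.
    case: (srt t) => [//|x u] so [su] /=.
    rewrite drop0 take0 /= mulr1 sort_map (sorted_sort tr) //.
    exact: path_sorted so.
rewrite addKn; apply: ler_wpM2l; last exact: IH.
by rewrite e1; apply: sumr_ge0.
Qed.

Variables (p : nat) (g : R).
Hypothesis p0 : (0 < p)%N.
Hypothesis g0 : 0 < g.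
Local Notation cf := (@cf C p).
Local Notation cweight := (@cweight R p g).
Local Notation Z := (@Z R p g).
Local Notation gs_energy := (@gs_energy R p g).

Definition th (a : R) (B : nat) : R := \sum_(0 <= i < B.*2.+1) expR (- (a * (i%:R - B%:R) ^+ 2)).

(** The integers from [- B] to [B + M]: they contain the window of radius [B] around every orbital
    up to [M], so a Gaussian centred at an orbital sums to at least [th]. *)
Definition box (B M : nat) : seq R := [seq (i%:R - B%:R) | i <- iota 0 (B.*2 + M).+1].

Lemma big_nat_shift (n j : nat) (f : nat -> R) :
  \sum_(j <= i < n + j) f i = \sum_(0 <= i < n) f (i + j)%N.
Proof. by rewrite -{1}[j]add0n big_addn addnK. Qed.

Lemma box_sum_ge (a : R) B M j : (j <= M)%N ->
  th a B <= \sum_(s <- box B M) expR (- (a * (s - j%:R) ^+ 2)).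
Proof.
move=> jM; rewrite /box big_map /th -[iota 0 _]/(index_iota 0 (B.*2 + M).+1).
apply: (@le_trans _ _ (\sum_(j <= i < B.*2.+1 + j) expR (- (a * (i%:R - B%:R - j%:R) ^+ 2)))).
  rewrite big_nat_shift le_eqVlt; apply/orP; left; apply/eqP.
  by apply: eq_bigr => i _; rewrite natrD; congr (expR (- (_ * _ ^+ 2))); ring.
by apply: sum_nat_widen; [move=> i; exact: expR_ge0 | by [] | lia].
Qed.

Lemma box_sum_le (a : R) B M c :
  \sum_(s <- box B M) expR (- (a * (s - c%:R) ^+ 2)) <= th a (B + M + c).
Proof.
rewrite /box big_map /th -[iota 0 _]/(index_iota 0 (B.*2 + M).+1).
pose d := (M + c)%N.
apply: (@le_trans _ _ (\sum_(M <= i < (B.*2 + M).+1 + M) expR (- (a * (i%:R - (B + M + c)%:R) ^+ 2)))).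
  rewrite big_nat_shift le_eqVlt; apply/orP; left; apply/eqP.
  by apply: eq_bigr => i _; rewrite !natrD; congr (expR (- (_ * _ ^+ 2))); ring.
by apply: sum_nat_widen; [move=> i; exact: expR_ge0 | by [] | lia].
Qed.

Lemma th_ge1 (a : R) B : 1 <= th a B.
Proof.
apply: (@le_trans _ _ (\sum_(B <= i < B.+1) expR (- (a * (i%:R - B%:R) ^+ 2)))).
  by rewrite big_nat1 subrr expr0n /= mulr0 oppr0 expR0.
by apply: sum_nat_widen; [move=> i; exact: expR_ge0 | by [] | lia].
Qed.

Lemma th_bounded (a : R) : 0 < a -> exists K : R, forall B, th a B <= K.
Proof.
move=> a0; have [K K1 HK] := exp_sum_le a0; exists K => B.
apply: le_trans (HK B%:R B.*2.+1); apply: ler_sum => i _; rewrite ler_expR lerN2 ler_pM2l //.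
have [->|iB] := eqVneq i B; first by rewrite subrr normr0 expr0n.
have : 1 <= `|i%:R - B%:R : R|.
  have [lt|gt|e] := ltngtP i B; last by rewrite e eqxx in iB.
    rewrite distrC -natrB 1?ltnW // ger0_norm ?ler0n // ler1n subn_gt0 //.
  by rewrite -natrB 1?ltnW // ger0_norm ?ler0n // ler1n subn_gt0.
move: (`|_|) (real_normK (num_real (i%:R - B%:R : R))) => y <- y1.
rewrite expr2; nra.
Qed.

Definition theta (a : R) : R := sup [set th a B | B in [set: nat]]%classic.

Lemma th_has_sup (a : R) : 0 < a -> has_sup [set th a B | B in [set: nat]]%classic.
Proof.
move=> a0; split; first by exists (th a 0); exists 0%N.
by have [K HK] := th_bounded a0; exists K => _ [B _ <-].
Qed.

Lemma th_le (a : R) B : 0 < a -> th a B <= theta a.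
Proof. by move=> a0; apply: (ub_le_sup (th_has_sup a0).2); exists B. Qed.

(** The truncation error is shared by [N] factors; an exponent of order [1/N] for each leaves the
    total factor [expR 1]. *)
Lemma th_near (a : R) N : 0 < a -> exists B, theta a ^+ N <= expR 1 * th a B ^+ N.
Proof.
move=> a0; case: N => [|N].
  by exists 0%N; rewrite !expr0 mulr1 -expR0 ler_expR.
have t1 : 1 <= theta a := le_trans (th_ge1 a 0) (th_le 0 a0).
have d0 : 0 < theta a * (1 - expR (- N.+1%:R^-1)).
  apply: mulr_gt0; first exact: lt_le_trans ltr01 t1.
  by rewrite subr_gt0 expR_lt1 oppr_lt0 invr_gt0 ltr0n.
have [_ [B _ <-]] := sup_adherent d0 (th_has_sup a0); rewrite -/(theta a) => hB.
exists B; have {}hB : theta a <= expR (N.+1%:R^-1) * th a B.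
  have : theta a * expR (- N.+1%:R^-1) <= th a B by apply: ltW; move: hB; lra.
  rewrite expRN ler_pdivrMr ?expR_gt0 // mulrC; exact.
apply: (@le_trans _ _ ((expR (N.+1%:R^-1) * th a B) ^+ N.+1)).
  apply: lerXn2r => //; rewrite nnegrE ?mulr_ge0 ?expR_ge0 ?(le_trans ler01) //.
  exact: th_ge1.
by rewrite exprMn -expRM_natl mulfV ?pnatr_eq0.
Qed.

Definition phi (v : R) : R := expR (- (g * `|v|)).

Lemma phiE v : phi v = expR (- (g * `|v|)).
Proof. by []. Qed.

Lemma sqr_exp (c : nat) (s : R) :
  expR (- (g * s ^+ 2)) * expR (2 * g * c%:R * s) =
  expR (g * c%:R ^+ 2) * expR (- (g * (s - c%:R) ^+ 2)).
Proof. by rewrite -!expRD; congr expR; ring. Qed.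

Lemma kapr_le (k : nat) B M j :
  kapr g (fun s => expR (- (g * s ^+ 2)) * expR (2 * g * k%:R * s)) (box B M) M j <=
  M%:R * theta g * expR (g * (k + j)%:R ^+ 2).
Proof.
rewrite /kapr -[leRHS]mulrA; apply: ler_wpM2l; first exact: ler0n.
rewrite [leRHS]mulrC.
rewrite (eq_bigr (fun s => expR (g * (k + j)%:R ^+ 2) * expR (- (g * (s - (k + j)%:R) ^+ 2)))).
  rewrite -mulr_sumr ler_wpM2l ?expR_ge0 //.
  exact: le_trans (box_sum_le _ _ _ _) (th_le _ g0).
move=> s _; rewrite -(sqr_exp (k + j) s) -mulrA -expRD; congr (_ * expR _); rewrite natrD; ring.
Qed.

Lemma expR_convex (lam y : R) : 0 <= lam <= 1 -> expR (lam * y) <= 1 - lam + lam * expR y.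
Proof.
move=> /andP[l0 l1]; have := expR_ge1Dx ((1 - lam) * y); have := expR_ge1Dx (- (lam * y)).
have E1 : expR ((1 - lam) * y) * expR (lam * y) = expR y by rewrite -expRD; congr expR; ring.
have E2 : expR (- (lam * y)) * expR (lam * y) = 1 by rewrite -expRD addNr expR0.
have e0 := expR_gt0 (lam * y).
move=> A B; rewrite -E1.
have A' : (1 - lam) * ((1 + - (lam * y)) * expR (lam * y)) <= (1 - lam) * 1.
  apply: ler_wpM2l; first by rewrite subr_ge0.
  by rewrite -[leRHS]E2; exact: ler_wpM2r (ltW e0) _ _ A.
have B' : lam * ((1 + (1 - lam) * y) * expR (lam * y)) <=
    lam * (expR ((1 - lam) * y) * expR (lam * y)).
  apply: ler_wpM2l => //; exact: ler_wpM2r (ltW e0) _ _ B.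
apply: (@le_trans _ _ ((1 - lam) * ((1 + - (lam * y)) * expR (lam * y)) +
   lam * ((1 + (1 - lam) * y) * expR (lam * y)))).
  by rewrite le_eqVlt; apply/orP; left; apply/eqP; ring.
by move: A' B'; rewrite mulr1 => A' B'; apply: lerD.
Qed.

(** The grid point [s = j] carries only about the fraction [1 / th] of the Gaussian sum. By
    convexity, enlarging its exponent by the factor [theta g] compensates for the other points,
    whose factor is merely at least 1. An exponential moment of orbitals is thus dominated by one of
    points. *)
Lemma kapr_ge (b x : R) B M j : 0 <= b -> (j <= M)%N ->
  M%:R * th g B * expR (g * j%:R ^+ 2) * expR (b * phi (j%:R - x)) <=
  kapr g (fun s => expR (- (g * s ^+ 2)) * expR (b * theta g * phi (s - x))) (box B M) M j.
Proof.
move=> b0 jM; rewrite /kapr -2!(mulrA M%:R); apply: ler_wpM2l; first exact: ler0n.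
rewrite (eq_bigr (fun s => expR (g * j%:R ^+ 2) * (expR (- (g * (s - j%:R) ^+ 2)) *
    expR (b * theta g * phi (s - x))))); last first.
  by move=> s _; rewrite mulrA -(sqr_exp j s) mulrAC.
rewrite -mulr_sumr [th g B * _]mulrC -[leLHS]mulrA; apply: ler_wpM2l; first exact: expR_ge0.
set y := b * theta g * phi (j%:R - x).
have th1 := th_ge1 g B; have tt := th_le B g0.
have y0 : 0 <= y by rewrite /y !mulr_ge0 ?expR_ge0 // (le_trans _ tt) // (le_trans ler01).
have th0 : 0 < th g B by exact: lt_le_trans ltr01 th1.
apply: (@le_trans _ _ (th g B * expR ((th g B)^-1 * y))).
  rewrite ler_wpM2l ?(ltW th0) // ler_expR /y mulrA ler_wpM2r ?expR_ge0 //.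
  by rewrite mulrCA ler_peMr // ler_pdivlMl // mulr1.
apply: (@le_trans _ _ (th g B - 1 + expR y)).
  have := @expR_convex (th g B)^-1 y; rewrite invr_ge0 (ltW th0) invf_le1 // th1 => /(_ isT).
  move=> H; apply: (le_trans (ler_wpM2l (ltW th0) H)).
  by rewrite mulrDr mulrBr mulr1 mulrA divff ?gt_eqF // mul1r.
have jb : j%:R \in box B M.
  by apply/mapP; exists (j + B)%N; rewrite ?mem_iota ?natrD ?addrK //; lia.
have ub : uniq (box B M).
  rewrite map_inj_uniq ?iota_uniq // => i i' /(addIr (- B%:R)) /eqP.
  by rewrite eqr_nat => /eqP.
have := box_sum_ge g B jM; rewrite !(bigD1_seq _ jb ub) /=.
rewrite subrr expr0n /= mulr0 oppr0 expR0 mul1r -/y => H.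
have H2 : \sum_(i <- box B M | i != j%:R) expR (- (g * (i - j%:R) ^+ 2)) <=
   \sum_(i <- box B M | i != j%:R) expR (- (g * (i - j%:R) ^+ 2)) * expR (b * theta g * phi (i - x)).
  apply: ler_sum => i _; rewrite ler_peMr ?expR_ge0 // -expR0 ler_expR.
  by rewrite !mulr_ge0 ?expR_ge0 // (le_trans _ tt) // (le_trans ler01).
by move: H H2; set A := \sum_(_ <- _ | _) _; set A' := \sum_(_ <- _ | _) _; lra.
Qed.

(** The tilt is the leading order of the interaction with particles further left: each of them
    contributes [expR (2 * g * p * x)]. *)
Definition g1 (k : nat) (t : seq (R * C)) : R :=
  (\prod_(q <- t) (expR (- (g * q.1 ^+ 2)) * expR (2 * g * k%:R * q.1))) *
  nc (vdm p (map (point_val g) t)) ^+ 2.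

Lemma g1_ge0 k t : 0 <= g1 k t.
Proof.
rewrite /g1 mulr_ge0 ?exprn_ge0 ?nc_ge0 //; apply: prodr_ge0 => q _.
by rewrite mulr_ge0 ?expR_ge0.
Qed.

Lemma nc_vdm_perm : perm_inv (fun t : seq C => nc (vdm p t)).
Proof.
apply: swap_perm_inv => s x y t; rewrite vdm_swap ComplexField.Normc.normcM ncX.
by rewrite normcN ComplexField.Normc.normc1 expr1n mul1r.
Qed.

Lemma g1_perm k : perm_inv (g1 k).
Proof.
move=> s t st; rewrite /g1 (perm_big _ st); congr (_ * _ ^+ 2).
by apply: nc_vdm_perm; apply: perm_map.
Qed.

Lemma prod_const_seq (c : R) (f : nat -> R) (m : seq nat) :
  \prod_(j <- m) (c * f j) = c ^+ size m * \prod_(j <- m) f j.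
Proof.
elim: m => [|j m IH]; first by rewrite !big_nil mulr1.
by rewrite !big_cons IH /= exprS; ring.
Qed.

Lemma cw0E m : nc (cf m) ^+ 2 * expR (g * ssq R m) = expR (gs_energy (size m)) * cweight [::] m.
Proof.
rewrite /cweight /= cfz0 big_nil mulr0 expR0 mulr1 add0n !mulrA -expRD subrr expR0.
by rewrite mul1r.
Qed.

Lemma prod_expsq (m : seq nat) k :
  \prod_(j <- m) expR (g * (k + j)%:R ^+ 2) = expR (g * ssq R (map (addn k) m)).
Proof. by rewrite expR_bigsum /ssq big_map mulr_sumr. Qed.

Lemma mval_vdm N n t : (n <= N)%N -> size t = n ->
  mval g (p * N) n cf t = vdm p (map (point_val g) t).
Proof. by move=> nN st; rewrite (@vdmEN _ _ _ N) ?size_map ?st. Qed.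

(** The tilt moves the orbitals by [p * k]. As [sumn] is constant on the support of [cf], the change
    of energy is a constant, the same as for the root configuration. *)
Lemma isum_g1_le B N k n : (k + n <= N)%N ->
  isum (grid (box B (p * N)) (p * N)) n (g1 (p * k)) <=
  ((p * N)%:R * theta g) ^+ n * expR (gs_energy (k + n) - gs_energy k) * Z n.
Proof.
move=> knN; have nN : (n <= N)%N by rewrite (leq_trans _ knN) ?leq_addl.
set M := (p * N)%N.
rewrite /isum (eq_tsum _ (G := fun ps => (\prod_(q <- ps) (fun s => expR (- (g * s ^+ 2)) *
   expR (2 * g * (p * k)%:R * s)) q.1) * nc (mval g M n cf ps) ^+ 2)); last first.
  by move=> t st; rewrite mval_vdm.
rewrite (parseval_real g (fun s => expR (- (g * s ^+ 2)) * expR (2 * g * (p * k)%:R * s))) -/(isum _ _ _).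
pose c := M%:R * theta g.
have c0 : 0 <= c by rewrite mulr_ge0 ?ler0n // (le_trans _ (th_le 0 g0)) // (le_trans ler01) // th_ge1.
apply: (@le_trans _ _ (isum (iota 0 M) n (fun m => c ^+ n * expR (gs_energy (k + n) - gs_energy k) * cweight [::] m))).
  apply: le_isum => m sm.
  apply: (@le_trans _ _ (nc (cf m) ^+ 2 * \prod_(j <- m) (c * expR (g * (p * k + j)%:R ^+ 2)))).
    apply: ler_wpM2l; first by rewrite exprn_ge0 ?nc_ge0.
    have H j : 0 <= kapr g (fun s => expR (- (g * s ^+ 2)) * expR (2 * g * (p * k)%:R * s)) (box B M) M j
      <= c * expR (g * (p * k + j)%:R ^+ 2).
      rewrite kapr_le andbT mulr_ge0 ?ler0n //; apply: sumr_ge0 => s _.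
      by rewrite !mulr_ge0 ?expR_ge0.
    by have /andP[_] := ler_prod_seq m H.
  rewrite prod_const_seq prod_expsq sm mulrCA -mulrA; apply: ler_wpM2l; first exact: exprn_ge0.
  have [cf0|nz] := eqVneq (cf m) 0.
    rewrite cf0 ComplexField.Normc.normc0 expr0n /= mul0r mulr_ge0 ?expR_ge0 //.
    exact: cweight_ge0.
  rewrite ssq_addn (cf_sum nz) sm.
  have -> : expR (g * (ssq R m + 2 * (p * k)%:R * (p * 'C(n, 2))%:R + n%:R * (p * k)%:R ^+ 2)) =
     expR (g * ssq R m) * expR (g * p%:R ^+ 2 * (2 * k%:R * ('C(n, 2))%:R + n%:R * k%:R ^+ 2)).
    by rewrite -expRD; congr expR; rewrite !natrM; ring.
  rewrite mulrA cw0E sm mulrAC -expRD le_eqVlt; apply/orP; left; apply/eqP.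
  by congr (expR _ * _); rewrite gs_energy_add; ring.
rewrite isumZ; apply: ler_wpM2l; first by rewrite mulr_ge0 ?expR_ge0 ?exprn_ge0.
rewrite /Z /mass add0n /isum (@tsum_iota_le _ (p * n)) ?leq_mul2l ?nN ?orbT //.
move=> m sm; apply: contraNeq => nz; have := cweight_supp nz; rewrite add0n sm.
case: n sm {knN nN} => [/size0nil -> //|n] sm; apply: sub_all.
by move=> j /leq_ltn_trans; apply; rewrite ltn_mul2l p0 /=.
Qed.

Definition srt : seq (R * C) -> seq (R * C) := sort (relpre fst <=%R : rel (R * C)).

(** In the stretch between two cuts the correlations are given up: in sorted order, each particle
    keeps half of its Gaussian confinement to the root position [p * i]. *)
Definition g2 (k1 d : nat) (t : seq (R * C)) : R :=
  prod_zip [seq (fun s : R => expR (g * p%:R ^+ 2 * i%:R ^+ 2 - g / 2 * (s - (p * i)%:R) ^+ 2))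
     | i <- iota k1 d] (sort <=%R (map fst t)).

Lemma in_map_expR (r : seq nat) (F : nat -> R -> R) f x :
  List.In f [seq (fun s => expR (F i s)) | i <- r] -> 0 <= f x.
Proof.
elim: r => //= i r IH [<-|/IH //]; exact: expR_ge0.
Qed.

Lemma g2_ge0 k1 d t : 0 <= g2 k1 d t.
Proof. by apply: prod_zip_ge0 => f x; apply: in_map_expR. Qed.

Lemma g2_perm k1 d : perm_inv (g2 k1 d).
Proof.
move=> t t' tt; congr (prod_zip _ _); apply/perm_sortP.
- exact: le_total.
- exact: le_trans.
- exact: le_anti.
- exact: perm_map.
Qed.

Lemma theta_ge1 a : 0 < a -> 1 <= theta a.
Proof. by move=> a0; exact: le_trans (th_ge1 a 0) (th_le 0 a0). Qed.

Lemma gs_energy_nat n : gs_energy n = g * p%:R ^+ 2 * \sum_(0 <= i < n) i%:R ^+ 2.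
Proof. by rewrite ENE big_mkord. Qed.

Lemma isum_g2_le B N k1 k2 : (k1 <= k2)%N ->
  isum (grid (box B (p * N)) (p * N)) (k2 - k1) (g2 k1 (k2 - k1)) <=
  ((p * N)%:R * theta (g / 2)) ^+ (k2 - k1) * expR (gs_energy k2 - gs_energy k1).
Proof.
move=> k12; have g20 : 0 < g / 2 by rewrite divr_gt0.
set fs := [seq (fun s : R => expR (g * p%:R ^+ 2 * i%:R ^+ 2 - g / 2 * (s - (p * i)%:R) ^+ 2))
     | i <- iota k1 (k2 - k1)].
have sf : size fs = (k2 - k1)%N by rewrite size_map size_iota.
have := @isum_sorted_prod_zip_le (grid (box B (p * N)) (p * N)) fs (fun f x => @in_map_expR _ _ f x).
rewrite sf => /le_trans; apply; rewrite big_map -/(index_iota k1 k2).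
set M := (p * N)%N.
have H i : 0 <= \sum_(q <- grid (box B M) M)
     expR (g * p%:R ^+ 2 * i%:R ^+ 2 - g / 2 * (q.1 - (p * i)%:R) ^+ 2) <=
   M%:R * theta (g / 2) * expR (g * p%:R ^+ 2 * i%:R ^+ 2).
  rewrite sumr_ge0 /=; last by move=> q _; exact: expR_ge0.
  rewrite /grid big_allpairs_dep /=.
  rewrite (eq_bigr (fun s => (M%:R * expR (g * p%:R ^+ 2 * i%:R ^+ 2)) *
     expR (- (g / 2 * (s - (p * i)%:R) ^+ 2)))); last first.
    move=> s _; rewrite big_const_seq count_predT size_iota iter_addr_0 -[LHS]mulr_natl.
    by rewrite expRD mulrA.
  rewrite -mulr_sumr [leRHS]mulrAC; apply: ler_wpM2l; first by rewrite mulr_ge0 ?ler0n ?expR_ge0.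
  exact: le_trans (box_sum_le _ _ _ _) (th_le _ g20).
have /andP[_ A] := ler_prod_seq (index_iota k1 k2) H; apply: (le_trans A).
rewrite prod_const_seq size_iota expR_bigsum -mulr_sumr !gs_energy_nat.
rewrite (@big_cat_nat _ _ _ k1 0 k2) //= mulrDr [X in expR (X - _)]addrC addrK.
exact: lexx.
Qed.

(** Interactions inside the stretch and across the cuts are replaced by their bounds; the linear
    terms of these bounds complete the squares around the root positions. *)
Lemma plasma_split (q : nat -> R * C) N k1 k2 : (forall i, nc (q i).2 == 1) ->
  (k1 <= k2)%N -> (k2 <= N)%N ->
  g1 0 (map q (index_iota 0 N)) <=
  g1 0 (map q (index_iota 0 k1)) * g1 (p * k2) (map q (index_iota k2 N)) *
  expR (2 * p%:R * cross_energy g (fun i => (q i).1) 0 k1 k1 N + 2 * p%:R * cross_energy g (fun i => (q i).1) k1 k2 k2 N +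
    2 * p%:R * self_energy g (fun i => (q i).1) k1 k2 - g * (\sum_(k1 <= i < k2) ((q i).1 - (p * i)%:R) ^+ 2) +
    g * p%:R ^+ 2 * \sum_(k1 <= i < k2) i%:R ^+ 2).
Proof.
move=> uq k12 k2N; have k1N := leq_trans k12 k2N.
have spl a b c : (a <= b)%N -> (b <= c)%N -> index_iota a c = index_iota a b ++ index_iota b c.
  move=> ab bc; rewrite /index_iota (_ : c - a = (b - a) + (c - b))%N; last by lia.
  by rewrite iotaD subnKC.
set tq := fun a b => map (point_val g \o q) (index_iota a b).
have tqE a b : map (point_val g) (map q (index_iota a b)) = tq a b by rewrite -map_comp.
have V : nc (vdm p (tq 0%N N)) = nc (vdm p (tq 0%N k1)) * (nc (vdm p (tq k1 k2)) *
   nc (vdm p (tq k2 N)) * nc (cross p (tq k1 k2) (tq k2 N))) * nc (cross p (tq 0%N k1) (tq k1 N)).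
  rewrite /tq (spl 0%N k1 N) // map_cat vdm_cat !ComplexField.Normc.normcM.
  by rewrite (spl k1 k2 N) // map_cat vdm_cat !ComplexField.Normc.normcM.
have ex k a b : \prod_(z <- map q (index_iota a b)) (expR (- (g * z.1 ^+ 2)) * expR (2 * g * k * z.1)) =
   expR (- (g * (\sum_(a <= i < b) (q i).1 ^+ 2)) + 2 * g * k * (\sum_(a <= i < b) (q i).1)).
  rewrite big_map (eq_bigr (fun i => expR (- g * (q i).1 ^+ 2 + 2 * g * k * (q i).1))).
    by rewrite expR_bigsum big_split /= -!mulr_sumr mulNr.
  by move=> i _; rewrite expRD mulNr.
rewrite /g1 !tqE V !ex.
have H1 := @nc_cross_le R p g q uq 0 k1 k1 N (leq0n _).
have H2 := @nc_cross_le R p g q uq k1 k2 k2 N k12.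
have H3 := @nc_vdm_le R p g q uq k1 k2 k12.
rewrite -/(tq _ _) -/(tq _ _) subn0 in H1; rewrite -/(tq _ _) -/(tq _ _) in H2; rewrite -/(tq _ _) in H3.
have -> : \sum_(k1 <= i < k2) ((q i).1 - (p * i)%:R) ^+ 2 = \sum_(k1 <= i < k2) (q i).1 ^+ 2 -
   2 * p%:R * (\sum_(k1 <= i < k2) i%:R * (q i).1) + p%:R ^+ 2 * (\sum_(k1 <= i < k2) i%:R ^+ 2).
  rewrite !mulr_sumr -sumrB -big_split /=; apply: eq_bigr => i _; rewrite natrM; ring.
have Wb : \sum_(k1 <= i < k2) (i - k1)%:R * (q i).1 = \sum_(k1 <= i < k2) i%:R * (q i).1 -
   k1%:R * (\sum_(k1 <= i < k2) (q i).1).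
  rewrite mulr_sumr -sumrB big_nat [RHS]big_nat; apply: eq_bigr => i /andP[ki _].
  by rewrite natrB // mulrBl.
rewrite Wb in H3.
have c3 (f : nat -> R) : \sum_(0 <= i < N) f i = \sum_(0 <= i < k1) f i +
    (\sum_(k1 <= i < k2) f i + \sum_(k2 <= i < N) f i).
  by rewrite -big_cat_nat // -big_cat_nat.
have c2 (f : nat -> R) : \sum_(k1 <= i < N) f i = \sum_(k1 <= i < k2) f i + \sum_(k2 <= i < N) f i.
  by rewrite -big_cat_nat.
rewrite c2 in H1; rewrite !mulr0 !mul0r !addr0 c3 natrM.
rewrite (natrB _ k12) in H2.
move: H1 H2 H3; move: (nc_ge0 (vdm p (tq 0%N k1))) (nc_ge0 (vdm p (tq k1 k2))) (nc_ge0 (vdm p (tq k2 N)))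
  (nc_ge0 (cross p (tq 0%N k1) (tq k1 N))) (nc_ge0 (cross p (tq k1 k2) (tq k2 N))).
move: (nc (vdm p (tq 0%N k1))) (nc (vdm p (tq k1 k2))) (nc (vdm p (tq k2 N)))
  (nc (cross p (tq 0%N k1) (tq k1 N))) (nc (cross p (tq k1 k2) (tq k2 N))) => v1 v2 v3 x1 x2 v10 v20 v30 x10 x20.
move: (\sum_(0 <= i < k1) (q i).1 ^+ 2) (\sum_(k1 <= i < k2) (q i).1 ^+ 2)
  (\sum_(k2 <= i < N) (q i).1 ^+ 2) => S0 S1 S2.
move: (\sum_(k1 <= i < k2) (q i).1) (\sum_(k2 <= i < N) (q i).1)
  (\sum_(k1 <= i < k2) i%:R * (q i).1) (\sum_(k1 <= i < k2) i%:R ^+ 2) => A2 A3 I1 I2.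
move: (cross_energy _ _ _ _ _ _) (cross_energy _ _ _ _ _ _) (self_energy _ _ _ _) (p%:R : R) (k1%:R : R) (k2%:R : R).
move=> Q2 Q1 P1 P l1 l2 H1 H2 H3.
have H : v2 * x2 * x1 <= expR (P * (g * (I1 - l1 * A2) + P1)) *
    expR (P * (g * (l2 - l1) * A3 + Q2)) * expR (P * (g * l1 * (A2 + A3) + Q1)).
  by apply: ler_pM; rewrite ?mulr_ge0 //; apply: ler_pM.
have H' : (v2 * x2 * x1) ^+ 2 <= expR (P * (g * (I1 - l1 * A2) + P1) +
    P * (g * (l2 - l1) * A3 + Q2) + P * (g * l1 * (A2 + A3) + Q1)) ^+ 2.
  rewrite !expRD; apply: lerXn2r => //; rewrite nnegrE ?mulr_ge0 ?expR_ge0 //.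
rewrite -expRM_natl in H'.
apply: (@le_trans _ _ (expR (- (g * (S0 + (S1 + S2)))) * (v1 ^+ 2 * v3 ^+ 2) * (v2 * x2 * x1) ^+ 2)).
  by rewrite le_eqVlt; apply/orP; left; apply/eqP; ring.
apply: (le_trans (ler_wpM2l _ H')); first by rewrite !mulr_ge0 ?expR_ge0 ?exprn_ge0.
rewrite mulrAC -expRD le_eqVlt; apply/orP; left; apply/eqP.
rewrite [RHS](_ : _ = expR (- (g * S0)) * expR (- (g * S2) + 2 * g * (P * l2) * A3) *
  expR (2 * P * Q1 + 2 * P * Q2 + 2 * P * P1 - g * (S1 - 2 * P * I1 + P ^+ 2 * I2) +
     g * P ^+ 2 * I2) * (v1 ^+ 2 * v3 ^+ 2)); last by ring.
by rewrite -!expRD; congr (expR _ * _); ring.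
Qed.

Lemma Z_mono k n : (k <= n)%N -> Z k <= Z n.
Proof.
move=> kn; rewrite -(subnK kn) addnC; apply: le_trans (Z_superM _ p0 _ _).
by rewrite ler_peMr ?Z_ge0 // Z_ge1.
Qed.

Lemma half_sum1 k : \sum_(0 <= i < k.+1) 2^-1 ^+ (k - i) <= 2 :> R.
Proof.
elim: k => [|k IH]; first by rewrite big_nat1 subnn expr0; lra.
rewrite big_nat_recr //= subnn expr0.
rewrite big_nat (eq_bigr (fun i => 2^-1 * 2^-1 ^+ (k - i))) -?big_nat -?mulr_sumr.
  by move: IH; set S := \sum_(_ <= i < _) _; lra.
by move=> i /andP[_ ik]; rewrite -exprS -subSn.
Qed.

Lemma half_sum2 n : \sum_(0 <= i < n) 2^-1 ^+ i <= 2 :> R.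
Proof.
apply: le_trans (half_sum1 n); rewrite [leRHS]big_nat_rev /= add0n.
rewrite [leRHS](eq_big_nat _ _ (F2 := fun i => 2^-1 ^+ i)); last first.
  by move=> i /andP[_ ik]; congr (_ ^+ _); lia.
by apply: sum_nat_widen => // i; apply: exprn_ge0; lra.
Qed.

(** Handing the particles of the stretch to the two outer systems only increases the partition
    functions, so both sums become geometric. *)
Lemma half_sum k0 N : (k0 <= N)%N ->
  \sum_(0 <= k1 < k0.+1) \sum_(k0 <= k2 < N.+1) 2^-1 ^+ (k2 - k1) * (Z k1 * Z (N - k2)) <=
  4 * (Z k0 * Z (N - k0)).
Proof.
move=> kN; have h0 : 0 <= 2^-1 :> R by lra.
apply: (@le_trans _ _ (\sum_(0 <= k1 < k0.+1) \sum_(k0 <= k2 < N.+1)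
   2^-1 ^+ (k0 - k1) * (2^-1 ^+ (k2 - k0) * (Z k0 * Z (N - k0))))).
  rewrite big_nat [leRHS]big_nat; apply: ler_sum => k1 /andP[_ k1k].
  rewrite big_nat [leRHS]big_nat; apply: ler_sum => k2 /andP[k2k k2N].
  rewrite mulrA -exprD (_ : k0 - k1 + (k2 - k0) = k2 - k1)%N; last by lia.
  apply: ler_wpM2l; first exact: exprn_ge0.
  apply: ler_pM; rewrite ?Z_ge0 //; apply: Z_mono; lia.
have ZZ : 0 <= Z k0 * Z (N - k0) by rewrite mulr_ge0 ?Z_ge0.
under eq_bigr do rewrite -mulr_sumr -mulr_suml.
rewrite -mulr_suml.
have A := half_sum1 k0.
have B : \sum_(k0 <= k2 < N.+1) 2^-1 ^+ (k2 - k0) <= 2 :> R.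
  have := big_nat_shift (N.+1 - k0) k0 (fun i => 2^-1 ^+ (i - k0)).
  rewrite subnK; last by lia.
  move=> ->; under eq_bigr do rewrite addnK.
  exact: half_sum2.
rewrite mulrA; apply: ler_wpM2r => //.
apply: (@le_trans _ _ (2 * 2)); last by lra.
by apply: ler_pM => //; apply: sum_nat_ge0 => i; apply: exprn_ge0.
Qed.

Definition wt (b x : R) (m : seq nat) : R := expR (b * \sum_(j <- m) phi (j%:R - x)).

(** Orbitals are converted to grid points ([claim1]) because cutting requires positions. Each grid
    configuration is cut around rank [k0] ([claim2]), and the outer blocks are converted back to
    orbitals ([claim3]). The powers of [M] and [theta g] from the two conversions compensate each
    other up to [expR 1]. *)
Theorem plasma (b : R) : 0 <= b -> exists2 K : R, 0 < K & forall N x k0, (k0 <= N)%N ->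
  (k0 = 0%N \/ (p * k0)%:R <= x) -> (k0 = N \/ x <= (p * k0.+1)%:R) ->
  isum (iota 0 (p * N)) N (fun m => cweight [::] m * wt b x m) <=
  K * (\sum_(0 <= k1 < k0.+1) \sum_(k0 <= k2 < N.+1) 2^-1 ^+ (k2 - k1) * (Z k1 * Z (N - k2))).
Proof.
move=> b0; have g20 : 0 < g / 2 by rewrite divr_gt0.
have t1 := theta_ge1 g0; have t21 := theta_ge1 g20.
have t0 : 0 <= theta g by exact: le_trans ler01 t1.
pose b' := b * theta g.
have b'0 : 0 <= b' by rewrite mulr_ge0.
(* At this rate the gain [expR (- c)] per particle of the stretch absorbs its factor [theta (g / 2)]
   and leaves 1/2. *)
pose c := ln (2 * theta (g / 2)).
have c0 : 0 <= c by apply: ln_ge0; lra.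
have ec : expR (- c) * theta (g / 2) = 2^-1.
  rewrite expRN lnK ?posrE; last by lra.
  by field; rewrite gt_eqF //; lra.
have [K0 HK0] := cut_exists p0 g0 b'0 c0.
exists (expR K0 * expR 1); first by rewrite mulr_gt0 ?expR_gt0.
move=> N x k0 k0N xl xr; set M := (p * N)%N.
have [B hB] := th_near N g0.
set S := \sum_(0 <= k1 < k0.+1) _; set L := isum _ _ _.
pose F t := (\prod_(q <- t) (fun s => expR (- (g * s ^+ 2)) * expR (b * theta g * phi (s - x))) q.1) *
   nc (vdm p (map (point_val g) t)) ^+ 2.
have claim1 : M%:R ^+ N * th g B ^+ N * expR (gs_energy N) * L <= isum (grid (box B M) M) N F.
  rewrite /isum (eq_tsum _ (G := fun ps => (\prod_(q <- ps) (fun s => expR (- (g * s ^+ 2)) *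
     expR (b * theta g * phi (s - x))) q.1) * nc (mval g M N cf ps) ^+ 2)); last first.
    by move=> t st; rewrite /F mval_vdm.
  rewrite (parseval_real g (fun s => expR (- (g * s ^+ 2)) * expR (b * theta g * phi (s - x)))).
  rewrite -/(isum _ _ _) /L -isumZ; apply: le_isum_in => m sm mM.
  have H : \prod_(j <- m) (M%:R * th g B * expR (g * j%:R ^+ 2) * expR (b * phi (j%:R - x))) <=
     \prod_(j <- m) kapr g (fun s => expR (- (g * s ^+ 2)) * expR (b * theta g * phi (s - x))) (box B M) M j.
    rewrite big_seq [leRHS]big_seq; apply: ler_prod => j jm; apply/andP; split.
      by rewrite !mulr_ge0 ?expR_ge0 ?ler0n // (le_trans ler01) // th_ge1.
    by apply: kapr_ge => //; have := mM j jm; rewrite mem_iota => /andP[_ /ltnW].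
  apply: le_trans (ler_wpM2l _ H); last by rewrite exprn_ge0 ?nc_ge0.
  rewrite le_eqVlt; apply/orP; left; apply/eqP.
  rewrite (eq_bigr (fun j : nat => M%:R * th g B * (expR (g * j%:R ^+ 2) * expR (b * phi (j%:R - x))))); last first.
    by move=> j _; rewrite mulrA.
  rewrite prod_const_seq sm big_split /= !expR_bigsum -!mulr_sumr -/(ssq R m).
  rewrite /wt mulrCA; move: (cw0E m); rewrite sm => E.
  transitivity (M%:R ^+ N * th g B ^+ N * (expR (gs_energy N) * cweight [::] m) * expR (b * \sum_(j <- m) phi (j%:R - x))).
    by move: (expR (gs_energy N)) (cweight [::] m) => ? ?; ring.
  by rewrite -E exprMn; ring.
pose H k1 k2 t := expR (K0 - c * (k2 - k1)%:R) * (g1 0 (take k1 (srt t)) *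
   (g2 k1 (k2 - k1) (take (k2 - k1) (drop k1 (srt t))) * g1 (p * k2) (drop k2 (srt t)))).
have H0 k1 k2 t : 0 <= H k1 k2 t.
  exact: mulr_ge0 (expR_ge0 _) (mulr_ge0 (g1_ge0 _ _) (mulr_ge0 (g2_ge0 _ _ _) (g1_ge0 _ _))).
have srtP t : perm_eq (srt t) t by rewrite perm_sort.
have claim2 t : size t = N -> {subset t <= grid (box B M) M} ->
   F t <= \sum_(0 <= k1 < k0.+1) \sum_(k0 <= k2 < N.+1) H k1 k2 t.
  move=> st tg; pose q i := nth (0, 1) (srt t) i.
  have szT : size (srt t) = N by rewrite (perm_size (srtP t)).
  have uq i : nc (q i).2 == 1.
    rewrite /q; have [iN|iN] := ltnP i (size (srt t)).
      have := mem_nth (0, 1) iN; rewrite (perm_mem (srtP t)) => /tg; exact: grid_unit.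
    by rewrite nth_default //; apply/eqP; exact: ComplexField.Normc.normc1.
  have so : sorted (relpre fst <=%R : rel (R * C)) (srt t).
    by apply: sort_sorted => y z; apply: le_total.
  have tr : transitive (relpre fst <=%R : rel (R * C)) by move=> y z w /=; apply: le_trans.
  have qs i j : (i <= j)%N -> (j < N)%N -> (q i).1 <= (q j).1.
    move=> ij jN; have := sorted_leq_nth tr _ (0, 1) so; apply; rewrite ?inE ?szT //.
    - by move=> y /=.
    - exact: leq_ltn_trans jN.
  have sl a d : (a <= d)%N -> (d <= N)%N -> map q (index_iota a d) = take (d - a) (drop a (srt t)).
    by move=> ad dN; rewrite /index_iota /q map_nth_iota // szT leq_sub2r.
  have TE : map q (index_iota 0 N) = srt t by rewrite sl // subn0 drop0 take_oversize // szT.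
  have [k1 [k2 [k1k k2k k2N HH]]] := HK0 N (fun i => (q i).1) k0 x k0N qs xl xr.
  have k12 := leq_trans k1k k2k.
  have FE : F t = g1 0 (srt t) * expR (b' * \sum_(0 <= i < N) phi ((q i).1 - x)).
    have -> : F t = F (srt t).
      rewrite /F; congr (_ * _ ^+ 2); first by apply: perm_big; rewrite perm_sym.
      by apply: nc_vdm_perm; apply: perm_map; rewrite perm_sym.
    rewrite /F /g1 big_split /= mulrAC; congr (_ * _ * _).
      by apply: eq_bigr => z _; rewrite mulr0 mul0r expR0 mulr1.
    by rewrite expR_bigsum -mulr_sumr -TE big_map.
  have HB : F t <= H k1 k2 t.
    rewrite FE -TE; apply: (le_trans (ler_wpM2r (expR_ge0 _) (plasma_split uq k12 k2N))).
    rewrite -[leLHS]mulrA -expRD /H.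
    have -> : take k1 (srt t) = map q (index_iota 0 k1) by rewrite sl ?subn0 ?drop0 // (leq_trans k12).
    rewrite -(sl k1 k2) //.
    have -> : drop k2 (srt t) = map q (index_iota k2 N).
      by rewrite sl // take_oversize // size_drop szT.
    rewrite [leRHS]mulrCA -[leLHS]mulrA; apply: ler_wpM2l; first exact: g1_ge0.
    rewrite [leRHS]mulrA [leRHS]mulrC; apply: ler_wpM2l; first exact: g1_ge0.
    have -> : g2 k1 (k2 - k1) (map q (index_iota k1 k2)) =
       expR (g * p%:R ^+ 2 * (\sum_(k1 <= i < k2) i%:R ^+ 2) -
         g / 2 * \sum_(k1 <= i < k2) ((q i).1 - (p * i)%:R) ^+ 2).
      rewrite /g2 sort_map sorted_sort //; last first.
        by rewrite sl // take_sorted // drop_sorted.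
      rewrite -map_comp -/(index_iota k1 k2) !mulr_sumr -sumrB -expR_bigsum.
      by elim: (index_iota k1 k2) => [|i r IH] /=; rewrite ?big_nil // big_cons IH.
    rewrite -expRD ler_expR; move: HH; rewrite /phi.
    move: (\sum_(0 <= i < N) _) (\sum_(k1 <= i < k2) _ ^+ 2) (\sum_(k1 <= i < k2) _ ^+ 2) => a1 a2 a3.
    move: (cross_energy _ _ _ _ _ _) (cross_energy _ _ _ _ _ _) (self_energy _ _ _ _) (c * _) => a4 a5 a6 a7; clear; lra.
  apply: (le_trans HB).
  apply: (@le_trans _ _ (\sum_(k0 <= k2 < N.+1) H k1 k2 t)).
    rewrite (bigD1_seq k2) ?iota_uniq ?mem_index_iota ?k2k //= lerDl; exact: sumr_ge0.
  rewrite [leRHS](bigD1_seq k1) ?iota_uniq ?mem_index_iota //= lerDl.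
  by apply: sumr_ge0 => i _; apply: sumr_ge0.
have claim3 : isum (grid (box B M) M) N F <= expR K0 * (M%:R ^+ N * theta g ^+ N) * expR (gs_energy N) * S.
  apply: (le_trans (le_isum_in claim2)); rewrite isum_sum /S mulr_sumr.
  rewrite big_nat [leRHS]big_nat; apply: ler_sum => k1 /andP[_ k1k].
  rewrite isum_sum mulr_sumr.
  rewrite big_nat [leRHS]big_nat; apply: ler_sum => k2 /andP[k2k k2N].
  have k12 : (k1 <= k2 <= N)%N by clear -k1k k2k k2N; lia.
  rewrite /H isumZ.
  have A := @isum_cut3_le _ _ (grid (box B M) M) N k1 k2 srt _ _ _ _ k12 srtP
    (g1_ge0 0) (g2_ge0 k1 (k2 - k1)) (g1_ge0 (p * k2)) (g1_perm 0) (@g2_perm k1 (k2 - k1)) (g1_perm (p * k2))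
    (fun t _ _ => lexx _).
  apply: (le_trans (ler_wpM2l (expR_ge0 _) A)).
  have B1 : isum (grid (box B M) M) k1 (g1 0) <= (M%:R * theta g) ^+ k1 * expR (gs_energy k1) * Z k1.
    have k1N : (k1 <= N)%N by clear -k12; lia.
    have := @isum_g1_le B N 0 k1; rewrite add0n muln0 => /(_ k1N) /le_trans; apply.
    by rewrite [gs_energy 0]ENE big_ord0 mulr0 subr0.
  have B2 := @isum_g2_le B N k1 k2 (proj1 (andP k12)).
  have B3 : isum (grid (box B M) M) (N - k2) (g1 (p * k2)) <=
     (M%:R * theta g) ^+ (N - k2) * expR (gs_energy N - gs_energy k2) * Z (N - k2).
    by have := @isum_g1_le B N k2 (N - k2); rewrite subnKC //; apply.
  have i0 n k : 0 <= isum (grid (box B M) M) n (g1 k) by apply: isum_ge0 => t _; apply: g1_ge0.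
  have i20 : 0 <= isum (grid (box B M) M) (k2 - k1) (g2 k1 (k2 - k1)).
    by apply: isum_ge0 => t _; apply: g2_ge0.
  apply: (@le_trans _ _ (expR (K0 - c * (k2 - k1)%:R) * ((M%:R * theta g) ^+ k1 * expR (gs_energy k1) * Z k1 *
    ((M%:R * theta (g / 2)) ^+ (k2 - k1) * expR (gs_energy k2 - gs_energy k1) *
    ((M%:R * theta g) ^+ (N - k2) * expR (gs_energy N - gs_energy k2) * Z (N - k2)))))).
    apply: ler_wpM2l; first exact: expR_ge0.
    apply: ler_pM => //; first by rewrite mulr_ge0.
    by apply: ler_pM.
  have -> : expR (K0 - c * (k2 - k1)%:R) = expR K0 * expR (- c) ^+ (k2 - k1).
    by rewrite -expRM_natl -expRD; congr expR; ring.
  rewrite !exprMn !expRB.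
  have e1 := expR_gt0 (gs_energy k1); have e2 := expR_gt0 (gs_energy k2).
  have -> : M%:R ^+ N = M%:R ^+ k1 * M%:R ^+ (k2 - k1) * M%:R ^+ (N - k2) :> R.
    by rewrite -!exprD; congr (_ ^+ _); clear -k12; lia.
  have h2 : expR (- c) ^+ (k2 - k1) * theta (g / 2) ^+ (k2 - k1) = 2^-1 ^+ (k2 - k1).
    by rewrite -exprMn ec.
  have tN : theta g ^+ k1 * theta g ^+ (N - k2) <= theta g ^+ N.
    by rewrite -exprD; apply: ler_weXn2l => //; clear -k12; lia.
  rewrite -h2.
  apply: (@le_trans _ _ (theta g ^+ k1 * theta g ^+ (N - k2) * (expR K0 *
     (M%:R ^+ k1 * M%:R ^+ (k2 - k1) * M%:R ^+ (N - k2)) * expR (gs_energy N) *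
     (expR (- c) ^+ (k2 - k1) * theta (g / 2) ^+ (k2 - k1) * (Z k1 * Z (N - k2)))))).
    rewrite le_eqVlt; apply/orP; left; apply/eqP.
    move: (expR (gs_energy k1)) (expR (gs_energy k2)) e1 e2 => y1 y2 e1 e2; field.
    by rewrite !gt_eqF.
  apply: (le_trans (ler_wpM2r _ tN)).
    have ZZ := mulr_ge0 (Z_ge0 p g k1) (Z_ge0 p g (N - k2)).
    rewrite h2 -!exprD; apply: mulr_ge0; last by rewrite mulr_ge0 // exprn_ge0.
    by rewrite !mulr_ge0 ?expR_ge0 ?exprn_ge0 ?ler0n.
  by rewrite le_eqVlt; apply/orP; left; apply/eqP; ring.
have MN0 : 0 < M%:R ^+ N :> R.
  rewrite /M; case: (N) => [|N']; first by rewrite expr0.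
  by rewrite exprn_gt0 // ltr0n muln_gt0 p0.
have th0 : 0 < th g B ^+ N by rewrite exprn_gt0 // (lt_le_trans ltr01) // th_ge1.
have S0 : 0 <= S.
  apply: sum_nat_ge0 => i; apply: sum_nat_ge0 => j; apply: mulr_ge0; first exact: exprn_ge0.
  exact: mulr_ge0 (Z_ge0 p g i) (Z_ge0 p g (N - j)).
have grid_pos : 0 < M%:R ^+ N * th g B ^+ N * expR (gs_energy N) by rewrite !mulr_gt0 ?expR_gt0.
rewrite -(ler_pM2l grid_pos); apply: (le_trans claim1); apply: (le_trans claim3).
apply: (@le_trans _ _ (expR K0 * M%:R ^+ N * expR (gs_energy N) * S * theta g ^+ N)).
  by rewrite le_eqVlt; apply/orP; left; apply/eqP; ring.
apply: (le_trans (ler_wpM2l _ hB)); first by rewrite !mulr_ge0 ?expR_ge0 ?(ltW MN0).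
by rewrite le_eqVlt; apply/orP; left; apply/eqP; ring.
Qed.

Corollary exp_moment (b : R) : 0 <= b -> exists2 K : R, 0 < K & forall N x,
  isum (iota 0 (p * N)) N (fun m => cweight [::] m * wt b x m) <= K * Z N.
Proof.
move=> b0; have [K K0 HK] := plasma b0; exists (K * 4); first by rewrite mulr_gt0.
move=> N x; have fin k0 : (k0 <= N)%N ->
  (k0 = 0%N \/ (p * k0)%:R <= x) -> (k0 = N \/ x <= (p * k0.+1)%:R) ->
  isum (iota 0 (p * N)) N (fun m => cweight [::] m * wt b x m) <= K * 4 * Z N.
  move=> k0N xl xr; apply: (le_trans (HK N x k0 k0N xl xr)).
  rewrite -mulrA ler_pM2l //; apply: (le_trans (half_sum k0N)).
  rewrite ler_pM2l // -{2}(subnKC k0N); exact: Z_superM.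
have P0 : 0 < p%:R :> R by rewrite ltr0n.
have [x0|x0] := ltP x 0.
  by apply: (fin 0%N) => //; [left | right; rewrite (le_trans (ltW x0)) // ler0n].
have [xN|xN] := leP (p * N)%:R x; first by apply: (fin N) => //; [right | left].
have xp0 : 0 <= x / p%:R by rewrite divr_ge0 // ltW.
(* The number of periods to the left of [x]: the rank that a particle at [x] would have in the root
   configuration. *)
pose k0 := Num.truncn (x / p%:R).
have /andP[A B] : k0%:R <= x / p%:R < k0.+1%:R by exact: truncn_itv.
move: A B; rewrite ler_pdivlMr // ltr_pdivrMr // => A B.
apply: (fin k0).
- rewrite leqNgt; apply/negP => Nk; suff : (p * N)%:R <= x by rewrite leNgt xN.
  by apply: le_trans A; rewrite natrM mulrC ler_pM2r // ler_nat ltnW.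
- by right; rewrite natrM mulrC.
- by right; rewrite natrM mulrC ltW.
Qed.

(** The moment bound with [b = 0], where the weight is 1, cutting around rank [k]. *)
Corollary Z_subM : exists2 K : R, 0 < K & forall k n, Z (k + n) <= K * (Z k * Z n).
Proof.
have [K K0 HK] := plasma (lexx 0); exists (K * 4); first by rewrite mulr_gt0.
move=> k n; have := HK (k + n)%N (p * k)%:R k (leq_addr _ _) (or_intror (lexx _)).
have -> : isum (iota 0 (p * (k + n))) (k + n) (fun m => cweight [::] m * wt 0 (p * k)%:R m) = Z (k + n).
  by apply: eq_isum => m _; rewrite /wt mul0r expR0 mulr1.
move=> H; apply: (le_trans (H _)); first by right; rewrite ler_nat leq_mul2l leqnSn orbT.
rewrite -mulrA ler_pM2l //; apply: (le_trans (half_sum (leq_addr _ _))).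
by rewrite addKn.
Qed.

End PlasmaBound2.

(** * Renewal theory *)

Section RenewalTheory.
Variables (R : realType) (z a : nat -> R) (K : R).
Hypotheses (z0 : z 0 = 1) (z1 : forall n, 1 <= z n).
Hypothesis zsup : forall k n, z k * z n <= z (k + n)%N.
Hypothesis K0 : 0 < K.
Hypothesis zsub : forall k n, z (k + n)%N <= K * (z k * z n).
Hypotheses (a0 : forall j, 0 <= a j) (a1 : 0 < a 1).
Hypothesis ren : forall N, (0 < N)%N -> z N = \sum_(j < N) a j.+1 * z (N - j.+1)%N.

Let zgt0 n : 0 < z n. Proof. exact: lt_le_trans ltr01 (z1 n). Qed.

Lemma z_powl M N : z M ^+ N <= z (N * M)%N.
Proof.
elim: N => [|N IH]; first by rewrite expr0 mul0n z0.
rewrite exprS mulSn; apply: le_trans (zsup _ _).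
by rewrite ler_pM2l.
Qed.

Lemma z_powr N M : z (M * N)%N <= (K * z N) ^+ M.
Proof.
elim: M => [|M IH]; first by rewrite expr0 mul0n z0.
rewrite exprS mulSn; apply: (le_trans (zsub _ _)).
by rewrite mulrA ler_pM2l // mulr_gt0.
Qed.

Lemma ln_ratio_le M N : (0 < M)%N -> (0 < N)%N ->
  ln (z M) / M%:R <= ln (K * z N) / N%:R.
Proof.
move=> M0 N0; have M0' : 0 < M%:R :> R by rewrite ltr0n.
have N0' : 0 < N%:R :> R by rewrite ltr0n.
rewrite ler_pdivrMr // mulrAC ler_pdivlMr //.
have H : z M ^+ N <= (K * z N) ^+ M.
  by apply: (le_trans (z_powl M N)); rewrite mulnC z_powr.
have : ln (z M ^+ N) <= ln ((K * z N) ^+ M).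
  by rewrite ler_ln // posrE exprn_gt0 // mulr_gt0.
rewrite !lnXn ?mulr_gt0 //.
by rewrite -(mulr_natr (ln (z M)) N) -(mulr_natr (ln (K * z N)) M).
Qed.

(** Fekete's argument: supermultiplicativity, and submultiplicativity up to [K], squeeze
    [ln (z N) / N] against its supremum. *)
Lemma growth : exists lam : R, forall N, z N <= expR (lam * N%:R) <= K * z N.
Proof.
pose E := [set ln (z M.+1) / M.+1%:R | M in [set: nat]]%classic.
have Es : has_sup E.
  split; first by exists (ln (z 1) / 1%:R); exists 0%N.
  by exists (ln (K * z 1) / 1%:R) => _ [M _ <-]; apply: ln_ratio_le.
exists (sup E) => -[|N].
  rewrite mulr0 expR0 z0 lexx /= mulr1 -[1]mulr1.
  by have := zsub 0 0; rewrite addn0 z0 !mulr1.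
have N0 : 0 < N.+1%:R :> R by rewrite ltr0n.
have zN : z N.+1 = expR (ln (z N.+1)) by rewrite lnK // posrE.
have KzN : K * z N.+1 = expR (ln (K * z N.+1)) by rewrite lnK // posrE mulr_gt0.
rewrite {1}zN KzN !ler_expR; apply/andP; split.
  by rewrite -ler_pdivrMr //; apply: (ub_le_sup Es.2); exists N.
rewrite -ler_pdivlMr //; apply: ge_sup; first exact: Es.1.
by move=> _ [M _ <-]; apply: ln_ratio_le.
Qed.

Variable lam : R.
Hypothesis lamP : forall N, z N <= expR (lam * N%:R) <= K * z N.

(** Normalization by the growth rate: [rf] becomes the law of a step, [ru] the renewal probability
    and [rt] the tail of the step. *)
Definition ru N := z N * expR (- (lam * N%:R)).
Definition rf j := a j * expR (- (lam * j%:R)).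
Definition rt i := 1 - \sum_(j < i) rf j.+1.

Lemma ru_le1 N : ru N <= 1.
Proof.
have /andP[A _] := lamP N; rewrite /ru expRN.
by rewrite ler_pdivrMr ?expR_gt0 // mul1r.
Qed.

Lemma ru_ge N : K^-1 <= ru N.
Proof.
have /andP[_ A] := lamP N; rewrite /ru expRN.
by rewrite ler_pdivlMr ?expR_gt0 // ler_pdivrMl.
Qed.

Lemma ru_gt0 N : 0 < ru N. Proof. by rewrite mulr_gt0 ?expR_gt0. Qed.

Lemma rf_ge0 j : 0 <= rf j. Proof. by rewrite mulr_ge0 ?expR_ge0. Qed.

Lemma ru_ren N : (0 < N)%N -> ru N = \sum_(j < N) rf j.+1 * ru (N - j.+1).
Proof.
move=> N0; rewrite /ru ren // mulr_suml; apply: eq_bigr => j _.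
rewrite /rf -!mulrA; congr (_ * _); rewrite mulrCA; congr (_ * _); rewrite -expRD.
by congr expR; rewrite natrB //; ring.
Qed.

Lemma rtS i : rt i.+1 = rt i - rf i.+1.
Proof. by rewrite /rt big_ord_recr /= opprD addrA. Qed.

Lemma rt_anti i j : (i <= j)%N -> rt j <= rt i.
Proof.
move=> ij; rewrite -(subnK ij); elim: (j - i)%N => [|k IH] //.
by rewrite addSn rtS (le_trans _ IH) // gerBl rf_ge0.
Qed.

Lemma rt_le1 i : rt i <= 1.
Proof. by rewrite (le_trans (rt_anti (leq0n i))) // /rt big_ord0 subr0. Qed.

(** The sum is conserved from [N] to [N + 1]. For [w = ru] it expresses that the last renewal point
    up to [N] lies at some distance [i] from [N]. *)
Lemma rt_conv (w : nat -> R) :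
  (forall N, (0 < N)%N -> w N = \sum_(j < N) rf j.+1 * w (N - j.+1)%N) ->
  forall N, \sum_(i < N.+1) rt i * w (N - i)%N = w 0%N.
Proof.
move=> wr; elim=> [|N IH]; first by rewrite big_ord1 /rt big_ord0 subr0 mul1r.
rewrite big_ord_recl {1}/rt big_ord0 !subr0 mul1r [w N.+1]wr //.
rewrite -IH -big_split /=; apply: eq_bigr => i _.
rewrite /bump /= add1n subSS rtS; ring.
Qed.

Let ru_conv N : \sum_(i < N.+1) rt i * ru (N - i) = 1.
Proof. by rewrite (rt_conv ru_ren) /ru z0 mulr0 oppr0 expR0 mulr1. Qed.

(** If [rt i] were negative, all later tails would be at most that, and with [ru] at least [1/K] the
    conserved sum would tend to minus infinity instead of being 1. *)
Lemma rt_ge0 i : 0 <= rt i.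
Proof.
rewrite leNgt; apply/negP => ti0.
have e0 : 0 < - rt i / K by rewrite divr_gt0 // oppr_gt0.
pose m := Num.truncn (i%:R / (- rt i / K)).
have mP : i%:R / (- rt i / K) < m.+1%:R by exact: truncnS_gt.
have := ru_conv (i + m.+1).
rewrite -(big_mkord xpredT (fun j => rt j * ru (i + m.+1 - j))) /=.
rewrite (@big_cat_nat _ _ _ i) //=; last by rewrite (leq_trans (leq_addr m.+1 i)).
have A : \sum_(0 <= j < i) rt j * ru (i + m.+1 - j) <= i%:R.
  apply: (@le_trans _ _ (\sum_(0 <= j < i) 1)); last by rewrite sumr_const_nat subn0.
  apply: ler_sum => j _; have u0 := ru_gt0 (i + m.+1 - j); have u1 := ru_le1 (i + m.+1 - j).
  have [t0|t0] := leP 0 (rt j); first by have := rt_le1 j; nra.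
  by nra.
have B : \sum_(i <= j < (i + m.+1).+1) rt j * ru (i + m.+1 - j) <= - (m.+2%:R * (- rt i / K)).
  apply: (@le_trans _ _ (\sum_(i <= j < (i + m.+1).+1) - (- rt i / K))); last first.
    by rewrite sumr_const_nat -addnS addKn -[leLHS]mulr_natl mulrN.
  rewrite big_nat [leRHS]big_nat; apply: ler_sum => j /andP[ij _].
  have tj := rt_anti ij; have := ru_ge (i + m.+1 - j); have := K0.
  move: (rt j) (rt i) (rt_anti ij) ti0 (ru _) => x y xy y0 v K0' Kv.
  have Ki : 0 < K^-1 by rewrite invr_gt0.
  by move: Ki Kv; move: K^-1 => k Ki Kv; nra.
move=> E; move: mP; rewrite ltr_pdivrMr // => mP.
have : m.+1%:R * (- rt i / K) <= m.+2%:R * (- rt i / K) by rewrite ler_pM2r // ler_nat.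
by move: A B E mP; move: (\sum_(_ <= _ < _) _) (\sum_(_ <= _ < _) _) => X Y; lra.
Qed.

(** The mean step is finite, by the conserved sum and [ru] being at least [1/K]. *)
Lemma rt_sum N : \sum_(i < N) rt i <= K.
Proof.
case: N => [|N]; first by rewrite big_ord0 ltW.
rewrite -[leRHS]mulr1 -(ru_conv N) mulr_sumr; apply: ler_sum => i _.
have := ru_ge (N - i); have := rt_ge0 i; move: (rt i) (ru _) => x v x0.
by rewrite -[K^-1]mulr1 ler_pdivrMl // => Kv; rewrite mulrCA ler_peMr.
Qed.

Lemma rt_tail (eps : R) : 0 < eps -> exists D, forall n, \sum_(D <= i < n) rt i <= eps.
Proof.
move=> e0; pose E := [set \sum_(i < n) rt i | n in [set: nat]]%classic.
have Es : has_sup E.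
  split; first by exists (\sum_(i < 0) rt i); exists 0%N.
  by exists K => _ [M _ <-]; apply: rt_sum.
have [_ [D _ <-] HD] := sup_adherent e0 Es; exists D => n.
have [nD|Dn] := leqP n D; first by rewrite big_geq // ltW.
have : \sum_(i < n) rt i <= sup E by apply: (ub_le_sup Es.2); exists n.
rewrite -!(big_mkord xpredT rt) /= in HD *.
rewrite (@big_cat_nat _ _ _ D) //=; last exact: ltnW.
move: HD; move: (\sum_(0 <= _ < D) _) (\sum_(D <= _ < _) _) (sup E) => ? ? ?; lra.
Qed.

Lemma rt_cvg0 (eps : R) : 0 < eps -> exists D, forall n, (D <= n)%N -> rt n <= eps.
Proof.
move=> e0; have [D HD] := rt_tail e0; exists D => n Dn.
by have := HD n.+1; rewrite big_nat_recr //=; apply: le_trans; rewrite lerDr; apply: sumr_ge0 => i _; apply: rt_ge0.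
Qed.

Lemma rf_sum n m : (n <= m)%N -> \sum_(n <= j < m) rf j.+1 = rt n - rt m.
Proof.
move=> nm; rewrite -(subnK nm); elim: (m - n)%N => [|k IH].
  by rewrite add0n big_geq // subrr.
by rewrite addSn big_nat_recr ?leq_addl //= IH rtS; ring.
Qed.

(** The left side is the weight of having no renewal in the first [i] places, which forces a first
    step longer than [i]. *)
Lemma renewal_gap n i : (i < n)%N ->
  ru n - \sum_(j < i) rf j.+1 * ru (n - j.+1) <= rt i.
Proof.
move=> iN; rewrite ru_ren ?(leq_ltn_trans _ iN) //.
rewrite -!(big_mkord xpredT (fun j => rf j.+1 * ru (n - j.+1))) /=.
rewrite (@big_cat_nat _ _ _ i) //=; last exact: ltnW.
rewrite [X in X - _]addrC addrK.
apply: (@le_trans _ _ (\sum_(i <= j < n) rf j.+1)).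
  by apply: ler_sum => j _; rewrite ler_piMr ?rf_ge0 ?ru_le1.
by rewrite rf_sum ?(ltnW iN) // gerBl rt_ge0.
Qed.

Section Limsup.
Variable w : nat -> R.
Hypothesis wr : forall N, (0 < N)%N -> w N = \sum_(j < N) rf j.+1 * w (N - j.+1)%N.
Hypothesis w1 : forall N, `|w N| <= 1.

Lemma limsup_ex : exists M : R, (forall e, 0 < e -> exists n0, forall n, (n0 <= n)%N -> w n <= M + e) /\
  (forall e n0, 0 < e -> exists2 n, (n0 <= n)%N & M - e <= w n).
Proof.
pose E := [set x : R | forall n0, exists2 n, (n0 <= n)%N & x <= w n]%classic.
have Es : has_sup E.
  split; first by exists (-1) => n0; exists n0 => //; have := w1 n0; rewrite ler_norml => /andP[].
  by exists 1 => x /(_ 0%N) [n _ /le_trans]; apply; have := w1 n; rewrite ler_norml => /andP[].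
exists (sup E); split=> [e e0|e n0 e0].
  apply: contrapT => H; have : E (sup E + e).
    move=> n0; apply: contrapT => H'; apply: H; exists n0 => n nn.
    rewrite leNgt; apply/negP => /ltW A; apply: H'; exists n => //.
  move=> /(ub_le_sup Es.2); lra.
have [x Ex xe] := sup_adherent e0 Es; have [n nn xw] := Ex n0.
by exists n => //; exact: le_trans (ltW xe) xw.
Qed.

Variable M : R.
Hypothesis Mup : forall e, 0 < e -> exists n0, forall n, (n0 <= n)%N -> w n <= M + e.
Hypothesis Mfr : forall e n0, 0 < e -> exists2 n, (n0 <= n)%N & M - e <= w n.

Let f1 : 0 < rf 1. Proof. by rewrite mulr_gt0 ?expR_gt0. Qed.

(** [w n.+1] is an average of earlier values, nearly all at most [M + d], in which [w n] has the
    fixed weight [rf 1]; an average close to [M] then forces [w n] up. *)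
Lemma limsup_step (e : R) : 0 < e -> exists2 d, 0 < d & exists n1, forall n, (n1 <= n)%N ->
  M - d <= w n.+1 -> M - e <= w n.
Proof.
move=> e0; pose d := e * rf 1 / 8.
have d0 : 0 < d by rewrite divr_gt0 // mulr_gt0.
have dE : e * rf 1 = 8 * d by rewrite /d; field.
clearbody d.
have M1 : `|M| <= 1.
  rewrite ler_norml; apply/andP; split; apply/ler_addgt0Pr => e' e'0.
    by have [n0 /(_ n0 (leqnn _))] := Mup e'0; have := w1 n0; rewrite ler_norml => /andP[]; lra.
  by have [n _] := Mfr 0 e'0; have := w1 n; rewrite ler_norml => /andP[]; lra.
exists d => //; have [n0 Hn0] := Mup d0; have [D HD] := rt_cvg0 d0.
exists (n0 + D)%N => n nn; rewrite wr // big_ord_recl /= subn1 /=.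
set S := \sum_(i < n) _.
suff HS : S <= M * (1 - rf 1) + 3 * d.
  move=> A; have : rf 1 * (M - e) <= rf 1 * w n by move: A HS dE d0; clearbody S; move: (w n) (rf 1) => ? ?; lra.
  by rewrite ler_pM2l.
rewrite /S -(big_mkord xpredT (fun j => rf (bump 0 j).+1 * w (n.+1 - (bump 0 j).+1)%N)) /=.
have nB : (n - n0 <= n)%N by exact: leq_subr.
rewrite (@big_cat_nat _ _ _ (n - n0)) //=.
have A1 : \sum_(0 <= j < n - n0) rf (bump 0 j).+1 * w (n.+1 - (bump 0 j).+1)%N <=
   (M + d) * (rt 1 - rt (n - n0).+1).
  rewrite -rf_sum // big_add1 /= mulr_sumr big_nat [leRHS]big_nat; apply: ler_sum => j /andP[_ jn].
  by rewrite mulrC; apply: ler_wpM2r; rewrite ?rf_ge0 // Hn0 // /bump; lia.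
have A2 : \sum_(n - n0 <= j < n) rf (bump 0 j).+1 * w (n.+1 - (bump 0 j).+1)%N <= d.
  apply: (@le_trans _ _ (\sum_(n - n0 <= j < n) rf j.+2)).
    apply: ler_sum => j _; rewrite ler_piMr ?rf_ge0 //; have := w1 (n.+1 - (bump 0 j).+1).
    by rewrite ler_norml => /andP[].
  have := @rf_sum (n - n0).+1 n.+1; rewrite ltnS nB => /(_ isT); rewrite big_add1 /= => ->.
  have := HD (n - n0).+1; have := rt_ge0 n.+1.
  by move=> t0 Hd; have : rt (n - n0).+1 <= d by [apply: Hd; lia]; lra.
have t1 : rt 1 = 1 - rf 1 by rewrite /rt big_ord1.
have tn : rt (n - n0).+1 <= d by apply: HD; lia.
have tn0 := rt_ge0 (n - n0).+1; have t10 := rt_ge0 1.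
apply: (le_trans (lerD A1 A2)); rewrite t1 in t10 *.
move: M1; rewrite ler_norml => /andP[Ma Mb].
move: (rt _) tn tn0 => x xd x0; move: (rf 1) f1 t10 => y y0 y1.
suff : d * (1 - y) + (- M) * x + (- (d * x)) <= 2 * d by lra.
have : d * (1 - y) <= d by nra.
have : (- M) * x <= d by nra.
have : 0 <= d * x by rewrite mulr_ge0 // ltW.
lra.
Qed.

Lemma limsup_iter (I : nat) (e : R) : 0 < e -> exists2 d, 0 < d & exists n1, forall n, (n1 <= n)%N ->
  M - d <= w (n + I)%N -> forall i, (i <= I)%N -> M - e <= w (n + I - i)%N.
Proof.
move=> e0; elim: I => [|I [d d0 [n1 H]]].
  by exists e => //; exists 0%N => n _ A i; rewrite leqn0 => /eqP ->; rewrite subn0.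
have [d' d'0 [n2 H2]] := limsup_step d0.
exists (Num.min d' e); first by rewrite lt_min d'0 e0.
exists (n1 + n2)%N => n nn A [|i] iI.
  by rewrite subn0 (le_trans _ A) // lerB // ge_min lexx orbT.
have B : M - d <= w (n + I)%N.
  by apply: H2; [lia | rewrite -addnS (le_trans _ A) // lerB // ge_min lexx].
by rewrite addnS subSS; apply: H => //; lia.
Qed.

(** Where [w] nearly attains its limsup, so do the [D] preceding values. Inserted in the conserved
    sum of [rt_conv], this leaves [M] times the mean step. *)
Lemma limsup_le (mu : R) : (forall n, \sum_(i < n) rt i <= mu) ->
  (forall e, 0 < e -> exists D, forall n, (D <= n)%N -> mu - e <= \sum_(i < n) rt i) ->
  M * mu <= w 0%N.
Proof.
move=> mu1 mu2; apply/ler_addgt0Pr => e e0.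
have mu0 : 0 <= mu by have := mu1 0%N; rewrite big_ord0.
pose d := e / (mu + 3).
have d0 : 0 < d by rewrite divr_gt0 //; lra.
have [D HD] := mu2 d d0; have [d' d'0 [n1 H]] := limsup_iter D d0.
have [n nn Hn] := Mfr (n1 + D) d'0.
have nE : n = (n - D + D)%N by lia.
have := rt_conv wr n; rewrite -(big_mkord xpredT (fun i => rt i * w (n - i)%N)) /=.
rewrite (@big_cat_nat _ _ _ D) //=; last by lia.
move=> E; rewrite -E.
have A1 : (M - d) * \sum_(i < D) rt i <= \sum_(0 <= i < D) rt i * w (n - i)%N.
  rewrite -(big_mkord xpredT rt) mulr_sumr big_nat [leRHS]big_nat; apply: ler_sum => i /andP[_ iD].
  rewrite mulrC; apply: ler_wpM2l; first exact: rt_ge0.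
  by rewrite nE; apply: H; [clear -nn; lia | rewrite -nE | exact: ltnW].
have A2 : - d <= \sum_(D <= i < n.+1) rt i * w (n - i)%N.
  have B := mu1 n.+1; have B2 := HD D (leqnn _).
  apply: (@le_trans _ _ (- \sum_(D <= i < n.+1) rt i)).
    rewrite lerN2; move: B B2; rewrite -!(big_mkord xpredT rt) /= (@big_cat_nat _ _ _ D 0 n.+1) //=; last by lia.
    by move: (\sum_(_ <= _ < _) _) (\sum_(_ <= _ < _) _) => ? ?; lra.
  rewrite -sumrN; apply: ler_sum => i _; have := rt_ge0 i; have := w1 (n - i).
  by rewrite ler_norml => /andP[? _] ?; nra.
have M1 : `|M| <= 1.
  rewrite ler_norml; apply/andP; split; apply/ler_addgt0Pr => e' e'0.
    by have [n0 /(_ n0 (leqnn _))] := Mup e'0; have := w1 n0; rewrite ler_norml => /andP[]; lra.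
  by have [k _] := Mfr 0 e'0; have := w1 k; rewrite ler_norml => /andP[]; lra.
have B1 := mu1 D; have B2 := HD D (leqnn _).
have de : d * (mu + 3) = e by rewrite /d divfK // gt_eqF //; lra.
move: A1 A2 B1 B2 M1; rewrite ler_norml -de; move: (\sum_(_ < D) _) => T A1 A2 B1 B2 /andP[Ma Mb].
move: A1 A2; move: (\sum_(_ <= _ < _) _) (\sum_(_ <= _ < _) _) => X Y A1 A2.
have C1 : M * (mu - T) <= d by nra.
have C2 : d * T <= d * mu by rewrite ler_pM2l.
by lra.
Qed.

End Limsup.

(* The renewal theorem: since [f_1 > 0], a sequence close to its limsup at [n] is close to it
   at [n - i] for every fixed [i]. *)
Lemma ru_cvg : exists U : R, forall e, 0 < e -> exists n0, forall n, (n0 <= n)%N -> `|ru n - U| <= e.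
Proof.
pose E := [set \sum_(i < n) rt i | n in [set: nat]]%classic.
have Es : has_sup E.
  split; first by exists (\sum_(i < 0) rt i); exists 0%N.
  by exists K => _ [M _ <-]; apply: rt_sum.
pose mu := sup E.
have mu1 n : \sum_(i < n) rt i <= mu by apply: (ub_le_sup Es.2); exists n.
have mu2 e : 0 < e -> exists D, forall n, (D <= n)%N -> mu - e <= \sum_(i < n) rt i.
  move=> e0; have [_ [D _ <-] HD] := sup_adherent e0 Es; exists D => n Dn.
  apply: (le_trans (ltW HD)); rewrite -!(big_mkord xpredT rt) /=.
  by apply: sum_nat_widen => // i; apply: rt_ge0.
have mu_ge : 1 <= mu by have := mu1 1%N; rewrite big_ord1 /rt big_ord0 subr0.
have ru0 : ru 0 = 1 by rewrite /ru z0 mulr0 oppr0 expR0 mulr1.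
have u1 N : `|ru N| <= 1 by rewrite ger0_norm ?ru_le1 // ltW // ru_gt0.
have [M1 [Mup1 Mfr1]] := limsup_ex u1.
have L1 := limsup_le ru_ren u1 Mup1 Mfr1 mu1 mu2.
(* The same bound for [- ru] controls the liminf; both limits are the inverse of the mean step. *)
have wr N : (0 < N)%N -> - ru N = \sum_(j < N) rf j.+1 * - ru (N - j.+1).
  by move=> N0; rewrite ru_ren // -sumrN; apply: eq_bigr => j _; rewrite mulrN.
have w1 N : `|- ru N| <= 1 by rewrite normrN.
have [M2 [Mup2 Mfr2]] := @limsup_ex (fun N => - ru N) w1.
have L2 := @limsup_le (fun N => - ru N) wr w1 M2 Mup2 Mfr2 mu mu1 mu2.
rewrite ru0 in L1 L2; exists (mu^-1) => e e0.
have [n1 H1] := Mup1 e e0; have [n2 H2] := Mup2 e e0.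
exists (n1 + n2)%N => n nn.
have mu0 : 0 < mu by lra.
have B1 : M1 <= mu^-1 by rewrite -[mu^-1]mul1r ler_pdivlMr.
have B2 : M2 <= - mu^-1 by rewrite -mulN1r ler_pdivlMr.
have A1 := H1 n (leq_trans (leq_addr _ _) nn); have A2 := H2 n (leq_trans (leq_addl _ _) nn).
by rewrite ler_norml; apply/andP; split; lra.
Qed.

End RenewalTheory.

(** * Renewal estimates for the partition functions *)

Section RenewalWeights.
Variables (R : realType) (p : nat) (g : R).
Hypothesis p0 : (0 < p)%N.
Hypothesis g0 : 0 < g.
Local Notation Z := (@Z R p g).
Local Notation mass := (@mass R p g).
Local Notation alpha := (@alpha R p g).

Let Zgt0 N : 0 < Z N. Proof. exact: lt_le_trans ltr01 (Z_ge1 _ p0 N). Qed.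

(** Both products belong to [k + N + m] particles, so the growth factors cancel and only normalized
    values remain, which are near their limit and at least [1/K]. This makes it immaterial on which
    side of a cut [m] further particles are placed. *)
Lemma Z_ratio (eps : R) : 0 < eps -> exists k0, forall k N m, (k0 <= k)%N -> (k0 <= N)%N ->
  `|Z (k + m) * Z N - Z k * Z (N + m)| <= eps * (Z k * Z (N + m)).
Proof.
move=> e0; have [K K0 HK] := Z_subM p0 g0.
have a1 : 0 < alpha 1 by rewrite alpha1.
have [lam lamP] := growth (Z0 p g) (Z_ge1 g p0) (Z_superM g p0) K0 HK.
have [U HU] := ru_cvg (Z0 p g) (Z_ge1 g p0) K0 (@alpha_ge0 R p g) a1 (Z_renewal g p0) lamP.
set u := ru Z lam in HU.
pose e := eps / (4 * K ^+ 2).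
have e0' : 0 < e by rewrite divr_gt0 // mulr_gt0 // exprn_gt0.
have [k0 Hk] := HU e e0'; exists k0 => k N m kk kN.
have uE n : Z n = u n * expR (lam * n%:R) by rewrite /u /ru -mulrA -expRD addNr expR0 mulr1.
have u0 n : 0 < u n by exact: ru_gt0 (Z_ge1 g p0) _ _.
have u1 n : u n <= 1 by exact: ru_le1 lamP _.
have uK n : K^-1 <= u n.
  by rewrite /u; apply: ru_ge; try exact: K0; exact: lamP.
rewrite !uE.
have E1 : expR (lam * (k + m)%:R) * expR (lam * N%:R) = expR (lam * k%:R) * expR (lam * (N + m)%:R).
  by rewrite -!expRD; congr expR; rewrite !natrD; ring.
have -> : u (k + m)%N * expR (lam * (k + m)%:R) * (u N * expR (lam * N%:R)) -
   u k * expR (lam * k%:R) * (u (N + m)%N * expR (lam * (N + m)%:R)) =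
   (u (k + m)%N * u N - u k * u (N + m)%N) * (expR (lam * k%:R) * expR (lam * (N + m)%:R)).
  by rewrite mulrBl -{1}E1; ring.
rewrite normrM [X in _ * X]ger0_norm ?mulr_ge0 ?expR_ge0 //.
rewrite [leRHS](_ : _ = eps * (u k * u (N + m)%N) * (expR (lam * k%:R) * expR (lam * (N + m)%:R))); last by ring.
apply: ler_wpM2r; first by rewrite mulr_ge0 ?expR_ge0.
have A1 := Hk (k + m)%N (leq_trans kk (leq_addr _ _)).
have A2 := Hk k kk; have A3 := Hk N kN; have A4 := Hk (N + m)%N (leq_trans kN (leq_addr _ _)).
have KK : K^-1 * K^-1 <= u k * u (N + m)%N by apply: ler_pM; rewrite ?invr_ge0 ?(ltW K0).
apply: (@le_trans _ _ (4 * e)); last first.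
  apply: (@le_trans _ _ (eps * (K^-1 * K^-1))); last by rewrite ler_pM2l.
  by rewrite le_eqVlt; apply/orP; left; apply/eqP; rewrite /e; field; rewrite gt_eqF.
have := u0 (k + m)%N; have := u1 (k + m)%N; have := u0 (N + m)%N; have := u1 (N + m)%N.
move: A1 A2 A3 A4; rewrite !ler_norml; move: (u _) (u _) (u _) (u _) => x1 x2 x3 x4.
move=> /andP[a b] /andP[c d] /andP[a' b'] /andP[c' d'] *.
by apply/andP; split; nra.
Qed.

(** Decomposing by the last renewal point before the gap leaves a sum of tails [rt] at distances at
    least [D], small because the mean step is finite. *)
Lemma gap_small (eps : R) : 0 < eps -> exists D, forall N A, (D <= A)%N -> (A < N)%N ->
  mass [::] N (no_renewal p (A - D) A) <= eps * Z N.
Proof.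
move=> e0; have [K K0 HK] := Z_subM p0 g0.
have [lam lamP] := growth (Z0 p g) (Z_ge1 g p0) (Z_superM g p0) K0 HK.
set u := ru Z lam.
have eK : 0 < eps / K by rewrite divr_gt0.
have [D HD] := rt_tail (Z0 p g) (Z_ge1 g p0) K0 (@alpha_ge0 R p g) (Z_renewal g p0) lamP eK.
exists D => N A DA AN.
have AN' : (A - D <= A <= N)%N by rewrite leq_subr ltnW.
rewrite mass_last //.
have uE n : Z n = u n * expR (lam * n%:R) by rewrite /u /ru -mulrA -expRD addNr expR0 mulr1.
have u1 n : u n <= 1 by exact: ru_le1 lamP _.
have aE j : alpha j = rf alpha lam j * expR (lam * j%:R).
  by rewrite /rf -mulrA -expRD addNr expR0 mulr1.
apply: (@le_trans _ _ (\sum_(k < (A - D).+1) rt alpha lam (A - k) * expR (lam * N%:R))).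
  apply: ler_sum => k _.
  have kA : (k <= A)%N by apply: (leq_trans (ltn_ord k : (k <= A - D)%N)); exact: leq_subr.
  rewrite mass_first //; last by apply: leq_sub2r; exact: ltnW.
  have kAN : (A - k < N - k)%N by rewrite ltn_sub2r // (leq_ltn_trans kA).
  have H := renewal_gap (Z0 p g) (Z_ge1 g p0) K0 (@alpha_ge0 R p g) (Z_renewal g p0) lamP kAN.
  have -> : Z (N - k) - \sum_(j < A - k) alpha j.+1 * Z (N - k - j.+1) =
     (u (N - k)%N - \sum_(j < A - k) rf alpha lam j.+1 * u (N - k - j.+1)%N) * expR (lam * (N - k)%:R).
    rewrite mulrBl -uE; congr (_ - _); rewrite mulr_suml; apply: eq_bigr => j _.
    rewrite aE uE mulrACA -expRD; congr (_ * expR _); rewrite -mulrDr -natrD subnKC //.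
    exact: ltn_trans (ltn_ord j) kAN.
  have -> : expR (lam * N%:R) = expR (lam * k%:R) * expR (lam * (N - k)%:R).
    by rewrite -expRD -mulrDr -natrD subnKC // (leq_trans kA) // ltnW.
  rewrite [Z k]uE mulrACA; apply: ler_wpM2r; first by rewrite mulr_ge0 ?expR_ge0.
  have t0 := rt_ge0 (Z0 p g) (Z_ge1 g p0) K0 (@alpha_ge0 R p g) (Z_renewal g p0) lamP (A - k).
  have uk0 : 0 < u k by exact: ru_gt0 (Z_ge1 g p0) _ _.
  move: H t0 uk0 (u1 k); rewrite -/u; move: (_ - _) (rt _ _ _) (u k) => X T v H t0 v0 v1.
  have [X0|X0] := leP X 0; last by nra.
  by apply: le_trans t0; rewrite pmulr_rle0.
rewrite -mulr_suml.
have -> : \sum_(k < (A - D).+1) rt alpha lam (A - k) = \sum_(D <= i < A.+1) rt alpha lam i.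
  rewrite [RHS]big_nat_rev /= -(big_mkord xpredT (fun k => rt alpha lam (A - k))) /=.
  have := @big_nat_shift R (A - D).+1 D (fun i => rt alpha lam (D + A.+1 - i.+1)).
  rewrite (_ : (A - D).+1 + D = A.+1)%N; last by rewrite addSn subnK.
  by move=> ->; apply: eq_bigr => i _; congr (rt _ _ _); lia.
apply: (le_trans (ler_wpM2r (expR_ge0 _) (HD A.+1))).
have /andP[_ H] := lamP N; apply: (le_trans (ler_wpM2l (ltW eK) H)).
by rewrite mulrA divfK // gt_eqF.
Qed.

End RenewalWeights.

(** * Configurations with fixed points *)

Section CauchySchwarz.
Variable R : realType.
Local Notation C := R[i].

Lemma discriminant_le (a b c : R) : 0 <= a -> 0 <= c ->
  (forall t, 0 <= t ^+ 2 * a + 2 * t * b + c) -> b ^+ 2 <= a * c.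
Proof.
move=> a0 c0 H; have [a1|a1] := ltP 0 a.
  have := H (- b / a); rewrite (_ : _ + c = (a * c - b ^+ 2) / a); last by field; rewrite gt_eqF.
  by rewrite pmulr_lge0 ?invr_gt0 // subr_ge0.
have {a1 a0}a0 : a = 0 by apply/eqP; rewrite eq_le a1 a0.
have [b0|b0] := eqVneq b 0; first by rewrite b0 a0 mul0r expr0n.
(* For [a = 0] and [b] nonzero, this argument gives the quadratic the value -1. *)
have := H (- (c + 1) / (2 * b)); rewrite a0 mulr0 add0r.
rewrite (_ : _ + c = -1); last by field.
by rewrite oppr_ge0 ler10.
Qed.

Lemma tsum_CS (X : Type) (rs : seq X) n (w a : seq X -> R) : (forall t, 0 <= w t) ->
  tsum rs n (fun t => w t * a t) ^+ 2 <= tsum rs n w * tsum rs n (fun t => w t * a t ^+ 2).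
Proof.
move=> w0; rewrite mulrC; apply: discriminant_le.
- by apply: tsum_ge0 => t _; rewrite mulr_ge0 ?sqr_ge0.
- by apply: tsum_ge0.
move=> t; rewrite -!tsumZ -!tsumD; apply: tsum_ge0 => s _.
rewrite (_ : _ + _ = w s * (t * a s + 1) ^+ 2); last by ring.
by rewrite mulr_ge0 ?sqr_ge0.
Qed.

Lemma nc_add (x y : C) : nc (x + y) <= nc x + nc y.
Proof.
have := ler_normD x y; rewrite !nc_norm -(rmorphD (real_complex R)).
by rewrite lecR.
Qed.

Lemma nc_sum (I : Type) (r : seq I) (F : I -> C) :
  nc (\sum_(i <- r) F i) <= \sum_(i <- r) nc (F i).
Proof.
elim: r => [|i r IH]; first by rewrite !big_nil ComplexField.Normc.normc0.
by rewrite !big_cons; apply: (le_trans (nc_add _ _)); apply: lerD.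
Qed.

Lemma nc_tsum (X : Type) (rs : seq X) n (F : seq X -> C) :
  nc (tsum rs n F) <= tsum rs n (fun t => nc (F t)).
Proof.
elim: n F => [|n IH] F //; rewrite !tsumS.
by apply: (le_trans (nc_sum _ _)); apply: ler_sum => x _; exact: IH.
Qed.

(** A sum is at most its length times its largest term; the 1 covers the empty list. This plays the
    part of Hölder's inequality for products of several moments. *)
Lemma exp_sum_max (ys : seq R) : (forall y, y \in ys -> 0 <= y) ->
  expR (\sum_(y <- ys) y) <= 1 + \sum_(y <- ys) expR ((size ys)%:R * y).
Proof.
move=> y0; have key : ys != [::] -> exists2 y, y \in ys & \sum_(y <- ys) y <= (size ys)%:R * y.
  elim: ys {y0} => // y ys IH _; have [->|/IH[y' yin le]] := eqVneq ys [::].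
    by exists y; rewrite ?mem_head // big_seq1 mul1r.
  have [yy|yy] := leP y y'.
    exists y'; first by rewrite inE yin orbT.
    by rewrite big_cons /= -natr1 mulrDl mul1r addrC lerD.
  exists y; rewrite ?mem_head // big_cons /= -natr1 mulrDl mul1r addrC lerD // (le_trans le) //.
  by rewrite ler_wpM2l ?ler0n // ltW.
have [->|/key[y yin le]] := eqVneq ys [::]; first by rewrite !big_nil expR0 addr0.
have : expR ((size ys)%:R * y) <= \sum_(y <- ys) expR ((size ys)%:R * y).
  rewrite (perm_big _ (perm_to_rem yin)) big_cons lerDl.
  by apply: sumr_ge0 => z _; exact: expR_ge0.
have : expR (\sum_(y <- ys) y) <= expR ((size ys)%:R * y) by rewrite ler_expR.
by move: (\sum_(_ <- _) expR _) (expR _) (expR _) => ? ? ?; lra.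
Qed.

Variables (p : nat) (g : R).
Hypothesis p0 : (0 < p)%N.
Hypothesis g0 : 0 < g.
Local Notation cf := (@cf C p).
Local Notation cfz := (@cfz C p).
Local Notation cweight := (@cweight R p g).
Local Notation Z := (@Z R p g).
Local Notation gs_energy := (@gs_energy R p g).
Local Notation mass := (@mass R p g).
Local Notation phi := (@phi R g).

Definition gw (ps : seq (R * C)) (m : seq nat) : R :=
  prod_zip [seq (fun j : nat => expR (- (g / 2 * (q.1 - j%:R) ^+ 2))) | q <- ps] m.

Lemma gw_ge0 ps m : 0 <= gw ps m.
Proof.
by rewrite /gw; elim: ps m => [|q ps IH] [|j m] //=; rewrite mulr_ge0 ?expR_ge0.
Qed.

(** Completing the square: the modulus of a monomial is the Gaussian overlap of points and orbitals,
    up to factors that are part of [cweight]. *)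
Lemma nc_mon ps m : unitp ps -> size m = size ps ->
  nc (mon m (map (point_val g) ps)) =
  gw ps m * expR (g / 2 * \sum_(q <- ps) q.1 ^+ 2) * expR (g / 2 * ssq R m).
Proof.
elim: ps m => [|q ps IH] [|j m] //.
  by move=> _ _; rewrite -[mon _ _]/1 ComplexField.Normc.normc1 /gw /ssq !big_nil /= !mulr0 expR0 !mulr1.
case/andP=> q1 ups [sm]; rewrite -[mon _ _]/(point_val g q ^+ j * mon m (map (point_val g) ps)).
rewrite ComplexField.Normc.normcM IH // ncX nc_point_val //.
rewrite /ssq !big_cons !mulrDr !expRD /gw /= -expRM_natl.
have -> : expR (j%:R * (g * q.1)) = expR (- (g / 2 * (q.1 - j%:R) ^+ 2)) *
   expR (g / 2 * q.1 ^+ 2) * expR (g / 2 * j%:R ^+ 2).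
  by rewrite -!expRD; congr expR; field.
by move: (expR _) (expR _) (expR _) (expR _) (expR _) (prod_zip _ _) => *; ring.
Qed.

(** The amplitude at the points [ps] is a sum over orbitals [m] for them. Cauchy-Schwarz with the
    Gaussian overlaps as weights replaces it by the weights of full orbital configurations
    [m ++ mu]. *)
Lemma cweight_CS ps mu : unitp ps ->
  cweight ps mu <= tsum (iota 0 (p * (size ps + size mu))) (size ps) (gw ps) *
    tsum (iota 0 (p * (size ps + size mu))) (size ps) (fun m => gw ps m * cweight [::] (m ++ mu)).
Proof.
move=> ups; set rs := iota 0 _; set n := size ps; set N := (n + size mu)%N.
pose a m := nc (cf (m ++ mu)) * expR (g / 2 * ssq R (m ++ mu)) * expR (- gs_energy N / 2).
have sq2 (x : R) : expR (x / 2) ^+ 2 = expR x.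
  by rewrite -expRM_natl; congr expR; field.
have sq3 (x : R) : expR (g / 2 * x) ^+ 2 = expR (g * x).
  by rewrite -expRM_natl; congr expR; field.
have -> : tsum rs n (fun m => gw ps m * cweight [::] (m ++ mu)) = tsum rs n (fun m => gw ps m * a m ^+ 2).
  apply: eq_tsum => m sm; congr (_ * _); rewrite /a /cweight /= cfz0 big_nil mulr0 expR0 mulr1 add0n.
  rewrite size_cat sm -/N !exprMn (sq2 (- gs_energy N)) (sq3 (ssq R (m ++ mu))).
  by move: (nc _) (expR (- gs_energy N)) (expR _) => *; ring.
apply: le_trans (tsum_CS _ _ _ (gw_ge0 ps)).
have -> : cweight ps mu = (expR (- gs_energy N / 2) * expR (- (g / 2 * \sum_(q <- ps) q.1 ^+ 2)) *
    nc (cfz (map (point_val g) ps) mu) * expR (g / 2 * ssq R mu)) ^+ 2.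
  rewrite /cweight !exprMn (sq2 (- gs_energy N)) (sq3 (ssq R mu)) -/N.
  have -> : expR (- (g / 2 * \sum_(q <- ps) q.1 ^+ 2)) ^+ 2 = expR (- g * \sum_(q <- ps) q.1 ^+ 2).
    by rewrite -expRM_natl; congr expR; field.
  by [].
apply: lerXn2r.
- by rewrite nnegrE !mulr_ge0 ?expR_ge0 ?nc_ge0.
- by rewrite nnegrE; apply: tsum_ge0 => t _; rewrite !mulr_ge0 ?expR_ge0 ?nc_ge0 ?gw_ge0.
apply: (@le_trans _ _ (expR (- gs_energy N / 2) * expR (- (g / 2 * \sum_(q <- ps) q.1 ^+ 2)) *
   tsum rs n (fun m => nc (cf (m ++ mu)) * nc (mon m (map (point_val g) ps))) * expR (g / 2 * ssq R mu))).
  rewrite ler_wpM2r ?expR_ge0 // ler_wpM2l ?mulr_ge0 ?expR_ge0 // cfzE size_map.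
  apply: (le_trans (nc_tsum _ _ _)); apply: le_tsum => m _.
  by rewrite ComplexField.Normc.normcM.
rewrite -tsumZ -tsumZr; apply: le_tsum => m sm.
rewrite nc_mon // /a ssq_cat mulrDr expRD expRN.
have e1 := expR_gt0 (g / 2 * \sum_(q <- ps) q.1 ^+ 2).
rewrite le_eqVlt; apply/orP; left; apply/eqP.
move: (expR (g / 2 * \sum_(q <- ps) q.1 ^+ 2)) e1 => y y0; field; by rewrite gt_eqF.
Qed.

Lemma half_gauss (v : R) : expR (- (g / 2 * v ^+ 2)) <= expR (- (g / 4 * v ^+ 2)) * (expR g * expR (- (g * `|v|))).
Proof.
rewrite -!expRD ler_expR -(real_normK (num_real v)).
have : 0 <= g * (`|v| / 2 - 1) ^+ 2 by rewrite mulr_ge0 ?sqr_ge0 // ltW.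
by move: `|v| => y; rewrite (_ : g * _ = g / 4 * y ^+ 2 - g * y + g); [lra | field].
Qed.

Lemma gauss_sum_le : exists2 K : R, 0 < K & forall x M,
  \sum_(j <- iota 0 M) expR (- (g / 2 * (x - j%:R) ^+ 2)) <= K.
Proof.
have [K K1 HK] := exp_sum_le g0; exists (expR g * K).
  by rewrite mulr_gt0 ?expR_gt0 // (lt_le_trans ltr01).
move=> x M; apply: (@le_trans _ _ (expR g * \sum_(j <- iota 0 M) expR (- (g * `|j%:R - x|)))).
  rewrite mulr_sumr; apply: ler_sum => j _; apply: (le_trans (half_gauss _)).
  rewrite distrC ler_piMl ?mulr_ge0 ?expR_ge0 // expR_le1 oppr_le0 mulr_ge0 ?sqr_ge0 //.
  by rewrite divr_ge0 // ltW.
rewrite ler_wpM2l ?expR_ge0 //; have := HK x M; by rewrite /index_iota subn0.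
Qed.

Definition gauss_fs (ps : seq (R * C)) : seq (nat -> R) :=
  [seq (fun j : nat => expR g * phi (j%:R - q.1)) | q <- ps].

Lemma gauss_fs_ge0 ps f j : List.In f (gauss_fs ps) -> 0 <= f j.
Proof.
elim: ps => //= q ps IH [<-|/IH //]; by rewrite mulr_ge0 ?expR_ge0.
Qed.

Lemma prod_zip_gauss_fs_ge0 ps m : 0 <= prod_zip (gauss_fs ps) m.
Proof. by apply: prod_zip_ge0 => f x; apply: gauss_fs_ge0. Qed.

(** Half of the Gaussian exponent is kept to penalize an orbital below [A], at distance at least [d]
    from its point; the other half becomes the exponential profile whose moments are known. *)
Lemma gw_le ps m (A : nat) (d : R) : 0 <= d -> size m = size ps ->
  A = 0%N \/ all (fun q => A%:R + d <= q.1) ps ->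
  gw ps m <= (if all (fun j => A <= j)%N m then 1 else expR (- (g / 4 * d ^+ 2))) * prod_zip (gauss_fs ps) m.
Proof.
move=> d0; elim: ps m => [|q ps IH] [|j m] //=; first by rewrite mul1r.
case=> sm HA; have {}HA : A = 0%N \/ (A%:R + d <= q.1) /\ all (fun q => A%:R + d <= q.1) ps.
  by case: HA => [->|/andP]; [left | right].
have {}IH := IH m sm.
have HA' : A = 0%N \/ all (fun q => A%:R + d <= q.1) ps by case: HA => [->|[]]; [left | right].
have {}IH := IH HA'.
have e1 : expR (- (g / 2 * (q.1 - j%:R) ^+ 2)) <=
   expR (- (g / 4 * (q.1 - j%:R) ^+ 2)) * (expR g * phi (j%:R - q.1)).
  by rewrite phiE distrC; exact: half_gauss.
have ph0 : 0 <= expR g * phi (j%:R - q.1) by rewrite mulr_ge0 ?expR_ge0.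
have g40 : 0 <= g / 4 by rewrite divr_ge0 // ltW.
have e2 : expR (- (g / 4 * (q.1 - j%:R) ^+ 2)) <= 1.
  by rewrite expR_le1 oppr_le0 mulr_ge0 ?sqr_ge0.
have e3 : expR (- (g / 2 * (q.1 - j%:R) ^+ 2)) <= expR g * phi (j%:R - q.1).
  by apply: (le_trans e1); rewrite ler_piMl.
have pz0 := prod_zip_gauss_fs_ge0 ps m; have gw0 := gw_ge0 ps m.
rewrite /gw /= -/(gw ps m).
case: (leqP A j) => /= jA.
  by rewrite [leRHS]mulrCA; apply: ler_pM => //; exact: expR_ge0.
have IH1 : gw ps m <= prod_zip (gauss_fs ps) m.
  apply: (le_trans IH); case: ifP => _; rewrite ?mul1r // ler_piMl //.
  by rewrite expR_le1 oppr_le0 mulr_ge0 ?sqr_ge0.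
rewrite [leRHS]mulrA; apply: ler_pM; [exact: expR_ge0 | by [] | | by []].
apply: (le_trans e1); apply: ler_wpM2r => //; rewrite ler_expR lerN2 ler_wpM2l //.
case: HA => [A0|[Ad _]]; first by rewrite A0 in jA.
have : j%:R <= A%:R :> R by rewrite ler_nat ltnW.
by move=> jA'; rewrite lerXn2r ?nnegrE //; lra.
Qed.

(** Transfers estimates to systems with observed points. The charge factor [G] near the points is
    unbounded but has a second moment, and [G <= kap + G ^+ 2 / kap] separates it from the event
    [P], with [kap] free. The term in [d] accounts for points resolved into orbitals below [A],
    where [P] could change. *)
Lemma mass_fixed_le n : exists2 K : R, 0 < K & forall N' ps (A : nat) (d kap : R) (P : pred (seq nat)),
  0 <= d -> 0 < kap -> size ps = n -> unitp ps -> perm_inv P ->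
  (A = 0%N \/ all (fun q => A%:R + d <= q.1) ps) ->
  (forall m mu, all (fun j => A <= j)%N m -> P (m ++ mu) = P mu) ->
  mass ps N' P <= K * (kap * mass [::] (n + N') P +
    (kap^-1 + 2 * expR (- (g / 4 * d ^+ 2))) * Z (n + N')).
Proof.
have [Th Th0 HTh] := gauss_sum_le.
have b0 : 0 <= 2 * expR g * n%:R by rewrite !mulr_ge0 ?expR_ge0 ?ler0n.
have [Cm Cm0 HCm] := exp_moment p0 g0 b0.
pose K := Th ^+ n * (1 + n%:R * Cm).
have nC0 : 0 <= n%:R * Cm by rewrite mulr_ge0 ?ler0n // ltW.
have K0 : 0 < K by rewrite mulr_gt0 ?exprn_gt0 //; lra.
exists K => // N' ps A d kap P d0 kap0 sps ups pP HA HP.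
set N := (n + N')%N; set del := expR (- (g / 4 * d ^+ 2)).
have del0 : 0 < del by exact: expR_gt0.
set rs := iota 0 (p * N).
pose F t := ((if P t then 1 else 0) + del) * cweight [::] t.
have F0 t : 0 <= F t.
  by rewrite /F mulr_ge0 ?cweight_ge0 // addr_ge0 ?(ltW del0) //; case: ifP.
have pF : perm_inv F by move=> s t st; rewrite /F (pP _ _ st) (cweight_perm _ _ _ st).
pose G t := \prod_(f <- gauss_fs ps) \sum_(x <- t) f x.
have step1 : mass ps N' P <= Th ^+ n * isum rs N (fun t => F t * G t).
  have := campbell_le rs N' pF (@gauss_fs_ge0 ps) F0; rewrite size_map sps -/N => Hc.
  apply: le_trans (ler_wpM2l _ Hc); last by rewrite exprn_ge0 // ltW.
  have gwT : tsum rs n (gw ps) <= Th ^+ n.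
    have := tsum_prod_zip rs [seq (fun j : nat => expR (- (g / 2 * (q.1 - j%:R) ^+ 2))) | q <- ps].
    rewrite size_map sps => ->; rewrite big_map -sps /rs.
    elim: (ps) => [|q qs IH]; first by rewrite big_nil expr0.
    rewrite big_cons /= exprS; apply: ler_pM => //; first by apply: sumr_ge0 => *; exact: expR_ge0.
    by apply: prodr_ge0 => z _; apply: sumr_ge0 => *; exact: expR_ge0.
  rewrite /mass sps -/N -/rs.
  apply: (@le_trans _ _ (Th ^+ n * isum rs N' (fun mu => tsum rs n (fun m => F (m ++ mu) * prod_zip (gauss_fs ps) m)))).
    rewrite -isumZ; apply: le_isum => mu smu.
    have T0 : 0 <= tsum rs n (fun m => F (m ++ mu) * prod_zip (gauss_fs ps) m).
      by apply: tsum_ge0 => m _; rewrite mulr_ge0 ?F0 ?prod_zip_gauss_fs_ge0.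
    case: ifP => Pmu; last by rewrite mulr_ge0 // exprn_ge0 // ltW.
    apply: (le_trans (cweight_CS mu ups)); rewrite smu sps -/N -/rs; apply: ler_pM => //.
    - by apply: tsum_ge0 => m _; exact: gw_ge0.
    - by apply: tsum_ge0 => m _; rewrite mulr_ge0 ?gw_ge0 ?cweight_ge0.
    apply: le_tsum => m sm; rewrite /F [leRHS]mulrAC; apply: ler_wpM2r; first exact: cweight_ge0.
    apply: (le_trans (gw_le d0 _ HA)); first by rewrite sm sps.
    apply: ler_wpM2r; first exact: prod_zip_gauss_fs_ge0.
    case: (boolP (all _ m)) => am; first by rewrite HP // Pmu lerDl ltW.
    by rewrite -/del lerDr; case: ifP.
  rewrite ler_wpM2l ?exprn_ge0 ?(ltW Th0) // le_eqVlt; apply/orP; left; apply/eqP.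
  rewrite /isum tsum_exch -tsumZ; apply: eq_tsum => m _.
  by rewrite tsumZr mulrA.
have G0 t : 0 <= G t.
  by rewrite /G /gauss_fs big_map; apply: prodr_ge0 => q _; apply: sumr_ge0 => j _; rewrite mulr_ge0 ?expR_ge0.
have G2 t : G t ^+ 2 <= 1 + \sum_(q <- ps) wt g (2 * expR g * n%:R) q.1 t.
  have H1 : G t <= expR (\sum_(q <- ps) expR g * \sum_(j <- t) phi (j%:R - q.1)).
    rewrite /G /gauss_fs big_map -expR_bigsum.
    have H (q : R * C) : 0 <= \sum_(j <- t) expR g * phi (j%:R - q.1) <= expR (expR g * \sum_(j <- t) phi (j%:R - q.1)).
      rewrite sumr_ge0 => [|j _]; last by rewrite mulr_ge0 ?expR_ge0.
      rewrite -mulr_sumr (le_trans _ (expR_ge1Dx _)) // lerDr //.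
    by have /andP[] := ler_prod_seq ps H.
  apply: (@le_trans _ _ (expR (\sum_(q <- ps) 2 * expR g * \sum_(j <- t) phi (j%:R - q.1)))).
    rewrite (_ : expR (\sum_(q <- ps) _) = expR (\sum_(q <- ps) expR g * \sum_(j <- t) phi (j%:R - q.1)) ^+ 2).
      by apply: lerXn2r; rewrite ?nnegrE ?expR_ge0.
    by rewrite -expRM_natl mulr_sumr; congr expR; apply: eq_bigr => q _; rewrite mulrA.
  rewrite -(big_map (fun q : R * C => 2 * expR g * \sum_(j <- t) phi (j%:R - q.1)) xpredT id).
  apply: (le_trans (exp_sum_max _)).
    move=> y /mapP[q _ ->]; rewrite !mulr_ge0 ?expR_ge0 //; apply: sumr_ge0 => j _; exact: expR_ge0.
  rewrite lerD2l big_map size_map sps le_eqVlt; apply/orP; left; apply/eqP.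
  by apply: eq_bigr => q _; rewrite /wt; congr expR; ring.
have EG2 : isum rs N (fun t => cweight [::] t * G t ^+ 2) <= (1 + n%:R * Cm) * Z N.
  apply: (@le_trans _ _ (isum rs N (fun t => cweight [::] t + \sum_(q <- ps) cweight [::] t * wt g (2 * expR g * n%:R) q.1 t))).
    apply: le_isum => t _; rewrite -mulr_sumr -{2}[cweight [::] t]mulr1 -mulrDr.
    by apply: ler_wpM2l; rewrite ?cweight_ge0.
  rewrite isumD isum_sum [leRHS]mulrDl mul1r; apply: lerD; first exact: lexx.
  apply: (@le_trans _ _ (\sum_(q <- ps) Cm * Z N)); first by apply: ler_sum => q _; exact: HCm.
  by rewrite big_const_seq count_predT iter_addr_0 sps -[leLHS]mulr_natl mulrA.
clearbody del.
apply: (le_trans step1); rewrite /K -mulrA ler_wpM2l ?exprn_ge0 ?(ltW Th0) //.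
have ki : 0 < kap^-1 by rewrite invr_gt0.
apply: (@le_trans _ _ (isum rs N (fun t => kap * (if P t then cweight [::] t else 0) +
   ((kap^-1 + del) * (cweight [::] t * G t ^+ 2) + del * cweight [::] t)))).
  apply: le_isum => t _; have c0 := cweight_ge0 p g [::] t; have Gt := G0 t.
  rewrite /F; suff : ((if P t then 1 else 0) + del) * G t <= kap * (if P t then 1 else 0) +
     ((kap^-1 + del) * G t ^+ 2 + del).
    move=> /(ler_wpM2l c0); case: ifP => _; move: (cweight _ _) (G t) => *; lra.
  have dG : del * G t <= del * G t ^+ 2 + del.
    rewrite -{3}[del]mulr1 -mulrDr; apply: ler_wpM2l; first exact: ltW.
    by have := sqr_ge0 (G t - 1); move: (G t) Gt => x x0; nra.
  have kk : G t <= kap + kap^-1 * G t ^+ 2.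
    have : 0 <= kap^-1 * (G t - kap / 2) ^+ 2 by rewrite mulr_ge0 ?sqr_ge0 // ltW.
    rewrite (_ : kap^-1 * _ = kap^-1 * G t ^+ 2 - G t + kap / 4); last by field; rewrite gt_eqF.
    by move=> ?; lra.
  have k2 : 0 <= kap^-1 * G t ^+ 2 by rewrite mulr_ge0 ?sqr_ge0 // ltW.
  move: dG kk k2; move: (kap^-1) (G t) => k x dG kk k2.
  by case: ifP => _; lra.
rewrite !isumD !isumZ -!/(mass [::] N P).
have -> : isum rs N (cweight [::]) = Z N by [].
have Zn := Z_ge0 p g N; have Mn := mass_ge0 p g [::] N P.
have kd : 0 <= kap^-1 + del by rewrite addr_ge0 // ltW.
have E' := ler_wpM2l kd EG2.
move: E'; move: (isum _ _ _) => X E'.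
set c := n%:R * Cm in nC0 E' *.
apply: (@le_trans _ _ (kap * mass [::] N P + ((kap^-1 + del) * ((1 + c) * Z N) + del * Z N))).
  by rewrite lerD2l lerD2r.
have t1 : 0 <= c * (kap * mass [::] N P) by exact: mulr_ge0 nC0 (mulr_ge0 (ltW kap0) Mn).
have t2 : 0 <= c * (del * Z N) by exact: mulr_ge0 nC0 (mulr_ge0 (ltW del0) Zn).
by rewrite -subr_ge0 (_ : _ - _ = c * (kap * mass [::] N P) + c * (del * Z N)) ?addr_ge0 //; ring.
Qed.

End CauchySchwarz.

(** * Correlations forget the edges *)

Section Bulk.
Variables (R : realType) (p : nat) (g : R).
Local Notation C := R[i].
Hypothesis p0 : (0 < p)%N.
Hypothesis g0 : 0 < g.
Local Notation cfz := (@cfz C p).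
Local Notation cweight := (@cweight R p g).
Local Notation Z := (@Z R p g).
Local Notation gs_energy := (@gs_energy R p g).
Local Notation mass := (@mass R p g).
Local Notation tot := (xpredT : pred (seq nat)).

Let Zgt0 N : 0 < Z N. Proof. exact: lt_le_trans ltr01 (Z_ge1 g p0 N). Qed.

Definition shiftr (ps : seq (R * C)) (k : nat) := [seq (q.1 + (p * k)%:R, q.2) | q <- ps].

Lemma shiftp_shiftr ps k m : shiftp p (shiftr ps m) (k + m) = shiftp p ps k.
Proof.
rewrite /shiftp /shiftr -map_comp; apply: eq_map => q /=; congr (_, _).
by rewrite mulnDr natrD; ring.
Qed.

Lemma unitp_shiftr ps m : unitp (shiftr ps m) = unitp ps.
Proof. by rewrite /unitp /shiftr all_map. Qed.

Lemma mass_bound n : exists2 K : R, 0 < K & forall N' ps, size ps = n -> unitp ps ->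
  mass ps N' tot <= K * Z (n + N').
Proof.
have [K K0 HK] := mass_fixed_le p0 g0 n; exists (K * 4); first by rewrite mulr_gt0.
move=> N' ps sps ups.
have := HK N' ps 0%N 0 1 tot (lexx 0) ltr01 sps ups (fun _ _ _ => erefl) (or_introl erefl) (fun _ _ _ => erefl).
rewrite invr1 expr0n /= mulr0 oppr0 expR0 mul1r mulr1 -/(Z (n + N')).
move=> /le_trans; apply; rewrite -mulrA ler_pM2l //.
by move: (Z _) => x; lra.
Qed.

Lemma renewal_at_cat_high A k m mu : (k <= A)%N -> all (fun j => p * A <= j)%N m ->
  renewal_at p k (m ++ mu) = renewal_at p k mu.
Proof.
move=> kA am; have fm : seq.filter (fun j => j < p * k)%N m = [::].
  apply/eqP; rewrite -size_eq0 size_filter -leqn0 leqNgt -has_count.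
  apply/hasPn => j jm; rewrite -leqNgt; have /allP/(_ j jm) := am.
  by apply: leq_trans; rewrite leq_mul2l kA orbT.
by rewrite /renewal_at count_cat filter_cat fm -[count _ m]size_filter fm.
Qed.

Lemma mass_gap n (eps : R) : 0 < eps -> exists D, exists2 d : R, 0 <= d & forall N' ps A,
  size ps = n -> unitp ps -> all (fun q => (p * A)%:R + d <= q.1) ps -> (D <= A)%N ->
  (A < n + N')%N -> mass ps N' (no_renewal p (A - D) A) <= eps * Z (n + N').
Proof.
move=> e0; have [K K0 HK] := mass_fixed_le p0 g0 n.
(* The contributions [K * kap * eta], [K / kap] and that of the Gaussian term are each at most
   [eps / 3]. *)
pose kap := 3 * K / eps; have kap0 : 0 < kap by rewrite divr_gt0 // mulr_gt0.
pose eta := eps / (3 * K * kap); have eta0 : 0 < eta by exact: divr_gt0 e0 (mulr_gt0 (mulr_gt0 (ltr0Sn R 2) K0) kap0).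
have [D HD] := gap_small p0 g0 eta0; exists D.
pose d := 1 + 24 * K / (eps * g).
have q0 : 0 < 24 * K / (eps * g) by rewrite divr_gt0 // mulr_gt0.
exists d; first by rewrite /d; lra.
move=> N' ps A sps ups Hps DA AN.
have d0 : 0 <= d by rewrite /d; lra.
(* Orbitals from [p * A] on do not influence renewal up to [A], so those assigned to the observed
   points can be ignored. *)
have Hl m mu : all (fun j => p * A <= j)%N m -> no_renewal p (A - D) A (m ++ mu) = no_renewal p (A - D) A mu.
  move=> am; apply: eq_in_all => k; rewrite mem_iota => /andP[_ kA].
  by rewrite (@renewal_at_cat_high A) //; clear -kA DA; lia.
have := HK N' ps (p * A)%N d kap _ d0 kap0 sps ups (no_renewal_perm p (A - D) A) (or_intror Hps) Hl.
move=> /le_trans; apply.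
have B := HD (n + N')%N A DA AN.
have ex : expR (- (g / 4 * d ^+ 2)) <= eps / (6 * K).
  have y1 : 6 * K / eps <= g / 4 * d ^+ 2.
    apply: (@le_trans _ _ (g / 4 * (24 * K / (eps * g)))).
      by rewrite le_eqVlt; apply/orP; left; apply/eqP; field; rewrite !gt_eqF.
    rewrite ler_pM2l ?divr_gt0 // /d; move: (24 * K / _) q0 => y y0; nra.
  have y2 : 6 * K / eps <= expR (g / 4 * d ^+ 2).
    by apply: (le_trans y1); apply: le_trans (expR_ge1Dx _); rewrite lerDr.
  rewrite expRN -[eps / _]invrK lef_pV2 ?posrE ?expR_gt0 ?invr_gt0 ?divr_gt0 ?mulr_gt0 //.
  by rewrite invf_div.
have Zn := Zgt0 (n + N').
move: B ex; move: (mass _ _ _) (expR _) => M e B ex.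
apply: (@le_trans _ _ (K * (kap * (eta * Z (n + N')) + (kap^-1 + 2 * (eps / (6 * K))) * Z (n + N')))).
  rewrite ler_pM2l // lerD ?ler_pM2l // ler_pM2r //.
  by rewrite lerD2l ler_pM2l.
rewrite le_eqVlt; apply/orP; left; apply/eqP; rewrite /eta /kap; field.
by rewrite !gt_eqF.
Qed.

Lemma mass_split_total ps N' A D : unitp ps -> (D <= A)%N -> (A <= N')%N ->
  mass ps N' tot = mass ps N' (no_renewal p (A - D) A) +
  \sum_((A - D).+1 <= k < A.+1) Z k * mass (shiftp p ps k) (N' - k) (no_renewal p 0 (A - k)).
Proof.
move=> ups DA AN; rewrite (mass_total _ p0 ups AN) mass_last ?leq_subr //.
rewrite -!(big_mkord xpredT (fun k => Z k * mass (shiftp p ps k) (N' - k) (no_renewal p 0 (A - k)))) /=.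
by rewrite -big_cat_nat //= ltnS leq_subr.
Qed.

(** Up to a small error there is a renewal point left of the observed points. To its right the
    systems with and without the [m] extra particles coincide, so the two sums differ only by the
    ratios controlled in [Z_ratio]. *)
Lemma left_shift n (eps : R) : 0 < eps -> exists2 d : R, 0 <= d & exists N0 : nat, forall N' m ps,
  size ps = n -> unitp ps -> all (fun q => d <= q.1) ps -> (N0 <= N')%N ->
  `|mass (shiftr ps m) (N' + m) tot / Z (n + N' + m) - mass ps N' tot / Z (n + N')| <= eps.
Proof.
move=> e0; have [K K0 HK] := mass_bound n.
(* Two gap errors, and a ratio error that multiplies a quantity bounded by [K]. *)
pose e1 := eps / (2 + K); have e10 : 0 < e1 by rewrite divr_gt0 // addr_gt0.
have [D [dg dg0 Hgap]] := mass_gap n e10; have [k0 Hk0] := Z_ratio p0 g0 e10.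
pose A := (k0 + D)%N.
exists ((p * A)%:R + dg); first by rewrite addr_ge0 ?ler0n.
exists A.+1 => N' m ps sps ups Hps AN.
have DA : (D <= A)%N by exact: leq_addl.
have T1 : mass ps N' (no_renewal p (A - D) A) <= e1 * Z (n + N') by apply: Hgap => //; lia.
have T2 : mass (shiftr ps m) (N' + m) (no_renewal p (A + m - D) (A + m)) <= e1 * Z (n + N' + m).
  have l1 : (D <= A + m)%N by exact: leq_trans DA (leq_addr _ _).
  have l2 : (A + m < n + (N' + m))%N by clear -AN; lia.
  rewrite -addnA; apply: Hgap; rewrite ?size_map ?unitp_shiftr //.
  rewrite all_map; apply: sub_all Hps => q /= H; rewrite mulnDr natrD; move: H.
  by move: (p * A)%:R (p * m)%:R => *; lra.
rewrite (@mass_split_total ps N' A D) //; last exact: ltnW.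
have DAm : (D <= A + m)%N by exact: leq_trans DA (leq_addr _ _).
have ANm : (A + m <= N' + m)%N by rewrite leq_add2r ltnW.
rewrite (@mass_split_total (shiftr ps m) (N' + m) (A + m) D) ?unitp_shiftr //.
have HM := HK N' ps sps ups; rewrite (@mass_split_total ps N' A D) // in HM; last exact: ltnW.
rewrite (_ : (A + m - D).+1 = (A - D).+1 + m)%N; last by rewrite addSn addnBAC.
rewrite -addSn big_addn addnK.
set X' := \sum_(_ <= k < _) _; set X := \sum_(_ <= k < _) _ in HM *.
have q_ge0 k : 0 <= mass (shiftp p ps k) (N' - k) (no_renewal p 0 (A - k)) by exact: mass_ge0.
have HX : `|X' * Z (n + N') - X * Z (n + N' + m)| <= e1 * (X * Z (n + N' + m)).
  rewrite /X' /X !mulr_suml -sumrB mulr_sumr; apply: (le_trans (ler_norm_sum _ _ _)).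
  rewrite big_nat [leRHS]big_nat; apply: ler_sum => k /andP[kA _].
  rewrite shiftp_shiftr !subnDr.
  have -> : Z (k + m) * mass (shiftp p ps k) (N' - k) (no_renewal p 0 (A - k)) * Z (n + N') -
     Z k * mass (shiftp p ps k) (N' - k) (no_renewal p 0 (A - k)) * Z (n + N' + m) =
     (Z (k + m) * Z (n + N') - Z k * Z (n + N' + m)) * mass (shiftp p ps k) (N' - k) (no_renewal p 0 (A - k)).
    by move: (Z (k + m)) (Z k) (Z _) (Z _) (mass _ _ _) => *; ring.
  rewrite normrM [X in _ * X]ger0_norm //.
  rewrite [leRHS](_ : _ = e1 * (Z k * Z (n + N' + m)) * mass (shiftp p ps k) (N' - k) (no_renewal p 0 (A - k))).
    apply: ler_wpM2r => //; apply: Hk0; first by move: kA; rewrite /A addnK => /ltnW.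
    exact: leq_trans (leq_trans (leq_addr D k0) (ltnW AN)) (leq_addl _ _).
  by move: (Z k) (Z _) (mass _ _ _) => *; ring.
have z1 := Zgt0 (n + N'); have z2 := Zgt0 (n + N' + m).
have T10 := mass_ge0 p g ps N' (no_renewal p (A - D) A).
have T20 := mass_ge0 p g (shiftr ps m) (N' + m) (no_renewal p (A + m - D) (A + m)).
have eE : e1 * (2 + K) = eps by rewrite /e1 divfK // gt_eqF // addr_gt0.
move: T1 T2 HM HX z1 z2 T10 T20; rewrite -eE; clearbody X X'.
move: (mass ps N' (no_renewal p (A - D) A)) (mass (shiftr ps m) (N' + m) (no_renewal p (A + m - D) (A + m))).
move: (Z (n + N')) (Z (n + N' + m)) => a b t1 t2 T1 T2 HM HX a0 b0 T10 T20.
have E : (t2 + X') / b - (t1 + X) / a = t2 / b - t1 / a + (X' * a - X * b) / (a * b).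
  by field; rewrite !gt_eqF.
have n1 : `|(X' * a - X * b) / (a * b)| <= e1 * K.
  have ab0 : 0 < a * b by rewrite mulr_gt0.
  rewrite normrM normfV (gtr0_norm ab0) ler_pdivrMr //; apply: (le_trans HX).
  have XK : X <= K * a by lra.
  rewrite -[leRHS]mulrA ler_pM2l // [leRHS]mulrA ler_pM2r //.
have n2 : 0 <= t2 / b <= e1 by rewrite divr_ge0 ?(ltW b0) //= ler_pdivrMr.
have n3 : 0 <= t1 / a <= e1 by rewrite divr_ge0 ?(ltW a0) //= ler_pdivrMr.
rewrite E; apply: (le_trans (ler_normD _ _)).
have : `|t2 / b - t1 / a| <= e1.
  by move: (t2 / b) (t1 / a) n2 n3 => u v /andP[? ?] /andP[? ?]; rewrite ler_norml; apply/andP; split; lra.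
by move: `|_| n1 `|_| => *; lra.
Qed.

(** Mirrors the orbital range from 0 to [p * N.-1]; the angular factor is inverted as well, to match
    the inversion of the variables. *)
Definition reflp (N : nat) (ps : seq (R * C)) : seq (R * C) :=
  [seq ((p * N.-1)%:R - q.1, q.2^-1) | q <- ps].

Lemma nc_inv_unit (z : C) : nc z == 1 -> nc z^-1 == 1.
Proof.
move=> /eqP z1; have z0 : z != 0.
  by apply/eqP => z0; move: z1; rewrite z0 ComplexField.Normc.normc0 => /eqP; rewrite eq_sym oner_eq0.
have : nc (z * z^-1) = 1 by rewrite mulfV // ComplexField.Normc.normc1.
by rewrite ComplexField.Normc.normcM z1 mul1r => ->.
Qed.

Lemma unitp_reflp N ps : unitp ps -> unitp (reflp N ps).
Proof. by rewrite /unitp /reflp all_map; apply: sub_all => q /=; exact: nc_inv_unit. Qed.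

Lemma point_val_neq0 (q : R * C) : nc q.2 == 1 -> point_val g q != 0.
Proof.
move=> q1; apply/eqP => e; have := nc_point_val g q1; rewrite e ComplexField.Normc.normc0 => /esym/eqP.
by rewrite gt_eqF ?expR_gt0.
Qed.

Lemma sumn_subn D m : all (fun j => j <= D)%N m ->
  (sumn (map (subn D) m) + sumn m = size m * D)%N.
Proof. by elim: m => //= j m IH /andP[jD /IH]; lia. Qed.

Lemma ssq_subn D m : all (fun j => j <= D)%N m ->
  ssq R (map (subn D) m) = (size m)%:R * D%:R ^+ 2 - 2 * D%:R * (sumn m)%:R + ssq R m.
Proof.
rewrite /ssq; elim: m => [|j m IH] /=; first by rewrite !big_nil mulr0 mul0r subrr addr0.
case/andP=> jD /IH E; rewrite !big_cons E natrB // natrD -natr1; ring.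
Qed.

Lemma bin2_double N : (2 * 'C(N, 2) = N * N.-1)%N.
Proof. by rewrite bin2; have := odd_double_half (N * N.-1); rewrite oddM; case: N => // N; rewrite /= -?mul2n; case: (odd N) => /=; lia. Qed.

Lemma cweight_refl ps mu : unitp ps -> all (fun j => j <= p * (size ps + size mu).-1)%N mu ->
  cweight (reflp (size ps + size mu) ps) (map (subn (p * (size ps + size mu).-1)) mu) = cweight ps mu.
Proof.
move=> ups; set N := (size ps + size mu)%N; set D := (p * N.-1)%N => muD.
pose zs := map (point_val g) ps; pose mu' := map (subn D) mu.
have zs0 : all (fun x => x != 0) zs.
  by rewrite /zs all_map; apply: sub_all ups => q /=; exact: point_val_neq0.
have szs : size zs = size ps by rewrite size_map.
have E1 : nc (cfz (map GRing.inv zs) mu') * nc (\prod_(z <- zs) z) ^+ D = nc (cfz zs mu).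
  have := @cfz_refl C p p0 zs mu zs0; rewrite szs -/N -/D => /(_ muD).
  by rewrite !nc_norm -rmorphXn -!rmorphM => /complexI.
pose c : C := (expR (g * D%:R))%:C%C.
have cz : map (point_val g) (reflp N ps) = [seq c * z | z <- map GRing.inv zs].
  rewrite /reflp /zs -!map_comp; apply: eq_map => q /=.
  rewrite /point_val /= -/D invfM mulrA /c -(rmorphV (real_complex R)) ?unitfE ?gt_eqF ?expR_gt0 //=.
  by rewrite -rmorphM /= -expRN -expRD; congr ((expR _)%:C%C * _); ring.
have := congr1 (@ComplexField.Normc.normc R) (cfzZ p c (map GRing.inv zs) mu').
rewrite -cz !ComplexField.Normc.normcM !ncX nc_real ger0_norm ?expR_ge0 //.
rewrite !size_map -/N -!expRM_natl => E2.
rewrite nc_prod_point_val // -expRM_natl in E1.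
have sE : (sumn mu')%:R = (size mu)%:R * D%:R - (sumn mu)%:R :> R.
  by have /(congr1 (fun k => k%:R : R)) := sumn_subn muD; rewrite natrD natrM => <-; rewrite addrK.
have bE : (p * 'C(N, 2))%:R = N%:R * D%:R / 2 :> R.
  have /(congr1 (fun k => k%:R : R)) := bin2_double N; rewrite natrM natrM => H.
  have {}H : ('C(N, 2))%:R = N%:R * N.-1%:R / 2 :> R by lra.
  by rewrite /D 2!natrM H; field.
rewrite sE bE in E2.
rewrite /cweight -/zs -/mu' !size_map -/N ssq_subn // -E1.
have -> : \sum_(q <- reflp N ps) q.1 ^+ 2 = (size ps)%:R * D%:R ^+ 2 - 2 * D%:R * (\sum_(q <- ps) q.1) +
   \sum_(q <- ps) q.1 ^+ 2.
  rewrite /reflp big_map; elim: (ps) => [|q qs IH]; first by rewrite !big_nil mulr0 mul0r subrr addr0.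
  by rewrite !big_cons IH /= -natr1 -/D; ring.
set Y := nc (cfz _ mu') in E2 *; set X := nc (cfz (map GRing.inv zs) mu') in E2 *.
have {E2}-> : Y = expR (N%:R * D%:R / 2 * (g * D%:R) - ((size mu)%:R * D%:R - (sumn mu)%:R) * (g * D%:R)) * X.
  rewrite expRB mulrAC -E2; set e := expR _.
  by rewrite mulrAC mulfV ?mul1r // gt_eqF ?expR_gt0.
move: (\sum_(q <- ps) q.1) (\sum_(q <- ps) q.1 ^+ 2) => S1 S2.
have NE : N%:R = (size ps)%:R + (size mu)%:R :> R by rewrite /N natrD.
rewrite !exprMn -!expRM_natl.
transitivity (X ^+ 2 * expR (- gs_energy N + - g * ((size ps)%:R * D%:R ^+ 2 - 2 * D%:R * S1 + S2) +
  2 * (N%:R * D%:R / 2 * (g * D%:R) - ((size mu)%:R * D%:R - (sumn mu)%:R) * (g * D%:R)) +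
  g * ((size mu)%:R * D%:R ^+ 2 - 2 * D%:R * (sumn mu)%:R + ssq R mu))).
  by rewrite !expRD; ring.
transitivity (X ^+ 2 * expR (- gs_energy N + - g * S2 + 2 * (D%:R * (g * S1)) + g * ssq R mu)); last first.
  by rewrite !expRD; ring.
by congr (_ * expR _); rewrite NE; field.
Qed.

Lemma mass_refl ps N' : unitp ps ->
  mass (reflp (size ps + N') ps) N' tot = mass ps N' tot.
Proof.
move=> ups; set N := (size ps + N')%N; set D := (p * N.-1)%N.
have [N0|N0] := posnP N.
  have ps0 : ps = [::] by apply/size0nil; move: N0; rewrite /N; lia.
  by rewrite ps0.
have DN : (D.+1 <= p * N)%N by rewrite ltn_mul2l p0 /=; move: N0; case: (N).
rewrite /mass size_map -/N /isum; congr (_ * _).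
have sup qs : size qs = size ps -> forall m, size m = N' -> ~~ all (fun j => j < D.+1)%N m -> cweight qs m = 0.
  by move=> sq m sm; apply: contraNeq => /cweight_supp; rewrite sq sm.
rewrite (@tsum_iota_le _ D.+1 (p * N)) //; last by apply: sup; rewrite size_map.
rewrite (@tsum_iota_le _ D.+1 (p * N)) //; last exact: sup.
rewrite -(tsum_perm _ _ (perm_iota_subn p0 D)) tsum_map; apply: eq_tsum_in => m sm mD.
have aD : all (fun j => j <= D)%N m by apply/allP => j /mD; rewrite mem_iota.
have := @cweight_refl ps m ups; rewrite sm -/N -/D => /(_ aD) H; exact: H.
Qed.

Lemma reflp_shift ps N m : (0 < N)%N -> reflp (N + m) ps = shiftr (reflp N ps) m.
Proof.
move=> N0; rewrite /reflp /shiftr -map_comp; apply: eq_map => q /=; congr (_, _).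
rewrite (_ : (N + m).-1 = N.-1 + m)%N; last by lia.
by rewrite mulnDr natrD; ring.
Qed.

(** Reflection reduces this to the left edge. The orbitals of [N] particles end at [p * N.-1],
    whence the extra [p] in the margin. *)
Lemma right_shift n (eps : R) : 0 < eps -> exists2 d : R, 0 <= d & exists N0 : nat, forall N' m ps,
  size ps = n -> unitp ps -> all (fun q => q.1 <= (p * (n + N'))%:R - d) ps -> (N0 <= N')%N ->
  `|mass ps (N' + m) tot / Z (n + N' + m) - mass ps N' tot / Z (n + N')| <= eps.
Proof.
move=> e0; have [d d0 [N0 H]] := left_shift n e0.
exists (d + p%:R); first by rewrite addr_ge0 ?ler0n.
exists N0.+1 => N' m ps sps ups Hps N0N.
have nN : (0 < n + N')%N by lia.
rewrite -(mass_refl N' ups) -(mass_refl (N' + m) ups) sps addnA reflp_shift //.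
apply: H; rewrite ?size_map ?unitp_reflp //; last exact: ltnW.
rewrite /reflp all_map; apply: sub_all Hps => q /=.
have -> : (p * (n + N'))%:R = (p * (n + N').-1)%:R + p%:R :> R.
  by rewrite -natrD -mulnSr prednK.
by move: (_%:R) p%:R => *; lra.
Qed.

Lemma bulk_shift n (eps : R) : 0 < eps -> exists2 d : R, 0 <= d & exists N0 : nat, forall N' a b ps,
  size ps = n -> unitp ps -> all (fun q => d <= q.1) ps ->
  all (fun q => q.1 <= (p * (n + N'))%:R - d) ps -> (N0 <= N')%N ->
  `|mass (shiftr ps a) (N' + a + b) tot / Z (n + (N' + a + b)) - mass ps N' tot / Z (n + N')| <= eps.
Proof.
move=> e0; have e20 : 0 < eps / 2 by rewrite divr_gt0.
have [d1 d10 [N1 H1]] := left_shift n e20; have [d2 d20 [N2 H2]] := right_shift n e20.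
exists (d1 + d2); first by rewrite addr_ge0.
exists (N1 + N2)%N => N' a b ps sps ups Hl Hr NN.
have A1 : `|mass (shiftr ps a) (N' + a) tot / Z (n + N' + a) - mass ps N' tot / Z (n + N')| <= eps / 2.
  by apply: H1 => //; [apply: sub_all Hl => q /=; lra | lia].
have A2 : `|mass (shiftr ps a) (N' + a + b) tot / Z (n + (N' + a) + b) -
    mass (shiftr ps a) (N' + a) tot / Z (n + (N' + a))| <= eps / 2.
  apply: H2; rewrite ?size_map ?unitp_shiftr //; last by clear -NN; lia.
  rewrite all_map; apply: sub_all Hr => q /=.
  have -> : (p * (n + (N' + a)))%:R = (p * (n + N'))%:R + (p * a)%:R :> R by rewrite addnA mulnDr natrD.
  by move: (p * (n + N'))%:R (p * a)%:R => *; lra.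
rewrite !addnA in A1 A2 *; apply: le_trans (ler_distD (mass (shiftr ps a) (N' + a) tot / Z (n + N' + a)) _ _) _.
by move: (`|_|) (`|_|) A1 A2 => *; lra.
Qed.

End Bulk.

(** * Angular averages of correlations *)

Section Correlation.
Variables (R : realType) (p : nat) (g : R).
Local Notation C := R[i].
Hypothesis p0 : (0 < p)%N.
Hypothesis g0 : 0 < g.
Local Notation cf := (@cf C p).
Local Notation cfz := (@cfz C p).
Local Notation cweight := (@cweight R p g).
Local Notation Z := (@Z R p g).
Local Notation gs_energy := (@gs_energy R p g).
Local Notation mass := (@mass R p g).
Local Notation tot := (xpredT : pred (seq nat)).

Let Zgt0 N : 0 < Z N. Proof. exact: lt_le_trans ltr01 (Z_ge1 g p0 N). Qed.

Definition root_pts (xs : seq R) (M : nat) (ys : seq nat) : seq (R * C) :=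
  zip xs [seq ee (y%:R / M%:R) | y <- ys].

Lemma unitp_root_pts xs M ys : unitp (root_pts xs M ys).
Proof.
rewrite /root_pts; elim: xs ys => [|x xs IH] [|y ys] //=.
by rewrite cos2Dsin2 sqrtr1 eqxx IH.
Qed.

Lemma size_root_pts xs M ys : size ys = size xs -> size (root_pts xs M ys) = size xs.
Proof. by move=> s; rewrite /root_pts size_zip size_map s minnn. Qed.

Definition exp_prod (xs : seq R) (m : seq nat) : R :=
  prod_zip [seq (fun j : nat => expR (2 * g * j%:R * x)) | x <- xs] m.

Definition gauss_prod (xs : seq R) (m : seq nat) : R :=
  prod_zip [seq (fun j : nat => expR (- (g * (x - j%:R) ^+ 2))) | x <- xs] m.

Lemma gauss_prod_ge0 xs m : 0 <= gauss_prod xs m.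
Proof.
by rewrite /gauss_prod; elim: xs m => [|q ps IH] [|j m] //=; rewrite mulr_ge0 ?expR_ge0.
Qed.

Lemma gauss_prod_split xs m : size m = size xs ->
  gauss_prod xs m = expR (- g * \sum_(x <- xs) x ^+ 2) * exp_prod xs m * expR (- (g * ssq R m)).
Proof.
elim: xs m => [|x xs IH] [|j m] //=.
  by rewrite /gauss_prod /exp_prod /ssq !big_nil /= !mulr0 oppr0 expR0 !mulr1.
case=> sm; rewrite /gauss_prod /exp_prod /= -/(gauss_prod xs m) -/(exp_prod xs m) IH // /ssq !big_cons.
rewrite !mulrDr opprD !expRD.
have -> : expR (- (g * (x - j%:R) ^+ 2)) = expR (- g * x ^+ 2) * expR (2 * g * j%:R * x) *
   expR (- (g * j%:R ^+ 2)).
  by rewrite -!expRD; congr expR; ring.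
by move: (expR (- g * x ^+ 2)) (expR (- g * _)) (exp_prod _ _) => *; ring.
Qed.

Lemma parseval_point (B : nat -> C) x M :
  \sum_(y <- iota 0 M) nc (\sum_(j <- iota 0 M) B j * point_val g (x, ee (y%:R / M%:R)) ^+ j) ^+ 2 =
  M%:R * \sum_(j <- iota 0 M) nc (B j) ^+ 2 * expR (2 * g * j%:R * x).
Proof.
apply: (@complexI R); have := parseval1 g (fun=> 1) B [:: x] M.
rewrite /grid big_allpairs_dep big_seq1 => E.
rewrite rc_sum [RHS](_ : _ = \sum_(j <- iota 0 M) B j * (B j)^*%C * kap g (fun=> 1) [:: x] M j).
  by rewrite -E; apply: eq_bigr => y _; rewrite -conjc_nc [RHS]mul1r.
rewrite rcM rc_sum mulr_sumr; apply: eq_bigr => j _; rewrite /kap big_seq1 mul1r conjc_nc rcM.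
rewrite (rmorph_nat (real_complex R)).
by move: (_%:C%C) (_%:C%C) (_%:R : C) => a b c; exact: mulrCA.
Qed.

Lemma parseval_points (A : seq nat -> C) xs M :
  tsum (iota 0 M) (size xs) (fun ys => nc (mval g M (size xs) A (root_pts xs M ys)) ^+ 2) =
  M%:R ^+ size xs * tsum (iota 0 M) (size xs) (fun m => nc (A m) ^+ 2 * exp_prod xs m).
Proof.
elim: xs A => [|x xs IH] A; first by rewrite /= /mval /= !mulr1 mul1r.
rewrite [size (x :: xs)]/= [LHS]tsumS [in RHS]tsumS.
pose Aq y m := \sum_(j <- iota 0 M) A (j :: m) * point_val g (x, ee (y%:R / M%:R)) ^+ j.
have mvE (y : nat) ys : mval g M (size xs).+1 A (root_pts (x :: xs) M (y :: ys)) =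
    mval g M (size xs) (Aq y) (root_pts xs M ys).
  rewrite /mval tsumS -tsum_sum; apply: eq_tsum => m _.
  by rewrite /Aq mulr_suml; apply: eq_bigr => j _; rewrite [mon _ _]/= mulrA.
rewrite (eq_bigr (fun y => M%:R ^+ size xs * tsum (iota 0 M) (size xs)
    (fun m => nc (Aq y m) ^+ 2 * exp_prod xs m))); last first.
  by move=> y _; rewrite -IH; apply: eq_tsum => ys _; rewrite mvE.
rewrite -mulr_sumr -tsum_sum exprSr -mulrA; congr (_ * _).
rewrite -tsum_sum -tsumZ; apply: eq_tsum => m _.
rewrite -mulr_suml (parseval_point (fun j => A (j :: m))) -mulrA mulr_suml; congr (_ * _).
by apply: eq_bigr => j _; rewrite /exp_prod /= mulrA.
Qed.

(* The correlation function of [N] particles at abscissae [xs], averaged over the angles. *)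
Definition avg_corr (N : nat) (xs : seq R) : R :=
  tsum (iota 0 (p * N)) (size xs) (fun m => gauss_prod xs m *
    isum (iota 0 (p * N)) (N - size xs) (fun mu => cweight [::] (m ++ mu))) / Z N.

(** By Parseval, averaging over roots of unity removes the interference between orbitals of the
    observed points; only their Gaussian profiles remain. *)
Lemma avg_corr_avg N xs : (size xs <= N)%N ->
  tsum (iota 0 (p * N)) (size xs) (fun ys => mass (root_pts xs (p * N) ys) (N - size xs) tot) =
  (p * N)%:R ^+ size xs * Z N * avg_corr N xs.
Proof.
move=> kN; set M := (p * N)%N; set k := size xs; set N' := (N - k)%N.
have kN' : (k + N' = N)%N by rewrite subnKC.
transitivity (isum (iota 0 M) N' (fun mu => tsum (iota 0 M) k (fun ys => cweight (root_pts xs M ys) mu))).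
  rewrite /isum tsum_exch -tsumZ; apply: eq_tsum => ys sys.
  by rewrite /mass size_root_pts // -/k kN'.
have zipE (F : R -> R) ys : size ys = k -> \sum_(q <- root_pts xs M ys) F q.1 = \sum_(x <- xs) F x.
  rewrite /root_pts /k; elim: xs ys {kN N' kN'} @k => [|x xs' IH] [|y ys] //=; first by rewrite !big_nil.
  by move=> [s]; rewrite !big_cons IH.
transitivity (isum (iota 0 M) N' (fun mu => M%:R ^+ k *
   tsum (iota 0 M) k (fun m => gauss_prod xs m * cweight [::] (m ++ mu)))).
  apply: eq_isum => mu smu.
  transitivity (tsum (iota 0 M) k (fun ys => (expR (- gs_energy N) * expR (- g * \sum_(x <- xs) x ^+ 2) *
     expR (g * ssq R mu)) * nc (mval g M k (fun m => cf (m ++ mu)) (root_pts xs M ys)) ^+ 2)).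
    apply: eq_tsum => ys sys; rewrite /cweight size_root_pts // -/k smu kN' (zipE (fun x => x ^+ 2)) //.
    rewrite /cfz size_map size_root_pts // -/k smu kN' -/M -/(mval g M k (fun m => cf (m ++ mu)) _).
    by rewrite mulrAC.
  rewrite tsumZ parseval_points mulrCA; congr (_ * _); rewrite -tsumZ; apply: eq_tsum => m sm.
  rewrite gauss_prod_split // /cweight /= cfz0 size_cat sm smu -/k kN' big_nil mulr0 expR0 mulr1 ssq_cat mulrDr expRD.
  have := expRxMexpNx_1 (g * ssq R m).
  move: (expR (- gs_energy N)) (expR (- g * _)) (expR (g * ssq R mu)) (exp_prod _ _) (nc _) => a b c d e.
  move: (expR (g * ssq R m)) (expR (- (g * ssq R m))) => u v uv.
  transitivity ((u * v) * (a * b * c * (e ^+ 2 * d))); first by rewrite uv mul1r.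
  by clear uv; ring.
rewrite isumZ -mulrA; congr (_ * _); rewrite /avg_corr -/k -/N' -/M mulrC divfK ?gt_eqF //.
rewrite /isum tsum_exch -tsumZ; apply: eq_tsum => m _.
by rewrite tsumZ mulrCA.
Qed.

Lemma avg_corr_ge0 N xs : 0 <= avg_corr N xs.
Proof.
rewrite /avg_corr divr_ge0 ?(ltW (Zgt0 N)) //; apply: tsum_ge0 => m _; rewrite mulr_ge0 ?gauss_prod_ge0 //.
by apply: isum_ge0 => *; exact: cweight_ge0.
Qed.

Lemma tsum_const (X : Type) (rs : seq X) n (c : R) : tsum rs n (fun=> c) = (size rs)%:R ^+ n * c.
Proof.
elim: n => [|n IH] /=; first by rewrite mul1r.
by rewrite big_const_seq count_predT iter_addr_0 IH exprS -mulrA mulr_natl.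
Qed.

Lemma avg_corr_diff N xs xs' (e : R) : (0 < N)%N -> (size xs <= N)%N -> size xs' = size xs ->
  (forall ys, size ys = size xs -> {subset ys <= iota 0 (p * N)} ->
    `|mass (root_pts xs' (p * N) ys) (N - size xs) tot - mass (root_pts xs (p * N) ys) (N - size xs) tot| <= e * Z N) ->
  `|avg_corr N xs' - avg_corr N xs| <= e.
Proof.
move=> N0 kN sx H; have M0 : 0 < (p * N)%:R ^+ size xs :> R by rewrite exprn_gt0 // ltr0n muln_gt0 p0.
have MZ : 0 < (p * N)%:R ^+ size xs * Z N by rewrite mulr_gt0.
have := avg_corr_avg kN; have := @avg_corr_avg N xs'; rewrite sx => /(_ kN) E' E.
rewrite -(ler_pM2l MZ) -{1}(gtr0_norm MZ) -normrM mulrBr -E -E' -tsumB.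
apply: (le_trans (ler_norm_tsum _ _ _)).
apply: (@le_trans _ _ (tsum (iota 0 (p * N)) (size xs) (fun=> e * Z N))).
  by apply: le_tsum_in => ys sys ysr; apply: H.
by rewrite tsum_const size_iota -[leRHS]mulrA [Z N * e]mulrC.
Qed.

Lemma avg_corr_bounded k : exists2 K : R, 0 < K & forall N xs, size xs = k -> (k <= N)%N -> avg_corr N xs <= K.
Proof.
have [K K0 HK] := mass_bound p0 g0 k; exists (K + 1); first by rewrite addr_gt0.
move=> N xs sx kN; case: (posnP N) => [N0|N0].
  have xs0 : xs = [::] by apply/size0nil; rewrite sx; lia.
  rewrite xs0 N0 /avg_corr /= mul1r /isum /= invr1 mul1r -/(Z 0).
  have -> : cweight [::] [::] = Z 0 by rewrite /Z /mass /isum /= invr1 mul1r.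
  by rewrite divff ?gt_eqF // lerDr ltW.
have M0 : 0 < (p * N)%:R ^+ k :> R by rewrite exprn_gt0 // ltr0n muln_gt0 p0.
have MZ : 0 < (p * N)%:R ^+ k * Z N by rewrite mulr_gt0.
have := @avg_corr_avg N xs; rewrite sx => /(_ kN) E.
apply: (@le_trans _ _ K); last by rewrite lerDl.
rewrite -(ler_pM2l MZ) -E; apply: (@le_trans _ _ (tsum (iota 0 (p * N)) k (fun=> K * Z N))).
  apply: le_tsum => ys sys; rewrite -{3}(subnKC kN); apply: HK; last exact: unitp_root_pts.
  by rewrite size_root_pts ?sx.
by rewrite tsum_const size_iota -[leRHS]mulrA [Z N * K]mulrC.
Qed.

Lemma avg_corr_nil N : avg_corr N [::] = 1.
Proof.
rewrite /avg_corr /= mul1r subn0; have -> : isum (iota 0 (p * N)) N (fun mu => cweight [::] mu) = Z N by [].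
by rewrite divff // gt_eqF.
Qed.

(** Summing over the new point makes the Gaussian of its orbital nearly constant, and its particle
    becomes one of the [N - size xs] unobserved ones. *)
Lemma avg_corr_sum N xs (ss : seq R) (A B : R) : (size xs < N)%N ->
  (forall j, (j < p * N)%N -> A <= \sum_(x <- ss) expR (- (g * (x - j%:R) ^+ 2)) <= B) ->
  A * (N - size xs)%:R * avg_corr N xs <= \sum_(x <- ss) avg_corr N (x :: xs) <= B * (N - size xs)%:R * avg_corr N xs.
Proof.
move=> kN HAB; set k := size xs; set rs := iota 0 (p * N).
pose T j := tsum rs k (fun m => gauss_prod xs m * isum rs (N - k.+1) (fun mu => cweight [::] (j :: m ++ mu))).
have T0 j : 0 <= T j.
  apply: tsum_ge0 => m _; rewrite mulr_ge0 ?gauss_prod_ge0 //; apply: isum_ge0 => *; exact: cweight_ge0.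
have E1 : \sum_(x <- ss) avg_corr N (x :: xs) =
    (\sum_(j <- rs) (\sum_(x <- ss) expR (- (g * (x - j%:R) ^+ 2))) * T j) / Z N.
  rewrite /avg_corr -mulr_suml; congr (_ / _); under [RHS]eq_bigr do rewrite mulr_suml.
  rewrite [RHS]exchange_big /=; apply: eq_bigr => x _; apply: eq_bigr => j _.
  by rewrite /T -tsumZ; apply: eq_tsum => m _; exact: (esym (mulrA _ _ _)).
have E2 : (N - k)%:R * avg_corr N xs = (\sum_(j <- rs) T j) / Z N.
  rewrite /avg_corr mulrA; congr (_ / _); rewrite /T -tsum_sum -tsumZ; apply: eq_tsum => m _.
  rewrite mulrCA -mulr_sumr; congr (_ * _); rewrite -/k.
  rewrite (_ : N - k = (N - k.+1).+1)%N; last by rewrite subnSK.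
  rewrite {1}/isum tsumS factS natrM invfM !mulrA mulfV ?pnatr_eq0 // mul1r mulr_sumr.
  apply: eq_bigr => j _; rewrite /isum; congr (_ * _); apply: eq_tsum => mu _; apply: cweight_perm.
  by rewrite -[j :: mu]cat1s -[j :: m ++ mu]/([:: j] ++ m ++ mu) perm_catCA.
rewrite -!mulrA E2 E1 !mulrA !mulr_sumr; apply/andP; split.
  rewrite ler_pM2r ?invr_gt0 // big_seq [leRHS]big_seq; apply: ler_sum => j; rewrite mem_iota => jr.
  by have /andP[H _] := HAB j jr; apply: ler_wpM2r.
rewrite ler_pM2r ?invr_gt0 // big_seq [leRHS]big_seq; apply: ler_sum => j; rewrite mem_iota => jr.
by have /andP[_ H] := HAB j jr; apply: ler_wpM2r.
Qed.

(** The limit is the sum of [expR (- (g * (i + x) ^+ 2))] over all integers [i]. It may depend on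
    [x], because the average runs over integers and not over the line. *)
Lemma thetax (x : R) : exists2 th : R, 0 < th & forall e, 0 < e -> exists B0, forall B M j,
  (B0 <= B)%N -> (j <= M)%N ->
  th - e <= \sum_(s <- box R B M) expR (- (g * (s + x - j%:R) ^+ 2)) <= th.
Proof.
pose t B := \sum_(0 <= i < B.*2.+1) expR (- (g * (i%:R - B%:R + x) ^+ 2)).
have tmono B B' : (B <= B')%N -> t B <= t B'.
  move=> BB; rewrite /t; pose d := (B' - B)%N.
  apply: (@le_trans _ _ (\sum_(d <= i < B.*2.+1 + d) expR (- (g * (i%:R - B'%:R + x) ^+ 2)))).
    rewrite big_nat_shift le_eqVlt; apply/orP; left; apply/eqP; apply: eq_bigr => i _.
    by rewrite natrD /d natrB //; congr (expR (- (_ * _ ^+ 2))); ring.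
  by apply: sum_nat_widen; [move=> i; exact: expR_ge0 | by [] | rewrite /d; lia].
have [K K1 HK] := exp_sum_le g0.
have tb B : t B <= expR g * K.
  apply: (@le_trans _ _ (expR g * \sum_(0 <= i < B.*2.+1) expR (- (g * `|i%:R - (B%:R - x)|)))).
    rewrite mulr_sumr; apply: ler_sum => i _; rewrite -expRD ler_expR.
    rewrite (_ : i%:R - (B%:R - x) = i%:R - B%:R + x); last by ring.
    move: (_ - _ + x) => y; rewrite -(real_normK (num_real y)); move: `|y| => z.
    have : 0 <= g * (z - 2^-1) ^+ 2 by rewrite mulr_ge0 ?sqr_ge0 // ltW.
    by rewrite expr2; move: g0; nra.
  by rewrite ler_pM2l ?expR_gt0.
pose E := [set t B | B in [set: nat]]%classic.
have Es : has_sup E.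
  by split; [exists (t 0%N); exists 0%N | exists (expR g * K) => _ [B _ <-]].
have tsup B : t B <= sup E by apply: (ub_le_sup Es.2); exists B.
exists (sup E).
  by apply: lt_le_trans (tsup 0%N); rewrite /t big_nat1 expR_gt0.
move=> e e0; have [_ [B0 _ <-] HB0] := sup_adherent e0 Es.
exists B0 => B M j BB jM; rewrite /box big_map -[iota 0 _]/(index_iota 0 (B.*2 + M).+1).
apply/andP; split.
  apply: (le_trans (ltW HB0)); apply: (le_trans (tmono _ _ BB)).
  apply: (@le_trans _ _ (\sum_(j <= i < B.*2.+1 + j) expR (- (g * (i%:R - B%:R + x - j%:R) ^+ 2)))).
    rewrite big_nat_shift le_eqVlt; apply/orP; left; apply/eqP; apply: eq_bigr => i _.
    by rewrite natrD; congr (expR (- (_ * _ ^+ 2))); ring.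
  by apply: sum_nat_widen; [move=> i; exact: expR_ge0 | by [] | lia].
apply: le_trans (tsup (B + M + j)%N); rewrite /t.
apply: (@le_trans _ _ (\sum_(M <= i < (B.*2 + M).+1 + M) expR (- (g * (i%:R - (B + M + j)%:R + x) ^+ 2)))).
  rewrite big_nat_shift le_eqVlt; apply/orP; left; apply/eqP; apply: eq_bigr => i _.
  by rewrite !natrD; congr (expR (- (_ * _ ^+ 2))); ring.
by apply: sum_nat_widen; [move=> i; exact: expR_ge0 | by [] | lia].
Qed.

Definition inbulk (d : nat) (N : nat) (xs : seq R) :=
  all (fun x => d%:R <= x <= (p * N)%:R - d%:R) xs.

Definition asym_inv (tau c : R) (k : nat) := forall e, 0 < e -> exists d N0 : nat, forall N xs,
  (N0 <= N)%N -> size xs = k -> inbulk d N xs ->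
  `|avg_corr N [seq x + tau | x <- xs] - c * avg_corr N xs| <= e.

Lemma count_outside n a b : \sum_(i <- iota 0 n) (if (a <= i)%N && (i + b < n)%N then 0 else 1) <= (a + b)%:R :> R.
Proof.
apply: (@le_trans _ _ (\sum_(i <- iota 0 n) ((if (i < a)%N then 1 else 0) + (if (n <= i + b)%N then 1 else 0)))).
  apply: ler_sum => i _; case: (leqP a i) => _; case: (leqP n (i + b)) => _ /=; lra.
rewrite big_split /= natrD; apply: lerD.
  elim: n => [|n IH]; first by rewrite big_nil ler0n.
  rewrite -addn1 iotaD big_cat /= big_seq1 add0n; case: ltnP => na; last by rewrite addr0.
  apply: (@le_trans _ _ (n%:R + 1)); last by rewrite natr1 ler_nat.
  rewrite lerD2r; apply: (@le_trans _ _ (\sum_(i <- iota 0 n) 1)).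
    by apply: ler_sum => i _; case: ifP.
  by rewrite big_const_seq count_predT size_iota iter_addr_0.
have [nb|bn] := leqP n b.
  apply: (@le_trans _ _ (\sum_(i <- iota 0 n) 1)).
    by apply: ler_sum => i _; case: ifP.
  by rewrite big_const_seq count_predT size_iota iter_addr_0 ler_nat.
rewrite -{1}(subnK (ltnW bn)) iotaD big_cat /= add0n big1_seq ?add0r; last first.
  move=> i; rewrite mem_iota => /andP[_ /andP[_ ib]]; rewrite ifF //; lia.
apply: (@le_trans _ _ (\sum_(i <- iota (n - b) b) 1)).
  by apply: ler_sum => i _; case: ifP.
by rewrite big_const_seq count_predT size_iota iter_addr_0.
Qed.

(* Averaging the last point over the integers in the bulk multiplies [F_k] by the number
   of remaining particles, up to edge effects. *)
Lemma asym_inv_step (tau : R) : exists2 r : R, 0 < r & forall c k, 0 <= c ->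
  asym_inv tau c k.+1 -> asym_inv tau (c * r) k.
Proof.
have [th0 th00 H0] := thetax 0; have [tht tht0 Ht] := thetax tau.
exists (th0 / tht); first by rewrite divr_gt0.
move=> c k c0 HA e e0.
have [K1 K10 HK1] := avg_corr_bounded k; have [K2 K20 HK2] := avg_corr_bounded k.+1.
pose C' := 2 * p%:R + 2 + K1 * (1 + c).
have C'0 : 0 < C'.
  have : 0 <= K1 * (1 + c) by rewrite mulr_ge0 ?addr_ge0 // ltW.
  by have : 0 <= p%:R :> R by [rewrite ler0n]; rewrite /C'; lra.
pose eta := e * tht / C'; have eta0 : 0 < eta by rewrite divr_gt0 // mulr_gt0.
have [d1 [N1 HN1]] := HA eta eta0.
have [B0 HB0] := H0 eta eta0; have [Bt HBt] := Ht eta eta0.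
pose B := (B0 + Bt)%N.
(* A number of particles from which on the abscissae near the edges, where the hypothesis says
   nothing, contribute at most [eta] per particle. *)
pose Q := K2 * (1 + c) * (2 * (B + d1))%:R / eta.
pose Nq := (Num.truncn Q).+1.
have HQ : Q < Nq%:R by exact: truncnS_gt.
clearbody Nq.
exists d1, (N1 + 2 * k + 2 * Nq + 4 * B + 2)%N => N xs NN sx bx.
set n := (N - k)%N.
have [nN nB nQ kN N1N] : [/\ (N <= 2 * n)%N, (2 * B + 1 <= n)%N, (Nq <= n)%N, (k < N)%N & (N1 <= N)%N].
  by rewrite /n; split; clear -NN; lia.
set M := (p * N)%N; set f := avg_corr N xs; set f' := avg_corr N [seq x + tau | x <- xs].
have f0 : 0 <= f by exact: avg_corr_ge0.
have f'0 : 0 <= f' by exact: avg_corr_ge0.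
have fK : f <= K1 by apply: HK1 => //; exact: ltnW.
have f'K : f' <= K1 by apply: HK1; rewrite ?size_map //; exact: ltnW.
have A0 : (th0 - eta) * n%:R * f <= \sum_(x <- box R B M) avg_corr N (x :: xs) <= th0 * n%:R * f.
  have := @avg_corr_sum N xs (box R B M) (th0 - eta) th0; rewrite sx; apply => // j jM.
  have := HB0 B M j (leq_addr _ _) (ltnW jM).
  by under eq_bigr do rewrite addr0.
have At : (tht - eta) * n%:R * f' <= \sum_(x <- box R B M) avg_corr N ((x + tau) :: [seq x + tau | x <- xs])
    <= tht * n%:R * f'.
  have := @avg_corr_sum N [seq x + tau | x <- xs] [seq x + tau | x <- box R B M] (tht - eta) tht.
  rewrite size_map sx big_map; apply => // j jM; rewrite big_map.
  exact: HBt B M j (leq_addl _ _) (ltnW jM).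
have D : `|\sum_(x <- box R B M) avg_corr N ((x + tau) :: [seq x + tau | x <- xs]) -
     c * \sum_(x <- box R B M) avg_corr N (x :: xs)| <= (B.*2 + M).+1%:R * eta + K2 * (1 + c) * (2 * (B + d1))%:R.
  rewrite mulr_sumr -sumrB; apply: (le_trans (ler_norm_sum _ _ _)); rewrite /box big_map.
  apply: (@le_trans _ _ (\sum_(i <- iota 0 (B.*2 + M).+1) (eta + K2 * (1 + c) *
     (if (B + d1 <= i)%N && (i + (B + d1) < (B.*2 + M).+1)%N then 0 else 1)))).
    apply: ler_sum => i _; case: ifP => [/andP[i1 i2]|_].
      rewrite mulr0 addr0; apply: (HN1 N ((i%:R - B%:R) :: xs)) => //=; first by rewrite sx.
      rewrite bx andbT; apply/andP; split.
        by rewrite lerBrDr -natrD ler_nat addnC.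
      have : (i + d1)%:R <= (B + M)%:R :> R by rewrite ler_nat; clear -i2; lia.
      by rewrite /M !natrD; move: (_%:R) (_%:R) (_%:R) (_%:R) => *; lra.
    rewrite mulr1; apply: (@le_trans _ _ (K2 + c * K2)).
      rewrite ler_norml; have a1 : avg_corr N ((i%:R - B%:R + tau) :: [seq x + tau | x <- xs]) <= K2.
        by apply: HK2; rewrite //= size_map sx.
      have a2 : avg_corr N ((i%:R - B%:R) :: xs) <= K2 by apply: HK2; rewrite //= sx.
      have b1 := avg_corr_ge0 N ((i%:R - B%:R + tau) :: [seq x + tau | x <- xs]).
      have b2 := avg_corr_ge0 N ((i%:R - B%:R) :: xs).
      move: a1 a2 b1 b2; move: (avg_corr _ _) (avg_corr _ _) => u v a1 a2 b1 b2.
      have : c * u <= c * K2 by rewrite ler_wpM2l.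
      have : 0 <= c * u by rewrite mulr_ge0.
      by move=> *; apply/andP; split; lra.
    by rewrite mulrDr mulr1 [c * K2]mulrC lerDr ltW.
  rewrite big_split [X in X + _ <= _]big_const_seq count_predT size_iota iter_addr_0 -[eta *+ _]mulr_natl.
  rewrite lerD2l -mulr_sumr; apply: ler_wpM2l; first by rewrite mulr_ge0 ?addr_ge0 // ltW.
  by apply: (le_trans (count_outside _ _ _)); rewrite ler_nat mul2n -addnn.
have n0 : 0 < n%:R :> R by rewrite ltr0n /n subn_gt0.
have r1 : (B.*2 + M).+1%:R <= n%:R * (2 * p%:R + 1) :> R.
  rewrite -natrM natr1 -natrM ler_nat /M; clear -nN nB; nia.
have r2 : K2 * (1 + c) * (2 * (B + d1))%:R <= n%:R * eta.
  rewrite -ler_pdivrMr //; apply: (le_trans (ltW HQ)); by rewrite ler_nat.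
have key : n%:R * `|tht * f' - c * th0 * f| <= n%:R * (eta * C').
  rewrite -{1}(gtr0_norm n0) -normrM.
  move: A0 At D; move: (\sum_(_ <- _) _) (\sum_(_ <- _) _) => St S0 /andP[a1 a2] /andP[b1 b2] D.
  have c1 : c * ((th0 - eta) * n%:R * f) <= c * S0 by rewrite ler_wpM2l.
  have c2 : c * S0 <= c * (th0 * n%:R * f) by rewrite ler_wpM2l.
  have en : 0 <= eta * n%:R by rewrite mulr_ge0 // ltW.
  have d2 : eta * n%:R * f <= eta * n%:R * K1 by rewrite ler_wpM2l.
  have d2' : eta * n%:R * f' <= eta * n%:R * K1 by rewrite ler_wpM2l.
  have d3 : c * (eta * n%:R * f) <= c * (eta * n%:R * K1) by rewrite ler_wpM2l.
  have d4 : (B.*2 + M).+1%:R * eta <= n%:R * (2 * p%:R + 1) * eta by rewrite ler_wpM2r // ltW.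
  move: D; rewrite !ler_norml /C' => /andP[D1 D2].
  move: r2 c1 c2 d2 d2' d3 d4 a1 a2 b1 b2 D1 D2; move: (_.+1%:R * eta) (K2 * _ * _) => y1 y2.
  by move=> *; apply/andP; split; lra.
move: key; rewrite ler_pM2l // => key.
have -> : f' - c * (th0 / tht) * f = (tht * f' - c * th0 * f) / tht by field; rewrite gt_eqF.
rewrite normrM normfV (gtr0_norm tht0) ler_pdivrMr //; apply: (le_trans key).
by rewrite /eta divfK ?gt_eqF.
Qed.

(** Each descent multiplies by the same [r]. After [n] of them the correlation function without
    points, which is 1, forces [r ^+ n = 1], hence [r = 1] by positivity when [n > 0]. *)
Lemma asym_inv_descend (tau : R) n k : (k <= n)%N -> asym_inv tau 1 n -> asym_inv tau 1 k.
Proof.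
move=> kn HA; have [r r0 Hr] := asym_inv_step tau.
have desc j : (j <= n)%N -> asym_inv tau (r ^+ j) (n - j).
  elim: j => [|j IH] jn; first by rewrite expr0 subn0.
  rewrite exprSr; apply: Hr; first by rewrite exprn_ge0 // ltW.
  by rewrite subnSK //; apply: IH; exact: ltnW.
have rn : r ^+ n = 1.
  have := desc n (leqnn n); rewrite subnn => H0; apply/eqP; rewrite eq_sym -subr_eq0 -normr_le0.
  apply/ler_addgt0Pr => e e0; rewrite add0r; have [d [N0 H]] := H0 e e0.
  by have := H N0 [::] (leqnn _) erefl erefl; rewrite /= avg_corr_nil mulr1.
have r1 : n = 0%N \/ r = 1.
  case: (posnP n) => [->|n0]; [by left | right].
  by apply/eqP; rewrite -(pexpr_eq1 n0) ?rn // ltW.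
have := desc (n - k)%N (leq_subr _ _); rewrite subKn //.
case: r1 => [n0|->]; last by rewrite expr1n.
by rewrite n0 sub0n expr0.
Qed.

End Correlation.

(** * A test function for the winding phase *)

Section TestFunction.
Variables (R : realType) (g : R).
Hypothesis g0 : 0 < g.
Local Notation C := R[i].
Import numFieldNormedType.Exports.

Lemma abs_sin_le (x : R) : `|sin x| <= `|x|.
Proof.
wlog x0 : x / 0 < x => [H|].
  have [x0|x0|<-] := ltgtP 0 x; [exact: H | | by rewrite sin0].
  by rewrite -normrN -sinN -[leRHS]normrN; apply: H; rewrite oppr_gt0.
have cont : {within `[0, x]%classic, continuous (@sin R)}%classic.
  exact/continuous_subspaceT/continuous_sin.
have [c _ E] := @MVT R sin cos 0 x x0 (fun y _ => is_derive_sin y) cont.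
by move: E; rewrite sin0 !subr0 => ->; rewrite normrM ler_piMl // cos_max.
Qed.

Lemma rcB (x y : R) : (x - y)%:C%C = x%:C%C - y%:C%C :> C.
Proof. exact: (rmorphB (real_complex R)). Qed.

(** A chord is at most its arc, here of length [2 * pi * |t|], and 8 exceeds [2 * pi]. *)
Lemma nc_ee_sub1 (t : R) : nc (ee t - 1) <= 8 * `|t|.
Proof.
have -> : nc (ee t - 1) = 2 * `|sin (pi * t)|.
  rewrite /ee (_ : 2 * pi * t = (pi * t) *+ 2); last by rewrite mulr2n; ring.
  rewrite cos_mulr2n sin_mulr2n /= subr0.
  have := cos2Dsin2 (pi * t); move: (cos _) (sin _) => c s cs.
  rewrite (_ : _ + _ = (2 * s) ^+ 2); last first.
    have c2 : c ^+ 2 = 1 - s ^+ 2 by rewrite -cs addrK.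
    by rewrite -[c * s *+ 2]mulr_natl !exprMn c2 mulr2n; ring.
  by rewrite sqrtr_sqr normrM ger0_norm.
have := abs_sin_le (pi * t); rewrite normrM (ger0_norm (pi_ge0 R)) => H.
have p4 := pihalf_lt2 R; have : pi * `|t| <= 4 * `|t| by rewrite ler_wpM2r //; lra.
by move: H; move: (`|sin _|) (pi * `|t|) (`|t|) => a b c *; lra.
Qed.

Lemma nc_ee_sub (s t : R) : nc (ee s - ee t) <= 8 * `|s - t|.
Proof.
have -> : ee s - ee t = ee t * (ee (s - t) - 1) by rewrite mulrBr mulr1 -eeD [t + _]addrC subrK.
by rewrite ComplexField.Normc.normcM nc_ee mul1r; exact: nc_ee_sub1.
Qed.

Definition gaussf (t : R) : R := expR (- (g * t ^+ 2)).

Definition gaussw (t : R) : R := (1 + `|t|) * gaussf t.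

Lemma gaussf_ge0 t : 0 <= gaussf t. Proof. exact: expR_ge0. Qed.

Lemma gaussw_ge0 t : 0 <= gaussw t. Proof. by rewrite mulr_ge0 ?gaussf_ge0 // addr_ge0. Qed.

Lemma gaussf_le_gaussw t : gaussf t <= gaussw t.
Proof. by rewrite ler_peMl ?gaussf_ge0 // lerDl. Qed.

Lemma absgg_le_gaussw t : `|t| * gaussf t <= gaussw t.
Proof. by rewrite ler_wpM2r ?gaussf_ge0 // lerDr. Qed.

Lemma gaussf_le_phi t : gaussf t <= expR g * phi g t.
Proof.
rewrite /gaussf /phi -expRD ler_expR -(real_normK (num_real t)); move: `|t| => y.
have : 0 <= g * (y - 2^-1) ^+ 2 by rewrite mulr_ge0 ?sqr_ge0 // ltW.
by rewrite expr2; move: g0; nra.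
Qed.

Lemma gaussw_le_phi t : gaussw t <= (2 + g^-1) * expR g * phi g t.
Proof.
have gi : 0 < g^-1 by rewrite invr_gt0.
have gg1 : g * g^-1 = 1 by rewrite mulfV ?gt_eqF.
rewrite /gaussw /gaussf /phi -(real_normK (num_real t)).
have : 0 <= `|t| by []; move: `|t| => y y0.
rewrite (_ : - (g * y ^+ 2) = - (g * y) - (g * (y - 2^-1) ^+ 2 - g / 4)); last by field.
rewrite expRD [expR (- (g * y)) * _]mulrC mulrA ler_wpM2r ?expR_ge0 //.
rewrite -ler_pdivlMr ?expR_gt0 // -expRN opprK -mulrA -expRD.
apply: (@le_trans _ _ ((2 + g^-1) * (1 + g * (y - 2^-1) ^+ 2))).
  have : 0 <= (y - 2^-1 - 2^-1) ^+ 2 by exact: sqr_ge0.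
  have : 0 <= (y - 2^-1) ^+ 2 by exact: sqr_ge0.
  have -> : (2 + g^-1) * (1 + g * (y - 2^-1) ^+ 2) =
    2 + g^-1 + 2 * g * (y - 2^-1) ^+ 2 + (g * g^-1) * (y - 2^-1) ^+ 2 by ring.
  rewrite gg1; move=> a b; have : 0 <= g * (y - 2^-1) ^+ 2 by rewrite mulr_ge0 // ltW.
  by move: a b; rewrite !expr2 => *; lra.
apply: ler_wpM2l; first by rewrite addr_ge0 // ltW.
apply: (@le_trans _ _ (expR (g * (y - 2^-1) ^+ 2))); first exact: expR_ge1Dx.
by rewrite ler_expR; move: (g * _) g0 => *; lra.
Qed.

(** The factor [q] counts mesh points per unit length. That [S] does not depend on the mesh keeps
    the errors of the Riemann sums of order [1/q]. *)
Lemma gaussw_sum : exists2 S : R, 0 < S & forall q n x, (0 < q)%N ->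
  \sum_(0 <= i < n) gaussw (i%:R / q%:R - x) <= S * q%:R.
Proof.
exists ((2 + g^-1) * expR g * (2 * (1 + g) / g)).
  by rewrite !mulr_gt0 ?expR_gt0 ?addr_gt0 ?invr_gt0.
move=> q n x q0; have q0' : 0 < q%:R :> R by rewrite ltr0n.
apply: (@le_trans _ _ ((2 + g^-1) * expR g * \sum_(0 <= i < n) expR (- (g / q%:R * `|i%:R - q%:R * x|)))).
  rewrite mulr_sumr; apply: ler_sum => i _; apply: (le_trans (gaussw_le_phi _)).
  rewrite /phi (_ : i%:R / q%:R - x = (i%:R - q%:R * x) / q%:R); last by field; rewrite gt_eqF.
  by rewrite normrM normfV (gtr0_norm q0') [g * (_ / _)]mulrA [g * _ / _]mulrAC.
rewrite -[leRHS]mulrA; apply: ler_wpM2l.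
  by rewrite mulr_ge0 ?expR_ge0 // addr_ge0 // invr_ge0 ltW.
have a0 : 0 < g / q%:R by rewrite divr_gt0.
apply: (le_trans (exp_sum_geom _ _ a0)).
have e1 := expR_ge1Dx (g / q%:R); have e2 : expR (g / q%:R) * expR (- (g / q%:R)) = 1 by exact: expRxMexpNx_1.
have e3 := expR_gt0 (- (g / q%:R)).
have ea : expR (- (g / q%:R)) < 1 by rewrite expR_lt1 oppr_lt0.
rewrite ler_pdivrMr ?subr_gt0 //.
have q1 : 1 <= q%:R :> R by rewrite ler1n.
have ag : g / q%:R <= g by rewrite ler_pdivrMr // ler_peMr // ltW.
have -> : 2 * (1 + g) / g * q%:R = 2 * (1 + g) / (g / q%:R) by field; rewrite !gt_eqF.
rewrite -ler_pdivrMl; last by rewrite divr_gt0 // mulr_gt0 // addr_gt0.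
move: a0 e1 e2 e3 ea ag; move: (g / q%:R) => a a0 e1 e2 e3 ea ag.
have -> : (2 * (1 + g) / a)^-1 * 2 = a / (1 + g) by field; rewrite !gt_eqF // addr_gt0.
rewrite ler_pdivrMr ?addr_gt0 //; apply: (@le_trans _ _ ((1 - expR (- a)) * (1 + a))); last first.
  by rewrite ler_wpM2l ?lerD2l // subr_ge0 ltW.
have : (1 + a) * expR (- a) <= expR a * expR (- a) by apply: ler_wpM2r => //; exact: ltW.
by rewrite e2; move=> *; lra.
Qed.

Lemma gaussf_lip (u x : R) : 0 <= x <= 1 -> `|gaussf (u - x) - gaussf u| <= 3 * g * x * (gaussw u + gaussw (u - x)).
Proof.
move=> /andP[x0 x1].
have key (A B : R) : `|expR (- A) - expR (- B)| <= `|A - B| * (expR (- A) + expR (- B)).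
  wlog AB : A B / A <= B => [H|].
    have [/H//|/ltW/H] := leP A B; by rewrite distrC [`|B - A|]distrC [expR (- B) + _]addrC.
  rewrite [`|A - B|]distrC ger0_norm; last by rewrite subr_ge0 ler_expR lerN2.
  rewrite [`|B - A|]ger0_norm ?subr_ge0 //; apply: (@le_trans _ _ ((B - A) * expR (- A))); last first.
    by rewrite ler_wpM2l ?subr_ge0 // lerDl expR_ge0.
  have -> : - B = - A + (A - B) by ring.
  rewrite expRD; have := expR_ge1Dx (A - B); have := expR_gt0 (- A).
  move: (expR (- A)) (expR (A - B)) => a b a0 H; have := ler_wpM2l (ltW a0) H; lra.
apply: (le_trans (key _ _)); rewrite -/(gaussf (u - x)) -/(gaussf u).
have -> : g * (u - x) ^+ 2 - g * u ^+ 2 = - (g * x * (2 * u - x)) by ring.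
rewrite normrN !normrM (gtr0_norm g0) (ger0_norm x0) -[3 * g * x]mulrA [3 * _]mulrC -[leRHS]mulrA -[leLHS]mulrA.
rewrite ler_wpM2l ?mulr_ge0 ?(ltW g0) //.
have b1 : `|2 * u - x| <= 3 * (1 + `|u|).
  have := ler_norm u; have := ler_normr u u; rewrite lexx /= => _; have := lerNnormlW (lexx `|u|).
  by move=> a b; have : 0 <= `|u| by []; move=> ?; rewrite ler_norml; apply/andP; split; lra.
have b2 : `|2 * u - x| <= 3 * (1 + `|u - x|).
  have -> : 2 * u - x = 2 * (u - x) + x by ring.
  have := ler_norm (u - x); have := lerNnormlW (lexx `|u - x|).
  by move=> a b; have : 0 <= `|u - x| by []; move=> ?; rewrite ler_norml; apply/andP; split; lra.
have := ler_wpM2r (gaussf_ge0 u) b1; have := ler_wpM2r (gaussf_ge0 (u - x)) b2; rewrite /gaussw.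
by move: (`|_|) (gaussf _) (gaussf _) (`|_|) (`|_|) => *; lra.
Qed.

(** On opposite sides of 0 the squared distance is at least the sum of the squares, so errors at an
    end of the window decay in the mesh point and in the orbital separately. *)
Lemma gaussf_split (t v : R) : t * v <= 0 -> gaussf (t - v) <= gaussf t * gaussf v.
Proof.
move=> tv; rewrite /gaussf -expRD ler_expR.
have -> : (t - v) ^+ 2 = t ^+ 2 + v ^+ 2 - 2 * (t * v) by ring.
have : g * (t * v) <= 0 by rewrite pmulr_rle0.
lra.
Qed.

Definition wphase (L : nat) (t : R) : C := ee (- t / L%:R).

Lemma eLD L s t : wphase L (s + t) = wphase L s * wphase L t.
Proof. by rewrite /wphase -eeD -mulrDl opprD. Qed.

Lemma nc_wphase L t : nc (wphase L t) = 1. Proof. exact: nc_ee. Qed.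

Lemma nc_wphase_sub1 L t : nc (wphase L t - 1) <= 8 * `|t| / L%:R.
Proof.
apply: (le_trans (nc_ee_sub1 _)); rewrite normrM normrN normfV [`|L%:R|]ger0_norm ?ler0n //.
by rewrite mulrA.
Qed.

Lemma wphase_sub L t : (0 < L)%N -> wphase L (t - L%:R) = wphase L t.
Proof.
move=> L0; rewrite eLD -[RHS]mulr1; congr (_ * _); rewrite /wphase opprK mulfV ?ee1 //.
by rewrite pnatr_eq0 -lt0n.
Qed.

Section Fixed.
Variables (L q : nat).
Hypothesis L0 : (0 < L)%N.
Hypothesis q0 : (0 < q)%N.

(** [gauss_mean] and [wave_mean] are, as Riemann sums of mesh [1/q], the factors by which
    convolution with the Gaussian multiplies constants and the wave [wphase]. *)
Definition gauss_mean : R := (\sum_(0 <= i < (2 * L * q).+1) gaussf (i%:R / q%:R - L%:R)) / q%:R.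

Definition wave_mean : C := (\sum_(0 <= i < (2 * L * q).+1)
  wphase L (i%:R / q%:R - L%:R) * (gaussf (i%:R / q%:R - L%:R))%:C%C) * (q%:R^-1)%:C%C.

(** Each of the two waves, [wphase] and the constant, is divided by its own factor, so that the
    superposition of Gaussians returns [wphase - 1] up to mesh and cutoff. *)
Definition test_coef (t : R) : C := wave_mean^-1 * wphase L t - (gauss_mean^-1)%:C%C.

Definition test_fun (v : R) : C := (\sum_(0 <= s < (L * q).+1)
  test_coef (s%:R / q%:R) * (gaussf (s%:R / q%:R - v))%:C%C) * (q%:R^-1)%:C%C.

Definition step_fun (v : R) : C := if 0 <= v <= L%:R then wphase L v - 1 else 0.

Variable S : R.
Hypothesis S0 : 0 < S.
Hypothesis HS : forall n x, \sum_(0 <= i < n) gaussw (i%:R / q%:R - x) <= S * q%:R.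

Let Lp : 0 < L%:R :> R. Proof. by rewrite ltr0n. Qed.
Let qp : 0 < q%:R :> R. Proof. by rewrite ltr0n. Qed.

Lemma gauss_mean_ge : expR (- g) <= gauss_mean.
Proof.
rewrite /gauss_mean ler_pdivlMr //.
have -> : expR (- g) * q%:R = \sum_(L * q <= i < q + L * q) expR (- g).
  by rewrite big_const_nat addnK iter_addr_0 mulr_natr.
apply: (@le_trans _ _ (\sum_(L * q <= i < q + L * q) gaussf (i%:R / q%:R - L%:R))).
  rewrite big_nat_cond [leRHS]big_nat_cond; apply: ler_sum => i /andP[/andP[i1 i2] _].
  rewrite ler_expR lerN2 ler_piMr ?(ltW g0) //.
  have a : 0 <= i%:R / q%:R - L%:R :> R by rewrite subr_ge0 ler_pdivlMr // -natrM ler_nat.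
  rewrite expr_le1 // lerBlDr ler_pdivrMr // mulrDl mul1r -natrM -natrD ler_nat ltnW //.
by apply: sum_nat_widen => //; [move=> i; exact: gaussf_ge0 | clear -L0 q0; nia].
Qed.

Let vth0 : 0 < gauss_mean. Proof. exact: lt_le_trans (expR_gt0 _) gauss_mean_ge. Qed.

Let qc : nc (q%:R^-1)%:C%C = q%:R^-1 :> R.
Proof. by rewrite nc_real ger0_norm // invr_ge0 ltW. Qed.

Lemma wave_mean_gauss_mean : nc (wave_mean - gauss_mean%:C%C) <= 8 * S / L%:R.
Proof.
rewrite /wave_mean /gauss_mean rcM rc_sum -mulrBl -sumrB ComplexField.Normc.normcM qc ler_pdivrMr //.
apply: (le_trans (nc_sum _ _)).
apply: (@le_trans _ _ (\sum_(0 <= i < (2 * L * q).+1) 8 / L%:R * gaussw (i%:R / q%:R - L%:R))).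
  apply: ler_sum => i _; move: (i%:R / q%:R - L%:R) => u.
  rewrite -{2}[(gaussf u)%:C%C]mul1r -mulrBl ComplexField.Normc.normcM nc_real (ger0_norm (gaussf_ge0 _)).
  apply: (@le_trans _ _ (8 * `|u| / L%:R * gaussf u)); first by rewrite ler_wpM2r ?gaussf_ge0 ?nc_wphase_sub1.
  have -> : 8 * `|u| / L%:R * gaussf u = 8 / L%:R * (`|u| * gaussf u) by ring.
  by rewrite ler_wpM2l ?absgg_le_gaussw // divr_ge0 // ltW.
rewrite -mulr_sumr; apply: (le_trans (ler_wpM2l _ (HS _ _))); first by rewrite divr_ge0 // ltW.
by rewrite le_eqVlt; apply/orP; left; apply/eqP; ring.
Qed.

Hypothesis LS : 16 * S * expR g <= L%:R.

Let eg1 : expR g * expR (- g) = 1. Proof. exact: expRxMexpNx_1. Qed.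

Lemma wave_mean_ge : expR (- g) / 2 <= nc wave_mean.
Proof.
have a := wave_mean_gauss_mean; have b := gauss_mean_ge.
have c : 8 * S / L%:R <= expR (- g) / 2.
  rewrite ler_pdivrMr //; have := ler_wpM2l (expR_ge0 (- g)) LS.
  have -> : expR (- g) * (16 * S * expR g) = 16 * S * (expR g * expR (- g)) by ring.
  rewrite eg1 [expR (- g) / 2 * _]mulrAC; move: (expR (- g) * _) => *; lra.
have := nc_sub wave_mean (wave_mean - gauss_mean%:C%C); rewrite opprB addrC subrK nc_real (gtr0_norm vth0).
by move: a b c; move: (nc (wave_mean - _)) (nc wave_mean) (8 * S / _) (expR (- g)) => *; lra.
Qed.

Let vLa0 : wave_mean != 0.
Proof.
apply/eqP => e; have := wave_mean_ge; rewrite e ComplexField.Normc.normc0.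
by rewrite leNgt divr_gt0 // expR_gt0.
Qed.

Lemma nc_inv (z : C) : nc z^-1 = (nc z)^-1.
Proof.
have [->|z0] := eqVneq z 0; first by rewrite invr0 ComplexField.Normc.normc0 invr0.
have nz : nc z != 0 by apply: contra_neq z0; exact: ComplexField.Normc.eq0_normc.
apply: (mulfI nz); rewrite -ComplexField.Normc.normcM mulfV // ComplexField.Normc.normc1 mulfV //.
Qed.

Lemma nc_vLaV : nc wave_mean^-1 <= 2 * expR g.
Proof.
rewrite nc_inv; have a := wave_mean_ge; have b : 0 < expR (- g) / 2 by rewrite divr_gt0 ?expR_gt0.
apply: (@le_trans _ _ (expR (- g) / 2)^-1).
  by rewrite lef_pV2 // posrE ?(lt_le_trans b a).
by rewrite invf_div expRN invrK.
Qed.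

Lemma vthV_le : gauss_mean^-1 <= expR g.
Proof.
rewrite -[expR g]invrK -expRN lef_pV2 ?gauss_mean_ge // posrE //; exact: expR_gt0.
Qed.

Definition edge_const : R := 16 * expR g + 16 * S * expR g ^+ 2.

Lemma edge_const_ge0 : 0 <= edge_const.
Proof. by rewrite addr_ge0 // !mulr_ge0 ?exprn_ge0 ?expR_ge0 // ltW. Qed.

(** Near the end 0 of the window [wphase] is close to 1, and [wave_mean] is close to [gauss_mean],
    so cutting the superposition off there costs only order [1/L]. Periodicity gives the same at the
    end [L] ([nc_tcL]). *)
Lemma nc_test_coef (t : R) : nc (test_coef t) <= edge_const / L%:R * (1 + `|t|).
Proof.
have -> : test_coef t = wave_mean^-1 * (wphase L t - 1) + wave_mean^-1 * (gauss_mean%:C%C - wave_mean) * (gauss_mean^-1)%:C%C.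
  rewrite /test_coef mulrBr mulr1 -addrA; congr (_ + _).
  have vv : gauss_mean%:C%C * (gauss_mean^-1)%:C%C = 1 :> C by rewrite -rcM mulfV ?gt_eqF.
  by rewrite [wave_mean^-1 * (_ - _)]mulrBr mulVf // mulrBl mul1r -mulrA vv mulr1 addKr.
apply: (le_trans (nc_add _ _)); rewrite !ComplexField.Normc.normcM -(opprB wave_mean) normcN.
rewrite nc_real (ger0_norm (ltW _)) ?invr_gt0 //.
apply: (@le_trans _ _ (2 * expR g * (8 * `|t| / L%:R) + 2 * expR g * (8 * S / L%:R) * expR g)).
  apply: lerD; first by apply: ler_pM; rewrite ?nc_ge0 ?nc_vLaV ?nc_wphase_sub1.
  apply: ler_pM; rewrite ?mulr_ge0 ?nc_ge0 ?invr_ge0 ?(ltW vth0) ?vthV_le //.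
  by apply: ler_pM; rewrite ?nc_ge0 ?nc_vLaV ?wave_mean_gauss_mean.
have -> : 2 * expR g * (8 * `|t| / L%:R) + 2 * expR g * (8 * S / L%:R) * expR g =
  (16 * expR g * `|t| + 16 * S * expR g ^+ 2) / L%:R by ring.
rewrite [leRHS]mulrAC ler_pM2r ?invr_gt0 // /edge_const.
have : 0 <= 16 * S * expR g ^+ 2 * `|t| by rewrite !mulr_ge0 ?exprn_ge0 ?expR_ge0 // ltW.
have : 0 <= expR g by exact: expR_ge0.
move: (16 * S * _) => u *; lra.
Qed.

Lemma nc_tcL (t : R) : nc (test_coef t) <= edge_const / L%:R * (1 + `|t - L%:R|).
Proof. by rewrite {1}/test_coef -wphase_sub // -/(test_coef (t - L%:R)); exact: nc_test_coef. Qed.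

Lemma test_coef_outside (t v : R) : t * v <= 0 \/ (t - L%:R) * (v - L%:R) <= 0 ->
  nc (test_coef t * (gaussf (t - v))%:C%C) <= edge_const / L%:R * (gaussw t * gaussf v + gaussw (t - L%:R) * gaussf (v - L%:R)).
Proof.
rewrite ComplexField.Normc.normcM nc_real (ger0_norm (gaussf_ge0 _)).
have CL : 0 <= edge_const / L%:R by rewrite divr_ge0 ?edge_const_ge0 // ltW.
case=> H.
  apply: (@le_trans _ _ (edge_const / L%:R * (1 + `|t|) * (gaussf t * gaussf v))).
    by apply: ler_pM; rewrite ?nc_ge0 ?gaussf_ge0 ?nc_test_coef ?gaussf_split.
  rewrite -mulrA [(1 + _) * _]mulrA; apply: ler_wpM2l => //.
  by rewrite lerDl mulr_ge0 ?gaussw_ge0 ?gaussf_ge0.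
apply: (@le_trans _ _ (edge_const / L%:R * (1 + `|t - L%:R|) * (gaussf (t - L%:R) * gaussf (v - L%:R)))).
  apply: ler_pM; rewrite ?nc_ge0 ?gaussf_ge0 ?nc_tcL //.
  have -> : t - v = t - L%:R - (v - L%:R) by ring.
  exact: gaussf_split.
rewrite -mulrA [(1 + _) * _]mulrA; apply: ler_wpM2l => //.
by rewrite lerDr mulr_ge0 ?gaussw_ge0 ?gaussf_ge0.
Qed.

Lemma test_coef_outside_sum n (h : nat -> R) (x v : R) (P : pred nat) :
  (forall i, h i = i%:R / q%:R - x) ->
  (forall i, P i -> h i * v <= 0 \/ (h i - L%:R) * (v - L%:R) <= 0) ->
  \sum_(0 <= i < n | P i) nc (test_coef (h i) * (gaussf (h i - v))%:C%C) <=
  edge_const * S * expR g * q%:R / L%:R * (phi g v + phi g (v - L%:R)).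
Proof.
move=> hE H; have CL : 0 <= edge_const / L%:R by rewrite divr_ge0 ?edge_const_ge0 // ltW.
apply: (@le_trans _ _ (\sum_(0 <= i < n | P i)
   edge_const / L%:R * (gaussw (h i) * gaussf v + gaussw (h i - L%:R) * gaussf (v - L%:R)))).
  by apply: ler_sum => i Pi; apply: test_coef_outside; exact: H.
apply: (@le_trans _ _ (\sum_(0 <= i < n)
   edge_const / L%:R * (gaussw (h i) * gaussf v + gaussw (h i - L%:R) * gaussf (v - L%:R)))).
  rewrite big_mkcond; apply: ler_sum => i _; case: ifP => // _.
  by rewrite mulr_ge0 // addr_ge0 // mulr_ge0 ?gaussw_ge0 ?gaussf_ge0.
rewrite -mulr_sumr big_split /= -!mulr_suml.
have -> : edge_const * S * expR g * q%:R / L%:R * (phi g v + phi g (v - L%:R)) =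
  edge_const / L%:R * (S * q%:R * (expR g * phi g v) + S * q%:R * (expR g * phi g (v - L%:R))).
  by move: (phi _ _) (phi _ _) => *; ring.
apply: ler_wpM2l => //; apply: lerD.
  apply: ler_pM; rewrite ?gaussf_ge0 ?gaussf_le_phi //; first by apply: sumr_ge0 => *; exact: gaussw_ge0.
  by under eq_bigr do rewrite hE; exact: HS.
apply: ler_pM; rewrite ?gaussf_ge0 ?gaussf_le_phi //; first by apply: sumr_ge0 => *; exact: gaussw_ge0.
by under eq_bigr do rewrite hE -addrA -opprD; exact: HS.
Qed.

Definition grid_const : R := 3 * expR g * (6 * g * S) + 2 * expR g * (8 * S).

Lemma test_fun_inside (v : R) : 0 <= v <= L%:R ->
  nc (test_fun v - step_fun v) <= grid_const / q%:R + edge_const * S * expR g / L%:R * (phi g v + phi g (v - L%:R)).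
Proof.
move=> /andP[v0 vL]; have qv0 : 0 <= q%:R * v by rewrite mulr_ge0 // ler0n.
(* The sum is recentred at [v]: [a] is the mesh index of [v] rounded down and [x] the rounding
   error. The sum [W] over the full range around [v] exceeds that of [test_fun] by mesh points
   outside the window. *)
pose a := Num.truncn (q%:R * v); have /andP[a1 a2] := truncn_itv qv0; rewrite -/a in a1 a2.
have aL : (a <= L * q)%N.
  rewrite -(ler_nat R) natrM; apply: (le_trans a1); rewrite mulrC ler_wpM2r // ltW //.
pose b := (L * q - a)%N; have ab : (a + b = L * q)%N by rewrite /b subnKC.
clearbody b; clear aL.
pose x := v - a%:R / q%:R.
have x0 : 0 <= x by rewrite subr_ge0 ler_pdivrMr // mulrC.
have xq : x <= q%:R^-1.
  rewrite lerBlDr -{1}[q%:R^-1]mul1r -mulrDl nat1r ler_pdivlMr // mulrC ltW //.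
have x1 : x <= 1 by apply: (le_trans xq); rewrite invf_le1 // ler1n.
pose h (i : nat) : R := i%:R / q%:R - b%:R / q%:R.
pose u (i : nat) : R := i%:R / q%:R - L%:R.
have hu i : h i = v + (u i - x).
  rewrite /h /u /x; have -> : b%:R = L%:R * q%:R - a%:R :> R by rewrite -natrM -ab natrD addrAC subrr add0r.
  by field; rewrite gt_eqF.
have huv i : h i - v = u i - x by rewrite hu addrC addKr.
pose W := \sum_(0 <= i < (2 * L * q).+1) test_coef (h i) * (gaussf (h i - v))%:C%C.
have WE : W = (\sum_(0 <= s < (L * q).+1) test_coef (s%:R / q%:R) * (gaussf (s%:R / q%:R - v))%:C%C) +
   \sum_(0 <= i < (2 * L * q).+1 | (i < b)%N || ((L * q).+1 + b <= i)%N) test_coef (h i) * (gaussf (h i - v))%:C%C.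
  rewrite /W (bigID (fun i => (i < b)%N || ((L * q).+1 + b <= i)%N)) /= addrC; congr (_ + _).
  transitivity (\sum_(b <= i < (L * q).+1 + b) test_coef (h i) * (gaussf (h i - v))%:C%C).
    rewrite big_nat_cond [RHS]big_nat_cond [LHS](big_nat_widenl _ 0) //.
    rewrite [RHS](big_nat_widenl _ 0) // [RHS](big_nat_widen _ _ (2 * L * q).+1); last by clear -ab; lia.
    by apply: eq_bigl => i /=; clear -ab; lia.
  rewrite -{1}[b]add0n big_addn addnK; apply: eq_bigr => s _.
  by have -> : h (s + b)%N = s%:R / q%:R by rewrite /h natrD mulrDl addrK.
have out : nc (\sum_(0 <= i < (2 * L * q).+1 | (i < b)%N || ((L * q).+1 + b <= i)%N) test_coef (h i) * (gaussf (h i - v))%:C%C)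
    <= edge_const * S * expR g * q%:R / L%:R * (phi g v + phi g (v - L%:R)).
  rewrite -big_filter; apply: (le_trans (nc_sum _ _)); rewrite big_filter.
  apply: (@test_coef_outside_sum _ h (b%:R / q%:R)) => // i /orP[ib|ib]; [left|right].
    rewrite mulr_le0_ge0 // /h -mulrBl pmulr_lle0 ?invr_gt0 // subr_le0 ler_nat ltnW //.
  rewrite mulr_ge0_le0 // ?subr_le0 // /h -mulrBl subr_ge0 ler_pdivlMr // lerBrDr -natrM -natrD ler_nat.
  by clear -ib; lia.
have -> : test_fun v - step_fun v = (W * (q%:R^-1)%:C%C - step_fun v) -
  (\sum_(0 <= i < (2 * L * q).+1 | (i < b)%N || ((L * q).+1 + b <= i)%N) test_coef (h i) * (gaussf (h i - v))%:C%C) * (q%:R^-1)%:C%C.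
  rewrite WE /test_fun mulrDl; move: (_ * (q%:R^-1)%:C%C) (_ * (q%:R^-1)%:C%C) (step_fun v) => A B D.
  by rewrite addrAC addrK.
apply: (le_trans (nc_sub _ _)); apply: lerD; last first.
  rewrite ComplexField.Normc.normcM qc ler_pdivrMr //; apply: (le_trans out).
  by rewrite le_eqVlt; apply/orP; left; apply/eqP; ring.
pose A := \sum_(0 <= i < (2 * L * q).+1) wphase L (u i - x) * (gaussf (u i - x))%:C%C.
pose T := \sum_(0 <= i < (2 * L * q).+1) gaussf (u i - x).
(* As [wphase] is a character, recentring at [v] merely factors out [wphase L v]. *)
have W2 : W = wave_mean^-1 * wphase L v * A - (gauss_mean^-1 * T)%:C%C.
  rewrite /W /A /T rcM rc_sum !mulr_sumr -sumrB; apply: eq_bigr => i _.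
  by rewrite /test_coef mulrBl huv hu eLD !mulrA.
have w2 : step_fun v = wave_mean^-1 * wphase L v * wave_mean - (gauss_mean^-1 * gauss_mean)%:C%C.
  by rewrite /step_fun v0 vL mulVf ?gt_eqF // [_ * wave_mean]mulrAC mulVf // mul1r.
have q1 : (q%:R^-1)%:C%C * q%:R%:C%C = 1 :> C by rewrite -rcM mulVf ?gt_eqF.
have W3 : W * (q%:R^-1)%:C%C - step_fun v =
   (wave_mean^-1 * wphase L v * (A - wave_mean * q%:R%:C%C) - (gauss_mean^-1 * (T - gauss_mean * q%:R))%:C%C) * (q%:R^-1)%:C%C.
  rewrite w2 W2 (rcM _ T) (rcM _ gauss_mean) (rcM _ (T - _)) rcB (rcM gauss_mean).
  move: q1; move: ((q%:R^-1)%:C%C : C) ((q%:R)%:C%C : C) (T%:C%C : C) (gauss_mean%:C%C : C) ((gauss_mean^-1)%:C%C : C).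
  move=> i j t vt vi ij; move: A (wave_mean^-1 * wphase L v) wave_mean {W2 w2 WE out} => A B V.
  have ij' w : w * j * i = w by rewrite -mulrA [j * i]mulrC ij mulr1.
  rewrite !mulrBl !mulrBr !mulrBl !(mulrA _ _ j) !ij' !opprB.
  move: (_ * i) (vi * t * i) (_ * V) (vi * vt) => x1' x2 x3 x4.
  by rewrite addrACA [- x2 + _]addrC addrACA [x4 - _]addrC.
have Tb : `|T - gauss_mean * q%:R| <= 6 * g * S.
  rewrite /T /gauss_mean divfK ?gt_eqF // -sumrB; apply: (le_trans (ler_norm_sum _ _ _)).
  apply: (@le_trans _ _ (\sum_(0 <= i < (2 * L * q).+1) 3 * g * x * (gaussw (u i) + gaussw (u i - x)))).
    by apply: ler_sum => i _; apply: gaussf_lip; rewrite x0.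
  rewrite -mulr_sumr big_split /=.
  apply: (@le_trans _ _ (3 * g * q%:R^-1 * (S * q%:R + S * q%:R))); last first.
    by rewrite le_eqVlt; apply/orP; left; apply/eqP; field; rewrite gt_eqF.
  have r0 : 0 <= \sum_(0 <= i < (2 * L * q).+1) gaussw (u i) by apply: sumr_ge0 => *; exact: gaussw_ge0.
  have r0' : 0 <= \sum_(0 <= i < (2 * L * q).+1) gaussw (u i - x) by apply: sumr_ge0 => *; exact: gaussw_ge0.
  have g3 : 0 <= 3 * g by rewrite mulr_ge0 // ltW.
  apply: ler_pM; [exact: mulr_ge0 | exact: addr_ge0 | by rewrite ler_wpM2l | apply: lerD].
    exact: HS.
  by rewrite /u; under eq_bigr do rewrite -addrA -opprD; exact: HS.
have Ab : nc (A - wave_mean * q%:R%:C%C) <= 6 * g * S + 8 * S.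
  have -> : A - wave_mean * q%:R%:C%C = \sum_(0 <= i < (2 * L * q).+1)
     (wphase L (u i - x) * (gaussf (u i - x))%:C%C - wphase L (u i) * (gaussf (u i))%:C%C).
    by rewrite sumrB /wave_mean -mulrA q1 mulr1.
  apply: (le_trans (nc_sum _ _)).
  apply: (@le_trans _ _ (\sum_(0 <= i < (2 * L * q).+1)
      (3 * g * x * (gaussw (u i) + gaussw (u i - x)) + 8 * x * gaussw (u i)))).
    apply: ler_sum => i _; move: (u i) => w.
    have -> : wphase L (w - x) * (gaussf (w - x))%:C%C - wphase L w * (gaussf w)%:C%C =
       wphase L (w - x) * (gaussf (w - x) - gaussf w)%:C%C + wphase L w * (wphase L (- x) - 1) * (gaussf w)%:C%C.
      rewrite rcB mulrBr [wphase L w * (_ - _)]mulrBr -eLD mulr1 mulrBl.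
      by rewrite addrA subrK.
    apply: (le_trans (nc_add _ _)); rewrite !ComplexField.Normc.normcM !nc_wphase !mul1r !nc_real.
    apply: lerD; first by apply: gaussf_lip; rewrite x0.
    rewrite (ger0_norm (gaussf_ge0 _)); apply: ler_pM; rewrite ?nc_ge0 ?gaussf_ge0 ?gaussf_le_gaussw //.
    apply: (le_trans (nc_wphase_sub1 _ _)); rewrite normrN (ger0_norm x0) ler_pdivrMr //.
    by rewrite ler_peMr ?mulr_ge0 // ler1n.
  rewrite big_split /= -!mulr_sumr big_split /=.
  apply: (@le_trans _ _ (3 * g * q%:R^-1 * (S * q%:R + S * q%:R) + 8 * q%:R^-1 * (S * q%:R))); last first.
    by rewrite le_eqVlt; apply/orP; left; apply/eqP; field; rewrite gt_eqF.
  have r0 : 0 <= \sum_(0 <= i < (2 * L * q).+1) gaussw (u i) by apply: sumr_ge0 => *; exact: gaussw_ge0.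
  have r0' : 0 <= \sum_(0 <= i < (2 * L * q).+1) gaussw (u i - x) by apply: sumr_ge0 => *; exact: gaussw_ge0.
  have r1 : \sum_(0 <= i < (2 * L * q).+1) gaussw (u i) <= S * q%:R by exact: HS.
  have r1' : \sum_(0 <= i < (2 * L * q).+1) gaussw (u i - x) <= S * q%:R.
    by rewrite /u; under eq_bigr do rewrite -addrA -opprD; exact: HS.
  have xg : 3 * g * x <= 3 * g * q%:R^-1 by rewrite ler_wpM2l // mulr_ge0 // ltW.
  have g3 : 0 <= 3 * g by rewrite mulr_ge0 // ltW.
  apply: lerD; apply: ler_pM => //; [exact: mulr_ge0 | exact: addr_ge0 | exact: lerD | |].
    exact: mulr_ge0.
  by rewrite ler_wpM2l.
rewrite W3 ComplexField.Normc.normcM qc ler_pM2r ?invr_gt0 //.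
apply: (le_trans (nc_sub _ _)); rewrite !ComplexField.Normc.normcM nc_wphase mulr1 nc_real normrM.
rewrite (ger0_norm (ltW _)) ?invr_gt0 //.
apply: (@le_trans _ _ (2 * expR g * (6 * g * S + 8 * S) + expR g * (6 * g * S))).
  by apply: lerD; apply: ler_pM; rewrite ?nc_ge0 ?nc_vLaV ?vthV_le ?invr_ge0 ?(ltW vth0).
by rewrite le_eqVlt; apply/orP; left; apply/eqP; rewrite /grid_const; ring.
Qed.

Lemma test_fun_outside (v : R) : ~~ (0 <= v <= L%:R) ->
  nc (test_fun v - step_fun v) <= edge_const * S * expR g / L%:R * (phi g v + phi g (v - L%:R)).
Proof.
move=> vn; rewrite /step_fun (negbTE vn) subr0 /test_fun ComplexField.Normc.normcM qc ler_pdivrMr //.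
apply: (le_trans (nc_sum _ _)); rewrite [leRHS](_ : _ = edge_const * S * expR g * q%:R / L%:R * (phi g v + phi g (v - L%:R))); last first.
  by move: (phi _ _) (phi _ _) => *; ring.
have := @test_coef_outside_sum (L * q).+1 (fun i => i%:R / q%:R) 0 v (fun i => (i <= L * q)%N).
rewrite big_mkcond big_nat_cond => H.
rewrite big_nat_cond; apply: (le_trans _ (H _ _)).
- rewrite le_eqVlt; apply/orP; left; apply/eqP; apply: eq_bigr => i /andP[/andP[_ il] _].
  by rewrite -ltnS il.
- by move=> i; rewrite subr0.
move=> i il; have h0 : 0 <= i%:R / q%:R :> R by rewrite divr_ge0 ?ler0n.
have hL : i%:R / q%:R - L%:R <= 0 :> R by rewrite subr_le0 ler_pdivrMr // -natrM ler_nat.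
move: vn; rewrite negb_and -!ltNge => /orP[v0|v0]; [left|right].
  by rewrite mulr_ge0_le0 // ltW.
by rewrite mulr_le0_ge0 // subr_ge0 ltW.
Qed.

End Fixed.

(** Rewrites a constant error on the window in terms of charges at integer positions, whose
    exponential moments are bounded. *)
Lemma window_le_phi (L : nat) (v : R) : 0 <= v <= L%:R ->
  1 <= expR g * \sum_(0 <= i < L.+1) phi g (v - i%:R).
Proof.
move=> /andP[v0 vL]; have /andP[a1 a2] := truncn_itv v0; set a := Num.truncn v in a1 a2.
have aL : (a <= L)%N by rewrite -(ler_nat R) (le_trans a1).
rewrite (bigD1_seq a) ?iota_uniq //=; last by rewrite mem_index_iota /= ltnS.
apply: (@le_trans _ _ (expR g * phi g (v - a%:R))); last first.
  by rewrite ler_wpM2l ?expR_ge0 // lerDl; apply: sumr_ge0 => *; exact: expR_ge0.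
rewrite /phi -expRD -[leLHS]expR0 ler_expR subr_ge0 [`|_|]ger0_norm ?subr_ge0 //.
rewrite -{2}[g]mulr1 ler_pM2l //.
by rewrite lerBlDr nat1r ltW.
Qed.

(* [test_fun] deconvolves the Gaussian: it reproduces the unimodular step [step_fun] up to errors
   of order [1/q] on the window and [1/L] at its two ends. *)
Lemma test_function : exists2 K : R, 0 < K & exists L1 : nat, forall L q, (L1 <= L)%N -> (0 < q)%N ->
  (forall v, nc (test_fun L q v - step_fun L v) <=
     K / q%:R * \sum_(0 <= i < L.+1) phi g (v - i%:R) + K / L%:R * (phi g v + phi g (v - L%:R))).
Proof.
have [S S0 HS] := gaussw_sum.
have Cq0 : 0 < grid_const S by rewrite addr_gt0 // !mulr_gt0 ?expR_gt0.
have Ct0 := edge_const_ge0 S0.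
exists (grid_const S * expR g + edge_const S * S * expR g).
  by rewrite ltr_pwDl ?mulr_gt0 ?expR_gt0 // !mulr_ge0 ?expR_ge0 // ltW.
pose L1 := (Num.truncn (16 * S * expR g)).+1; exists L1 => L q LL q0 v.
have L0 : (0 < L)%N by exact: leq_trans LL.
have LS : 16 * S * expR g <= L%:R.
  by apply: (le_trans (ltW (truncnS_gt _))); rewrite ler_nat.
have s0 : 0 <= \sum_(0 <= i < L.+1) phi g (v - i%:R) by apply: sumr_ge0 => *; exact: expR_ge0.
have p2 : 0 <= phi g v + phi g (v - L%:R) by rewrite addr_ge0 // expR_ge0.
have Lp : 0 < L%:R :> R by rewrite ltr0n.
have qp : 0 < q%:R :> R by rewrite ltr0n.
have k1 : edge_const S * S * expR g / L%:R * (phi g v + phi g (v - L%:R)) <=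
   (grid_const S * expR g + edge_const S * S * expR g) / L%:R * (phi g v + phi g (v - L%:R)).
  rewrite ler_wpM2r // ler_pM2r ?invr_gt0 // lerDr mulr_ge0 ?expR_ge0 // ltW //.
case: (boolP (0 <= v <= L%:R)) => vb; last first.
  apply: (le_trans (test_fun_outside L0 q0 S0 (fun n x => HS q n x q0) LS vb)); apply: (le_trans k1).
  rewrite lerDr mulr_ge0 // divr_ge0 ?(ltW qp) // addr_ge0 // !mulr_ge0 ?expR_ge0 // ltW //.
apply: (le_trans (test_fun_inside L0 q0 S0 (fun n x => HS q n x q0) LS vb)); apply: lerD => //.
rewrite -mulrA [q%:R^-1 * _]mulrC mulrA ler_pM2r ?invr_gt0 //.
have w := window_le_phi vb.
apply: (@le_trans _ _ (grid_const S * (expR g * \sum_(0 <= i < L.+1) phi g (v - i%:R)))).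
  by rewrite ler_peMr // ltW.
by rewrite mulrA ler_wpM2r // lerDl !mulr_ge0 ?expR_ge0 // ltW.
Qed.

End TestFunction.

(** * Symmetry breaking *)

Section SymmetryBreaking.
Variables (R : realType) (p : nat) (g : R).
Local Notation C := R[i].
Hypothesis p0 : (0 < p)%N.
Hypothesis g0 : 0 < g.
Local Notation cweight := (@cweight R p g).
Local Notation Z := (@Z R p g).
Local Notation mass := (@mass R p g).
Local Notation avg_corr := (@avg_corr R p g).
Local Notation asym_inv := (@asym_inv R p g).
Local Notation ncM := ComplexField.Normc.normcM.

Let Zgt0 N : 0 < Z N. Proof. exact: lt_le_trans ltr01 (Z_ge1 g p0 N). Qed.
Let pp : 0 < p%:R :> R. Proof. by rewrite ltr0n. Qed.

Definition expect N (f : seq nat -> R) : R :=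
  isum (iota 0 (p * N)) N (fun m => cweight [::] m * f m) / Z N.

Definition cexpect N (f : seq nat -> C) : C :=
  isum (iota 0 (p * N)) N (fun m => (cweight [::] m)%:C%C * f m) * ((Z N)^-1)%:C%C.

Lemma expect_le N f h : (forall m, size m = N -> f m <= h m) -> expect N f <= expect N h.
Proof.
move=> H; rewrite /expect ler_pM2r ?invr_gt0 //; apply: le_isum => m sm.
by apply: ler_wpM2l; [exact: cweight_ge0 | exact: H].
Qed.

Lemma ERD N f h : expect N (fun m => f m + h m) = expect N f + expect N h.
Proof.
rewrite /expect -mulrDl -isumD; congr (_ / _); apply: eq_isum => m _; exact: mulrDr.
Qed.

Lemma ERZ N c f : expect N (fun m => c * f m) = c * expect N f.
Proof.
rewrite /expect mulrA -isumZ; congr (_ / _); apply: eq_isum => m _; exact: mulrCA.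
Qed.

Lemma isum_cweight N : isum (iota 0 (p * N)) N (fun m => cweight [::] m) = Z N.
Proof. by []. Qed.

Lemma expect_cst N c : expect N (fun=> c) = c.
Proof.
rewrite -[c in LHS]mulr1 ERZ /expect; under eq_isum => m _ do rewrite mulr1.
by rewrite isum_cweight divff ?mulr1 // gt_eqF.
Qed.

Lemma rcD (x y : R) : (x + y)%:C%C = x%:C%C + y%:C%C :> C.
Proof. exact: (rmorphD (real_complex R)). Qed.

Lemma rc_tsum (X : Type) (rs : seq X) n (F : seq X -> R) :
  (tsum rs n F)%:C%C = tsum rs n (fun t => (F t)%:C%C) :> C.
Proof. exact: (raddf_tsum (real_complex R)). Qed.

Lemma rc_natV n : (n%:R^-1)%:C%C = n%:R^-1 :> C.
Proof. by rewrite (fmorphV (real_complex R)) (rmorph_nat (real_complex R)). Qed.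

Lemma rc_isum (X : Type) (rs : seq X) n (F : seq X -> R) :
  (isum rs n F)%:C%C = isum rs n (fun t => (F t)%:C%C) :> C.
Proof. by rewrite /isum rcM rc_tsum rc_natV. Qed.

Lemma nc_isum (X : Type) (rs : seq X) n (F : seq X -> C) :
  nc (isum rs n F) <= isum rs n (fun t => nc (F t)).
Proof.
rewrite /isum ncM -rc_natV nc_real (ger0_norm (factV_ge0 _ _)).
by apply: ler_wpM2l; [exact: factV_ge0 | exact: nc_tsum].
Qed.

Lemma nc_EXB N f h : nc (cexpect N f - cexpect N h) <= expect N (fun m => nc (f m - h m)).
Proof.
rewrite /cexpect -mulrBl -isumB ncM nc_real ger0_norm ?invr_ge0 ?(ltW (Zgt0 N)) //.
rewrite ler_pM2r ?invr_gt0 //; apply: (le_trans (nc_isum _ _ _)); apply: le_isum => m _.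
by rewrite -mulrBr ncM nc_real ger0_norm ?cweight_ge0.
Qed.

Lemma cexpect_cst N c : cexpect N (fun=> c) = c.
Proof.
rewrite /cexpect (eq_isum _ (G := fun m => c * (cweight [::] m)%:C%C)); last by move=> m _; rewrite mulrC.
by rewrite isumZ -rc_isum isum_cweight -mulrA -rcM mulfV ?gt_eqF // mulr1.
Qed.

(** Factors are replaced one at a time; as the reference factors are unimodular, the individual
    errors add up in an exponent. *)
Lemma prod_diff (a b : nat -> C) (e : nat -> R) m :
  (forall j, nc (b j) = 1) -> (forall j, nc (a j - b j) <= e j) ->
  nc (\prod_(j <- m) a j - \prod_(j <- m) b j) <= expR (\sum_(j <- m) e j) - 1.
Proof.
move=> b1 ab; elim: m => [|j m IH].
  by rewrite !big_nil !subrr ComplexField.Normc.normc0 expR0 subrr.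
rewrite !big_cons; move: IH; set A := \prod_(_ <- m) _; set B := \prod_(_ <- m) _ => IH.
have nB : nc B = 1.
  by rewrite nc_prod big1 // => i _; exact: b1.
have nA : nc A <= expR (\sum_(i <- m) e i).
  have := nc_add (A - B) B; rewrite subrK nB; move: IH.
  by move: (nc _) (nc _) (expR _) => *; lra.
have -> : a j * A - b j * B = (a j - b j) * A + b j * (A - B).
  by rewrite mulrBl mulrBr addrA subrK.
apply: (le_trans (nc_add _ _)); rewrite !ncM b1 mul1r.
have e0 : 0 <= e j by apply: le_trans (ab j); exact: nc_ge0.
have : nc (a j - b j) * nc A <= e j * expR (\sum_(i <- m) e i) by apply: ler_pM; rewrite ?nc_ge0.
have : expR (\sum_(i <- m) e i) * (1 + e j) <= expR (e j + \sum_(i <- m) e i).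
  by rewrite [e j + _]addrC expRD ler_wpM2l ?expR_ge0 // expR_ge1Dx.
move: IH; move: (nc (A - B)) (nc _ * nc A) (expR (\sum_(i <- m) e i)) (expR (e j + _)) => *; lra.
Qed.

(** Convexity, with the remaining weight placed at 0. It lets the exponent of the whole window enter
    with weight [1/q] and that of the two ends with weight [1/L]. *)
Lemma expR_convex3 (al be A B : R) : 0 <= al -> 0 <= be -> al + be <= 1 ->
  expR (al * A + be * B) - 1 <= al * expR A + be * expR B.
Proof.
move=> a0 b0 ab; set s := al * A + be * B.
have tg x : expR s * (1 + (x - s)) <= expR x.
  have {2}-> : x = s + (x - s) by rewrite addrC subrK.
  by rewrite [leRHS]expRD ler_wpM2l ?expR_ge0 // expR_ge1Dx.
have t1 := ler_wpM2l a0 (tg A); have t2 := ler_wpM2l b0 (tg B).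
have c0 : 0 <= 1 - al - be by lra.
have t3 := ler_wpM2l c0 (tg 0); rewrite expR0 in t3.
have E : al * (expR s * (1 + (A - s))) + be * (expR s * (1 + (B - s))) +
   (1 - al - be) * (expR s * (1 + (0 - s))) = expR s.
  transitivity (expR s * (1 + (al * A + be * B) - s)); first by ring.
  by rewrite -/s addrK mulr1.
rewrite mulr1 in t3; move: t1 t2 t3 E.
move: (al * (expR s * (1 + (A - s)))) (be * (expR s * (1 + (B - s)))) ((1 - al - be) * (expR s * _)).
by move: (al * expR A) (be * expR B) (expR s) => *; lra.
Qed.

Definition charge_at (x : R) (m : seq nat) : R := \sum_(j <- m) phi g (j%:R - x).

Lemma charge_at_ge0 x m : 0 <= charge_at x m.
Proof. by apply: sumr_ge0 => j _; exact: expR_ge0. Qed.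

(** Moments at several abscissae reduce to single ones by [exp_sum_max], at the price of a factor
    [r] in the exponent. *)
Lemma expect_expsum r b : 0 <= b -> exists2 K : R, 0 < K & forall N xs, size xs = r ->
  expect N (fun m => expR (b * \sum_(x <- xs) charge_at x m)) <= K.
Proof.
move=> b0; have br : 0 <= r%:R * b by rewrite mulr_ge0.
have [K K0 HK] := exp_moment p0 g0 br.
exists (1 + r%:R * K).
  by rewrite ltr_pwDl // mulr_ge0 // ltW.
move=> N xs sx.
apply: (@le_trans _ _ (expect N (fun m => 1 + \sum_(x <- xs) wt g (r%:R * b) x m))).
  apply: expect_le => m _; rewrite mulr_sumr.
  have := @exp_sum_max R [seq b * charge_at x m | x <- xs]; rewrite !big_map size_map sx => H.
  apply: (le_trans (H _)); first by move=> y /mapP[x _ ->]; rewrite mulr_ge0 ?charge_at_ge0.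
  by rewrite lerD2l; apply: ler_sum => x _; rewrite mulrA.
rewrite ERD expect_cst lerD2l.
have -> : expect N (fun m => \sum_(x <- xs) wt g (r%:R * b) x m) =
    \sum_(x <- xs) expect N (fun m => wt g (r%:R * b) x m).
  rewrite /expect -mulr_suml -isum_sum; congr (_ / _); apply: eq_isum => m _; exact: mulr_sumr.
apply: (@le_trans _ _ (\sum_(x <- xs) K)).
  by apply: ler_sum => x _; rewrite ler_pdivrMr.
by rewrite big_const_seq count_predT sx iter_addr_0 mulr_natl.
Qed.

(** As [wphase] is 1 at both ends of the window, the phase of every particle depends on its clamped
    position only; the product of phases thus becomes the phase of a real sum. *)
Definition clamp (L : nat) (v : R) : R := if v < 0 then 0 else if v <= L%:R then v else L%:R.

Lemma step_fun_clamp L (v : R) : (0 < L)%N -> 1 + step_fun L v = wphase L (clamp L v).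
Proof.
move=> L0; rewrite /step_fun /clamp; have [v0|v0] := ltP v 0; rewrite /=.
  by rewrite addr0 /wphase oppr0 mul0r ee0.
have [vL|vL] := leP v L%:R; rewrite /=; first by rewrite addrC subrK.
by rewrite addr0 -wphase_sub // subrr /wphase oppr0 mul0r ee0.
Qed.

Lemma nc_1ww L (v : R) : (0 < L)%N -> nc (1 + step_fun L v) = 1.
Proof. by move=> L0; rewrite step_fun_clamp // nc_wphase. Qed.

Lemma prod_wphase L (f : nat -> R) m : \prod_(j <- m) wphase L (f j) = wphase L (\sum_(j <- m) f j).
Proof.
elim: m => [|j m IH]; first by rewrite !big_nil /wphase oppr0 mul0r ee0.
by rewrite !big_cons IH eLD.
Qed.

Definition test_prod L q X (m : seq nat) : C := \prod_(j <- m) (1 + test_fun g L q (j%:R - X)).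
Definition step_prod L X (m : seq nat) : C := \prod_(j <- m) (1 + step_fun L (j%:R - X)).

Lemma sum_window L X m : \sum_(j <- m) \sum_(0 <= i < L.+1) phi g (j%:R - X - i%:R) =
  \sum_(x <- [seq X + i%:R | i <- iota 0 L.+1]) charge_at x m.
Proof.
rewrite exchange_big big_map /index_iota subn0; apply: eq_bigr => i _; apply: eq_bigr => j _.
by rewrite opprD addrA.
Qed.

(** The order of quantifiers matters: the error from the ends of the window has a constant
    independent of [L], while the mesh error may depend on [L], as [q] is chosen after it. The
    second bound serves to truncate the expansion. *)
Lemma test_prod_step_prod : exists2 K : R, 0 < K & exists L1 : nat, forall L, (L1 <= L)%N -> (1 < L)%N ->
  exists2 KL : R, 0 < KL & forall q N X, (1 < q)%N ->
  nc (cexpect N (test_prod L q X) - cexpect N (step_prod L X)) <= KL / q%:R + K / L%:R /\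
  expect N (fun m => \prod_(j <- m) (1 + 2 * nc (test_fun g L q (j%:R - X)))) <= KL.
Proof.
have [K K0 [L1 HK]] := test_function g0.
have [K2 K20 HK2] := expect_expsum 2 (ltW K0).
exists K2 => //; exists L1 => L LL L2.
have L0 : (0 < L)%N by exact: ltnW.
have Lp : 0 < L%:R :> R by rewrite ltr0n.
pose K3 := 2 * (2 * expR g + 3 * K).
have K30 : 0 < K3 by rewrite mulr_gt0 // addr_gt0 // mulr_gt0 // expR_gt0.
have [KL KL0 HKL] := expect_expsum L.+1 (ltW K30).
exists KL => // q N X q1; have q0 : (0 < q)%N by exact: ltnW.
have qp : 0 < q%:R :> R by rewrite ltr0n.
have KK3 : K <= K3 by rewrite /K3; have := expR_gt0 g; lra.
pose e v := K / q%:R * \sum_(0 <= i < L.+1) phi g (v - i%:R) + K / L%:R * (phi g v + phi g (v - L%:R)).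
have close v : nc (1 + test_fun g L q v - (1 + step_fun L v)) <= e v.
  by rewrite opprD addrACA subrr add0r; exact: HK.
pose xs := [seq X + i%:R | i <- iota 0 L.+1].
have sxs : size xs = L.+1 by rewrite size_map size_iota.
have HA : expect N (fun m => expR (K * \sum_(x <- xs) charge_at x m)) <= KL.
  apply: le_trans (HKL N xs sxs); apply: expect_le => m _; rewrite ler_expR ler_wpM2r //.
  by apply: sumr_ge0 => *; exact: charge_at_ge0.
split.
  apply: (le_trans (nc_EXB _ _ _)).
  apply: (@le_trans _ _ (expect N (fun m => q%:R^-1 * expR (K * \sum_(x <- xs) charge_at x m) +
      L%:R^-1 * expR (K * \sum_(x <- [:: X; X + L%:R]) charge_at x m)))).
    apply: expect_le => m _; apply: (le_trans (@prod_diff _ _ (fun j => e (j%:R - X)) m _ _)).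
    - by move=> j; exact: nc_1ww.
    - by move=> j; exact: close.
    have -> : \sum_(j <- m) e (j%:R - X) = q%:R^-1 * (K * \sum_(x <- xs) charge_at x m) +
        L%:R^-1 * (K * \sum_(x <- [:: X; X + L%:R]) charge_at x m).
      rewrite /e big_split -!mulr_sumr sum_window big_split.
      have -> : \sum_(x <- [:: X; X + L%:R]) charge_at x m = charge_at X m + charge_at (X + L%:R) m.
        by rewrite big_cons big_seq1.
      have -> : charge_at (X + L%:R) m = \sum_(j <- m) phi g (j%:R - X - L%:R).
        by apply: eq_bigr => j _; rewrite opprD addrA.
      by rewrite !mulrA ![_^-1 * K]mulrC.
    apply: expR_convex3; rewrite ?invr_ge0 ?ler0n //.
    have a : q%:R^-1 <= 2^-1 :> R by rewrite lef_pV2 ?posrE ?ler_nat.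
    have b : L%:R^-1 <= 2^-1 :> R by rewrite lef_pV2 ?posrE ?ler_nat.
    by lra.
  rewrite ERD !ERZ [KL / _]mulrC [K2 / _]mulrC; apply: lerD; apply: ler_wpM2l; rewrite ?invr_ge0 ?ler0n //.
  exact: HK2.
apply: le_trans (HKL N xs sxs); apply: expect_le => m _.
rewrite /xs -sum_window mulr_sumr -expR_bigsum; apply: ler_prod => j _.
rewrite addr_ge0 ?mulr_ge0 ?nc_ge0 //=; apply: le_trans (expR_ge1Dx _); rewrite lerD2l.
move: (j%:R - X) => v.
have s0 : 0 <= \sum_(0 <= i < L.+1) phi g (v - i%:R) by apply: sumr_ge0 => *; exact: expR_ge0.
have w2 : nc (step_fun L v) <= 2 * expR g * \sum_(0 <= i < L.+1) phi g (v - i%:R).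
  rewrite /step_fun; case: ifP => [vb|_]; last first.
    by rewrite ComplexField.Normc.normc0 mulr_ge0 // mulr_ge0 // expR_ge0.
  apply: (@le_trans _ _ 2).
    by apply: (le_trans (nc_sub _ _)); rewrite nc_wphase ComplexField.Normc.normc1.
  by rewrite -mulrA ler_peMr //; exact: window_le_phi.
have ev : e v <= 3 * K * \sum_(0 <= i < L.+1) phi g (v - i%:R).
  have a : phi g v <= \sum_(0 <= i < L.+1) phi g (v - i%:R).
    by rewrite big_nat_recl // subr0 lerDl; apply: sumr_ge0 => *; exact: expR_ge0.
  have b : phi g (v - L%:R) <= \sum_(0 <= i < L.+1) phi g (v - i%:R).
    by rewrite big_nat_recr //= lerDr; apply: sumr_ge0 => *; exact: expR_ge0.
  have Kq : K / q%:R <= K by rewrite ler_pdivrMr // ler_peMr ?ler1n // ltW.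
  have KL' : K / L%:R <= K by rewrite ler_pdivrMr // ler_peMr ?ler1n // ltW.
  apply: (@le_trans _ _ (K * \sum_(0 <= i < L.+1) phi g (v - i%:R) +
     K * (\sum_(0 <= i < L.+1) phi g (v - i%:R) + \sum_(0 <= i < L.+1) phi g (v - i%:R)))).
    apply: lerD; first by apply: ler_wpM2r.
    by apply: ler_pM; rewrite ?divr_ge0 ?addr_ge0 ?expR_ge0 ?ler0n ?(ltW K0) // lerD.
  by rewrite le_eqVlt; apply/orP; left; apply/eqP; ring.
have : nc (test_fun g L q v) <= e v + nc (step_fun L v).
  have -> : test_fun g L q v = (1 + test_fun g L q v - (1 + step_fun L v)) + step_fun L v.
    by rewrite opprD addrACA subrr add0r subrK.
  by apply: (le_trans (nc_add _ _)); rewrite lerD2r.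
by rewrite /K3; move: w2 ev; move: (nc _) (nc _) (e v) (\sum_(_ <= _ < _) _) => *; lra.
Qed.

(** * Expansion of the deconvolved product in correlation functions *)

Section Expansion.
Variables (L q : nat).
Hypothesis q0 : (0 < q)%N.
Let qp : 0 < q%:R :> R. Proof. by rewrite ltr0n. Qed.

Definition grid_coef (i : nat) : C := test_coef g L q (i%:R / q%:R) * (q%:R^-1)%:C%C.

Definition grid_pos (X : R) (s : seq nat) : seq R := [seq X + i%:R / q%:R | i <- s].

(** The terms with [k] selected particles in the expansion of the product of [1 + test_fun]. Each
    [test_fun] is a combination of Gaussians at mesh points, so correlations appear only through
    [avg_corr]. *)
Definition corr_term N k X : C := isum (iota 0 (L * q).+1) k (fun s =>
  (\prod_(i <- s) grid_coef i) * (avg_corr N (grid_pos X s))%:C%C).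

Lemma test_fun_grid X (j : nat) : test_fun g L q (j%:R - X) =
  \sum_(i <- iota 0 (L * q).+1) grid_coef i * (gaussf g (X + i%:R / q%:R - j%:R))%:C%C.
Proof.
rewrite /test_fun /index_iota subn0 mulr_suml; apply: eq_bigr => i _; rewrite /grid_coef mulrAC.
by congr (_ * (gaussf g _)%:C%C); rewrite opprB addrA [_ + X]addrC.
Qed.

Lemma prod_test_fun X s : \prod_(j <- s) test_fun g L q (j%:R - X) =
  tsum (iota 0 (L * q).+1) (size s) (fun t => (\prod_(i <- t) grid_coef i) * (gauss_prod g (grid_pos X t) s)%:C%C).
Proof.
pose f (j i : nat) : C := grid_coef i * (gaussf g (X + i%:R / q%:R - j%:R))%:C%C.
transitivity (\prod_(h <- [seq f j | j <- s]) \sum_(i <- iota 0 (L * q).+1) h i).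
  by rewrite big_map; apply: eq_bigr => j _; exact: test_fun_grid.
rewrite -tsum_prod_zip size_map; apply: eq_tsum => t st.
elim: s t st => [|j s IH] [|i t] //=; first by rewrite big_nil mulr1.
case=> /IH ->; rewrite big_cons /f /gauss_prod /= rcM mulrACA.
by [].
Qed.

Let abs_term (ph : nat -> R) N k : R := isum (iota 0 (p * N)) k (fun s =>
     isum (iota 0 (p * N)) (N - k) (fun s' => cweight [::] (s ++ s')) * \prod_(x <- s) ph x) / Z N.

Lemma test_prod_expansion N X : cexpect N (test_prod L q X) = \sum_(k < N.+1) corr_term N k X.
Proof.
rewrite /cexpect /test_prod isum_prod1; last by move=> s t st; rewrite (@cweight_perm R p g [::] _ _ st).
rewrite mulr_suml; apply: eq_bigr => k _; rewrite /corr_term.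
set rs := iota 0 (p * N); set ix := iota 0 (L * q).+1.
transitivity (isum rs k (fun s => tsum ix k (fun t => (\prod_(i <- t) grid_coef i) *
   ((gauss_prod g (grid_pos X t) s)%:C%C * (isum rs (N - k) (fun s' => cweight [::] (s ++ s')))%:C%C))) * ((Z N)^-1)%:C%C).
  congr (_ * _); apply: eq_isum => s ss; rewrite prod_test_fun ss -rc_isum mulrC -tsumZr.
  by apply: eq_tsum => t _; rewrite -mulrA.
rewrite /isum tsum_exch -mulrA -tsumZr; congr (_ * _); apply: eq_tsum => t st.
rewrite tsumZ -mulrA; congr (_ * _); rewrite /avg_corr rcM rc_tsum size_map st; congr (_ * _).
by apply: eq_tsum => s _; rewrite rcM.
Qed.

Lemma corr_term_abs_term N k X : corr_term N k X = isum (iota 0 (p * N)) k (fun s =>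
   isum (iota 0 (p * N)) (N - k) (fun s' => (cweight [::] (s ++ s'))%:C%C) *
   \prod_(x <- s) test_fun g L q (x%:R - X)) * ((Z N)^-1)%:C%C.
Proof.
rewrite /corr_term; set rs := iota 0 (p * N); set ix := iota 0 (L * q).+1.
transitivity (isum rs k (fun s => tsum ix k (fun t => (\prod_(i <- t) grid_coef i) *
   ((gauss_prod g (grid_pos X t) s)%:C%C * (isum rs (N - k) (fun s' => cweight [::] (s ++ s')))%:C%C))) * ((Z N)^-1)%:C%C).
  rewrite /isum tsum_exch -mulrA -tsumZr; congr (_ * _); apply: eq_tsum => t st.
  rewrite tsumZ -mulrA; congr (_ * _); rewrite /avg_corr rcM rc_tsum size_map st; congr (_ * _).
  by apply: eq_tsum => s _; rewrite rcM.
congr (_ * _); apply: eq_isum => s ss; rewrite prod_test_fun ss -rc_isum mulrC -tsumZr.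
by apply: eq_tsum => t _; rewrite -mulrA.
Qed.

(** Doubling the moduli multiplies the [k]-th absolute term by [2 ^+ k], so the terms from [n] on
    gain [2^-1 ^+ n] against the moment. *)
Lemma test_prod_trunc N n X : (n <= N)%N ->
  nc (cexpect N (test_prod L q X) - \sum_(k < n) corr_term N k X) <=
  2^-1 ^+ n * expect N (fun m => \prod_(j <- m) (1 + 2 * nc (test_fun g L q (j%:R - X)))).
Proof.
move=> nN; set ph := fun j : nat => nc (test_fun g L q (j%:R - X)).
have TU k : nc (corr_term N k X) <= abs_term ph N k.
  rewrite corr_term_abs_term ncM nc_real ger0_norm ?invr_ge0 ?(ltW (Zgt0 N)) // ler_pM2r ?invr_gt0 //.
  apply: (le_trans (nc_isum _ _ _)); apply: le_isum => s _.
  rewrite ncM -rc_isum nc_real ger0_norm; last by apply: isum_ge0 => *; exact: cweight_ge0.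
  by rewrite nc_prod.
have U0 k : 0 <= abs_term ph N k by exact: le_trans (nc_ge0 _) (TU k).
have U2 k : abs_term (fun j => 2 * ph j) N k = 2 ^+ k * abs_term ph N k.
  rewrite /abs_term mulrA -isumZ; congr (_ / _); apply: eq_isum => s ss.
  by rewrite big_split /= big_const_seq count_predT ss iter_mulr_1 mulrCA.
have EU : expect N (fun m => \prod_(j <- m) (1 + 2 * ph j)) = \sum_(k < N.+1) 2 ^+ k * abs_term ph N k.
  rewrite /expect isum_prod1; last exact: cweight_perm.
  by rewrite mulr_suml; apply: eq_bigr => k _; rewrite -U2.
rewrite test_prod_expansion EU -!(big_mkord xpredT (fun k => corr_term N k X)) -(big_mkord xpredT (fun k => 2 ^+ k * abs_term ph N k)).
rewrite (big_cat_nat (n := n)) //=; last exact: leqW.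
rewrite addrAC subrr add0r; apply: (le_trans (nc_sum _ _)).
rewrite [X in _ <= _ * X](big_cat_nat (n := n)) //=; last exact: leqW.
rewrite mulrDr; apply: (@le_trans _ _ (2^-1 ^+ n * \sum_(n <= k < N.+1) 2 ^+ k * abs_term ph N k)); last first.
  rewrite lerDr mulr_ge0 ?exprn_ge0 ?invr_ge0 //; apply: sumr_ge0 => k _.
  by rewrite mulr_ge0 ?exprn_ge0.
rewrite mulr_sumr big_nat_cond [leRHS]big_nat_cond; apply: ler_sum => k /andP[/andP[nk _] _].
apply: (le_trans (TU k)); rewrite mulrA ler_peMl // -(subnKC nk) exprD mulrA -exprMn.
by rewrite mulVf // expr1n mul1r exprn_ege1 // ler1n.
Qed.

Lemma corr_term_shift tau k : asym_inv tau 1 k -> forall e, 0 < e -> exists d N0 : nat, forall N X,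
  (N0 <= N)%N -> d%:R <= X -> X + L%:R <= (p * N)%:R - d%:R ->
  nc (corr_term N k (X + tau) - corr_term N k X) <= e.
Proof.
move=> HA e e0; pose B := isum (iota 0 (L * q).+1) k (fun s => \prod_(i <- s) nc (grid_coef i)).
have B0 : 0 <= B by apply: isum_ge0 => s _; apply: prodr_ge0 => i _; exact: nc_ge0.
have B1 : 0 < B + 1 by lra.
have eB : 0 < e / (B + 1) by rewrite divr_gt0.
have [d [N0 H]] := HA _ eB; exists d, N0 => N X NN X1 X2.
rewrite /corr_term -isumB; apply: (le_trans (nc_isum _ _ _)).
apply: (@le_trans _ _ (isum (iota 0 (L * q).+1) k (fun s => e / (B + 1) * \prod_(i <- s) nc (grid_coef i)))).
  apply: le_isum_in => s ss sr; rewrite -mulrBr ncM nc_prod mulrC ler_wpM2r //.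
    by apply: prodr_ge0 => i _; exact: nc_ge0.
  rewrite -rcB nc_real.
  have -> : grid_pos (X + tau) s = [seq x + tau | x <- grid_pos X s].
    by rewrite /grid_pos -map_comp; apply: eq_map => i /=; rewrite addrAC.
  rewrite -[avg_corr N (grid_pos X s)]mul1r; apply: H => //; first by rewrite size_map.
  apply/allP => x /mapP[i /sr]; rewrite mem_iota add0n ltnS => /andP[_ iL] ->.
  have a : 0 <= i%:R / q%:R :> R by rewrite divr_ge0 ?ler0n.
  have b : i%:R / q%:R <= L%:R :> R by rewrite ler_pdivrMr // -natrM ler_nat.
  by move: a b; move: (i%:R / q%:R) => y a b; apply/andP; split; lra.
rewrite isumZ -/B mulrAC ler_pdivrMr // ler_wpM2l ?(ltW e0) //; lra.
Qed.

(** Invariance for [n] points is enough, as [asym_inv_descend] supplies it for every smaller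
    number. *)
Lemma sum_corr_term_shift tau n : asym_inv tau 1 n -> forall e, 0 < e -> exists d N0 : nat, forall N X,
  (N0 <= N)%N -> d%:R <= X -> X + L%:R <= (p * N)%:R - d%:R ->
  nc (\sum_(k < n.+1) corr_term N k (X + tau) - \sum_(k < n.+1) corr_term N k X) <= e.
Proof.
move=> HA; suff H n' : (n' <= n.+1)%N -> forall e, 0 < e -> exists d N0 : nat, forall N X,
    (N0 <= N)%N -> d%:R <= X -> X + L%:R <= (p * N)%:R - d%:R ->
    nc (\sum_(k < n') corr_term N k (X + tau) - \sum_(k < n') corr_term N k X) <= e by exact: H.
elim: n' => [|n' IH] nn e e0.
  by exists 0%N, 0%N => N X _ _ _; rewrite !big_ord0 subrr ComplexField.Normc.normc0 ltW.
have e2 : 0 < e / 2 by rewrite divr_gt0.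
have [d1 [N1 H1]] := IH (ltnW nn) _ e2.
have [d2 [N2 H2]] := @corr_term_shift tau n' (asym_inv_descend p0 g0 (nn : (n' <= n)%N) HA) _ e2.
exists (d1 + d2)%N, (N1 + N2)%N => N X NN; rewrite natrD => X1 X2.
have d10 : 0 <= d1%:R :> R by rewrite ler0n.
have d20 : 0 <= d2%:R :> R by rewrite ler0n.
rewrite !big_ord_recr /= opprD addrACA; apply: (le_trans (nc_add _ _)).
rewrite [e]splitr; apply: lerD.
  by apply: H1; [exact: leq_trans (leq_addr _ _) NN | lra | lra].
by apply: H2; [exact: leq_trans (leq_addl _ _) NN | lra | lra].
Qed.

End Expansion.

Lemma renewal_at_sum k (X : R) m : renewal_at p k m ->
  \sum_(j <- m) (if (j < p * k)%N then j%:R - X else 0) = (p * 'C(k, 2))%:R - k%:R * X.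
Proof.
move=> /andP[/eqP ck /eqP sk].
rewrite -sk -[in k%:R]ck; elim: m {ck sk} => [|j m IH]; first by rewrite big_nil /= mul0r subr0.
rewrite big_cons IH /=; case: ifP => _ /=; last by rewrite add0r.
by rewrite add1n -natr1 natrD; ring.
Qed.

Lemma bin2_real k : ('C(k, 2))%:R = k%:R * (k%:R - 1) / 2 :> R.
Proof.
elim: k => [|k IH]; first by rewrite !mul0r.
by rewrite binS bin1 natrD IH -natr1; field.
Qed.

(* Each renewal point fixes the sum of the orbitals to its left, so between two of them the
   phase is determined by the window and the position [X], up to corrections of order [1/L]. *)
Lemma winding_config (X : R) l k1 k2 m (h : R) : (0 < l)%N -> 0 <= h ->
  (p * k1)%:R <= X -> X + (p * l)%:R <= (p * k2)%:R ->
  X - (p * k1)%:R <= p%:R * h -> (p * k2)%:R - X - (p * l)%:R <= p%:R * h ->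
  renewal_at p k1 m -> renewal_at p k2 m ->
  nc (step_prod (p * l) X m - ee (X / p%:R - (l%:R - 1) / 2)) <=
  8 * (p%:R * h * expR (g * (p%:R * h)) * (charge_at X m + charge_at (X + (p * l)%:R) m) + p%:R * (h * (h + 1))) / (p * l)%:R.
Proof.
move=> l0 h0 X1 X2 X3 X4 R1 R2; set L := (p * l)%N in X2 X4 *.
have L0 : (0 < L)%N by rewrite muln_gt0 p0.
have Lp : 0 < L%:R :> R by rewrite ltr0n.
have lp : 0 < l%:R :> R by rewrite ltr0n.
have X0 : 0 <= X by apply: le_trans X1; rewrite ler0n.
set H := p%:R * h in X3 X4 *; have H0 : 0 <= H by rewrite mulr_ge0 // ltW.
(* [A] puts the two renewal points in place of the ends of the window, so that its sum is known by
   [renewal_at_sum]. The correction [co] vanishes except for orbitals within [H] of [X] or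
   [X + L]. *)
pose A (j : nat) : R := (if (j < p * k2)%N then j%:R - X else 0) -
  (if (j < p * k1)%N then j%:R - X else 0) + (if (p * k2 <= j)%N then L%:R else 0).
pose co (j : nat) : R := clamp L (j%:R - X) - A j.
have coB j : `|co j| <= H * expR (g * H) * (phi g (j%:R - X) + phi g (j%:R - (X + L%:R))).
  have ph (v : R) : `|v| <= H -> 1 <= expR (g * H) * phi g v.
    move=> vH; rewrite /phi -expRD -[leLHS]expR0 ler_expR subr_ge0 ler_pM2l //.
  have q1 := expR_ge0 (- (g * `|j%:R - X|)); have q2 := expR_ge0 (- (g * `|j%:R - (X + L%:R)|)).
  rewrite -/(phi g (j%:R - X)) in q1; rewrite -/(phi g (j%:R - (X + L%:R))) in q2.
  have fin : (co j = 0) \/ (`|co j| <= H /\ (`|j%:R - X| <= H \/ `|j%:R - (X + L%:R)| <= H)) ->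
      `|co j| <= H * expR (g * H) * (phi g (j%:R - X) + phi g (j%:R - (X + L%:R))).
    case=> [->|[cH dd]].
      by rewrite normr0 mulr_ge0 ?addr_ge0 // mulr_ge0 ?expR_ge0.
    apply: (le_trans cH); rewrite -mulrA ler_peMr // mulrDr.
    case: dd => /ph a.
      by apply: (le_trans a); rewrite lerDl mulr_ge0 ?expR_ge0.
    by apply: (le_trans a); rewrite lerDr mulr_ge0 ?expR_ge0.
  apply: fin; rewrite /co /A /clamp.
  have k12 : (p * k1 <= p * k2)%N.
    by rewrite -(ler_nat R) (le_trans X1) // (le_trans _ X2) // lerDl ler0n.
  case: (ltnP j (p * k1)) => j1.
    have j2 : (j < p * k2)%N by exact: leq_trans j1 k12.
    rewrite j2 leqNgt j2 /= subrr addr0 subr0.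
    have : j.+1%:R <= (p * k1)%:R :> R by rewrite ler_nat.
    rewrite -natr1 => j1'; left; rewrite ifT //; lra.
  have j1' : (p * k1)%:R <= j%:R :> R by rewrite ler_nat.
  case: (ltnP j (p * k2)) => j2; rewrite /= subr0; last first.
    have j2' : (p * k2)%:R <= j%:R :> R by rewrite ler_nat.
    rewrite add0r; left; have [a|a] := ltP (j%:R - X) 0; first by lra.
    by have [b|b] := leP (j%:R - X) L%:R; rewrite ?subrr //; lra.
  have j2' : j%:R <= (p * k2)%:R :> R by rewrite ler_nat ltnW.
  rewrite addr0; have [a|a] := ltP (j%:R - X) 0.
    right; split; [|left]; rewrite ler_norml; apply/andP; split; lra.
  have [b|b] := leP (j%:R - X) L%:R; first by left; rewrite subrr.
  by right; split; [|right]; rewrite ler_norml; apply/andP; split; lra.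
pose c := count (fun j => p * k2 <= j)%N m.
have sA : \sum_(j <- m) A j = ((p * 'C(k2, 2))%:R - k2%:R * X) - ((p * 'C(k1, 2))%:R - k1%:R * X) + c%:R * L%:R.
  rewrite /A big_split /= sumrB (renewal_at_sum _ R1) (renewal_at_sum _ R2); congr (_ + _).
  rewrite -big_mkcond big_const_seq iter_addr_0 mulr_natl; congr (_ *+ _).
have sC : \sum_(j <- m) clamp L (j%:R - X) = \sum_(j <- m) A j + \sum_(j <- m) co j.
  by rewrite -big_split /=; apply: eq_bigr => j _; rewrite /co addrC subrK.
have lk2 : (l <= k2)%N.
  rewrite -(leq_pmul2l p0) -(ler_nat R); apply: le_trans X2; rewrite -/L lerDr //.
(* The distances, in periods, from the window to the renewal points; the quadratic terms in [k1] and
   [k2] cancel up to [O], of order [1/l]. *)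
pose a := X / p%:R - k1%:R; pose b := k2%:R - X / p%:R - l%:R.
have XE : X = p%:R * (X / p%:R) by rewrite mulrC divfK ?gt_eqF.
have a0 : 0 <= a /\ a <= h.
  move: X1 X3; rewrite /H /a natrM; move: (X / _) XE => x ->.
  by rewrite -mulrBr !ler_pM2l // => *; split; lra.
have b0 : 0 <= b /\ b <= h.
  move: X2 X4; rewrite /H /b /L !natrM; move: (X / _) XE => x ->.
  by rewrite -mulrDr -!mulrBr !ler_pM2l // => *; split; lra.
pose O := 2^-1 * (a + b) * (b - a - 1) / l%:R.
have OB : `|O| <= p%:R * (h * (h + 1)) / L%:R.
  have -> : p%:R * (h * (h + 1)) / L%:R = h * (h + 1) / l%:R.
    by rewrite /L natrM; field; rewrite !gt_eqF.
  rewrite /O normrM normfV (gtr0_norm lp).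
  rewrite ler_pM2r ?invr_gt0 // normrM; apply: ler_pM => //.
    by rewrite ger0_norm; lra.
  by rewrite ler_norml; apply/andP; split; lra.
(* The [c] particles to the right of the window contribute full turns; together with [k2 - l] they
   form an integer, on which [ee] is trivial. *)
have phase : - (\sum_(j <- m) clamp L (j%:R - X)) / L%:R =
   X / p%:R - (l%:R - 1) / 2 - (O + (\sum_(j <- m) co j) / L%:R) - (k2 - l + c)%:R.
  rewrite sC sA /O /a /b natrD natrB // /L !natrM !bin2_real; move: (\sum_(j <- m) co j) => s.
  move: (X / _) XE => x ->; move: (k1%:R : R) (k2%:R : R) (c%:R : R) => x1 x2 x3.
  by field; rewrite !gt_eqF.
rewrite /step_prod (eq_bigr (fun j : nat => wphase L (clamp L (j%:R - X)))); last by move=> j _; rewrite step_fun_clamp.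
rewrite prod_wphase /wphase phase [ee (_ - (_ + c)%:R)]eeD eeN ee_nat (rmorph1 (@conjc R)) mulr1.
apply: (le_trans (nc_ee_sub _ _)); rewrite -mulrA ler_pM2l //.
have -> : X / p%:R - (l%:R - 1) / 2 - (O + (\sum_(j <- m) co j) / L%:R) - (X / p%:R - (l%:R - 1) / 2) =
  - (O + (\sum_(j <- m) co j) / L%:R).
  by move: (X / p%:R - _) (O + _) => u v; ring.
rewrite normrN; apply: (le_trans (ler_normD _ _)); rewrite mulrDl addrC; apply: lerD => //.
rewrite normrM normfV (gtr0_norm Lp) ler_pM2r ?invr_gt0 //.
apply: (le_trans (ler_norm_sum _ _ _)); apply: (le_trans (ler_sum _ (fun j _ => coB j))).
by rewrite -mulr_sumr big_split.
Qed.

(** Except with probability [eps] on each side, renewal points lie within a bounded number of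
    periods of both ends of the window. On the exceptional events the error is at most 2, whence
    [4 * eps]. *)
Lemma winding (eps : R) : 0 < eps -> exists D : nat, exists2 K : R, 0 < K & forall l N X, (0 < l)%N ->
  (p * D)%:R <= X -> X + (p * (l + D + 2))%:R <= (p * N)%:R ->
  nc (cexpect N (step_prod (p * l) X) - ee (X / p%:R - (l%:R - 1) / 2)) <= 4 * eps + K / (p * l)%:R.
Proof.
move=> e0; have [D HD] := gap_small p0 g0 e0; exists D.
pose h : R := D.+1%:R; have h0 : 0 <= h by rewrite ler0n.
pose H := p%:R * h.
have H0 : 0 <= H by rewrite mulr_ge0 // ltW.
have [K1 K10 HK1] := expect_expsum 2 (@ler01 R).
pose K := 8 * (H * expR (g * H) * K1 + p%:R * (h * (h + 1))).
have K0 : 0 < K.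
  have h1 : 0 < h by rewrite ltr0n.
  have : 0 < p%:R * (h * (h + 1)) by rewrite mulr_gt0 // mulr_gt0 // addr_gt0.
  have : 0 <= H * expR (g * H) * K1 by rewrite mulr_ge0 ?mulr_ge0 ?expR_ge0 ?(ltW K10).
  by rewrite /K; move: (_ * K1) (_ * (h * _)) => *; lra.
exists K => // l N X l0 X1 X2.
set L := (p * l)%N; have L0 : (0 < L)%N by rewrite muln_gt0 p0.
have Lp : 0 < L%:R :> R by rewrite ltr0n.
have X0 : 0 <= X by apply: le_trans X1; rewrite ler0n.
have Xp0 : 0 <= X / p%:R by rewrite divr_ge0 // ltW.
have [A A1 A2] : exists2 A : nat, (p * A)%:R <= X & X < (p * A.+1)%:R.
  have /andP[A1 A2] := truncn_itv Xp0; exists (Num.truncn (X / p%:R)); rewrite natrM mulrC.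
    by rewrite -ler_pdivlMr.
  by rewrite -ltr_pdivrMr.
have DA : (D <= A)%N.
  by have := le_lt_trans X1 A2; rewrite ltr_nat ltn_pmul2l // ltnS.
have AN : (A + l + D + 2 <= N)%N.
  rewrite -(leq_pmul2l p0) -(ler_nat R); apply: le_trans X2.
  by rewrite -!addnA mulnDr natrD lerD2r.
(* The second gap starts right after the window: the places from [A + l + 2] to [A'] all lie beyond
   [X + p * l]. *)
pose A' := (A + l + 1 + D)%N.
have AN1 : (A < N)%N by clear -AN; lia.
have AN2 : (A' < N)%N by rewrite /A'; clear -AN; lia.
have DA' : (D <= A')%N by rewrite /A'; clear; lia.
pose om := ee (X / p%:R - (l%:R - 1) / 2).
pose ind P (m : seq nat) : R := if P m then 1 else 0.
have ERind P : expect N (ind P) = mass [::] N P / Z N.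
  congr (_ / _); apply: eq_isum => m _; rewrite /ind; case: ifP => _; by rewrite ?mulr1 ?mulr0.
have b1 : expect N (ind (no_renewal p (A - D) A)) <= eps by rewrite ERind ler_pdivrMr //; exact: HD.
have b2 : expect N (ind (no_renewal p (A' - D) A')) <= eps by rewrite ERind ler_pdivrMr //; exact: HD.
rewrite -[ee _](cexpect_cst N); apply: (le_trans (nc_EXB _ _ _)).
apply: (@le_trans _ _ (expect N (fun m => 2 * ind (no_renewal p (A - D) A) m + 2 * ind (no_renewal p (A' - D) A') m +
   (8 * (H * expR (g * H)) / L%:R * expR (1 * \sum_(x <- [:: X; X + L%:R]) charge_at x m) +
    8 * (p%:R * (h * (h + 1))) / L%:R)))); last first.
  rewrite !ERD !ERZ expect_cst.
  have := ler_wpM2l _ (HK1 N [:: X; X + L%:R] erefl) => /(_ (8 * (H * expR (g * H)) / L%:R)) b3.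
  have {}b3 := b3 (divr_ge0 (mulr_ge0 (ler0n _ 8) (mulr_ge0 H0 (expR_ge0 _))) (ltW Lp)).
  have -> : K / L%:R = 8 * (H * expR (g * H)) / L%:R * K1 + 8 * (p%:R * (h * (h + 1))) / L%:R.
    by rewrite /K; move: (expR _) (L%:R^-1) => *; ring.
  apply: lerD; last by rewrite lerD2r.
  by move: b1 b2; move: (expect _ _) (expect _ _) => *; lra.
apply: expect_le => m _.
have c0 : 0 <= 8 * (H * expR (g * H)) / L%:R * expR (1 * \sum_(x <- [:: X; X + L%:R]) charge_at x m) +
    8 * (p%:R * (h * (h + 1))) / L%:R.
  apply: addr_ge0; last by rewrite divr_ge0 ?ler0n // !mulr_ge0 // addr_ge0.
  by rewrite mulr_ge0 ?expR_ge0 // divr_ge0 ?ler0n // !mulr_ge0 ?expR_ge0.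
have n2 : nc (step_prod L X m - om) <= 2.
  apply: (le_trans (nc_sub _ _)); rewrite nc_ee nc_prod big1 // => j _; exact: nc_1ww.
rewrite /ind; case: ifP => g1.
  apply: (le_trans n2); case: ifP => _; move: c0; move: (_ + _ / _) => *; lra.
case: ifP => g2; first by apply: (le_trans n2); move: c0; move: (_ + _ / _) => *; lra.
have [k1 [k1a k1b] R1] : exists2 k1, (A - D < k1 /\ k1 <= A)%N & renewal_at p k1 m.
  have /negbT := g1; rewrite /no_renewal -has_predC => /hasP[k]; rewrite mem_iota /= negbK => kk R1.
  by exists k => //; clear -kk DA; lia.
have [k2 [k2a k2b] R2] : exists2 k2, (A' - D < k2 /\ k2 <= A')%N & renewal_at p k2 m.
  have /negbT := g2; rewrite /no_renewal -has_predC => /hasP[k]; rewrite mem_iota /= negbK => kk R2.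
  by exists k => //; clear -kk DA'; lia.
rewrite !mulr0 !add0r; apply: (le_trans (@winding_config X l k1 k2 m h l0 h0 _ _ _ _ R1 R2)).
- by apply: le_trans A1; rewrite ler_nat leq_mul2l k1b orbT.
- apply: (@le_trans _ _ (p * (A.+1 + l))%:R); first by rewrite mulnDr natrD lerD2r ltW.
  by rewrite ler_nat leq_mul2l; apply/orP; right; move: k2a; rewrite /A'; clear; lia.
- have : (A.+1 <= k1 + D.+1)%N by clear -k1a DA; lia.
  rewrite -(leq_pmul2l p0) -(ler_nat R) mulnDr natrD [X in _ + X]natrM -/h => t.
  by move: A2 t; move: (p%:R * h) (_%:R) (_%:R) => *; lra.
- have : (k2 <= A + l + D.+1)%N by move: k2b; rewrite /A'; clear; lia.
  rewrite -(leq_pmul2l p0) -(ler_nat R) !mulnDr !natrD [X in _ + X]natrM -/h => t.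
  by move: A1 t; move: (p%:R * h) (_%:R) (_%:R) (_%:R) => *; lra.
rewrite -/L -/H mulrDr mulrDl lerD2r big_cons big_seq1 mul1r.
rewrite mulrA [leLHS]mulrAC ler_wpM2l //.
  by rewrite divr_ge0 ?ler0n // !mulr_ge0 ?expR_ge0.
by apply: le_trans (expR_ge1Dx _); rewrite lerDr.
Qed.

(** Here the cosine is nonpositive, so the squared distance, 2 minus twice the cosine, is at least
    2. *)
Lemma ee_far (t : R) : 3^-1 <= t <= 2 / 3 -> 1 < nc (ee t - 1).
Proof.
move=> /andP[t1 t2]; have pi0 := pi_gt0 R.
have c0 : cos (2 * pi * t) <= 0.
  have -> : 2 * pi * t = (2 * pi * t - pi) + pi by ring.
  rewrite cosDpi oppr_le0; apply: cos_ge0_pihalf.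
  have a : pi * 3^-1 <= pi * t by rewrite ler_pM2l.
  have b : pi * t <= pi * (2 / 3) by rewrite ler_pM2l.
  have -> : 2 * pi * t = 2 * (pi * t) by rewrite mulrA.
  by move: a b; move: (pi * t) => *; apply/andP; split; lra.
have n0 := nc_ge0 (ee t - 1).
rewrite ltNge; apply/negP => n1.
have : nc (ee t - 1) ^+ 2 <= 1 by rewrite expr_le1.
rewrite /ee /= subr0 sqr_sqrtr ?addr_ge0 ?sqr_ge0 //.
have := cos2Dsin2 (2 * pi * t); move: c0; move: (cos _) (sin _) => c s c0 cs.
have -> : (c - 1) ^+ 2 + s ^+ 2 = c ^+ 2 + s ^+ 2 - 2 * c + 1 by ring.
by rewrite cs; lra.
Qed.

(** [l] is chosen for the ends of the window, [q] for the mesh error at this [l], and [n] for the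
    truncation, all before [tau]. Gaps, ends, mesh and truncation cost 1/16 each; two approximations
    and one shift add up to 9/16, less than the distance between the phases at [X] and [X + tau]. *)
Theorem no_small_period : exists n, forall tau, p%:R / 3 <= tau <= 2 * p%:R / 3 -> ~ asym_inv tau 1 n.
Proof.
have e0 : 0 < 64^-1 :> R by rewrite invr_gt0.
have [D [K1 K10 H1]] := winding e0.
have [K2 K20 [L1 H2]] := test_prod_step_prod.
pose l := ((Num.truncn (16 * (K1 + K2))).+1 + L1 + 2)%N.
have l0 : (0 < l)%N by rewrite /l; lia.
pose L := (p * l)%N.
have lL : (l <= L)%N by rewrite leq_pmull.
have L1L : (L1 <= L)%N by apply: leq_trans lL; rewrite /l; lia.
have L2 : (1 < L)%N by apply: leq_trans lL; rewrite /l; lia.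
have Lp : 0 < L%:R :> R by rewrite ltr0n ltnW.
have KL1 : (K1 + K2) / L%:R <= 16^-1.
  rewrite ler_pdivrMr // -ler_pdivrMl ?invr_gt0 // invrK.
  apply: (le_trans (ltW (truncnS_gt _))); rewrite ler_nat; apply: leq_trans lL; rewrite /l -addnA leq_addr //.
have [KL KL0 H3] := H2 L L1L L2.
pose q := (Num.truncn (16 * KL)).+2.
have q1 : (1 < q)%N by [].
have qp : 0 < q%:R :> R by rewrite ltr0n.
have KLq : KL / q%:R <= 16^-1.
  rewrite ler_pdivrMr // -ler_pdivrMl ?invr_gt0 // invrK.
  by apply: (le_trans (ltW (truncnS_gt _))); rewrite ler_nat.
clearbody q; clearbody l.
pose n := (Num.truncn (16 * KL)).+1.
have nK : 2^-1 ^+ n.+1 * KL <= 16^-1.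
  rewrite exprVn -ler_pdivlMl ?invr_gt0 ?exprn_gt0 // invrK -ler_pdivrMr ?invr_gt0 // invrK mulrC.
  apply: (le_trans (ltW (truncnS_gt _))); rewrite -natrX ler_nat -/n.
  by apply: ltnW; apply: leq_trans (ltn_expl n.+1 _).
exists n => tau /andP[t1 t2] HA.
have e1 : 0 < 16^-1 :> R by rewrite invr_gt0.
have [d [N0 H4]] := sum_corr_term_shift L (ltnW q1) HA e1.
have tau0 : 0 <= tau by apply: le_trans t1; rewrite divr_ge0 // ltW.
have taup : tau <= p%:R by move: pp t2; lra.
pose M := (D + d)%N; pose X : R := (p * M)%:R.
have [N [N0N nN MN1 MN2]] : exists N, [/\ N0 <= N, n.+1 <= N, M + l + d <= N &
    M + 1 + (l + D + 2) <= N]%N.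
  by exists (M + l + D + d + n + N0 + 4)%N; clear; split; lia.
have dM : d%:R <= X by rewrite /X ler_nat /M; apply: leq_trans (leq_pmull _ p0); exact: leq_addl.
have DM : (p * D)%:R <= X by rewrite /X ler_nat leq_mul2l leq_addr orbT.
have XL : X + L%:R <= (p * N)%:R - d%:R.
  rewrite lerBrDr /X /L -!natrD -!mulnDr ler_nat.
  apply: (@leq_trans (p * (M + l) + p * d)); first by rewrite leq_add2l leq_pmull.
  by rewrite -mulnDr leq_mul2l MN1 orbT.
have XN : X + p%:R + (p * (l + D + 2))%:R <= (p * N)%:R.
  rewrite /X -natrD -{2}[p]muln1 -mulnDr -natrD -mulnDr ler_nat leq_mul2l MN2 orbT //.
have X0 : 0 <= X by rewrite ler0n.
have approx Y : (p * D)%:R <= Y -> Y + (p * (l + D + 2))%:R <= (p * N)%:R ->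
    nc (\sum_(k < n.+1) corr_term L q N k Y - ee (Y / p%:R - (l%:R - 1) / 2)) <= 4^-1.
  move=> Y1 Y2; have a := H1 l N Y l0 Y1 Y2; have [b c] := H3 q N Y q1.
  have d' := test_prod_trunc L q Y nN.
  have {}d' : nc (cexpect N (test_prod L q Y) - \sum_(k < n.+1) corr_term L q N k Y) <= 16^-1.
    apply: (le_trans d'); apply: le_trans nK; apply: ler_wpM2l => //.
  move: a b d'; rewrite -/L; move: (cexpect N (test_prod L q Y)) (cexpect N (step_prod L Y)) => g1 w1.
  move: (\sum_(_ < _) _) (ee _) => T om a b d'.
  have -> : T - om = - (g1 - T) + (g1 - w1) + (w1 - om).
    by rewrite opprB [T - g1 + _]addrA subrK addrA subrK.
  apply: (le_trans (nc_add _ _)); have := nc_add (- (g1 - T)) (g1 - w1); rewrite normcN.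
  move: KL1; rewrite mulrDl; move: a b d' KLq.
  move: (nc (w1 - om)) (nc (g1 - w1)) (nc (g1 - T)) (nc (_ + _)) (KL / _) (K1 / _) (K2 / _).
  by move=> *; lra.
have a1 : nc (\sum_(k < n.+1) corr_term L q N k X - ee (X / p%:R - (l%:R - 1) / 2)) <= 4^-1.
  by apply: approx => //; apply: le_trans XN; rewrite lerD2r lerDl ltW.
have a2 : nc (\sum_(k < n.+1) corr_term L q N k (X + tau) - ee ((X + tau) / p%:R - (l%:R - 1) / 2)) <= 4^-1.
  apply: approx; first by apply: (le_trans DM); rewrite lerDl.
  by apply: le_trans XN; rewrite lerD2r lerD2l.
have a3 := H4 N X N0N dM XL.
have far : 1 < nc (ee (tau / p%:R) - 1).
  apply: ee_far; rewrite ler_pdivlMr // ler_pdivrMr //; apply/andP; split.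
    by rewrite mulrC.
  by rewrite mulrAC.
have E : nc (ee ((X + tau) / p%:R - (l%:R - 1) / 2) - ee (X / p%:R - (l%:R - 1) / 2)) = nc (ee (tau / p%:R) - 1).
  rewrite mulrDl addrAC [ee (_ + tau / _)]eeD; move: (X / p%:R - _) => u.
  by rewrite -{2}[ee u]mulr1 -mulrBr ncM nc_ee mul1r.
move: a1 a2 a3 E far; move: (\sum_(_ < _) _) (\sum_(_ < _) _) (ee (_ - _)) (ee (_ - _)) => T2 T1 o2 o1.
move=> a1 a2 a3 <- far.
have := nc_add (- (T2 - o2) + (T2 - T1)) (T1 - o1); have := nc_add (- (T2 - o2)) (T2 - T1).
rewrite normcN; have -> : - (T2 - o2) + (T2 - T1) + (T1 - o1) = o2 - o1.
  by rewrite opprB !addrA !subrK.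
by move: a1 a2 a3 far; move: (nc _) (nc _) (nc _) (nc _) (nc _) => *; lra.
Qed.

End SymmetryBreaking.

(** * Integration over the cylinder *)

Section CylinderIntegral.
Variable R : realType.
Local Notation C := R[i].
Local Notation mu := (@lebesgue_measure R).
Import numFieldNormedType.Exports.
Local Open Scope classical_set_scope.

(** Integrability and value travel together, so that each linearity step yields both. *)
Definition has_int (D : set R) (f : R -> R) (v : R) : Prop :=
  mu.-integrable D (EFin \o f) /\ (\int[mu]_(x in D) (f x)%:E)%E = v%:E.

Lemma has_int_ext D f h v : (forall x, f x = h x) -> has_int D f v -> has_int D h v.
Proof. by move=> /funext ->. Qed.

Lemma has_intD D f h v w : measurable D -> has_int D f v -> has_int D h w ->
  has_int D (fun x => f x + h x) (v + w).
Proof.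
move=> mD [fi fv] [hi hw]; split.
  have -> : EFin \o (fun x => f x + h x) = ((EFin \o f) \+ (EFin \o h))%E by apply/funext.
  exact: integrableD.
by under eq_integral do rewrite EFinD; rewrite integralD // fv hw.
Qed.

Lemma has_intZ D c f v : measurable D -> has_int D f v -> has_int D (fun x => c * f x) (c * v).
Proof.
move=> mD [fi fv]; split.
  have -> : EFin \o (fun x => c * f x) = (fun x => (c%:E * (EFin \o f) x)%E) by apply/funext.
  exact: integrableZl.
by under eq_integral do rewrite EFinM; rewrite integralZl // fv.
Qed.

Lemma has_int0 D : has_int D (fun=> 0) 0.
Proof. by split; [exact: integrable0 | exact: integral0]. Qed.

Lemma has_int_sum D (I : Type) (s : seq I) (f : I -> R -> R) (v : I -> R) : measurable D ->
  (forall i, has_int D (f i) (v i)) ->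
  has_int D (fun x => \sum_(i <- s) f i x) (\sum_(i <- s) v i).
Proof.
move=> mD H; elim: s => [|i s IH].
  by rewrite big_nil; apply: has_int_ext (has_int0 D) => x; rewrite big_nil.
rewrite big_cons; apply: has_int_ext (has_intD mD (H i) IH) => x; by rewrite big_cons.
Qed.

Lemma has_int_tsum D (X : Type) (rs : seq X) n (F : seq X -> R -> R) (V : seq X -> R) :
  measurable D -> (forall t, has_int D (F t) (V t)) ->
  has_int D (fun x => tsum rs n (fun t => F t x)) (tsum rs n V).
Proof.
move=> mD; elim: n F V => [|n IH] F V H; first exact: H.
by apply: has_int_sum => // i; apply: IH => t; exact: H.
Qed.

Lemma has_int_FTC (f F : R -> R) (b : R) : 0 < b ->
  (forall y : R, is_derive y (1 : R) F (f y)) -> continuous f ->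
  has_int `[0, b] f (F b - F 0).
Proof.
move=> b0 dF cf; have cf' : {within `[0, b], continuous f} by exact: continuous_subspaceT.
split.
  by apply: continuous_compact_integrable => //; exact: segment_compact.
have cF y : F z @[z --> y] --> F y.
  by apply: differentiable_continuous; apply/derivable1_diffP; case: (dF y).
rewrite (@continuous_FTC2 R f F 0 b) // => [|y _].
  split => [y _||]; [by case: (dF y) | exact: cvg_at_right_filter | exact: cvg_at_left_filter].
by rewrite derive1E; have := dF y => dFy; rewrite derive_val.
Qed.

Lemma is_derive_scale (k y : R) : is_derive y 1 (fun z : R => k * z) k.
Proof. exact: (is_derive_eq (is_deriveZ k (is_derive_id y 1)) (mulr1 k)). Qed.

Lemma has_int_const (b c : R) : 0 < b -> has_int `[0, b] (fun=> c) (c * b).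
Proof.
move=> b0; have := @has_int_FTC (fun=> c) (fun z => c * z) b b0 (is_derive_scale c) (@cst_continuous _ _ c).
by rewrite mulr0 subr0.
Qed.

Lemma continuous_scale (h : R -> R) (k : R) : continuous h -> continuous (fun y => h (k * y)).
Proof.
move=> ch y; apply: (@continuous_comp _ _ _ (fun z => k * z) h); first exact: mulrl_continuous.
exact: ch.
Qed.

Lemma has_int_cos (b k : R) : 0 < b -> k != 0 -> sin (k * b) = 0 -> has_int `[0, b] (fun y => cos (k * y)) 0.
Proof.
move=> b0 k0 s0; have E : k^-1 * sin (k * b) - k^-1 * sin (k * 0) = 0.
  by rewrite s0 !mulr0 sin0 mulr0 subrr.
rewrite -[X in has_int _ _ X]E.
apply: (@has_int_FTC _ (fun y => k^-1 * sin (k * y))) => // [y|]; last exact/continuous_scale/continuous_cos.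
have := is_deriveZ k^-1 (is_derive1_comp (is_derive_sin (k * y)) (is_derive_scale k y)).
by move=> H; apply: (is_derive_eq H); rewrite /GRing.scale /= mulrC mulfK.
Qed.

Lemma has_int_sin (b k : R) : 0 < b -> k != 0 -> cos (k * b) = 1 -> has_int `[0, b] (fun y => sin (k * y)) 0.
Proof.
move=> b0 k0 s0; have E : - k^-1 * cos (k * b) - - k^-1 * cos (k * 0) = 0.
  by rewrite s0 mulr0 cos0 subrr.
rewrite -[X in has_int _ _ X]E.
apply: (@has_int_FTC _ (fun y => - k^-1 * cos (k * y))) => // [y|]; last exact/continuous_scale/continuous_sin.
have := is_deriveZ (- k^-1) (is_derive1_comp (is_derive_cos (k * y)) (is_derive_scale k y)).
move=> H; apply: (is_derive_eq H); rewrite /GRing.scale /=.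
by rewrite !mulNr mulrN opprK mulrCA mulVf // mulr1.
Qed.

Lemma ee_int_sub (j k : nat) : ee (j%:R - k%:R) = 1 :> C.
Proof. by rewrite eeD ee_nat mul1r eeN ee_nat (rmorph1 (@conjc R)). Qed.

(** Real parts suffice for Parseval: the double sum obtained from a squared modulus is real. *)
Lemma has_int_phase (b : R) (c : C) (j k : nat) : 0 < b ->
  has_int `[0, b] (fun y => complex.Re (c * ee ((j%:R - k%:R) * (y / b))))
    (if j == k then complex.Re c * b else 0).
Proof.
move=> b0; have mD : measurable `[0, b] by exact: measurable_itv.
case: eqP => [->|/eqP jk].
  apply: has_int_ext (has_int_const (complex.Re c) b0) => y.
  by rewrite subrr mul0r ee0 mulr1.
pose ka : R := 2 * pi * (j%:R - k%:R) / b.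
have kab : ka * b = 2 * pi * (j%:R - k%:R) by rewrite /ka divfK ?gt_eqF.
have ka0 : ka != 0.
  have jk' : j%:R - k%:R != 0 :> R by rewrite subr_eq0 eqr_nat.
  have pn : pi != 0 :> R by rewrite gt_eqF // pi_gt0.
  have bn : b^-1 != 0 by rewrite invr_neq0 // gt_eqF.
  by rewrite /ka !mulf_neq0 // pnatr_eq0.
have E1 : cos (ka * b) = 1 by rewrite kab; have [] := ee_int_sub j k.
have E2 : sin (ka * b) = 0 by rewrite kab; have [] := ee_int_sub j k.
have := has_intD mD (has_intZ (complex.Re c) mD (has_int_cos b0 ka0 E2))
  (has_intZ (- complex.Im c) mD (has_int_sin b0 ka0 E1)).
rewrite !mulr0 addr0; apply: has_int_ext => y.
have -> : ka * y = 2 * pi * ((j%:R - k%:R) * (y / b)) by rewrite /ka; ring.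
by case: c => u v /=; rewrite mulNr.
Qed.

Lemma Re_sum (I : Type) (s : seq I) (F : I -> C) :
  complex.Re (\sum_(i <- s) F i) = \sum_(i <- s) complex.Re (F i).
Proof. exact: (raddf_sum (@complex.Re R)). Qed.

Lemma has_int_parseval (b : R) (B : nat -> C) M : 0 < b ->
  has_int `[0, b] (fun y => nc (\sum_(j <- iota 0 M) B j * ee (y / b) ^+ j) ^+ 2)
    (b * \sum_(j <- iota 0 M) nc (B j) ^+ 2).
Proof.
move=> b0; have mD : measurable `[0, b] by exact: measurable_itv.
pose f j k y := complex.Re (B j * (B k)^*%C * ee ((j%:R - k%:R) * (y / b))).
have := @has_int_sum `[0, b] _ (iota 0 M) (fun j y => \sum_(k <- iota 0 M) f j k y)
  (fun j => \sum_(k <- iota 0 M) (if j == k then complex.Re (B j * (B k)^*%C) * b else 0)) mD.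
move=> /(_ (fun j => has_int_sum (iota 0 M) mD (fun k => has_int_phase (B j * (B k)^*%C) j k b0))).
have -> : \sum_(j <- iota 0 M) \sum_(k <- iota 0 M) (if j == k then complex.Re (B j * (B k)^*%C) * b else 0) =
    b * \sum_(j <- iota 0 M) nc (B j) ^+ 2.
  rewrite mulr_sumr big_seq [RHS]big_seq; apply: eq_bigr => j jM.
  rewrite (bigD1_seq j) ?iota_uniq //= eqxx big1 => [|k kj]; last by rewrite eq_sym (negbTE kj).
  by rewrite addr0 conjc_nc /= mulrC.
apply: has_int_ext => y; apply: (@complexI R); rewrite -conjc_nc.
pose P : C := \sum_(j <- iota 0 M) B j * ee (y / b) ^+ j; rewrite -/P.
have -> : P * P^*%C = (complex.Re (P * P^*%C))%:C%C by rewrite conjc_nc.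
congr (_%:C%C); rewrite /P cj_sum mulr_suml Re_sum; apply: eq_bigr => j _.
rewrite mulr_sumr Re_sum; apply: eq_bigr => k _; rewrite /f; congr (complex.Re _).
by rewrite cjM cjX -eeN -!eeX mulrACA -eeD; congr (_ * ee _); ring.
Qed.

(** * Identification of the correlation functions with orbital sums *)

Section Laughlin.
Variables (l r : R).
Hypothesis l0 : 0 < l.
Hypothesis r0 : 0 < r.

(** [len_unit] is the spacing of the orbitals along the axis, [coupling] the Gaussian parameter in
    this unit, and [pt_norm] the one-particle integral of an orbital without its factor
    [expR (coupling * j ^+ 2)]. *)
Definition len_unit : R := l ^+ 2 / r.
Definition coupling : R := l ^+ 2 / r ^+ 2.
Definition pt_norm : R := 2 * pi * r * Num.sqrt (l ^+ 2 * pi).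

Lemma aU0 : 0 < len_unit. Proof. by rewrite divr_gt0 ?exprn_gt0. Qed.
Lemma gU0 : 0 < coupling. Proof. by rewrite divr_gt0 ?exprn_gt0. Qed.
Lemma cir0 : 0 < 2 * pi * r. Proof. by rewrite !mulr_gt0 ?pi_gt0. Qed.
Lemma hU0 : 0 < pt_norm.
Proof. by rewrite mulr_gt0 ?cir0 // sqrtr_gt0 mulr_gt0 ?pi_gt0 ?exprn_gt0. Qed.

Definition cyl_pt (z : C) : R * C :=
  (complex.Re z / len_unit, ee (complex.Im z / (2 * pi * r))).

Lemma unitp_cyl_pt zs : unitp (map cyl_pt zs).
Proof. by elim: zs => //= z zs ->; rewrite cos2Dsin2 sqrtr1 eqxx. Qed.

Lemma cexp_point_val z : cexp (z / r%:C%C) = point_val coupling (cyl_pt z).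
Proof.
have rn : r != 0 by rewrite gt_eqF.
have ln : l != 0 by rewrite gt_eqF.
have pn : pi != 0 :> R by rewrite gt_eqF // pi_gt0.
have -> : z / r%:C%C = Complex (complex.Re z / r) (complex.Im z / r).
  have -> : (r%:C%C)^-1 = (r^-1)%:C%C :> C by rewrite (fmorphV (real_complex R)).
  by case: z => x y; apply/eqP; rewrite eq_complex /= !mulr0 subr0 add0r !eqxx.
rewrite /cexp /point_val /cyl_pt /ee /= (_ : coupling * (complex.Re z / len_unit) = complex.Re z / r); last first.
  by rewrite /coupling /len_unit; field; rewrite rn ln.
rewrite (_ : 2 * pi * (complex.Im z / (2 * pi * r)) = complex.Im z / r); last first.
  by move: pn; move: (pi : R) (complex.Im z) => P y pn; field; rewrite ?rn ?pn.
congr (_ * _); apply/eqP; rewrite eq_complex /=.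
by rewrite !mul0r !mul1r subr0 addr0 !add0r !eqxx.
Qed.

Lemma vdm_ord p (t : seq C) :
  \prod_(k < size t) \prod_(j < size t | (j < k)%N) (nth 0 t k - nth 0 t j) ^+ p = vdm p t.
Proof.
elim: t => [|x t IH]; first by rewrite big_ord0.
rewrite [size _]/= big_ord_recl big1 ?mul1r; last by move=> j; rewrite ltn0.
rewrite (eq_bigr (fun k : 'I_(size t) => (nth 0 t k - x) ^+ p *
   \prod_(j < size t | (j < k)%N) (nth 0 t k - nth 0 t j) ^+ p)); last first.
  by move=> k _; rewrite big_mkcond big_ord_recl /= -big_mkcond.
rewrite big_split /= IH; congr (_ * _).
by rewrite (big_nth 0) big_mkord.
Qed.

Lemma laughlin_sqE p zs : laughlin_sq p l r zs =
  nc (vdm p (map (point_val coupling) (map cyl_pt zs))) ^+ 2 * expR (- coupling * \sum_(q <- map cyl_pt zs) q.1 ^+ 2).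
Proof.
have rn : r != 0 by rewrite gt_eqF.
have ln : l != 0 by rewrite gt_eqF.
rewrite /laughlin_sq /laughlin ComplexField.Normc.normcM exprMn nc_real; congr (_ * _).
  congr (nc _ ^+ 2); rewrite -vdm_ord !size_map; apply: eq_bigr => k _; apply: eq_bigr => j _.
  by rewrite !(nth_map (cyl_pt 0)) ?size_map // !(nth_map 0) // !cexp_point_val.
rewrite ger0_norm ?expR_ge0 // -expRM_natl; congr expR.
rewrite big_map /= /cyl_pt /= -sumrN !mulr_suml !mulr_sumr; apply: eq_bigr => z _.
by rewrite /coupling /len_unit; field; rewrite rn ln.
Qed.

Lemma dbl_half (a w : R) : 2 * (- (a / 2) * w) = - a * w.
Proof. by field. Qed.

Lemma nc_expM (a : R) (z : C) : nc ((expR a)%:C%C * z) ^+ 2 = expR (2 * a) * nc z ^+ 2.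
Proof. by rewrite ComplexField.Normc.normcM exprMn nc_real ger0_norm ?expR_ge0 // -expRM_natl. Qed.

Lemma eq_cyl_int m (f h : seq C -> \bar R) : (forall w, size w = m -> f w = h w) ->
  cyl_int r m f = cyl_int r m h.
Proof.
elim: m f h => [|m IH] f h H /=; first exact: H.
apply: eq_integral => x _; apply: eq_integral => y _; apply: IH => w sw.
by apply: H; rewrite /= sw.
Qed.

(** Completing the square gives a normal density with mean [j * len_unit] and variance
    [l ^+ 2 / 2]. *)
Lemma has_int_gauss (j : nat) :
  has_int setT (fun x => expR (- coupling * (x / len_unit) ^+ 2) * expR (2 * coupling * j%:R * (x / len_unit)))
    (Num.sqrt (l ^+ 2 * pi) * expR (coupling * j%:R ^+ 2)).
Proof.
have rn : r != 0 by rewrite gt_eqF.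
have ln : l != 0 by rewrite gt_eqF.
pose s := l / Num.sqrt 2; have s2 : s ^+ 2 *+ 2 = l ^+ 2.
  by rewrite /s exprMn exprVn sqr_sqrtr // -mulr_natr divfK.
have s0 : s != 0 by rewrite mulf_neq0 // invr_neq0 // gt_eqF // sqrtr_gt0.
have sp : Num.sqrt (s ^+ 2 * pi *+ 2) = Num.sqrt (l ^+ 2 * pi) by rewrite -mulrnAl s2.
have q0 : Num.sqrt (l ^+ 2 * pi) != 0 by rewrite gt_eqF // sqrtr_gt0 mulr_gt0 ?pi_gt0 ?exprn_gt0.
pose m := j%:R * len_unit.
have H1 : has_int setT (normal_pdf m s) 1.
  by split; [exact: integrable_normal_pdf | exact: integral_normal_pdf].
have := has_intZ (Num.sqrt (l ^+ 2 * pi) * expR (coupling * j%:R ^+ 2)) measurableT H1.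
rewrite mulr1; apply: has_int_ext => x.
have -> : normal_pdf m s x = (Num.sqrt (l ^+ 2 * pi))^-1 * expR (- (x - m) ^+ 2 / l ^+ 2).
  by rewrite normal_pdfE // -sp -s2.
rewrite mulrACA mulfV // mul1r -!expRD; congr expR; rewrite /m /coupling /len_unit; field; rewrite rn ln //.
Qed.

(** One particle at a time: Parseval in the angle removes the interference of orbitals, and the
    Gaussian integral weighs each orbital. For the induction, the first particle is absorbed into
    the coefficients [A'] of the others. *)
Lemma cyl_int_mval M m (A : seq nat -> C) :
  cyl_int r m (fun w => (nc (mval coupling M m A (map cyl_pt w)) ^+ 2 *
     expR (- coupling * \sum_(q <- map cyl_pt w) q.1 ^+ 2))%:E) =
  (pt_norm ^+ m * tsum (iota 0 M) m (fun mu => nc (A mu) ^+ 2 * expR (coupling * ssq R mu)))%:E.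
Proof.
elim: m A => [|m IH] A.
  rewrite /= big_nil mulr0 expR0 mulr1 mul1r /mval /= mulr1 /ssq big_nil mulr0 expR0 mulr1 //.
pose E x : R := expR (- coupling * (x / len_unit) ^+ 2).
pose B x mu (j : nat) : C := A (j :: mu) * ((expR (coupling * (x / len_unit)))%:C%C) ^+ j.
have step x y : cyl_int r m (fun s => (nc (mval coupling M m.+1 A (map cyl_pt ((x +i* y)%C :: s))) ^+ 2 *
     expR (- coupling * \sum_(q <- map cyl_pt ((x +i* y)%C :: s)) q.1 ^+ 2))%:E) =
   (tsum (iota 0 M) m (fun mu => pt_norm ^+ m * E x * expR (coupling * ssq R mu) *
      nc (\sum_(j <- iota 0 M) B x mu j * ee (y / (2 * pi * r)) ^+ j) ^+ 2))%:E.
  pose A' mu := (expR (- (coupling / 2) * (x / len_unit) ^+ 2))%:C%C *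
     \sum_(j <- iota 0 M) B x mu j * ee (y / (2 * pi * r)) ^+ j.
  rewrite (eq_cyl_int (h := fun w => (nc (mval coupling M m A' (map cyl_pt w)) ^+ 2 *
     expR (- coupling * \sum_(q <- map cyl_pt w) q.1 ^+ 2))%:E)).
    rewrite IH; congr (_%:E); rewrite -tsumZ; apply: eq_tsum => mu _.
    rewrite /A' nc_expM.
    rewrite dbl_half -/(E x); move: (nc _) (expR _) (E x) (pt_norm ^+ m) => *; ring.
  move=> w _; congr (_%:E); rewrite map_cons big_cons.
  have -> : mval coupling M m A' (map cyl_pt w) = (expR (- (coupling / 2) * (x / len_unit) ^+ 2))%:C%C *
      mval coupling M m.+1 A (cyl_pt (x +i* y)%C :: map cyl_pt w).
    rewrite /mval tsumS -tsum_sum -tsumZ; apply: eq_tsum => mu _.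
    rewrite /A' -mulrA; congr (_ * _); rewrite mulr_suml; apply: eq_bigr => j _.
    have pvE : point_val coupling (cyl_pt (x +i* y)%C) = (expR (coupling * (x / len_unit)))%:C%C * ee (y / (2 * pi * r)) by [].
    rewrite /B -[mon (j :: mu) _]/(point_val coupling (cyl_pt (x +i* y)%C) ^+ j * mon mu _) pvE exprMn.
    by rewrite -!mulrA.
  rewrite nc_expM mulrDr expRD dbl_half.
  by rewrite /=; move: (nc _) (expR _) (expR _) => *; ring.
have inner x : (\int[mu]_(y in `[0%R, (2 * pi * r)%R]) cyl_int r m
     (fun s => (nc (mval coupling M m.+1 A (map cyl_pt ((x +i* y)%C :: s))) ^+ 2 *
     expR (- coupling * \sum_(q <- map cyl_pt ((x +i* y)%C :: s)) q.1 ^+ 2))%:E))%E =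
   (tsum (iota 0 M) m (fun mu => pt_norm ^+ m * (2 * pi * r) * expR (coupling * ssq R mu) *
      \sum_(j <- iota 0 M) nc (A (j :: mu)) ^+ 2 *
        (E x * expR (2 * coupling * j%:R * (x / len_unit)))))%:E.
  apply: etrans; first by apply: eq_integral => y _; exact: step.
  have mD : measurable `[0, (2 * pi * r)] by exact: measurable_itv.
  have := has_int_tsum (iota 0 M) m mD (fun mu => has_intZ (pt_norm ^+ m * E x * expR (coupling * ssq R mu)) mD
     (has_int_parseval (B x mu) M cir0)).
  move=> [_ E1]; apply: (etrans E1); congr (_%:E); apply: eq_tsum => mu _.
  move: (expR (coupling * ssq R mu)) => e1; rewrite !mulr_sumr; apply: eq_bigr => j _.
  have -> : nc (B x mu j) ^+ 2 = nc (A (j :: mu)) ^+ 2 * expR (2 * coupling * j%:R * (x / len_unit)).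
    rewrite /B ComplexField.Normc.normcM exprMn ncX nc_real ger0_norm ?expR_ge0 // -exprM -expRM_natl.
    congr (_ * expR _); rewrite natrM; ring.
  by move: (nc _) (expR _) (E x) (2 * pi * r) (pt_norm ^+ m) => *; ring.
apply: etrans; first by apply: eq_integral => x _; exact: inner.
have mD : measurable [set: R] by exact: measurableT.
have := has_int_tsum (iota 0 M) m mD (fun mu => has_intZ (pt_norm ^+ m * (2 * pi * r) * expR (coupling * ssq R mu)) mD
  (has_int_sum (iota 0 M) mD (fun j => has_intZ (nc (A (j :: mu)) ^+ 2) mD (has_int_gauss j)))).
move=> [_ E1]; apply: (etrans E1); congr (_%:E); rewrite tsumS -tsum_sum -tsumZ; apply: eq_tsum => mu _.
have eE (i : nat) : expR (coupling * ssq R (i :: mu)) = expR (coupling * i%:R ^+ 2) * expR (coupling * ssq R mu).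
  by rewrite /ssq big_cons mulrDr expRD.
under [in RHS]eq_bigr do rewrite eE.
have -> : pt_norm ^+ m.+1 = pt_norm ^+ m * pt_norm by rewrite exprSr.
move: (expR (coupling * ssq R mu)) => e1; move: (pt_norm ^+ m) => hm.
rewrite /pt_norm; move: (2 * pi * r) (Num.sqrt _) => c sq.
rewrite !mulr_sumr; apply: eq_bigr => j _.
by move: (nc _) (expR _) => *; ring.
Qed.

(** The observed points stay fixed inside the coefficients [cfz], so only the remaining particles
    are summed over orbitals. *)
Lemma cyl_int_laughlin p zs m : (0 < p)%N ->
  cyl_int r m (fun w => (laughlin_sq p l r (zs ++ w))%:E) =
  (pt_norm ^+ m * expR (gs_energy p coupling (size zs + m)) * (m`!)%:R * mass p coupling (map cyl_pt zs) m xpredT)%:E.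
Proof.
move=> p0; set ps := map cyl_pt zs; set M := (p * (size zs + m))%N.
pose A mu := (expR (- (coupling / 2) * \sum_(q <- ps) q.1 ^+ 2))%:C%C * cfz p (map (point_val coupling) ps) mu.
rewrite (eq_cyl_int (h := fun w => (nc (mval coupling M m A (map cyl_pt w)) ^+ 2 *
     expR (- coupling * \sum_(q <- map cyl_pt w) q.1 ^+ 2))%:E)); last first.
  move=> w sw; congr (_%:E); rewrite laughlin_sqE !map_cat vdm_cfz // big_cat /= mulrDr expRD.
  rewrite !size_map sw -/M -/ps.
  have -> : mval coupling M m A (map cyl_pt w) = (expR (- (coupling / 2) * \sum_(q <- ps) q.1 ^+ 2))%:C%C *
     tsum (iota 0 M) m (fun mu => cfz p (map (point_val coupling) ps) mu * mon mu (map (point_val coupling) (map cyl_pt w))).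
    by rewrite /mval -tsumZ; apply: eq_tsum => mu _; rewrite /A mulrA.
  rewrite nc_expM dbl_half.
  by rewrite mulrCA mulrA.
rewrite cyl_int_mval; congr (_%:E); rewrite -!mulrA; congr (_ * _).
rewrite /mass size_map -/M /isum mulVKf ?fact_neq0 // -tsumZ; apply: eq_tsum => mu smu.
rewrite /cweight size_map smu /A nc_expM dbl_half.
rewrite !mulrA expRxMexpNx_1 mul1r //.
Qed.

Lemma rhoN_mass p N n (z : 'I_n -> C) : (0 < p)%N -> (n <= N)%N ->
  rhoN p l r N z = mass p coupling (map cyl_pt (pts z)) (N - n) xpredT / Z p coupling N / pt_norm ^+ n.
Proof.
move=> p0 nN; have spz : size (pts z) = n by rewrite size_map size_enum_ord.
have := cyl_int_laughlin [::] N p0; rewrite /= add0n => E0.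
rewrite /rhoN E0 cyl_int_laughlin // spz subnKC // -/(Z p coupling N) /=.
have h0 := hU0; have Zg : Z p coupling N != 0 by rewrite gt_eqF // (lt_le_trans ltr01) // Z_ge1.
have f1 := fact_neq0 R N; have f2 := fact_neq0 R (N - n).
have e0 : expR (gs_energy p coupling N) != 0 by rewrite gt_eqF ?expR_gt0.
have hN : pt_norm ^+ N = pt_norm ^+ (N - n) * pt_norm ^+ n by rewrite -exprD subnK.
rewrite hN.
have hn : pt_norm ^+ n != 0 by rewrite expf_neq0 // gt_eqF.
have hm : pt_norm ^+ (N - n) != 0 by rewrite expf_neq0 // gt_eqF.
move: f1 f2 e0 Zg hn hm; move: (_`!%:R) (_`!%:R) (expR _) (Z _ _ _) (pt_norm ^+ n) (pt_norm ^+ _) (mass _ _ _ _ _).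
by move=> *; field; do ?[apply/andP; split].
Qed.

End Laughlin.
End CylinderIntegral.

(** * The bulk limit *)

Section FinalLimit.
Variable R : realType.
Local Notation C := R[i].

(** The limit is the supremum of all eventual lower bounds. *)
Lemma cauchy_limit (u : nat -> R) :
  (forall e, 0 < e -> exists M, forall m n, (M <= m)%N -> (M <= n)%N -> `|u m - u n| <= e) ->
  exists l, forall e, 0 < e -> exists M, forall m, (M <= m)%N -> `|u m - l| <= e.
Proof.
move=> H; pose E := [set x : R | exists M, forall m, (M <= m)%N -> x <= u m]%classic.
have lowE e M : (forall m n, (M <= m)%N -> (M <= n)%N -> `|u m - u n| <= e) ->
    forall m, (M <= m)%N -> E (u m - e).
  move=> HM m Mm; exists M => n Mn; have := HM m n Mm Mn.
  by rewrite ler_norml => /andP[_ a]; lra.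
have upE e M : (forall m n, (M <= m)%N -> (M <= n)%N -> `|u m - u n| <= e) ->
    forall m, (M <= m)%N -> ubound E (u m + e).
  move=> HM m Mm x [M' HM']; apply: (le_trans (HM' (maxn M M') (leq_maxr _ _))).
  have := HM m (maxn M M') Mm (leq_maxl _ _).
  by rewrite ler_norml => /andP[a _]; lra.
have [M1 HM1] := H 1 ltr01.
have sE : has_sup E.
  split; first by exists (u M1 - 1); exact: lowE HM1 _ (leqnn _).
  by exists (u M1 + 1); exact: upE HM1 _ (leqnn _).
exists (sup E) => e e0; have [M HM] := H e e0; exists M => m Mm.
have a : u m - e <= sup E by apply: (ub_le_sup sE.2); exact: lowE HM _ Mm.
have b : sup E <= u m + e by apply: ge_sup; [exact: sE.1 | exact: upE HM _ Mm].
by rewrite ler_norml; apply/andP; split; lra.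
Qed.

Lemma limit_le (u : nat -> R) (l c e : R) :
  (forall e, 0 < e -> exists M, forall m, (M <= m)%N -> `|u m - l| <= e) ->
  (exists M, forall m, (M <= m)%N -> `|u m - c| <= e) -> `|l - c| <= e.
Proof.
move=> ul [M1 H1]; apply/ler_addgt0Pr => d d0; have [M2 H2] := ul d d0.
apply: (le_trans (ler_distD (u (maxn M1 M2)) _ _)); rewrite addrC; apply: lerD.
  by apply: H1; exact: leq_maxl.
by rewrite distrC; apply: H2; exact: leq_maxr.
Qed.

Variables (l r : R) (p : nat).
Hypothesis l0 : 0 < l.
Hypothesis r0 : 0 < r.
Hypothesis p0 : (0 < p)%N.
Local Notation g := (coupling l r).
Local Notation a := (len_unit l r).
Local Notation h := (pt_norm l r).
Local Notation cyl_pt := (cyl_pt l r).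
Local Notation mass := (@mass R p g).
Local Notation Z := (@Z R p g).
Local Notation tot := (xpredT : pred (seq nat)).

Let g0 : 0 < g := gU0 l0 r0.
Let a0 : 0 < a := aU0 l0 r0.
Let h0 : 0 < h := hU0 l0 r0.

Section FixedN.
Variable n : nat.

(** [2 * M] particles, with the points moved to the middle: along this sequence both edges recede,
    and every system with the points in its bulk can be compared with it. *)
Definition centered_corr (ps : seq (R * C)) (M : nat) : R :=
  mass (shiftr p ps M) (2 * M - n) tot / Z (2 * M).

Lemma shiftrD (ps : seq (R * C)) i j : shiftr p (shiftr p ps i) j = shiftr p ps (i + j).
Proof.
rewrite /shiftr -map_comp; apply: eq_map => q /=.
by rewrite -addrA -natrD -mulnDr.
Qed.

Lemma shiftr0 (ps : seq (R * C)) : shiftr p ps 0 = ps.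
Proof.
rewrite /shiftr (eq_map (g := id)) ?map_id // => q.
by rewrite muln0 addr0; case: q.
Qed.

Lemma shiftr_bulk ps (d : R) : exists M0 : nat, forall M, (M0 <= M)%N ->
  all (fun q => d <= q.1) (shiftr p ps M) && all (fun q => q.1 <= (p * (2 * M))%:R - d) (shiftr p ps M).
Proof.
elim: ps => [|q ps [M0 IH]]; first by exists 0%N.
pose M1 := (Num.truncn (`|q.1| + `|d|)).+1; exists (maxn M0 M1) => M.
rewrite geq_max => /andP[MM0 MM1]; have /andP[A B] := IH M MM0.
rewrite /= A B !andbT.
have b : `|q.1| + `|d| <= (p * M)%:R.
  apply: (le_trans (ltW (truncnS_gt _))); rewrite ler_nat (leq_trans MM1) // leq_pmull //.
have := ler_norm q.1; have := lerNnormlW (lexx `|q.1|); have := ler_norm d.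
have -> : (p * (2 * M))%:R = (p * M)%:R + (p * M)%:R :> R by rewrite -natrD mulnCA mul2n addnn.
by move: b; move: (_%:R) => *; apply/andP; split; lra.
Qed.

Lemma bulk_mass (e : R) : 0 < e -> exists2 d : R, 0 <= d & exists N0 : nat, forall N i j ps,
  size ps = n -> unitp ps -> all (fun q => d <= q.1) ps ->
  all (fun q => q.1 <= (p * N)%:R - d) ps -> (N0 <= N)%N -> (n <= N)%N ->
  `|mass (shiftr p ps i) (N + i + j - n) tot / Z (N + i + j) - mass ps (N - n) tot / Z N| <= e.
Proof.
move=> e0; have [d d0 [N0 H]] := bulk_shift p0 g0 n e0; exists d => //.
exists (N0 + n)%N => N i j ps sp up b1 b2 NN nN.
have := H (N - n)%N i j ps sp up b1; rewrite !addnA subnKC // => /(_ b2).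
have -> : (N - n + i + j = N + i + j - n)%N by rewrite -addnA addnBAC // addnA.
by apply; clear -NN; lia.
Qed.

Lemma centered_corr_cauchy ps : size ps = n -> unitp ps ->
  forall e, 0 < e -> exists M, forall m k, (M <= m)%N -> (M <= k)%N -> `|centered_corr ps m - centered_corr ps k| <= e.
Proof.
move=> sp up e e0; have e2 : 0 < e / 2 by rewrite divr_gt0.
have [d d0 [N0 H]] := bulk_mass e2; have [M0 HM0] := shiftr_bulk ps d.
pose M := (M0 + N0 + n)%N.
have key m : (M <= m)%N -> `|centered_corr ps m - centered_corr ps M| <= e / 2.
  move=> Mm; have /andP[b1 b2] : all (fun q => d <= q.1) (shiftr p ps M) &&
      all (fun q => q.1 <= (p * (2 * M))%:R - d) (shiftr p ps M).
    by apply: HM0; rewrite /M -addnA leq_addr.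
  have := H (2 * M)%N (m - M)%N (m - M)%N (shiftr p ps M).
  rewrite shiftrD subnKC // (_ : 2 * M + (m - M) + (m - M) = 2 * m)%N; last by clear -Mm; lia.
  apply => //; rewrite ?size_map ?unitp_shiftr // /M; clear; lia.
exists M => m k Mm Mk; rewrite [e]splitr; apply: (le_trans (ler_distD (centered_corr ps M) _ _)).
by apply: lerD; [exact: key | rewrite distrC; exact: key].
Qed.

Definition cyl_pts (z : 'I_n -> C) := map cyl_pt (pts z).

Lemma size_cyl_pts z : size (cyl_pts z) = n.
Proof. by rewrite /cyl_pts /pts size_map size_map size_enum_ord. Qed.

Lemma unitp_cyl_pts z : unitp (cyl_pts z). Proof. exact: unitp_cyl_pt. Qed.

Definition rho_lim (z : 'I_n -> C) : R :=
  sval (cid (cauchy_limit (centered_corr_cauchy (size_cyl_pts z) (unitp_cyl_pts z)))).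

Lemma rho_limP z e : 0 < e -> exists M, forall m, (M <= m)%N -> `|centered_corr (cyl_pts z) m - rho_lim z| <= e.
Proof. by rewrite /rho_lim; case: cid => x /= H; exact: H. Qed.

Definition rho_bulk (z : 'I_n -> C) : R := rho_lim z / h ^+ n.

Let hn0 : 0 < h ^+ n. Proof. exact: exprn_gt0. Qed.

Lemma all_cyl_pts (P : pred R) z : (forall i, P (complex.Re (z i) / a)) -> all (fun q => P q.1) (cyl_pts z).
Proof. by move=> H; rewrite /cyl_pts /pts !all_map; apply/allP => i _ /=; exact: H. Qed.

Lemma rho_bulk_limit : bulk_limit p l r rho_bulk.
Proof.
move=> eps e0; have e1 : 0 < eps * h ^+ n / 2 by rewrite divr_gt0 // mulr_gt0.
have [d d0 [N0 H]] := bulk_mass e1; exists (d * a), N0 => N NN nN z _ bz.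
rewrite rhoN_mass // /rho_bulk -mulrBl normrM normfV (gtr0_norm hn0) ltr_pdivrMr //.
apply: (@le_lt_trans _ _ (eps * h ^+ n / 2)); last by rewrite ltr_pdivrMr // ltr_pMr ?mulr_gt0 // ltr1n.
rewrite distrC; apply: (limit_le (rho_limP z)); exists N => m Nm.
(* The given system becomes the centred one with [2 * m] particles by adding [m] particles on the
   left and [m - N] on the right. *)
have := H N m (m - N)%N (cyl_pts z) (size_cyl_pts z) (unitp_cyl_pts z).
rewrite (_ : N + m + (m - N) = 2 * m)%N; last by clear -Nm; lia.
apply => //.
  apply: (all_cyl_pts (P := fun x => d <= x)) => i; have /andP[b _] := bz i.
  by rewrite ler_pdivlMr.
apply: (all_cyl_pts (P := fun x => x <= (p * N)%:R - d)) => i; have /andP[_ b] := bz i.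
by rewrite ler_pdivrMr // mulrBl /a /len_unit mulrA.
Qed.

Lemma cyl_pts_shift z (t : R) : cyl_pts (Defs.shift z t) = [seq (q.1 + t / a, q.2) | q <- cyl_pts z].
Proof.
rewrite /cyl_pts /pts /Defs.shift -!map_comp; apply: eq_map => i /=.
by case: (z i) => x y; rewrite /cyl_pt /= addr0 mulrDl.
Qed.

Let T : R := p%:R * l ^+ 2 / r.

Lemma Ta : T / a = p%:R.
Proof. by rewrite /T -[_ / r]mulrA -/(len_unit l r) mulfK // gt_eqF. Qed.

Lemma rho_bulk_period : is_period r rho_bulk T.
Proof.
move=> z _; rewrite /rho_bulk; congr (_ / _).
have pE : cyl_pts (Defs.shift z T) = shiftr p (cyl_pts z) 1.
  by rewrite cyl_pts_shift Ta /shiftr; apply: eq_map => q; rewrite muln1.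
apply/eqP; rewrite -subr_eq0 -normr_le0; apply/ler_addgt0Pr => e e0; rewrite add0r.
have e3 : 0 < e / 3 by rewrite divr_gt0.
apply: (limit_le (rho_limP (Defs.shift z T))).
have [d d0 [N0 H]] := bulk_mass e3.
have [M1 HM1] := rho_limP z e3.
have [M2 HM2] := shiftr_bulk (cyl_pts z) d; have [M3 HM3] := shiftr_bulk (shiftr p (cyl_pts z) 1) d.
exists (M1 + M2 + M3 + N0 + n)%N => m Mm.
have [m1 m2 m3 mN mn] : [/\ M1 <= m, M2 <= m, M3 <= m, N0 <= 2 * m & n <= 2 * m]%N.
  by clear -Mm; split; lia.
(* An intermediate system with one particle more: an extra particle on the left for the original
   points, an extra one on the right for the shifted points. *)
pose u := mass (shiftr p (cyl_pts z) m.+1) (2 * m + 1 - n) tot / Z (2 * m + 1).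
have A1 : `|u - centered_corr (cyl_pts z) m| <= e / 3.
  have /andP[b1 b2] := HM2 m m2.
  have := H (2 * m)%N 1%N 0%N (shiftr p (cyl_pts z) m); rewrite shiftrD addn1 addn0; apply => //.
    by rewrite size_map size_cyl_pts.
  by rewrite unitp_shiftr unitp_cyl_pts.
have A2 : `|u - centered_corr (cyl_pts (Defs.shift z T)) m| <= e / 3.
  have /andP[b1 b2] := HM3 m m3.
  move: b1 b2; rewrite /centered_corr pE shiftrD add1n => b1 b2.
  have := H (2 * m)%N 0%N 1%N (shiftr p (cyl_pts z) m.+1); rewrite shiftr0 addn0; apply => //.
    by rewrite size_map size_cyl_pts.
  by rewrite unitp_shiftr unitp_cyl_pts.
have A3 := HM1 m m1.
move: A1 A2 A3; move: (centered_corr _ _) (centered_corr _ _) (rho_lim z) u => x y w u A1 A2 A3.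
have : `|x - w| <= `|x - u| + (`|u - y| + `|y - w|).
  by apply: (le_trans (ler_distD u _ _)); rewrite lerD2l; exact: ler_distD.
by rewrite [`|x - u|]distrC; move: A1 A2 A3; move: (`|u - x|) (`|u - y|) (`|y - w|) => *; lra.
Qed.

Lemma shiftD (z : 'I_n -> C) (s t : R) : Defs.shift (Defs.shift z s) t = Defs.shift z (s + t).
Proof. by apply/funext => i; rewrite /Defs.shift rcD addrA. Qed.

Lemma on_cyl_shift (z : 'I_n -> C) (t : R) : on_cyl r z -> on_cyl r (Defs.shift z t).
Proof. by move=> H i; rewrite /Defs.shift; have := H i; case: (z i) => x y /=; rewrite addr0. Qed.

Lemma periodD (rho : ('I_n -> C) -> R) s t : is_period r rho s -> is_period r rho t -> is_period r rho (s + t).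
Proof.
by move=> Hs Ht z cz; rewrite -shiftD Ht ?Hs //; exact: on_cyl_shift.
Qed.

Lemma periodB (rho : ('I_n -> C) -> R) s t : is_period r rho s -> is_period r rho t -> is_period r rho (t - s).
Proof.
move=> Hs Ht z cz; rewrite -(Hs (Defs.shift z (t - s))); last exact: on_cyl_shift.
by rewrite shiftD subrK Ht.
Qed.

(** Replacing [t] by [T - t] allows [t <= 2 * T / 3]; a period below [T / 3] has multiples too close
    together to jump over the middle third. *)
Lemma period_mid (rho : ('I_n -> C) -> R) (t : R) : is_period r rho T -> 0 < t < T -> is_period r rho t ->
  exists2 s, T / 3 <= s <= 2 * T / 3 & is_period r rho s.
Proof.
move=> HT /andP[t0 tT] Ht.
wlog t3 : t t0 tT Ht / t <= 2 * T / 3 => [W|].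
  have [t3|t3] := leP t (2 * T / 3); first exact: (W t).
  by apply: (W (T - t)); [lra | lra | exact: periodB | lra].
have [t1|t1] := leP (T / 3) t; first by exists t => //; rewrite t1 t3.
pose k := Num.truncn (T / 3 / t).
have T0 : 0 <= T / 3 / t by apply: divr_ge0; lra.
have /andP[k1 k2] := truncn_itv T0; rewrite -/k in k1 k2.
have per j : is_period r rho (j.+1%:R * t).
  elim: j => [|j IH]; first by rewrite mul1r.
  by rewrite -natr1 mulrDl mul1r; exact: periodD.
exists (k.+1%:R * t) => //; rewrite ler_pdivlMr // in k1; rewrite ltr_pdivrMr // in k2.
rewrite (ltW k2) /= -natr1 mulrDl mul1r; lra.
Qed.

(** Exact periodicity of the limit becomes approximate invariance at finite [N]. It is tested only
    at points whose angles are roots of unity, since these determine [avg_corr]. *)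
Lemma period_asym_inv (rho : ('I_n -> C) -> R) (t : R) : bulk_limit p l r rho -> 0 <= t <= T ->
  is_period r rho t -> asym_inv p g (t / a) 1 n.
Proof.
move=> Hrho /andP[t0 tT] Ht e e0; set tau := t / a.
have tau0 : 0 <= tau by rewrite divr_ge0 // ltW.
have taup : tau <= p%:R by rewrite -Ta ler_pM2r ?invr_gt0.
have e1 : 0 < e / h ^+ n / 2 by rewrite !divr_gt0.
have [d [N0 H]] := Hrho _ e1.
pose D := ((Num.truncn (`|d| / a)).+1 + p)%N.
have dD : d / a + p%:R <= D%:R.
  rewrite natrD lerD2r; apply: le_trans (ltW (truncnS_gt _)).
  by rewrite ler_pM2r ?invr_gt0 // ler_norm.
exists D, (N0 + n + 1)%N => N xs NN sx bx; rewrite mul1r.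
have [N1 N2 N3] : [/\ N0 <= N, n <= N & 0 < N]%N by clear -NN; split; lia.
apply: (avg_corr_diff p0) => //; rewrite ?sx ?size_map // => ys sy ysr.
set M := (p * N)%N; have Mp : 0 < M%:R :> R by rewrite ltr0n muln_gt0 p0.
pose zf (x : nat -> R) (i : nat) : C := Complex (a * x i) (2 * pi * r * ((nth 0%N ys i)%:R / M%:R)).
pose z : 'I_n -> C := fun i => zf (nth 0 xs) i.
have ptsE (f : nat -> C) : pts (fun i : 'I_n => f i) = [seq f i | i <- iota 0 n].
  by rewrite /pts -val_enum_ord -map_comp.
have pzE : cyl_pts z = root_pts xs M ys.
  rewrite /cyl_pts /z ptsE -map_comp; apply: (@eq_from_nth _ (0, 0)).
    by rewrite size_map size_iota size_root_pts ?sx.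
  move=> i; rewrite size_map size_iota => ni.
  rewrite (nth_map 0%N) ?size_iota // nth_iota // add0n /root_pts nth_zip ?size_map ?sx // (nth_map 0%N) ?sy //.
  rewrite /= /cyl_pt /zf /=; congr (_, ee _); first by rewrite mulrC mulKf // gt_eqF.
  by rewrite mulrC mulKf // gt_eqF // cir0.
have psE : cyl_pts (Defs.shift z t) = root_pts [seq x + tau | x <- xs] M ys.
  rewrite cyl_pts_shift pzE /root_pts -/tau; elim: (xs) (ys) => [|x xs' IH] [|y ys'] //=.
  by rewrite IH.
have cz : on_cyl r z.
  move=> i; rewrite /z /zf /=; have c0 := cir0 r0.
  have yM : (nth 0%N ys i)%:R / M%:R <= 1 :> R.
    rewrite ler_pdivrMr // mul1r ler_nat.
    have := ysr (nth 0%N ys i); rewrite mem_nth ?sy // mem_iota => /(_ isT) /=.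
    by rewrite add0n => /ltnW.
  have y0 : 0 <= (nth 0%N ys i)%:R / M%:R :> R by rewrite divr_ge0 ?ler0n.
  by rewrite mulr_ge0 ?(ltW c0) //= ler_piMr // ltW.
have pNE : (p * N)%:R * l ^+ 2 / r = (p * N)%:R * a :> R by rewrite /a /len_unit mulrA.
have bz (s : R) : 0 <= s <= p%:R -> forall i : 'I_n, d <= a * (nth 0 xs i + s) <= (p * N)%:R * l ^+ 2 / r - d.
  move=> /andP[s0 sp] i; have /allP /(_ (nth 0 xs i)) := bx; rewrite mem_nth ?sx // => /(_ isT) /andP[x1 x2].
  have da : d = a * (d / a) by rewrite mulrC divfK // gt_eqF.
  rewrite pNE [_ * a]mulrC {1 2}da -mulrBr !ler_pM2l //.
  by move: dD x1 x2; move: (d / a) (D%:R : R) (nth 0 xs i) ((p * N)%:R : R) => *; apply/andP; split; lra.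
have b1 : in_bulk p l r N d z.
  by move=> i; have := bz 0; rewrite lexx /= => /(_ (ler0n _ _) i); rewrite addr0.
have b2 : in_bulk p l r N d (Defs.shift z t).
  move=> i; rewrite /Defs.shift /z /zf /=; have := bz tau; rewrite tau0 taup => /(_ isT i).
  by rewrite mulrDr /tau [a * (t / a)]mulrC divfK // gt_eqF.
have := H N N1 N2 z cz b1; have := H N N1 N2 (Defs.shift z t) (on_cyl_shift t cz) b2.
rewrite (Ht z cz) !rhoN_mass // -/(cyl_pts z) -/(cyl_pts (Defs.shift z t)) pzE psE -/M.
have Zg : 0 < Z N by rewrite (lt_le_trans ltr01) // Z_ge1.
move: (mass _ _ _) (mass _ _ _) => m2 m1 B2 B1.
have B3 : `|m1 / Z N / h ^+ n - m2 / Z N / h ^+ n| <= e / h ^+ n.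
  rewrite [e / _]splitr; apply: (le_trans (ler_distD (rho z) _ _)).
  by apply: lerD; [exact: ltW | rewrite distrC; exact: ltW].
move: B3; rewrite -!mulrBl !normrM !normfV (gtr0_norm hn0) (gtr0_norm Zg).
by rewrite ler_pM2r ?invr_gt0 // ler_pdivrMr // distrC.
Qed.

End FixedN.
End FinalLimit.

Theorem theorem2p2 (R : realType) (l r : R) (p : nat) :
  0 < l -> 0 < r -> (0 < p)%N ->
  exists n : nat, exists rho : ('I_n -> R[i]) -> R,
    bulk_limit p l r rho /\ smallest_period r rho (p%:R * l ^+ 2 / r).
Proof.
move=> l0 r0 p0; have a0 := aU0 l0 r0.
have [n Hn] := no_small_period p0 (gU0 l0 r0).
exists n, (rho_bulk l0 r0 p0 (n := n)); split; first exact: rho_bulk_limit.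
have T0 : 0 < p%:R * l ^+ 2 / r by rewrite divr_gt0 // mulr_gt0 ?exprn_gt0 // ltr0n.
have PT := @rho_bulk_period R l r p l0 r0 p0 n.
split=> //; split=> // theta ht Hper.
have [s /andP[s1 s2] Ps] := period_mid PT ht Hper.
have AIs : asym_inv p (coupling l r) (s / len_unit l r) 1 n.
  apply: (period_asym_inv l0 r0 p0 _ _ Ps); first exact: rho_bulk_limit.
  by apply/andP; split; lra.
apply: Hn AIs; rewrite ler_pdivlMr // ler_pdivrMr // /len_unit.
have TE : p%:R * (l ^+ 2 / r) = p%:R * l ^+ 2 / r by rewrite mulrA.
rewrite ![_ / 3 * _]mulrAC -[2 * p%:R * _]mulrA TE; exact/andP.
Qed.
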